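(* Let $1<p<2$, let $q=\frac{p}{p-1}$, and let $\beta>0$ be such that $\beta q\le 1$. (1) If $u\in \ell^1_\beta(\mathbb{Z})$ and $\dim(\mathcal{Z}(\widehat{u}))<\frac{2}{q}(1-\beta q)$, then $u$ is cyclic in $\ell^p_\beta(\mathbb{Z})$. (2) If $u\in \ell^1_\beta(\mathbb{Z})$ and $\dim(\mathcal{Z}(\widehat{u}))>1-\beta q$, then $u$ is not cyclic in $\ell^p_\beta(\mathbb{Z})$. (3) For every $\alpha$ with $\frac{2}{q}(1-\beta q)<\alpha\le 1$, there exists a closed subset $E\subset\mathbb{T}$ such that $\dim(E)=\alpha$ and every $u\in\ell^1_\beta(\mathbb{Z})$ satisfying $\mathcal{Z}(\widehat{u})=E$ is not cyclic in $\ell^p_\beta(\mathbb{Z})$. (4) If $p=\frac{2k}{2k-1}$ for some positive integer $k$, there exists a closed subset $E\subset\mathbb{T}$ such that $\dim(E)=1-\beta q$ and every $u\in\ell^1_\beta(\mathbb{Z})$ satisfying $\mathcal{Z}(\widehat{u})=E$ is cyclic in $\ell^p_\beta(\mathbb{Z})$.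
   Context: For $p\ge 1$ and $\beta\in\mathbb{R}$, $\ell^p_\beta(\mathbb{Z})$ is the Banach space of all complex sequences $u=(u_n)_{n\in\mathbb{Z}}$ with $\|u\|_{\ell^p_\beta}^p=\sum_{n\in\mathbb{Z}}|u_n|^p(1+|n|)^{p\beta}<\infty$. For $\beta\ge 0$, a vector $u\in\ell^p_\beta(\mathbb{Z})$ is called cyclic in $\ell^p_\beta(\mathbb{Z})$ if the linear span of its translates $\{(u_{n+k})_{n\in\mathbb{Z}} : k\in\mathbb{Z}\}$ is dense in $\ell^p_\beta(\mathbb{Z})$. The circle is $\mathbb{T}=\mathbb{R}/2\pi\mathbb{Z}$. For $u\in\ell^1_\beta(\mathbb{Z})$ with $\beta\ge0$, $\widehat{u}(t)=\sum_{n\in\mathbb{Z}}u_ne^{int}$ is a continuous function on $\mathbb{T}$ and $\mathcal{Z}(\widehat{u})=\{t\in\mathbb{T}:\widehat{u}(t)=0\}$. $\dim$ denotes Hausdorff dimension of subsets of $\mathbb{T}$. *)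

(* Defs.v *)
From HB Require Import structures.
From mathcomp Require Import all_boot all_order all_algebra generic_quotient.
From mathcomp Require Import all_classical all_reals all_analysis.
From mathcomp Require Import complex zify.

Set Implicit Arguments.
Unset Strict Implicit.
Unset Printing Implicit Defensive.

Import Order.TTheory GRing.Theory Num.Theory.
Import numFieldNormedType.Exports.

Local Open Scope classical_set_scope.
Local Open Scope ring_scope.
Local Open Scope complex_scope.
Local Open Scope quotient_scope.

Section circle.
Variable R : realType.

Definition eqmod2pi (x y : R) : bool := (x - y) / (pi *+ 2) \is a Num.int.

Lemma eqmod2pi_refl : reflexive eqmod2pi.
Proof. by move=> x; rewrite /eqmod2pi subrr mul0r rpred0. Qed.

Lemma eqmod2pi_sym : symmetric eqmod2pi.
Proof. by move=> x y; rewrite /eqmod2pi -opprB mulNr rpredN. Qed.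

Lemma eqmod2pi_trans : transitive eqmod2pi.
Proof.
move=> y x z; rewrite /eqmod2pi => xy yz.
have -> : x - z = (x - y) + (y - z) by rewrite addrA subrK.
by rewrite mulrDl rpredD.
Qed.

Canonical eqmod2pi_equiv :=
  EquivRel eqmod2pi eqmod2pi_refl eqmod2pi_sym eqmod2pi_trans.

Definition circle : Type := {eq_quot eqmod2pi}.

HB.instance Definition _ := Quotient.on circle.
HB.instance Definition _ := Choice.on circle.

Let twopi_gt0 : 0 < pi *+ 2 :> R.
Proof. by rewrite mulrn_wgt0// pi_gt0. Qed.

Definition lifts (x : R) : set R :=
  [set `|x + (pi *+ 2) * k%:~R| | k in [set: int]].

Definition circle_dist (s t : circle) : R := inf (lifts (repr s - repr t)).

Let lifts0 x : lifts x !=set0.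
Proof. by exists `|x + (pi *+ 2) * 0%:~R|, 0. Qed.

Let lifts_lb x : has_lbound (lifts x).
Proof. by exists 0 => _ [k _ <-]. Qed.

Let lifts_inf x : has_inf (lifts x).
Proof. by split. Qed.

Let lifts_ge0 x : 0 <= inf (lifts x).
Proof. by apply: lb_le_inf => // _ [k _ <-]. Qed.

Let lifts_le x k : inf (lifts x) <= `|x + (pi *+ 2) * k%:~R|.
Proof. by apply: ge_inf => //; exists k. Qed.

Lemma circle_distxx t : circle_dist t t = 0.
Proof.
apply/eqP; rewrite eq_le lifts_ge0 andbT (le_trans (lifts_le _ 0))//.
by rewrite subrr mulr0 addr0 normr0.
Qed.

Lemma circle_dist_sym s t : circle_dist s t = circle_dist t s.
Proof.
have sub x : lifts x `<=` lifts (- x).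
  move=> _ [k _ <-]; exists (- k) => //.
  by rewrite rmorphN/= mulrN -opprD normrN.
rewrite /circle_dist; congr inf; apply/seteqP; split.
  by rewrite -[X in _ `<=` lifts X]opprB; exact: sub.
by rewrite -[X in _ `<=` lifts X]opprB; exact: sub.
Qed.

Lemma circle_dist_triangle t s u :
  circle_dist s u <= circle_dist s t + circle_dist t u.
Proof.
rewrite /circle_dist; set a := repr s; set b := repr t; set c := repr u.
apply/ler_addgt0Pr => e e0.
have e2 : 0 < e / 2 by rewrite divr_gt0.
have [_ [k _ <-] hk] := inf_adherent e2 (lifts_inf (a - b)).
have [_ [l _ <-] hl] := inf_adherent e2 (lifts_inf (b - c)).
apply: (le_trans (lifts_le _ (k + l))).
have -> : a - c + pi *+ 2 * (k + l)%:~R =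
    (a - b + pi *+ 2 * k%:~R) + (b - c + pi *+ 2 * l%:~R).
  by rewrite rmorphD/= mulrDr [RHS]addrACA [a - b + _]addrA subrK.
apply: (le_trans (ler_normD _ _)).
by rewrite (splitr e) addrACA lerD// ltW.
Qed.

Lemma circle_dist_positivity s t : circle_dist s t = 0 -> s = t.
Proof.
rewrite /circle_dist; set x := repr s - repr t => x0.
have [_ [k _ <-]] := inf_adherent (pi_gt0 R) (lifts_inf x).
rewrite x0 add0r => hk.
suff xk : x + pi *+ 2 * k%:~R = 0.
  rewrite -[s]reprK -[t]reprK; apply/eqP; rewrite eqmodE/=.
  move/eqP: xk; rewrite addr_eq0 => /eqP xE.
  rewrite /eqmod2pi -/x xE mulNr mulrC mulKf ?gt_eqF//.
  by rewrite rpredN intr_int.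
apply/eqP; rewrite -normr_le0; apply/ler_addgt0Pr => e e0; rewrite add0r.
have m0 : 0 < Num.min e pi by rewrite lt_min e0 pi_gt0.
have [_ [l _ <-]] := inf_adherent m0 (lifts_inf x).
rewrite x0 add0r lt_min => /andP[le lp].
suff -> : k = l by exact: ltW.
have : `|pi *+ 2 * (k - l)%:~R| < pi *+ 2 :> R.
  have -> : pi *+ 2 * (k - l)%:~R =
      (x + pi *+ 2 * k%:~R) - (x + pi *+ 2 * l%:~R) :> R.
    by rewrite rmorphB/= mulrBr opprD addrACA subrr add0r.
  by rewrite (le_lt_trans (ler_normB _ _))// mulr2n ltrD.
rewrite normrM (gtr0_norm twopi_gt0) gtr_pMr// -intr_norm.
rewrite -[1]/(1%:~R) ltr_int => kl.
by apply/eqP; rewrite -subr_eq0 -normr_le0; lia.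
Qed.

HB.instance Definition _ := isMetric.Build R circle
  circle_distxx circle_dist_positivity circle_dist_sym circle_dist_triangle.

End circle.

Section hausdorff.
Context {R : realType} {T : metricType R}.
Implicit Types (A E : set T) (s d : R).
Local Open Scope ereal_scope.

Definition diam A : \bar R :=
  ereal_sup [set (mdist x y)%:E | x in A & y in A].

(* The empty set contributes 0, whereas a singleton contributes 0 `^ 0 = 1
   when s = 0. *)
Definition diam_pow s A : \bar R := if A == set0 then 0 else diam A `^ s.

Definition hausdorff_premeasure s d E : \bar R :=
  ereal_inf [set \sum_(0 <= i <oo) diam_pow s (U i) |
    U in [set U : nat -> set T |
      E `<=` \bigcup_i U i /\ forall i, diam (U i) <= d%:E]].

Definition hausdorff_measure s E : \bar R :=
  ereal_sup [set hausdorff_premeasure s d E | d in [set d | (0 < d)%R]].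

(* As s ranges over the nonnegative reals, the empty set has dimension 0. *)
Definition hausdorff_dim E : \bar R :=
  ereal_inf [set s%:E | s in [set s | (0 <= s)%R /\ hausdorff_measure s E = 0]].

End hausdorff.

Section sequence_spaces.
Variable R : realType.
Implicit Types (p beta : R) (u v w : int -> R[i]).

Definition lp_norm p beta u : \bar R :=
  ((\esum_(n in [set: int])
     (Normc.normc (u n) `^ p * (1 + `|n|%:~R) `^ (p * beta))%:E) `^ p^-1)%E.

Definition lp_space p beta : set (int -> R[i]) :=
  [set u | (lp_norm p beta u < +oo)%E].

Definition translate u (k : int) : int -> R[i] := fun n => u (n + k).

Definition linear_span (A : set (int -> R[i])) : set (int -> R[i]) :=
  [set w | exists (m : nat) (c : 'I_m -> R[i]) (v : 'I_m -> int -> R[i]),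
    (forall j, A (v j)) /\ w = fun n => \sum_(j < m) c j * v j n].

(* Density of the span of the translates of u in the normed space lp_space.
   This is only meaningful for u in lp_space p beta, where beta >= 0; note that
   lp_space 1 beta is included in lp_space p beta for p >= 1. *)
Definition cyclic p beta u : Prop :=
  forall v, lp_space p beta v -> forall e : R, 0 < e ->
    exists2 w, linear_span (range (translate u)) w &
      (lp_norm p beta (fun n => (v n - w n)%R) < e%:E)%E.

End sequence_spaces.

Section fourier.
Variable R : realType.
Implicit Types (u : int -> R[i]) (t : circle R).

Definition expi (x : R) : R[i] := cos x +i* sin x.

Definition fourier_partial u (x : R) (N : nat) : R[i]^o :=
  \sum_(j < N.*2.+1) u (j%:Z - N%:Z) * expi ((j%:Z - N%:Z)%:~R * x).

(* For absolutely summable u the symmetric partial sums converge to the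
   unconditional sum over int, and fourierE shows that the value does not
   depend on the representative of t. *)
Definition fourier u t : R[i]^o := limn (fourier_partial u (repr t)).

Definition zero_set u : set (circle R) := [set t | fourier u t = 0].

Lemma expi_period (x : R) (k : int) : expi (x + pi *+ 2 * k%:~R) = expi x.
Proof.
have H (y : R) (n : nat) : expi (y + pi *+ 2 * n%:R) = expi y.
  elim: n => [|n IH]; first by rewrite mulr0 addr0.
  by rewrite -[RHS]IH -natr1 mulrDr mulr1 addrA /expi cosD2pi sinD2pi.
case: k => n; first by rewrite -[n%:~R]/(n%:R).
by rewrite NegzE rmorphN/= mulrN -[LHS](H _ n.+1) subrK.
Qed.

Lemma fourierE u (x : R) :
  fourier u (\pi_(circle R) x) = limn (fourier_partial u x).
Proof.
rewrite /fourier; congr (limn _); apply/funext => N; apply: eq_bigr => j _.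
congr (_ * _); set n := (_ - _).
have : \pi_(circle R) (repr (\pi_(circle R) x)) = \pi_(circle R) x.
  by rewrite reprK.
move/eqP; rewrite eqmodE/= /eqmod2pi => /intrP[m hm].
have -> : repr (\pi_(circle R) x) = x + pi *+ 2 * m%:~R.
  have pi2 : pi *+ 2 != 0 :> R by rewrite gt_eqF// mulrn_wgt0// pi_gt0.
  by rewrite [_ * m%:~R]mulrC -hm (divfK pi2) addrC subrK.
by rewrite mulrDr mulrCA -rmorphM/= expi_period.
Qed.

End fourier.

(* Main.v *)
(* (1) A closed set of vanishing a-dimensional measure, a < 2/q (1 - beta q),
   carries Lipschitz cutoffs chi, equal to 1 near it, with small energy
   sum |chi^(n)|^2 (1 + |n|)^(1 - a); by Hoelder's inequality chi^ is then small
   in l^p_beta. For the zero set of u^, the sequence (1 - chi)^ lies in the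
   closed span of the translates of u, by a local Wiener-Levy theorem, so the
   unit vector is a limit of elements of that span.

   (2) A Frostman measure on the zero set yields bounded sequences in the dual of
   l^p_beta that almost annihilate every translate of u.

   (3), (4) E is the set where every factor of a product F_1 F_2 ... may be
   nonzero, the F_K being Lipschitz bumps of mean 1 whose other Fourier
   coefficients are so small in a dual norm that the partial products stay
   bounded there. In (3), F_K is an average of translated narrow bumps at random
   centres, and the partial products almost annihilate the translates of u. In
   (4), F_K is a bump dilated by a large integer A_K, and the product only serves
   to bound the dimension below. If u were not cyclic there, take a near-minimiser
   d of the distance from the unit vector to the closed span: the sequence
   S = |d|^(p-2) conj(d) w^(p beta) has spectrum near E, hence S^k, which is
   square summable with a weight because q = 2k, has spectrum near the k-fold
   sumset of E. By the arithmetic structure of E this sumset has small capacity,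
   which forces S_0 to be near 0. *)

Require Import Defs.
From HB Require Import structures.
From mathcomp Require Import all_boot all_order all_algebra.
From mathcomp Require Import all_classical all_reals all_analysis.
From mathcomp Require Import complex ring lra zify.

Set Implicit Arguments.
Unset Strict Implicit.
Unset Printing Implicit Defensive.

Import Order.TTheory GRing.Theory Num.Theory.
Import numFieldNormedType.Exports.

Local Open Scope classical_set_scope.
Local Open Scope ring_scope.
Local Open Scope complex_scope.

(** * The complex modulus and symmetric windows *)

(** Nothing is integrated and no limit measure is formed. Functions on the circle are periodic
    functions on the line, and their coefficients are limits of averages over finite grids.
    Lipschitz functions serve for every cutoff and factor: [q > 2] and [beta * q <= 1] force
    [beta < 1/2], so their coefficients are summable against the weight. Measures are finite sums of
    point masses or Lipschitz densities; almost annihilators of bounded dual norm stand in for weak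
    limits. The thresholds are exponent counts. In (1), passing from exponent 2 to p leaves a power
    of the weight that is summable exactly when a < 2/q (1 - beta q). In (3), averaging about
    Q^alpha random bumps of width 1/Q gains a factor Q^(-alpha/2) in each coefficient; the q-th
    power sum is Q^(1 - beta q - alpha q/2) up to small powers, which decays exactly above the same
    threshold. In (4), E is cut out by conditions that A_K x be close to 2 pi Z; these are
    subadditive, so a k-fold sum satisfies them with k times the width, which costs only a constant
    in capacity. *)

Notation cabs := (@Normc.normc _).

Section modulus.
Variable R : realType.
Implicit Types (z : R[i]) (x : R).

Lemma cabs_ge0 z : 0 <= cabs z.
Proof. by case: z => a b; exact: sqrtr_ge0. Qed.

Lemma cabs0 : cabs (0 : R[i]) = 0. Proof. exact: Normc.normc0. Qed.

Lemma cabs1 : cabs (1 : R[i]) = 1. Proof. exact: Normc.normc1. Qed.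

Lemma cabsM z1 z2 : cabs (z1 * z2) = cabs z1 * cabs z2.
Proof. exact: Normc.normcM. Qed.

Lemma cabsD z1 z2 : cabs (z1 + z2) <= cabs z1 + cabs z2.
Proof. exact: (@le_normcD R z1 z2). Qed.

Lemma cabsN z : cabs (- z) = cabs z.
Proof. exact: (@normcN R z). Qed.

Lemma cabsB z1 z2 : cabs (z1 - z2) <= cabs z1 + cabs z2.
Proof. by rewrite -(cabsN z2) cabsD. Qed.

Lemma cabs_distC z1 z2 : cabs (z1 - z2) = cabs (z2 - z1).
Proof. by rewrite -cabsN opprB. Qed.

Lemma cabs_dist_triangle z3 z1 z2 :
  cabs (z1 - z2) <= cabs (z1 - z3) + cabs (z3 - z2).
Proof. by rewrite -{1}(subrK z3 z1) -addrA cabsD. Qed.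

Lemma cabsX z n : cabs (z ^+ n) = cabs z ^+ n.
Proof. by elim: n => [|n IH]; rewrite ?expr0 ?cabs1// !exprS cabsM IH. Qed.

Lemma cabsR x : cabs x%:C = `|x|.
Proof. by rewrite /= expr0n /= addr0 sqrtr_sqr. Qed.

Lemma cabs_nat n : cabs (n%:R : R[i]) = n%:R.
Proof. by rewrite -(rmorph_nat (real_complex R)) cabsR ger0_norm. Qed.

Lemma cabsV z : cabs z^-1 = (cabs z)^-1.
Proof. exact: Normc.normcV. Qed.

Lemma cabsJ z : cabs (conjc z) = cabs z.
Proof. by case: z => a b /=; rewrite sqrrN. Qed.

Lemma cabs_eq0 z : cabs z = 0 -> z = 0.
Proof. exact: Normc.eq0_normc. Qed.

Lemma cabs_gt0 z : z != 0 -> 0 < cabs z.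
Proof.
move=> z0; rewrite lt_neqAle cabs_ge0 andbT eq_sym.
by apply: contra_neq z0 => /cabs_eq0.
Qed.

Lemma cabs_sqr z : cabs z ^+ 2 = complex.Re z ^+ 2 + complex.Im z ^+ 2.
Proof. by case: z => a b /=; rewrite sqr_sqrtr// addr_ge0// sqr_ge0. Qed.

Lemma cabs_sqrC z : (cabs z ^+ 2)%:C = z * conjc z.
Proof. by case: z => a b; rewrite cabs_sqr/=; apply/eqP; rewrite eq_complex /= ; apply/andP; split; apply/eqP; ring. Qed.

Lemma conjcM z1 z2 : conjc (z1 * z2) = conjc z1 * conjc z2.
Proof. exact: (rmorphM (@conjc R)). Qed.

Lemma cabs_Re z : `|complex.Re z| <= cabs z.
Proof.
by case: z => a b /=; rewrite -sqrtr_sqr ler_wsqrtr // lerDl sqr_ge0.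
Qed.

Lemma cabs_Im z : `|complex.Im z| <= cabs z.
Proof.
by case: z => a b /=; rewrite -sqrtr_sqr ler_wsqrtr // lerDr sqr_ge0.
Qed.

Lemma cabs_ReIm z : cabs z <= `|complex.Re z| + `|complex.Im z|.
Proof.
rewrite -(@ler_pXn2r _ 2)// ?nnegrE ?cabs_ge0 ?addr_ge0//.
rewrite cabs_sqr -(real_normK (num_real (complex.Re z))) -(real_normK (num_real (complex.Im z))).
have := normr_ge0 (complex.Re z); have := normr_ge0 (complex.Im z); nra.
Qed.

Lemma cabs_sum (I : Type) (r : seq I) (P : pred I) (F : I -> R[i]) :
  cabs (\sum_(i <- r | P i) F i) <= \sum_(i <- r | P i) cabs (F i).
Proof.
elim/big_ind2: _ => [|x1 x2 y1 y2 h1 h2|//]; first by rewrite cabs0.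
by rewrite (le_trans (cabsD _ _))// lerD.
Qed.

Lemma expiD x y : expi (x + y) = expi x * expi y :> R[i].
Proof. by rewrite /expi cosD sinD; simpc; congr (_ +i* _); ring. Qed.

Lemma expi0 : expi 0 = 1 :> R[i].
Proof. by rewrite /expi cos0 sin0. Qed.

Lemma expiN x : expi (- x) = conjc (expi x) :> R[i].
Proof. by rewrite /expi cosN sinN. Qed.

Lemma cabs_expi x : cabs (expi x) = 1.
Proof. by rewrite /expi /= cos2Dsin2 sqrtr1. Qed.

Lemma expiMn (n : nat) x : expi (n%:R * x) = expi x ^+ n.
Proof.
elim: n => [|n IH]; first by rewrite mul0r expi0 expr0.
by rewrite -natr1 mulrDl mul1r expiD IH exprSr.
Qed.

Lemma cabs_expi_sub1 x : cabs (expi x - 1) ^+ 2 = (2 * sin (x / 2)) ^+ 2.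
Proof.
rewrite cabs_sqr /=.
have -> : x = x / 2 + x / 2 by rewrite -splitr.
set y := x / 2; have -> : (y + y) / 2 = y by field.
rewrite cosD sinD; have := cos2Dsin2 y.
set c := cos y; set s := sin y => h.
have -> : c * c = 1 - s ^+ 2 by rewrite -h; ring.
rewrite oppr0 addr0.
have -> : s * c + c * s = 2 * (s * c) by ring.
rewrite exprMn (exprMn _ s c).
have -> : c ^+ 2 = 1 - s ^+ 2 by rewrite -h; ring.
by ring.
Qed.

Lemma sin_lip0 x : `|sin x| <= `|x|.
Proof.
wlog x0 : x / 0 <= x.
  move=> h; have [x0|/ltW x0] := leP 0 x; first exact: h.
  by have := h (- x); rewrite sinN !normrN; apply; rewrite oppr_ge0.
rewrite [X in _ <= X]ger0_norm//.
have [|c _] := @MVT_segment R sin cos 0 x x0.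
  by apply: continuous_subspaceT; exact: continuous_sin.
by rewrite sin0 !subr0 => ->; rewrite normrM (ger0_norm x0) ler_piMl// cos_max.
Qed.

Lemma cabs_expi_lip x y : cabs (expi x - expi y) <= `|x - y|.
Proof.
have -> : expi x - expi y = expi y * (expi (x - y) - 1).
  by rewrite mulrBr -expiD mulr1 [y + _]addrC subrK.
rewrite cabsM cabs_expi mul1r -(@ler_pXn2r _ 2)// ?nnegrE ?cabs_ge0//.
rewrite cabs_expi_sub1 -(real_normK (num_real (2 * _))).
rewrite ler_pXn2r ?nnegrE// normrM ger0_norm//.
have := sin_lip0 ((x - y) / 2); rewrite normrM [`|2^-1|]ger0_norm ?invr_ge0//; lra.
Qed.

End modulus.

Section windows.
Variable R : realType.
Implicit Types (n m : int) (N : nat) (a : int -> R[i]) (h : int -> R).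

(** The window from -N to N, listed in the order of [fourier_partial]; it is locked so that
    simplification never unfolds it. *)
Definition zw N : seq int := locked [seq j%:Z - N%:Z | j <- iota 0 N.*2.+1].

Lemma mem_zw N n : (n \in zw N) = (absz n <= N)%N.
Proof.
rewrite /zw -lock; apply/mapP/idP => [[j]|nN]; first by rewrite mem_iota => ? ->; lia.
by exists (absz (n + N%:Z)); [rewrite mem_iota|]; lia.
Qed.

Lemma zw_uniq N : uniq (zw N).
Proof. by rewrite /zw -lock map_inj_uniq ?iota_uniq// => i j; lia. Qed.

Lemma sum_zw (V : nmodType) N (F : int -> V) :
  \sum_(n <- zw N) F n = \sum_(j < N.*2.+1) F (j%:Z - N%:Z).
Proof. by rewrite /zw -lock big_map -(big_mkord xpredT (fun j : nat => F (j%:Z - N%:Z))). Qed.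

Lemma perm_zwS N : perm_eq (zw N.+1) [:: N.+1%:Z, - N.+1%:Z & zw N].
Proof.
apply: uniq_perm; rewrite ?zw_uniq//=.
  by rewrite !inE !mem_zw zw_uniq; lia.
by move=> n; rewrite !inE !mem_zw; lia.
Qed.

Lemma sum_zwS (V : nmodType) N (F : int -> V) :
  \sum_(n <- zw N.+1) F n = F N.+1%:Z + (F (- N.+1%:Z) + \sum_(n <- zw N) F n).
Proof. by rewrite (perm_big _ (perm_zwS N)) !big_cons. Qed.

Lemma sum_zw0 (V : nmodType) (F : int -> V) : \sum_(n <- zw 0) F n = F 0.
Proof. by rewrite /zw -lock big_map big_seq1. Qed.

Lemma ler_sum_sub (I : eqType) (s t : seq I) (F : I -> R) :
  uniq s -> {subset s <= t} -> uniq t -> (forall i, i \in t -> 0 <= F i) ->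
  \sum_(i <- s) F i <= \sum_(i <- t) F i.
Proof.
move=> us st ut F0; rewrite [X in _ <= X](bigID (mem s))/=.
have -> : \sum_(i <- t | i \in s) F i = \sum_(i <- s) F i.
  rewrite -big_filter; apply: perm_big; apply: uniq_perm => //.
    exact: filter_uniq.
  move=> i; rewrite mem_filter andb_idr//; exact: st.
by rewrite lerDl big_seq_cond sumr_ge0// => i /andP[/F0].
Qed.

Lemma ler_sum_zw h (s : seq int) N : uniq s -> (forall n, 0 <= h n) ->
  (forall n, n \in s -> (absz n <= N)%N) ->
  \sum_(n <- s) h n <= \sum_(n <- zw N) h n.
Proof.
move=> us h0 sN; apply: ler_sum_sub; rewrite ?zw_uniq// => n ns.
by rewrite mem_zw sN.
Qed.

Lemma seq_absz_bound (s : seq int) : exists N, forall n, n \in s -> (absz n <= N)%N.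
Proof.
elim: s => [|n s [N IH]]; first by exists 0%N.
exists (maxn (absz n) N) => k; rewrite inE leq_max => /predU1P[->|/IH ->].
  by rewrite leqnn.
by rewrite orbT.
Qed.

Lemma zw_bound_sum h C (s : seq int) : uniq s -> (forall n, 0 <= h n) ->
  (forall N, \sum_(n <- zw N) h n <= C) -> \sum_(n <- s) h n <= C.
Proof.
move=> us h0 hC; have [N sN] := seq_absz_bound s.
by rewrite (le_trans (ler_sum_zw us h0 sN)).
Qed.

(** The window sums have a supremum. Once a window comes within e of it, any finite set disjoint
    from that window can add at most e. *)
Lemma zw_tail h C : (forall n, 0 <= h n) ->
  (forall N, \sum_(n <- zw N) h n <= C) -> forall e, 0 < e ->
  exists N0, forall s, uniq s -> (forall n, n \in s -> (N0 < absz n)%N) ->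
    \sum_(n <- s) h n <= e.
Proof.
move=> h0 hC e e0; pose S := [set \sum_(n <- zw N) h n | N in [set: nat]].
have hS : has_sup S.
  by split; [exists (\sum_(n <- zw 0) h n), 0%N | exists C => _ [N _ <-]].
have [_ [N0 _ <-] hN0] := sup_adherent e0 hS.
exists N0 => s us sN.
have : \sum_(n <- s ++ zw N0) h n <= sup S.
  have [M hM] := seq_absz_bound (s ++ zw N0).
  apply: (@le_trans _ _ (\sum_(n <- zw M) h n)).
    apply: ler_sum_zw => //; rewrite cat_uniq us zw_uniq andbT /=.
    by apply/hasPn => n; rewrite mem_zw => nN; apply/negP => /sN; rewrite ltnNge nN.
  by apply: ub_le_sup; [case: hS|exists M].
by rewrite big_cat/=; lra.
Qed.

End windows.

(** * Limits of complex sequences, with real epsilons *)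

Section complex_limits.
Variable R : realType.
Implicit Types (z w : nat -> R[i]) (l : R[i]).

Definition clim z l := forall e : R, 0 < e ->
  exists N0, forall N, (N0 <= N)%N -> cabs (z N - l) <= e.

Lemma climD z w l k : clim z l -> clim w k -> clim (fun N => z N + w N) (l + k).
Proof.
move=> hz hw e e0; have e2 : 0 < e / 2 by lra.
have [N1 h1] := hz _ e2; have [N2 h2] := hw _ e2.
exists (maxn N1 N2) => N; rewrite geq_max => /andP[/h1 {}h1 /h2 {}h2].
have -> : z N + w N - (l + k) = (z N - l) + (w N - k) by ring.
by rewrite (le_trans (cabsD _ _))//; lra.
Qed.

Lemma climMl c z l : clim z l -> clim (fun N => c * z N) (c * l).
Proof.
move=> hz e e0; have c0 := cabs_ge0 c.
have [|N1 h1] := hz (e / (1 + cabs c)); first by rewrite divr_gt0//; lra.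
exists N1 => N /h1; rewrite -mulrBr cabsM ler_pdivlMr; last by lra.
have := cabs_ge0 (z N - l); nra.
Qed.

Lemma clim_bound z l C N1 : clim z l -> (forall N, (N1 <= N)%N -> cabs (z N) <= C) ->
  cabs l <= C.
Proof.
move=> hz hC; apply/ler_addgt0Pr => e e0.
have [N0 h0] := hz _ e0; pose N := maxn N0 N1.
have -> : l = z N - (z N - l) by rewrite opprB addrC subrK.
by rewrite (le_trans (cabsB _ _))// lerD ?hC ?h0// ?leq_maxr ?leq_maxl.
Qed.

Lemma clim_cst l : clim (fun=> l) l.
Proof. by move=> e e0; exists 0%N => N _; rewrite subrr cabs0 ltW. Qed.

Lemma eq_clim N1 z w l : (forall N, (N1 <= N)%N -> z N = w N) -> clim z l -> clim w l.
Proof.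
move=> zw hz e e0; have [N0 h0] := hz _ e0; exists (maxn N0 N1) => N.
by rewrite geq_max => /andP[/h0 h /zw <-].
Qed.

Lemma climN z l : clim z l -> clim (fun N => - z N) (- l).
Proof. 
move=> /(climMl (-1)); rewrite mulN1r; apply: (@eq_clim 0%N) => N _.
by rewrite mulN1r.
Qed.

Lemma clim_unique z l k : clim z l -> clim z k -> l = k.
Proof.
move=> hl hk; apply/eqP; rewrite -subr_eq0; apply/eqP/cabs_eq0/eqP.
rewrite eq_le cabs_ge0 andbT; apply/ler_addgt0Pr => e e0.
have [N0 h0] := climD hl (climN hk) e0; have := h0 N0 (leqnn _).
by rewrite subrr sub0r cabsN add0r.
Qed.

Lemma clim_sum (I : Type) (r : seq I) (F : I -> nat -> R[i]) (L : I -> R[i]) :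
  (forall i, clim (F i) (L i)) ->
  clim (fun N => \sum_(i <- r) F i N) (\sum_(i <- r) L i).
Proof.
move=> h; elim: r => [|i r IH].
  by rewrite big_nil; apply: (@eq_clim 0%N) (clim_cst 0) => N _; rewrite big_nil.
rewrite big_cons; apply: (@eq_clim 0%N) (climD (h i) IH) => N _.
by rewrite big_cons.
Qed.

(** Completeness is inherited from the reals through the real and imaginary parts. *)
Lemma cauchy_clim z :
  (forall e, 0 < e -> exists N0, forall M N, (N0 <= N)%N -> (N <= M)%N ->
     cabs (z M - z N) <= e) ->
  exists l, clim z l.
Proof.
move=> hz.
have key (f : R[i] -> R) : (forall x y, `|f x - f y| <= cabs (x - y)) ->
    exists l : R, forall e, 0 < e -> exists N0, forall N, (N0 <= N)%N -> `|f (z N) - l| <= e.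
  move=> hf.
  have cv : cvgn (f \o z).
    apply/cauchy_cvgP/cauchyP => e e0.
    have e2 : 0 < e / 2 by lra.
    have [N0 h0] := hz _ e2.
    exists (f (z N0)); exists N0 => //= N hN.
    by rewrite /ball /= distrC (le_lt_trans (hf _ _))// (le_lt_trans (h0 _ _ _ hN))//; lra.
  exists (limn (f \o z)) => e e0.
  have /cvgrPdist_le/(_ _ e0)[N0 _ h0] := cv.
  by exists N0 => N hN; rewrite distrC h0.
have [|lr hr] := key (@complex.Re R).
  move=> x y; apply: le_trans (cabs_Re (x - y)).
  by case: x => ? ?; case: y.
have [|li hi] := key (@complex.Im R).
  move=> x y; apply: le_trans (cabs_Im (x - y)).
  by case: x => ? ?; case: y.
exists (lr +i* li) => e e0; have e2 : 0 < e / 2 by lra.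
have [N1 h1] := hr _ e2; have [N2 h2] := hi _ e2.
exists (maxn N1 N2) => N; rewrite geq_max => /andP[/h1 {}h1 /h2 {}h2].
rewrite (le_trans (cabs_ReIm _))//.
by move: h1 h2; case: (z N) => a b /=; lra.
Qed.

End complex_limits.

(** * Weighted summable sequences and their Fourier series *)

Section weights.
Variable R : realType.
Implicit Types (n m : int) (b : R).

Definition wt n : R := 1 + `|n|%:~R.

Lemma wtE n : wt n = 1 + (absz n)%:R.
Proof. by rewrite /wt -abszE. Qed.

Lemma wt_ge1 n : 1 <= wt n.
Proof. by rewrite wtE lerDl. Qed.

Lemma wt_gt0 n : 0 < wt n.
Proof. exact: lt_le_trans ltr01 (wt_ge1 n). Qed.

Lemma wt_ge0 n : 0 <= wt n. Proof. exact/ltW/wt_gt0. Qed.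

Lemma wt0 : wt 0 = 1. Proof. by rewrite wtE addr0. Qed.

Lemma wtN n : wt (- n) = wt n.
Proof. by rewrite !wtE abszN. Qed.

(** Submultiplicativity of the weight is what makes weighted l^1 a convolution algebra and
    translations bounded. *)
Lemma wtD m n : wt (m + n) <= wt m * wt n.
Proof.
rewrite !wtE mulrDr mulr1 mulrDl mul1r -!addrA lerD2l -natrM -!natrD ler_nat.
have : (absz (m + n)%R <= absz m + absz n)%N by lia.
by move=> h; rewrite (leq_trans h)// leq_add2l leq_addr.
Qed.

Lemma wtB m n : wt n <= wt m * wt (n - m).
Proof. by rewrite -{1}(subrK m n) addrC wtD. Qed.

Lemma wtp_gt0 b n : 0 < wt n `^ b.
Proof. by rewrite powR_gt0// wt_gt0. Qed.

Lemma wtp_ge0 b n : 0 <= wt n `^ b. Proof. exact: powR_ge0. Qed.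

Lemma wtp_ge1 b n : 0 <= b -> 1 <= wt n `^ b.
Proof. by move=> b0; rewrite -(powRr0 (wt n)) ler_powR// wt_ge1. Qed.

Lemma wtpB b m n : 0 <= b -> wt n `^ b <= wt m `^ b * wt (n - m) `^ b.
Proof.
move=> b0; rewrite -powRM ?wt_ge0//.
by rewrite ge0_ler_powR ?nnegrE ?wt_ge0 ?mulr_ge0 ?wt_ge0 ?wtB.
Qed.

End weights.
Arguments wt {R} n.

Lemma ler_sum_seq (R : numDomainType) (I : eqType) (r : seq I) (F G : I -> R) :
  (forall i, i \in r -> F i <= G i) -> \sum_(i <- r) F i <= \sum_(i <- r) G i.
Proof. by move=> h; rewrite big_seq [X in _ <= X]big_seq ler_sum. Qed.

Section csum.
Variable R : realType.
Implicit Types (f g a : int -> R[i]) (n m : int) (b C : R).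

(** Limit of the symmetric window sums, with default value 0; a bound [ssum] guarantees that the
    limit exists. *)
Definition csum f : R[i] := xget 0 [set l | clim (fun N => \sum_(n <- zw N) f n) l].

Definition ssum f C := forall N, \sum_(n <- zw N) cabs (f n) <= C.

Lemma csum_eq f l : clim (fun N => \sum_(n <- zw N) f n) l -> csum f = l.
Proof.
move=> h; rewrite /csum; case: xgetP => [k _ hk|/(_ l)//].
exact: clim_unique hk h.
Qed.

Lemma csumP f C : ssum f C -> clim (fun N => \sum_(n <- zw N) f n) (csum f).
Proof.
move=> hf; suff [l hl] : exists l, clim (fun N => \sum_(n <- zw N) f n) l.
  by rewrite (csum_eq hl).
apply: cauchy_clim => e e0.
have [N0 h0] := zw_tail (fun n => cabs_ge0 (f n)) hf e0.
exists N0 => M N hN NM.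
have -> : \sum_(n <- zw M) f n - \sum_(n <- zw N) f n =
   \sum_(n <- [seq n <- zw M | n \notin zw N]) f n.
  rewrite (bigID (mem (zw N)))/= big_filter [X in X + _ - _](_ : _ = \sum_(n <- zw N) f n).
    by rewrite addrC addKr.
  rewrite -big_filter; apply: perm_big; apply: uniq_perm; rewrite ?filter_uniq ?zw_uniq//.
  by move=> n; rewrite mem_filter !mem_zw andb_idr// => /leq_trans; apply.
rewrite (le_trans (cabs_sum _ _ _))// h0 ?filter_uniq ?zw_uniq//.
by move=> n; rewrite mem_filter !mem_zw -ltnNge => /andP[+ _]; apply: leq_ltn_trans.
Qed.

Lemma csum_bound f C : ssum f C -> cabs (csum f) <= C.
Proof.
move=> hf; apply: (clim_bound (N1 := 0%N) (csumP hf)) => N _.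
exact: le_trans (cabs_sum _ _ _) (hf N).
Qed.

Lemma csumD f g C D : ssum f C -> ssum g D ->
  csum (fun n => f n + g n) = csum f + csum g.
Proof.
move=> hf hg; apply: csum_eq; apply: (@eq_clim _ 0%N) (climD (csumP hf) (csumP hg)).
by move=> N _; rewrite big_split.
Qed.

Lemma csumZ (c : R[i]) f C : ssum f C -> csum (fun n => c * f n) = c * csum f.
Proof.
move=> hf; apply: csum_eq; apply: (@eq_clim _ 0%N) (climMl c (csumP hf)).
by move=> N _; rewrite mulr_sumr.
Qed.

Lemma csum_fin f N : (forall n, (N < absz n)%N -> f n = 0) ->
  csum f = \sum_(n <- zw N) f n.
Proof.
move=> hf; apply: csum_eq; apply: (@eq_clim _ N) (clim_cst _) => M NM.
rewrite [RHS](bigID (mem (zw N)))/= [X in _ = _ + X]big1 ?addr0; last first.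
  by move=> n; rewrite mem_zw -ltnNge => /hf.
rewrite -[RHS]big_filter; apply: perm_big; apply: uniq_perm; rewrite ?filter_uniq ?zw_uniq//.
by move=> n; rewrite mem_filter !mem_zw andb_idr// => /leq_trans; apply.
Qed.

Lemma ssumZ (c : R[i]) f C : ssum f C -> ssum (fun n => c * f n) (cabs c * C).
Proof.
move=> hf N; rewrite (le_trans _ (ler_wpM2l (cabs_ge0 c) (hf N)))//.
by rewrite mulr_sumr ler_sum// => n _; rewrite cabsM.
Qed.

Lemma le_ssum f g C : (forall n, cabs (f n) <= cabs (g n)) -> ssum g C -> ssum f C.
Proof. by move=> h hg N; rewrite (le_trans _ (hg N))// ler_sum. Qed.

Lemma ssum_ge0 f C : ssum f C -> 0 <= C.
Proof. by move=> /(_ 0%N); apply: le_trans; rewrite sumr_ge0// => n _; exact: cabs_ge0. Qed.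

Lemma ssum_cabs f C n : ssum f C -> cabs (f n) <= C.
Proof.
move=> /(_ (absz n)); apply: le_trans.
rewrite -(big_seq1 +%R n (fun n => cabs (f n))); apply: ler_sum_zw => // [k|k].
  exact: cabs_ge0.
by rewrite inE => /eqP ->.
Qed.

Lemma ssum_shift f C m : ssum f C -> ssum (fun n => f (n - m)) C.
Proof.
move=> hf N; rewrite -(big_map (fun n => n - m) xpredT (fun n => cabs (f n))).
apply: zw_bound_sum => // [|n]; last exact: cabs_ge0.
by rewrite map_inj_uniq ?zw_uniq// => x y /addIr.
Qed.

(** The weighted l^1 norm of a is at most C. Explicit bounds on all windows replace norms, so no
    supremum has to be manipulated. *)
Definition bnd b a C := forall N, \sum_(n <- zw N) cabs (a n) * wt n `^ b <= C.

Lemma bnd_ssum b a C : 0 <= b -> bnd b a C -> ssum a C.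
Proof.
move=> b0 ha N; rewrite (le_trans _ (ha N))// ler_sum// => n _.
by rewrite ler_peMr ?cabs_ge0// wtp_ge1.
Qed.

Lemma ssum_bnd a C : ssum a C -> bnd 0 a C.
Proof.
by move=> ha N; rewrite (le_trans _ (ha N))// ler_sum// => n _; rewrite powRr0 mulr1.
Qed.

Lemma bnd_ge0 b a C : bnd b a C -> 0 <= C.
Proof.
move=> /(_ 0%N); apply: le_trans; rewrite sumr_ge0// => n _.
by rewrite mulr_ge0 ?cabs_ge0 ?wtp_ge0.
Qed.

Lemma bndD b f g C D : bnd b f C -> bnd b g D -> bnd b (fun n => f n + g n) (C + D).
Proof.
move=> hf hg N; rewrite (le_trans _ (lerD (hf N) (hg N)))//.
rewrite -big_split/= ler_sum// => n _; rewrite -mulrDl.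
by rewrite ler_wpM2r ?wtp_ge0 ?cabsD.
Qed.

Lemma bndZ b (c : R[i]) f C : bnd b f C -> bnd b (fun n => c * f n) (cabs c * C).
Proof.
move=> hf N; rewrite (le_trans _ (ler_wpM2l (cabs_ge0 c) (hf N)))//.
by rewrite mulr_sumr ler_sum// => n _; rewrite cabsM mulrA.
Qed.

Lemma bndN b f C : bnd b f C -> bnd b (fun n => - f n) C.
Proof.
by move=> hf N; rewrite (le_trans _ (hf N))// ler_sum// => n _; rewrite cabsN.
Qed.

Lemma bndB b f g C D : bnd b f C -> bnd b g D -> bnd b (fun n => f n - g n) (C + D).
Proof. by move=> hf /bndN; exact: bndD. Qed.

Lemma bnd_le b f C D : C <= D -> bnd b f C -> bnd b f D.
Proof. by move=> h hf N; rewrite (le_trans (hf N)). Qed.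

Lemma bnd_weight b b' f C : b' <= b -> bnd b f C -> bnd b' f C.
Proof.
move=> h hf N; rewrite (le_trans _ (hf N))// ler_sum// => n _.
by rewrite ler_wpM2l ?cabs_ge0// ler_powR// wt_ge1.
Qed.

Definition single m (c : R[i]) : int -> R[i] := fun n => if n == m then c else 0.

Lemma bnd_single b m c : bnd b (single m c) (cabs c * wt m `^ b).
Proof.
move=> N; have c0 : 0 <= cabs c * wt m `^ b by rewrite mulr_ge0 ?cabs_ge0 ?wtp_ge0.
have [mN|mN] := boolP (m \in zw N).
  rewrite (bigD1_seq m)//= ?zw_uniq// big1 ?addr0 /single ?eqxx//.
  by move=> i /negPf ->; rewrite cabs0 mul0r.
rewrite big_seq big1// => n nN; rewrite /single; case: eqP nN mN => [-> ->//|_ _ _].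
by rewrite cabs0 mul0r.
Qed.

Definition trunc N a : int -> R[i] := fun n => if (absz n <= N)%N then a n else 0.

Lemma bnd_trunc b N a C : bnd b a C -> bnd b (trunc N a) C.
Proof.
move=> ha M; rewrite (le_trans _ (ha M))// ler_sum// => n _.
by rewrite ler_wpM2r ?wtp_ge0// /trunc; case: ifP => // _; rewrite cabs0 cabs_ge0.
Qed.

Lemma trunc_approx b a C : bnd b a C -> forall e, 0 < e -> exists N0, forall N, (N0 <= N)%N ->
  bnd b (fun n => a n - trunc N a n) e.
Proof.
move=> ha e e0.
have h0 n : 0 <= cabs (a n) * wt n `^ b by rewrite mulr_ge0 ?cabs_ge0 ?wtp_ge0.
have [N0 hN0] := zw_tail h0 ha e0; exists N0 => N NN M.
apply: le_trans (hN0 _ (filter_uniq (fun n => (N < absz n)%N) (zw_uniq M)) _); last first.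
  by move=> n; rewrite mem_filter => /andP[/(leq_ltn_trans NN)].
rewrite big_filter [X in X <= _](bigID (fun n => (N < absz n)%N))/= addrC big1 ?add0r.
  by apply: ler_sum => n nN; rewrite /trunc leqNgt nN/= subr0.
by move=> n; rewrite -leqNgt /trunc => ->; rewrite subrr cabs0 mul0r.
Qed.

Lemma trunc0 a : trunc 0 a = single 0 (a 0).
Proof.
by apply/funext => n; rewrite /trunc /single leqn0 absz_eq0; case: eqP => [->|].
Qed.

Lemma truncS N a : trunc N.+1 a = fun n => single N.+1%:Z (a N.+1%:Z) n +
  (single (- N.+1%:Z) (a (- N.+1%:Z)) n + trunc N a n).
Proof.
apply/funext => n; rewrite /trunc /single.
have [->|n1] := eqVneq n N.+1%:Z; first by rewrite leqnn ifF ?ltnn ?addr0//; lia.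
have [->|n2] := eqVneq n (- N.+1%:Z); first by rewrite abszN absz_nat leqnn ltnn add0r addr0.
by rewrite !add0r; congr (if _ then _ else _); lia.
Qed.

(** Density of finitely supported sequences. Linear identities such as [ev_shift] and [ev_conv] need
    then be checked on one-point sequences only, without rearranging double series. *)
Lemma l1_dense b (Phi : (int -> R[i]) -> R[i]) (K : R) :
  (forall a1 a2 C1 C2, bnd b a1 C1 -> bnd b a2 C2 ->
     Phi (fun n => a1 n + a2 n) = Phi a1 + Phi a2) ->
  (forall a C, bnd b a C -> cabs (Phi a) <= K * C) ->
  (forall m c, Phi (single m c) = 0) ->
  forall a C, bnd b a C -> Phi a = 0.
Proof.
move=> add bound sing a C ha.
have trn N : Phi (trunc N a) = 0.
  elim: N => [|N IH]; first by rewrite trunc0 sing.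
  have h1 := bnd_single b N.+1%:Z (a N.+1%:Z).
  have h2 := bnd_single b (- N.+1%:Z) (a (- N.+1%:Z)).
  have h3 := bnd_trunc N ha.
  by rewrite truncS (add _ _ _ _ h1 (bndD h2 h3)) (add _ _ _ _ h2 h3) IH !sing !addr0.
apply/cabs_eq0/eqP; rewrite eq_le cabs_ge0 andbT; apply/ler_addgt0Pr => e e0.
have K1 : 0 < 1 + `|K| by rewrite ltr_wpDr.
have e1 : 0 < e / (1 + `|K|) by rewrite divr_gt0.
have [N /(_ N (leqnn _)) hN] := trunc_approx ha e1.
have -> : a = fun n => (a n - trunc N a n) + trunc N a n.
  by apply/funext => n; rewrite subrK.
rewrite (add _ _ _ _ hN (bnd_trunc N ha)) trn addr0 add0r (le_trans (bound _ _ hN))//.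
rewrite mulrA ler_pdivrMr// [K * e]mulrC ler_wpM2l ?ltW//.
by rewrite (le_lt_trans (ler_norm K))// ltrDr.
Qed.

End csum.

(** * Values of Fourier series, and convolution *)

Section evaluation.
Variable R : realType.
Implicit Types (f g a : int -> R[i]) (n m : int) (b C x : R).

Definition ev a x := csum (fun n => a n * expi (n%:~R * x)).

Lemma ssum_ev a C x : ssum a C -> ssum (fun n => a n * expi (n%:~R * x)) C.
Proof. by apply: le_ssum => n; rewrite cabsM cabs_expi mulr1. Qed.

Lemma ev_bound a C x : ssum a C -> cabs (ev a x) <= C.
Proof. by move=> ha; exact/csum_bound/ssum_ev. Qed.

Lemma evD f g C D x : ssum f C -> ssum g D ->
  ev (fun n => f n + g n) x = ev f x + ev g x.
Proof.
move=> hf hg; rewrite /ev -(csumD (ssum_ev x hf) (ssum_ev x hg)).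
by congr csum; apply/funext => n; rewrite mulrDl.
Qed.

Lemma evZ c f C x : ssum f C -> ev (fun n => c * f n) x = c * ev f x.
Proof.
move=> hf; rewrite /ev -(csumZ c (ssum_ev x hf)).
by congr csum; apply/funext => n; rewrite mulrA.
Qed.

Lemma evB f g C D x : ssum f C -> ssum g D ->
  ev (fun n => f n - g n) x = ev f x - ev g x.
Proof.
move=> hf hg; have -> : (fun n => f n - g n) = (fun n => f n + (-1) * g n).
  by apply/funext => n; rewrite mulN1r.
by rewrite (evD _ hf (ssumZ (-1) hg)) (evZ _ _ hg) mulN1r.
Qed.

Lemma ev_fin a N x : (forall n, (N < absz n)%N -> a n = 0) ->
  ev a x = \sum_(n <- zw N) a n * expi (n%:~R * x).
Proof. by move=> ha; apply: csum_fin => n /ha ->; rewrite mul0r. Qed.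

Lemma ev_trunc a N x :
  ev (trunc N a) x = \sum_(n <- zw N) a n * expi (n%:~R * x).
Proof.
rewrite (@ev_fin _ N) => [|n]; last by rewrite /trunc ltnNge => /negPf ->.
by apply: eq_big_seq => n; rewrite mem_zw /trunc => ->.
Qed.

Lemma ev_single m c x : ev (single m c) x = c * expi (m%:~R * x).
Proof.
rewrite (@ev_fin _ (absz m)) => [|n]; last by rewrite /single; case: eqP => // ->; rewrite ltnn.
rewrite (bigD1_seq m) ?zw_uniq ?mem_zw ?leqnn//= big1 ?addr0 /single ?eqxx//.
by move=> n /negPf ->; rewrite mul0r.
Qed.

Lemma ev_period a x (k : int) : ev a (x + pi *+ 2 * k%:~R) = ev a x.
Proof.
rewrite /ev; congr csum; apply/funext => n; congr (_ * _).
by rewrite mulrDr mulrCA -intrM expi_period.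
Qed.

Lemma ev_shift f C m x : ssum f C -> ev (fun n => f (n - m)) x = expi (m%:~R * x) * ev f x.
Proof.
move=> hf; apply/eqP; rewrite -subr_eq0; apply/eqP.
pose Phi a := ev (fun n => a (n - m)) x - expi (m%:~R * x) * ev a x.
have h0 := lexx (0 : R).
apply: (@l1_dense _ 0 Phi 2 _ _ _ f C (ssum_bnd hf)).
- move=> a1 a2 C1 C2 /(bnd_ssum h0) h1 /(bnd_ssum h0) h2; rewrite /Phi.
  rewrite (evD _ (ssum_shift m h1) (ssum_shift m h2)) (evD _ h1 h2).
  by rewrite mulrDr opprD addrACA.
- move=> a D /(bnd_ssum h0) ha; rewrite /Phi (le_trans (cabsB _ _))//.
  rewrite cabsM cabs_expi mul1r mulr_natl mulr2n lerD ?ev_bound//.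
  exact: ssum_shift.
- move=> k c; rewrite /Phi; have -> : (fun n => single k c (n - m)) = single (k + m) c.
    by apply/funext => n; rewrite /single subr_eq.
  by rewrite !ev_single intrD mulrDl expiD; ring.
Qed.

Definition convol a f : int -> R[i] := fun n => csum (fun m => a m * f (n - m)).

Lemma ssum_conv1 a f A C n : ssum a A -> ssum f C -> ssum (fun m => a m * f (n - m)) (A * C).
Proof.
move=> ha hf N; apply: (@le_trans _ _ (\sum_(m <- zw N) cabs (a m) * C)).
  by apply: ler_sum => m _; rewrite cabsM ler_wpM2l ?cabs_ge0// ssum_cabs.
by rewrite -mulr_suml ler_wpM2r// (ssum_ge0 hf).
Qed.

Lemma clim_unif (I : eqType) (s : seq I) (F : I -> nat -> R[i]) (L : I -> R[i]) e :
  (forall i, clim (F i) (L i)) -> 0 < e ->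
  exists N, forall i, i \in s -> cabs (F i N - L i) <= e.
Proof.
move=> h e0; suff [N0 hN] : exists N0, forall i, i \in s -> forall N, (N0 <= N)%N -> cabs (F i N - L i) <= e.
  by exists N0 => i /hN; apply.
elim: s => [|i s [N1 IH]]; first by exists 0%N.
have [N2 h2] := h i _ e0; exists (maxn N1 N2) => j; rewrite inE => /predU1P[->|js] N.
  by rewrite geq_max => /andP[_ /h2].
by rewrite geq_max => /andP[/(IH _ js)].
Qed.

Lemma bnd_conv b a f A C : 0 <= b -> bnd b a A -> bnd b f C -> bnd b (convol a f) (A * C).
Proof.
move=> b0 ha hf N; have ha0 := bnd_ssum b0 ha; have hf0 := bnd_ssum b0 hf.
have C0 := bnd_ge0 hf.
apply/ler_addgt0Pr => e e0; pose W := \sum_(n <- zw N) wt n `^ b : R.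
have W0 : 0 <= W by rewrite sumr_ge0// => n _; exact: wtp_ge0.
have e1 : 0 < e / (1 + W) by rewrite divr_gt0// ltr_wpDr.
(* Each convolution value is an infinite sum. One M approximates the finitely many values in the
   window, with an error divided by the total weight W. *)
have [M hM] := clim_unif (zw N) (fun n => csumP (ssum_conv1 n ha0 hf0)) e1.
have step : \sum_(n <- zw N) cabs (convol a f n) * wt n `^ b <=
  \sum_(n <- zw N) (\sum_(m <- zw M) cabs (a m) * cabs (f (n - m)) + e / (1 + W)) * wt n `^ b.
  apply: ler_sum_seq => n nN; rewrite ler_wpM2r ?wtp_ge0//.
  have -> : convol a f n = \sum_(m <- zw M) a m * f (n - m) - (\sum_(m <- zw M) a m * f (n - m) - convol a f n) by rewrite subKr.
  rewrite (le_trans (cabsB _ _))// lerD ?hM//.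
  rewrite (le_trans (cabs_sum _ _ _))// ler_sum// => m _.
  by rewrite cabsM.
rewrite (le_trans step)//.
under eq_bigr do rewrite mulrDl.
rewrite big_split lerD//=; last first.
  by rewrite -mulr_sumr mulrAC ler_pdivrMr ?ltr_wpDr// mulrDr mulr1 -/W lerDr ltW.
under eq_bigr do rewrite mulr_suml.
rewrite exchange_big/= (@le_trans _ _ (\sum_(m <- zw M) cabs (a m) * wt m `^ b * C))//; last first.
  by rewrite -mulr_suml ler_wpM2r.
apply: ler_sum => m _.
apply: (@le_trans _ _ (\sum_(n <- zw N) cabs (a m) * wt m `^ b * (cabs (f (n - m)) * wt (n - m) `^ b))).
  apply: ler_sum => n _; rewrite mulrACA ler_wpM2l ?mulr_ge0 ?cabs_ge0//.
  exact: wtpB.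
rewrite -mulr_sumr ler_wpM2l ?mulr_ge0 ?cabs_ge0 ?wtp_ge0//.
rewrite -(big_map (fun n => n - m) xpredT (fun n => cabs (f n) * wt n `^ b)).
apply: zw_bound_sum => // [|n]; last by rewrite mulr_ge0 ?cabs_ge0 ?wtp_ge0.
by rewrite map_inj_uniq ?zw_uniq// => x y /addIr.
Qed.

Lemma ssum_conv a f A C : ssum a A -> ssum f C -> ssum (convol a f) (A * C).
Proof.
by move=> /ssum_bnd ha /ssum_bnd hf; exact: bnd_ssum (lexx 0) (bnd_conv (lexx 0) ha hf).
Qed.

Lemma convDl a1 a2 f A1 A2 C : ssum a1 A1 -> ssum a2 A2 -> ssum f C ->
  convol (fun n => a1 n + a2 n) f = fun n => convol a1 f n + convol a2 f n.
Proof.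
move=> h1 h2 hf; apply/funext => n; rewrite /convol.
rewrite -(csumD (ssum_conv1 n h1 hf) (ssum_conv1 n h2 hf)).
by congr csum; apply/funext => m; rewrite mulrDl.
Qed.

Lemma conv_single m c f : convol (single m c) f = fun n => c * f (n - m).
Proof.
apply/funext => n; rewrite /convol (@csum_fin _ _ (absz m)).
  rewrite (bigD1_seq m) ?zw_uniq ?mem_zw ?leqnn//= big1 ?addr0 /single ?eqxx//.
  by move=> k /negPf ->; rewrite mul0r.
by move=> k; rewrite /single; case: eqP => [->|_ _]; rewrite ?ltnn ?mul0r.
Qed.

(** For a one-point sequence a the convolution is a translate of f, where [ev_shift] applies;
    density does the rest. *)
Lemma ev_conv a f A C x : ssum a A -> ssum f C -> ev (convol a f) x = ev a x * ev f x.
Proof.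
move=> ha hf; apply/eqP; rewrite -subr_eq0; apply/eqP.
have h0 := lexx (0 : R).
apply: (@l1_dense _ 0 (fun a => ev (convol a f) x - ev a x * ev f x) (C + C) _ _ _ a A (ssum_bnd ha)).
- move=> a1 a2 C1 C2 /(bnd_ssum h0) h1 /(bnd_ssum h0) h2.
  rewrite (convDl h1 h2 hf) (evD _ (ssum_conv h1 hf) (ssum_conv h2 hf)) (evD _ h1 h2).
  by rewrite mulrDl opprD addrACA.
- move=> a1 D /(bnd_ssum h0) h1; rewrite (le_trans (cabsB _ _))//.
  rewrite mulrDl lerD//; first by rewrite mulrC; exact: ev_bound (ssum_conv h1 hf).
  rewrite cabsM mulrC ler_pM ?cabs_ge0 ?(ev_bound _ h1) ?(ev_bound _ hf)//.
- move=> k c; rewrite conv_single ev_single.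
  by rewrite (evZ _ _ (ssum_shift k hf)) (ev_shift _ _ hf) mulrA subrr.
Qed.

End evaluation.

(** * Discrete Fourier coefficients *)

Section grid.
Variable R : realType.
Implicit Types (N i j : nat) (n k o : int) (x : R) (g : R -> R[i]) (a : int -> R[i]).

Definition gp N (k : int) : R := pi *+ 2 * (k%:~R / N%:R).

Definition gmean N (f : R -> R) : R := N%:R^-1 * \sum_(j < N) f (gp N j%:Z).

(** Discrete Fourier coefficient on N points, a Riemann sum that stands in for the integral
    coefficient. *)
Definition dc N g n : R[i] :=
  N%:R^-1 * \sum_(j < N) g (gp N j%:Z) * expi (- (n%:~R * gp N j%:Z)).

Definition per (T : Type) (g : R -> T) := forall x k, g (x + pi *+ 2 * k%:~R) = g x.

Lemma gpD N k n : gp N (k + n) = gp N k + gp N n.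
Proof. by rewrite /gp intrD; ring. Qed.

Lemma gp0 N : gp N 0 = 0. Proof. by rewrite /gp mul0r mulr0. Qed.

Lemma gp_mul N k n : n%:~R * gp N k = k%:~R * gp N n.
Proof. by rewrite /gp; ring. Qed.

Lemma gp_mulC N k n : n%:~R * gp N k = gp N (n * k).
Proof. by rewrite /gp intrM; ring. Qed.

Lemma gpN N k : (0 < N)%N -> gp N (N%:Z * k) = pi *+ 2 * k%:~R.
Proof.
by move=> N0; rewrite /gp intrM -[N%:Z%:~R]/(N%:R); field; rewrite pnatr_eq0 -lt0n.
Qed.

Lemma expi_gpN N k : (0 < N)%N -> expi (gp N (N%:Z * k)) = 1.
Proof. by move=> N0; rewrite gpN// -[_ * _]add0r expi_period expi0. Qed.

Lemma expi_gp_neq1 N j : (0 < j < N)%N -> expi (gp N j%:Z) != 1.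
Proof.
move=> /andP[j0 jN]; apply/eqP => h; have N0 : (0 < N)%N by lia.
have := cabs_expi_sub1 (gp N j%:Z); rewrite h subrr cabs0 expr0n/= => /esym/eqP.
rewrite sqrf_eq0 mulf_eq0 pnatr_eq0/= gt_eqF// sin_gt0_pi//.
have -> : gp N j%:Z / 2 = pi * (j%:R / N%:R) by rewrite /gp -mulr_natr; field; rewrite pnatr_eq0 -lt0n.
rewrite mulr_gt0 ?pi_gt0 ?divr_gt0 ?ltr0n//=.
by rewrite gtr_pMr ?pi_gt0// ltr_pdivrMr ?ltr0n// mul1r ltr_nat.
Qed.

Lemma sum_expi_gp N k : (0 < N)%N -> ~~ (N%:Z %| k)%Z ->
  \sum_(j < N) expi (k%:~R * gp N j%:Z) = 0 :> R[i].
Proof.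
move=> N0 Nk; have NZ : N%:Z != 0 by lia.
pose r := absz (k %% N%:Z)%Z.
have rE : (k %% N%:Z)%Z = r%:Z by rewrite gez0_abs// modz_ge0.
have r0 : (0 < r < N)%N.
  rewrite lt0n absz_eq0; apply/andP; split.
    by apply: contraNN Nk => /eqP/dvdz_mod0P.
  by rewrite -ltz_nat -rE ltz_pmod// ltz_nat.
pose z : R[i] := expi (gp N r%:Z).
have h j : expi (k%:~R * gp N j%:Z) = z ^+ j :> R[i].
  rewrite (divz_eq k N%:Z) rE gp_mul gp_mulC mulrDr gpD expiD.
  rewrite (_ : _ * (_ * N%:Z) = N%:Z * (j%:Z * (k %/ N%:Z)%Z)); last by ring.
  rewrite expi_gpN// mul1r.
  by rewrite -gp_mulC -[j%:~R]/(j%:R) expiMn.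
under eq_bigr do rewrite h.
apply/eqP; have := subrX1 z N; rewrite -expiMn -[N%:R]/(N%:Z%:~R) gp_mulC.
rewrite expi_gpN// subrr => /esym/eqP; rewrite mulf_eq0 subr_eq0.
by rewrite (negPf (expi_gp_neq1 r0)).
Qed.

Lemma sum_expi_gp1 N k : (0 < N)%N -> (N%:Z %| k)%Z ->
  \sum_(j < N) expi (k%:~R * gp N j%:Z) = N%:R :> R[i].
Proof.
move=> N0 /dvdzP[q ->]; under eq_bigr => j _.
  rewrite gp_mulC mulrAC mulrC expi_gpN//; over.
by rewrite sumr_const card_ord.
Qed.

Lemma dvdz_small N k : (absz k < N)%N -> (N%:Z %| k)%Z -> k = 0.
Proof.
rewrite dvdzE absz_nat => kN /dvdn_leq h; apply/eqP; rewrite -absz_eq0 -leqn0 leqNgt.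
by apply/negP => /h; rewrite leqNgt kN.
Qed.

Lemma gmean_le N (f g : R -> R) : (forall x, f x <= g x) -> gmean N f <= gmean N g.
Proof. by move=> h; rewrite ler_wpM2l ?invr_ge0// ler_sum. Qed.

Lemma gmean_ge0 N (f : R -> R) : (forall x, 0 <= f x) -> 0 <= gmean N f.
Proof. by move=> h; rewrite mulr_ge0 ?invr_ge0// sumr_ge0. Qed.

Lemma gmean_cst N c : (0 < N)%N -> gmean N (fun=> c) = c.
Proof.
by move=> N0; rewrite /gmean sumr_const card_ord -[c *+ N]mulr_natl mulKf// pnatr_eq0 -lt0n.
Qed.

Lemma gmean_le_cst N (f : R -> R) c : (0 < N)%N -> (forall x, f x <= c) -> gmean N f <= c.
Proof. by move=> N0 h; rewrite -(gmean_cst c N0); exact: gmean_le. Qed.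

Lemma gmeanD N (f g : R -> R) : gmean N (fun x => f x + g x) = gmean N f + gmean N g.
Proof. by rewrite /gmean big_split mulrDr. Qed.

Lemma gmeanZ N c (f : R -> R) : gmean N (fun x => c * f x) = c * gmean N f.
Proof. by rewrite /gmean -mulr_sumr mulrCA. Qed.

Lemma gmean_sum N (I : Type) (r : seq I) (F : I -> R -> R) :
  gmean N (fun x => \sum_(i <- r) F i x) = \sum_(i <- r) gmean N (F i).
Proof. by rewrite /gmean exchange_big/= mulr_sumr. Qed.

Lemma cabs_dc N g n : cabs (dc N g n) <= gmean N (fun x => cabs (g x)).
Proof.
rewrite /dc cabsM cabsV cabs_nat ler_wpM2l ?invr_ge0//.
rewrite (le_trans (cabs_sum _ _ _))// ler_sum// => j _.
by rewrite cabsM cabs_expi mulr1.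
Qed.

Lemma dcD N g1 g2 n : dc N (fun x => g1 x + g2 x) n = dc N g1 n + dc N g2 n.
Proof.
rewrite /dc -mulrDr -big_split/=; congr (_ * _); apply: eq_bigr => j _.
by rewrite mulrDl.
Qed.

Lemma dcZ N c g n : dc N (fun x => c * g x) n = c * dc N g n.
Proof.
rewrite /dc mulrCA; congr (_ * _); rewrite mulr_sumr; apply: eq_bigr => j _.
by rewrite -mulrA.
Qed.

Lemma dcN N g n : dc N (fun x => - g x) n = - dc N g n.
Proof.
by rewrite -mulN1r -dcZ; congr dc; apply/funext => x; rewrite mulN1r.
Qed.

Lemma dc_sum N (I : Type) (r : seq I) (F : I -> R -> R[i]) n :
  dc N (fun x => \sum_(i <- r) F i x) n = \sum_(i <- r) dc N (F i) n.
Proof.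
rewrite /dc -mulr_sumr exchange_big/=; congr (_ * _); apply: eq_bigr => j _.
by rewrite mulr_suml.
Qed.

Lemma dc_expi N k n : (0 < N)%N ->
  dc N (fun x => expi (k%:~R * x)) n = if (N%:Z %| k - n)%Z then 1 else 0.
Proof.
move=> N0; rewrite /dc.
under eq_bigr do rewrite -expiD -mulrBl -intrB.
case: ifPn => h; first by rewrite sum_expi_gp1// mulVf// pnatr_eq0 -lt0n.
by rewrite sum_expi_gp// mulr0.
Qed.

(** Sampling only identifies frequencies modulo N, so the discrete coefficient of a trigonometric
    polynomial is exact once N exceeds the spread of its frequencies; the remaining tail is
    uniformly small. *)
Lemma dc_aliasing a C n : ssum a C -> clim (fun N => dc N (ev a) n) (a n).
Proof.
move=> ha e e0; have e2 : 0 < e / 2 by lra.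
have [M0 hM0] := trunc_approx (ssum_bnd ha) e2.
pose M := maxn M0 (absz n); have nM : (absz n <= M)%N by rewrite leq_maxr.
have /(bnd_ssum (lexx 0)) hr := hM0 M (leq_maxl _ _).
exists (M + M).+1 => N hN; have N0 : (0 < N)%N by lia.
have -> : ev a = fun x => ev (trunc M a) x + ev (fun k => a k - trunc M a k) x.
  apply/funext => x; rewrite -(evD _ (bnd_ssum (lexx 0) (bnd_trunc M (ssum_bnd ha))) hr).
  by congr ev; apply/funext => k; rewrite addrC subrK.
rewrite dcD.
have -> : dc N (ev (trunc M a)) n = a n.
  have -> : ev (trunc M a) = fun x => \sum_(k <- zw M) a k * expi (k%:~R * x).
    by apply/funext => x; rewrite ev_trunc.
  rewrite dc_sum; under eq_bigr do rewrite dcZ dc_expi//.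
  rewrite (bigD1_seq n)/= ?zw_uniq ?mem_zw// subrr dvdz0 mulr1 big_seq_cond big1 ?addr0//.
  move=> k /andP[]; rewrite mem_zw => kM kn; case: ifPn => h; last by rewrite mulr0.
  by have := dvdz_small _ h; lia.
rewrite addrAC subrr add0r (le_trans (cabs_dc _ _ _))//.
rewrite gmean_le_cst// => x.
by rewrite (le_trans (ev_bound x hr))//; lra.
Qed.

Lemma sum_ord_shift (V : zmodType) N (F : nat -> V) h :
  (forall j, F (j + N)%N = F j) -> \sum_(j < N) F (j + h)%N = \sum_(j < N) F j.
Proof.
move=> FN; elim: h => [|h <-]; first by apply: eq_bigr => j _; rewrite addn0.
case: N FN => [|N] FN; first by rewrite !big_ord0.
rewrite big_ord_recr/= [RHS]big_ord_recl/= addrC; congr (_ + _).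
  by rewrite addnS -addSn addnC FN.
by apply: eq_bigr => j _; rewrite addnS addSn.
Qed.

Lemma gp_nat N (i j : nat) : gp N (i + j)%N%:Z = gp N i%:Z + gp N j%:Z.
Proof. by rewrite PoszD gpD. Qed.

Lemma dc_shift N g n (h : nat) : (0 < N)%N -> per g ->
  dc N (fun x => g (x + gp N h%:Z)) n = expi (n%:~R * gp N h%:Z) * dc N g n.
Proof.
move=> N0 pg; rewrite /dc mulrCA; congr (_ * _).
pose F j := g (gp N j%:Z) * expi (- (n%:~R * gp N j%:Z)).
have FN j : F (j + N)%N = F j.
  have hN : gp N N%:Z = pi *+ 2 * 1%:~R by rewrite -[N%:Z]mulr1 gpN.
  have e1 : expi (- (n%:~R * gp N N%:Z)) = 1 :> R[i].
    by rewrite expiN gp_mulC mulrC expi_gpN// conjc1.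
  by rewrite /F gp_nat mulrDr opprD expiD e1 mulr1 hN pg.
rewrite -(sum_ord_shift h FN) mulr_sumr; apply: eq_bigr => j _.
rewrite /F gp_nat mulrDr opprD expiD.
have e1 : expi (- (n%:~R * gp N h%:Z)) * expi (n%:~R * gp N h%:Z) = 1 :> R[i].
  by rewrite -expiD addNr expi0.
by rewrite -[LHS]mulr1 -e1; ring.
Qed.

Lemma dc_parseval N g o : (0 < N)%N ->
  \sum_(k < N) cabs (dc N g (o + k%:Z)) ^+ 2 = gmean N (fun x => cabs (g x) ^+ 2).
Proof.
move=> N0; apply: (@complexI R); rewrite rmorph_sum/=.
under eq_bigr do rewrite cabs_sqrC.
pose G j : R[i] := g (gp N j%:Z).
have NC : N%:R != 0 :> R[i] by rewrite pnatr_eq0 -lt0n.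
have E (k : nat) : dc N g (o + k%:Z) * conjc (dc N g (o + k%:Z)) = N%:R^-1 * N%:R^-1 *
    \sum_(i < N) \sum_(j < N) G i * conjc (G j) * expi ((o + k%:Z)%:~R * gp N (j%:Z - i%:Z)).
  rewrite /dc rmorphM fmorphV rmorph_nat mulrACA; congr (_ * _).
  rewrite rmorph_sum/= mulr_suml; apply: eq_bigr => i _.
  rewrite mulr_sumr; apply: eq_bigr => j _.
  rewrite conjcM -expiN opprK mulrACA -expiD; congr (_ * expi _).
  by rewrite gpD -[- i%:Z]mulN1r -gp_mulC; ring.
under eq_bigr => k _ do rewrite E.
rewrite -mulr_sumr exchange_big/=.
have E2 (i : 'I_N) : \sum_(k < N) \sum_(j < N) G i * conjc (G j) *
   expi ((o + k%:Z)%:~R * gp N (j%:Z - i%:Z)) = N%:R * (G i * conjc (G i)).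
  rewrite exchange_big/= (bigD1 i)//= [X in _ + X]big1 ?addr0.
    under eq_bigr do rewrite subrr gp0 mulr0 expi0 mulr1.
    by rewrite sumr_const card_ord mulr_natl.
  move=> j ji; under eq_bigr do rewrite intrD mulrDl expiD mulrA gp_mul.
  rewrite -mulr_sumr; under eq_bigr => k _ do rewrite gp_mul.
  rewrite sum_expi_gp ?mulr0//; apply/negP => /(dvdz_small _) h.
  move: ji; rewrite -val_eqE/=; have := ltn_ord i; have := ltn_ord j; lia.
under eq_bigr => i _ do rewrite E2.
rewrite -mulr_sumr mulrA divfK// /gmean rmorphM/= fmorphV rmorph_nat rmorph_sum.
by congr (_ * _); apply: eq_bigr => i _; rewrite -(cabs_sqrC (G i)).
Qed.

Lemma dc_inverse N g o (i : nat) : (0 < N)%N -> (i < N)%N ->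
  \sum_(k < N) dc N g (o + k%:Z) * expi ((o + k%:Z)%:~R * gp N i%:Z) = g (gp N i%:Z).
Proof.
move=> N0 iN; rewrite /dc.
have NC : N%:R != 0 :> R[i] by rewrite pnatr_eq0 -lt0n.
under eq_bigr do rewrite -mulrA mulr_suml.
rewrite -mulr_sumr exchange_big/= (bigD1 (Ordinal iN))//= [X in _ + X]big1 ?addr0.
  under eq_bigr do rewrite -mulrA -expiD addNr expi0 mulr1.
  by rewrite sumr_const card_ord -[g _ *+ N]mulr_natl mulKf.
move=> j ji; under eq_bigr do rewrite -mulrA -expiD addrC -mulrBr -mulN1r -[-1]/((-1)%:~R) gp_mulC mulN1r -gpD intrD mulrDl expiD.
rewrite -mulr_sumr -mulr_sumr; under eq_bigr => k _ do rewrite gp_mul.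
rewrite sum_expi_gp ?mulr0//; apply/negP => /(dvdz_small _) h.
move: ji; rewrite -val_eqE/=; have := ltn_ord j; lia.
Qed.

Lemma dc_bessel N g o (s : seq int) : (0 < N)%N -> uniq s ->
  (forall n, n \in s -> o <= n < o + N%:Z) ->
  \sum_(n <- s) cabs (dc N g n) ^+ 2 <= gmean N (fun x => cabs (g x) ^+ 2).
Proof.
move=> N0 us hs; rewrite -(dc_parseval g o N0).
rewrite -(big_mkord xpredT (fun k : nat => cabs (dc N g (o + k%:Z)) ^+ 2)).
rewrite -(big_map (fun k : nat => o + k%:Z) xpredT (fun n => cabs (dc N g n) ^+ 2)).
apply: ler_sum_sub => //.
- move=> n /hs h; apply/mapP; exists (absz (n - o)); last by lia.
  by rewrite mem_index_iota; lia.
- by rewrite map_inj_uniq ?iota_uniq// => x y; lia.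
- by move=> n _; rewrite exprn_ge0// cabs_ge0.
Qed.

(** Translation by a grid step multiplies the n-th coefficient by a phase; Bessel's inequality for
    the difference therefore weighs each coefficient by |phase - 1|^2. *)
Lemma dc_bessel_diff N g o (h : nat) (s : seq int) : (0 < N)%N -> per g -> uniq s ->
  (forall n, n \in s -> o <= n < o + N%:Z) ->
  \sum_(n <- s) cabs (expi (n%:~R * gp N h%:Z) - 1) ^+ 2 * cabs (dc N g n) ^+ 2 <=
    gmean N (fun x => cabs (g (x + gp N h%:Z) - g x) ^+ 2).
Proof.
move=> N0 pg us hs.
apply: le_trans (dc_bessel (fun x => g (x + gp N h%:Z) - g x) N0 us hs).
apply: ler_sum => n _.
have -> : dc N (fun x => g (x + gp N h%:Z) - g x) n =
    (expi (n%:~R * gp N h%:Z) - 1) * dc N g n.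
  by rewrite dcD dcN dc_shift//; ring.
by rewrite cabsM exprMn.
Qed.

(** The dyadic block 2^(j-1) < |n| <= 2^j, written without subtraction so that j = 0 gives |n| =
    1. *)
Definition blk j (n : int) : bool := (2 ^ j < 2 * absz n)%N && (absz n <= 2 ^ j)%N.

(** The angle n pi / 2^j lies in (pi/2, pi] up to sign. There the cosine is nonpositive, and |e^(i
    theta) - 1|^2 = 2 - 2 cos theta. *)
Lemma expi_blk j n : blk j n -> 2 <= cabs (expi (n%:~R * (pi / 2 ^+ j)) - 1 : R[i]) ^+ 2.
Proof.
move=> /andP[h1 h2].
wlog n0 : n h1 h2 / 0 <= n.
  move=> H; have [n0|n0] := leP 0 n; first exact: H.
  have := H (- n); rewrite abszN => /(_ h1 h2); rewrite intrN mulNr expiN.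
  set z := expi _; have -> : conjc z - 1 = conjc (z - 1) by rewrite rmorphB rmorph1.
  by rewrite cabsJ; apply; lia.
rewrite -[n]gez0_abs// in h1 h2 *; set k := absz n in h1 h2 *; rewrite -[k%:~R]/(k%:R).
have p0 := pi_gt0 R.
have t0 : 0 < 2 ^+ j :> R by rewrite exprn_gt0.
rewrite cabs_expi_sub1; set y := _ / 2.
have yE : y = pi * (k%:R / 2 ^+ j) / 2 by rewrite /y; field; rewrite gt_eqF.
have k1 : 1 / 2 < k%:R / 2 ^+ j :> R.
  rewrite ltr_pdivlMr// mulrAC mul1r ltr_pdivrMr// -natrX -natrM ltr_nat mulnC.
  by rewrite absz_nat in h1.
have k2 : k%:R / 2 ^+ j <= 1 :> R.
  by rewrite ler_pdivrMr// mul1r -natrX ler_nat absz_nat in h2 *.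
have y1 : pi / 4 < y by rewrite yE; nra.
have y2 : y <= pi / 2 by rewrite yE; nra.
have : cos (y + y) <= 0.
  have -> : y + y = (y + y - pi / 2) + pi / 2 by rewrite subrK.
  rewrite cosDpihalf oppr_le0 sin_ge0_pi//; lra.
rewrite cosD; have := cos2Dsin2 y; nra.
Qed.

Lemma dc_blk m j g : (j < m)%N -> per g ->
  \sum_(n <- zw (2 ^ j) | blk j n) cabs (dc (2 ^ m) g n) ^+ 2 <=
    gmean (2 ^ m) (fun x => cabs (g (x + pi / 2 ^+ j) - g x) ^+ 2).
Proof.
move=> jm pg; pose N := (2 ^ m)%N; have N0 : (0 < N)%N by rewrite expn_gt0.
pose h := (2 ^ (m - j.+1))%N.
have jN : (2 ^ j * 2 <= N)%N by rewrite -expnSr leq_pexp2l.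
have hN : gp N h%:Z = pi / 2 ^+ j.
  rewrite /gp /N /h -[_%:~R]/((2 ^ (m - j.+1))%:R) !natrX.
  have -> : m = (m - j.+1 + j.+1)%N by lia.
  rewrite addnK exprD exprS; field; rewrite !expf_neq0//.
pose P (n : int) := cabs (dc N g n) ^+ 2.
pose Q := gmean N (fun x => cabs (g (x + pi / 2 ^+ j) - g x) ^+ 2).
(* The whole block can span N + 1 consecutive integers, one too many for Bessel. Positive and
   negative frequencies are treated apart, and the factor 2 of [expi_blk] pays for the two
   halves. *)
have half o (s : seq int) : uniq s -> (forall n, n \in s -> blk j n && (o <= n < o + N%:Z)) ->
    \sum_(n <- s) P n <= Q / 2.
  move=> us hs; rewrite ler_pdivlMr// mulrC mulr_sumr /Q -hN.
  apply: (@le_trans _ _ (\sum_(n <- s) cabs (expi (n%:~R * gp N h%:Z) - 1) ^+ 2 * P n)).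
    apply: ler_sum_seq => n /hs/andP[nb _].
    by rewrite ler_wpM2r ?exprn_ge0 ?cabs_ge0// hN expi_blk.
  by apply: (@dc_bessel_diff _ _ o) => // n /hs/andP[].
rewrite -/N -/Q (bigID (fun n : int => 0 < n))/= [Q]splitr -big_filter -[X in _ + X]big_filter.
apply: lerD.
  apply: (half 1); first by rewrite filter_uniq ?zw_uniq.
  by move=> n; rewrite mem_filter /blk; lia.
apply: (half (- N%:Z)); first by rewrite filter_uniq ?zw_uniq.
by move=> n; rewrite mem_filter /blk; lia.
Qed.

End grid.

(** * Fourier series of Lipschitz functions *)

Section lipschitz_series.
Variable R : realType.
Implicit Types (N i j m : nat) (n k : int) (x y : R) (g : R -> R) (a : int -> R[i]) (h : int -> R).

Lemma climJ (z : nat -> R[i]) l : clim z l -> clim (fun N => conjc (z N)) (conjc l).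
Proof.
move=> hz e e0; have [N0 h0] := hz _ e0; exists N0 => N /h0.
by rewrite -(rmorphB (@conjc R)) cabsJ.
Qed.

Lemma climM (z w : nat -> R[i]) (l k : R[i]) : clim z l -> clim w k -> clim (fun N => z N * w N) (l * k).
Proof.
move=> hz hw e e0; have l0 := cabs_ge0 l; have k0 := cabs_ge0 k.
have [N0 h0] := hz 1 ltr01.
have [|N1 h1] := hz (e / 2 / (1 + cabs k)); first by rewrite !divr_gt0//; lra.
have [|N2 h2] := hw (e / 2 / (1 + cabs l)); first by rewrite !divr_gt0//; lra.
exists (maxn N0 (maxn N1 N2)) => N; rewrite !geq_max => /and3P[/h0 g0 /h1 g1 /h2 g2].
have -> : z N * w N - l * k = z N * (w N - k) + k * (z N - l) by ring.
rewrite (le_trans (cabsD _ _))// !cabsM.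
have zb : cabs (z N) <= 1 + cabs l.
  by rewrite -[z N](subrK l) (le_trans (cabsD _ _))// lerD.
have {}g1 : cabs (z N - l) * (1 + cabs k) <= e / 2 by rewrite -ler_pdivlMr//; lra.
have {}g2 : cabs (w N - k) * (1 + cabs l) <= e / 2 by rewrite -ler_pdivlMr//; lra.
have h3 := ler_wpM2r (cabs_ge0 (w N - k)) zb; have := cabs_ge0 (z N - l).
lra.
Qed.

Lemma clim_sq_le (s : seq int) (z : int -> nat -> R[i]) (l : int -> R[i]) D N1 :
  (forall n, clim (z n) (l n)) ->
  (forall N, (N1 <= N)%N -> \sum_(n <- s) cabs (z n N) ^+ 2 <= D) ->
  \sum_(n <- s) cabs (l n) ^+ 2 <= D.
Proof.
move=> hz hD.
have h : clim (fun N => \sum_(n <- s) z n N * conjc (z n N)) (\sum_(n <- s) l n * conjc (l n)).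
  by apply: clim_sum => n; apply: climM => //; exact: climJ.
have E (f : int -> R[i]) : \sum_(n <- s) f n * conjc (f n) = (\sum_(n <- s) cabs (f n) ^+ 2)%:C.
  by rewrite rmorph_sum; apply: eq_bigr => n _; rewrite -(cabs_sqrC (f n)).
have P0 (f : int -> R[i]) : 0 <= \sum_(n <- s) cabs (f n) ^+ 2.
  by rewrite sumr_ge0// => n _; rewrite exprn_ge0 ?cabs_ge0.
have := @clim_bound _ _ _ D N1 h _; rewrite (E l) cabsR ger0_norm//; apply.
by move=> N /hD; rewrite (E (fun n => z n N)) cabsR ger0_norm.
Qed.

Lemma pow2_ge (e : R) : exists m, forall m', (m <= m')%N -> e <= 2 ^+ m'.
Proof.
exists (Num.truncn e).+1 => m' hm; have h : e < (Num.truncn e).+1%:R by exact: real_truncnS_gt (num_real _).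
rewrite (le_trans (ltW h))// -natrX ler_nat (leq_trans hm)//.
by rewrite ltnW// ltn_expl.
Qed.

Lemma geometric_small (C r e : R) : 0 <= r < 1 -> 0 < e ->
  exists k1 : nat, forall k : nat, (k1 <= k)%N -> C * r ^+ k <= e.
Proof.
move=> /andP[r0 r1] e0.
have : (fun k : nat => C * r ^+ k) @ \oo --> C * 0.
  by apply: cvgM; [exact: cvg_cst|apply: cvg_expr; rewrite ger0_norm].
rewrite mulr0 => /cvgrPdist_le /(_ _ e0) [k1 _ hk1]; exists k1 => k /hk1.
by rewrite sub0r normrN; apply: le_trans; exact: ler_norm.
Qed.

Lemma clim_geometric (z : nat -> R[i]) (K : R) :
  (forall m, cabs (z m.+1 - z m) <= K / 2 ^+ m) -> exists l, clim z l.
Proof.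
move=> hz; have K0 : 0 <= K.
  by have := hz 0%N; rewrite expr0 divr1; apply: le_trans; exact: cabs_ge0.
have hd N d : cabs (z (N + d)%N - z N) <= 2 * K / 2 ^+ N - 2 * K / 2 ^+ (N + d).
  elim: d => [|d IH]; first by rewrite addn0 !subrr cabs0.
  rewrite (le_trans (cabs_dist_triangle (z (N + d)%N) _ _))//.
  have := hz (N + d)%N; rewrite addnS => h1.
  rewrite (le_trans (lerD h1 IH))// exprS.
  rewrite (_ : 2 * K / (2 * 2 ^+ (N + d)) = K / 2 ^+ (N + d)); last first.
    by field; rewrite expf_neq0.
  lra.
apply: cauchy_clim => e e0; have [m hm] := pow2_ge (2 * K / e).
exists m => M N mN NM; rewrite -(subnKC NM) (le_trans (hd _ _))//.
rewrite lerBlDr (@le_trans _ _ e)//; last by rewrite lerDl divr_ge0 ?mulr_ge0 ?exprn_ge0.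
move: (hm N mN); rewrite ler_pdivrMr// => h.
by rewrite ler_pdivrMr ?exprn_gt0// [e * _]mulrC.
Qed.

Lemma sum_zw_blkS J h : \sum_(n <- zw (2 ^ J.+1)) h n =
  \sum_(n <- zw (2 ^ J)) h n + \sum_(n <- zw (2 ^ J.+1) | blk J.+1 n) h n.
Proof.
rewrite (bigID (blk J.+1))/= addrC; congr (_ + _).
rewrite -big_filter; apply: perm_big; apply: uniq_perm; rewrite ?filter_uniq ?zw_uniq//.
by move=> n; rewrite mem_filter !mem_zw /blk expnS; lia.
Qed.

Lemma sum_zw_blk0 h : \sum_(n <- zw (2 ^ 0)) h n =
  h 0 + \sum_(n <- zw (2 ^ 0) | blk 0 n) h n.
Proof.
rewrite (bigID (blk 0))/= addrC; congr (_ + _).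
rewrite -big_filter -[RHS](big_seq1 +%R 0 h); apply: perm_big; apply: uniq_perm; rewrite ?filter_uniq ?zw_uniq//.
by move=> n; rewrite mem_filter !mem_zw /blk inE; lia.
Qed.

Lemma sum_zw_tail h (C r : R) J0 d : 0 <= r < 1 -> 0 <= C ->
  (forall j, (J0 < j <= J0 + d)%N -> \sum_(n <- zw (2 ^ j) | blk j n) h n <= C * r ^+ j) ->
  \sum_(n <- zw (2 ^ (J0 + d))) h n <= \sum_(n <- zw (2 ^ J0)) h n + C / (1 - r) * r ^+ J0.
Proof.
move=> /andP[r0 r1] C0 hb; have r2 : 0 < 1 - r by lra.
suff : \sum_(n <- zw (2 ^ (J0 + d))) h n <=
   \sum_(n <- zw (2 ^ J0)) h n + C / (1 - r) * (r ^+ J0 - r ^+ (J0 + d)).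
  move=> /le_trans; apply; rewrite lerD2l ler_wpM2l ?divr_ge0 ?(ltW r2)//.
  by rewrite gerBl exprn_ge0.
elim: d hb => [|d IH] hb; first by rewrite addn0 subrr mulr0 addr0.
rewrite addnS sum_zw_blkS.
have h1 : \sum_(n <- zw (2 ^ (J0 + d).+1) | blk (J0 + d).+1 n) h n <= C * r ^+ (J0 + d).+1.
  by have := hb (J0 + d.+1)%N; rewrite addnS; apply; rewrite ltnS leq_addr leqnn.
have h2 := IH (fun j hj => hb j ltac:(move: hj; rewrite addnS; lia)).
rewrite (le_trans (lerD h2 h1))// -addrA lerD2l.
have r3 : r ^+ (J0 + d).+1 = r * r ^+ (J0 + d) by rewrite exprS.
have -> : C / (1 - r) * (r ^+ J0 - r ^+ (J0 + d).+1) =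
   C / (1 - r) * (r ^+ J0 - r ^+ (J0 + d)) + C * r ^+ (J0 + d).
  by rewrite r3; field; rewrite gt_eqF.
rewrite lerD2l ler_wpM2l// r3 ler_piMl ?exprn_ge0// ltW//.
Qed.

Lemma zw_le_pow2 N : exists J, (N <= 2 ^ J)%N.
Proof. by exists N; rewrite ltnW// ltn_expl. Qed.

(** Cauchy-Schwarz over a block, through h <= t h^2 / 2 + 1 / (2 t). With v = u^j = 2^(j/2) and t =
    v^3 / B the two sums are at most B / (2 v) and 3 B / (2 v), the window having at most 3 * 2^j
    points. *)
Lemma blk_l1 j h (B u : R) : u ^+ 2 = 2 -> 0 < u -> 0 < B ->
  \sum_(n <- zw (2 ^ j) | blk j n) h n ^+ 2 <= (B / 2 ^+ j) ^+ 2 ->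
  \sum_(n <- zw (2 ^ j) | blk j n) h n <= 2 * B / u ^+ j.
Proof.
move=> u2 u0 B0 hB; set v := u ^+ j; have v0 : 0 < v by rewrite exprn_gt0.
have vv : 2 ^+ j = v ^+ 2 by rewrite -u2 -!exprM mulnC.
pose t := v ^+ 3 / B; have t0 : 0 < t by rewrite divr_gt0// exprn_gt0.
apply: (@le_trans _ _ (\sum_(n <- zw (2 ^ j) | blk j n) (t / 2 * h n ^+ 2 + (2 * t)^-1))).
  apply: ler_sum => n _.
  have E : (2 * t)^-1 * (t * h n - 1) ^+ 2 = t / 2 * h n ^+ 2 - h n + (2 * t)^-1.
    by field; rewrite gt_eqF.
  have : 0 <= (2 * t)^-1 * (t * h n - 1) ^+ 2.
    by rewrite mulr_ge0 ?sqr_ge0// invr_ge0 mulr_ge0// ltW.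
  rewrite E; lra.
rewrite big_split/= -mulr_sumr.
have h1 : \sum_(n <- zw (2 ^ j) | blk j n) (2 * t)^-1 <= 3 * v ^+ 2 * (2 * t)^-1.
  apply: (@le_trans _ _ (\sum_(n <- zw (2 ^ j)) (2 * t)^-1)).
    rewrite [X in _ <= X](bigID (blk j))/= lerDl sumr_ge0// => n _.
    by rewrite invr_ge0 mulr_ge0 ?ltW.
  rewrite sum_zw sumr_const card_ord -[_ *+ _]mulr_natl ler_wpM2r//.
    by rewrite invr_ge0 mulr_ge0// ltW.
  rewrite -vv -natrX -natrM ler_nat.
  by have : (0 < 2 ^ j)%N; [rewrite expn_gt0|clear; lia].
have h2 : t / 2 * (\sum_(n <- zw (2 ^ j) | blk j n) h n ^+ 2) <= t / 2 * (B / v ^+ 2) ^+ 2.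
  by apply: ler_wpM2l; [rewrite divr_ge0// ltW|rewrite -vv].
rewrite (le_trans (lerD h2 h1))// /t.
rewrite (_ : _ + _ = 2 * B / v)//; field.
by rewrite !gt_eqF.
Qed.

Lemma sum_even_odd (V : nmodType) N (F : nat -> V) :
  \sum_(j < N.*2) F j = \sum_(j < N) (F j.*2 + F j.*2.+1).
Proof.
elim: N => [|N IH]; first by rewrite !big_ord0.
by rewrite doubleS !big_ord_recr/= IH -addrA.
Qed.

Definition toC g : R -> R[i] := fun x => (g x)%:C.

(** On the doubled grid the even points are the old grid and the odd points its translate by d = pi
    / N. The change is half of a phase defect plus the coefficient of g(x + d) - g(x), both of size
    1 / N; hence geometric convergence on dyadic grids. *)
Lemma dc_double N g n (L M : R) : (0 < N)%N ->
  (forall x y, `|g x - g y| <= L * `|x - y|) -> (forall x, `|g x| <= M) ->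
  cabs (dc N.*2 (toC g) n - dc N (toC g) n) <= 4 * (`|n|%:~R * M + L) / N%:R.
Proof.
move=> N0 hL hM; pose d := gp R N.*2 1.
have N2 : N.*2%:R = 2 * N%:R :> R by rewrite -muln2 natrM mulrC.
have NR : 0 < N%:R :> R by rewrite ltr0n.
have M0 : 0 <= M by rewrite (le_trans _ (hM 0)).
have dE : d = pi / N%:R by rewrite /d /gp N2; field; rewrite gt_eqF.
have d0 : 0 <= d by rewrite dE divr_ge0// pi_ge0.
have L0 : 0 <= L by have := hL 1 0; rewrite subr0 normr1 mulr1; apply: le_trans.
pose gd x := toC g (x + d).
have E : dc N.*2 (toC g) n = 2^-1 * (dc N (toC g) n + expi (- (n%:~R * d)) * dc N gd n).
  pose F (j : nat) := toC g (gp R N.*2 j%:Z) * expi (- (n%:~R * gp R N.*2 j%:Z)).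
  transitivity (N.*2%:R^-1 * \sum_(j < N) (F j.*2 + F j.*2.+1)).
    by rewrite /dc -(sum_even_odd N F).
  rewrite /dc /F big_split/= (_ : N.*2%:R^-1 = 2^-1 * N%:R^-1); last first.
    by rewrite -muln2 natrM mulrC invfM.
  rewrite -mulrA; congr (_ * _); rewrite mulrDr; congr (_ + _).
    congr (_ * _); apply: eq_bigr => j _; rewrite (_ : gp R N.*2 j.*2 = gp R N j)//.
    by rewrite /gp N2 -[j.*2%:~R]/(j.*2%:R) -muln2 natrM -[j%:~R]/(j%:R); field; rewrite gt_eqF.
  rewrite mulrCA; congr (_ * _); rewrite mulr_sumr; apply: eq_bigr => j _.
  rewrite (_ : gp R N.*2 j.*2.+1 = gp R N j + d).
    by rewrite mulrDr opprD expiD /gd; ring.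
  have jE : j.*2.+1%:R = 2 * j%:R + 1 :> R by rewrite -addn1 natrD -muln2 natrM mulrC.
  rewrite /d /gp N2 -[j.*2.+1%:~R]/(j.*2.+1%:R) jE -[j%:~R]/(j%:R).
  by field; rewrite gt_eqF.
have -> : dc N.*2 (toC g) n - dc N (toC g) n =
    2^-1 * ((expi (- (n%:~R * d)) - 1) * dc N gd n + dc N (fun x => gd x - toC g x) n).
  by rewrite E dcD dcN; field.
rewrite cabsM cabsV (_ : cabs 2 = 2); last exact: cabs_nat.
have h1 : cabs (expi (- (n%:~R * d)) - 1 : R[i]) <= `|n|%:~R * d.
  rewrite -expi0 (le_trans (cabs_expi_lip _ _))// subr0 normrN normrM intr_norm.
  by rewrite (ger0_norm d0).
have h2 : cabs (dc N gd n) <= M.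
  by rewrite (le_trans (cabs_dc _ _ _))// gmean_le_cst// => x; rewrite /gd /toC cabsR.
have h3 : cabs (dc N (fun x => gd x - toC g x) n) <= L * d.
  rewrite (le_trans (cabs_dc _ _ _))// gmean_le_cst// => x.
  rewrite /gd /toC -rmorphB cabsR (le_trans (hL _ _))//.
  by rewrite addrAC subrr add0r (ger0_norm d0).
have h4 : cabs ((expi (- (n%:~R * d)) - 1) * dc N gd n) <= `|n|%:~R * d * M.
  by rewrite cabsM ler_pM ?cabs_ge0.
have h5 := le_trans (cabsD ((expi (- (n%:~R * d)) - 1) * dc N gd n) (dc N (fun x => gd x - toC g x) n)) (lerD h4 h3).
have p4 : pi < 4 :> R by have := @pihalf_lt2 R; lra.
have p5 : d <= 4 / N%:R by rewrite dE ler_wpM2r ?invr_ge0 ?ltW.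
have n0 : 0 <= `|n|%:~R :> R by rewrite ler0z.
have K0 : 0 <= `|n|%:~R * M + L by rewrite addr_ge0// mulr_ge0.
apply: (@le_trans _ _ ((`|n|%:~R * M + L) * d)).
  have := mulr_ge0 K0 d0; nra.
by rewrite (le_trans (ler_wpM2l K0 p5))// mulrCA mulrA.
Qed.

Lemma ev_unif_cont a C : ssum a C -> forall e, 0 < e -> exists2 d, 0 < d &
  forall x y, `|x - y| <= d -> cabs (ev a x - ev a y) <= e.
Proof.
move=> ha e e0; have e3 : 0 < e / 3 by lra.
have [N /(_ N (leqnn _))/(bnd_ssum (lexx 0)) hN] := trunc_approx (ssum_bnd ha) e3.
pose K := \sum_(n <- zw N) cabs (a n) * `|n|%:~R.
have K0 : 0 <= K by rewrite sumr_ge0// => n _; rewrite mulr_ge0 ?cabs_ge0 ?ler0z.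
have K1 : 0 < 1 + K by lra.
exists (e / 3 / (1 + K)); first by rewrite divr_gt0.
move=> x y xy; have ht := bnd_ssum (lexx 0) (bnd_trunc N (ssum_bnd ha)).
have E z : ev a z = ev (trunc N a) z + ev (fun k => a k - trunc N a k) z.
  by rewrite -(evD _ ht hN); congr ev; apply/funext => k; rewrite addrC subrK.
rewrite !E !ev_trunc.
have -> (p q r s : R[i]) : p + q - (r + s) = (p - r) + (q - s) by ring.
rewrite (le_trans (cabsD _ _))//.
have h1 : cabs (ev (fun k => a k - trunc N a k) x - ev (fun k => a k - trunc N a k) y) <= e / 3 + e / 3.
  by rewrite (le_trans (cabsB _ _))// lerD// ev_bound.
suff h2 : cabs (\sum_(n <- zw N) a n * expi (n%:~R * x) - \sum_(n <- zw N) a n * expi (n%:~R * y)) <= e / 3 by lra.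
rewrite -sumrB (le_trans (cabs_sum _ _ _))//.
apply: (@le_trans _ _ (K * `|x - y|)).
  rewrite /K mulr_suml ler_sum// => n _; rewrite -mulrBr cabsM -mulrA ler_wpM2l ?cabs_ge0//.
  by rewrite (le_trans (cabs_expi_lip _ _))// -mulrBr normrM intr_norm.
rewrite (le_trans (ler_wpM2l K0 xy))// mulrA ler_pdivrMr// mulrC ler_wpM2l ?ltW//.
by rewrite ltrDr.
Qed.

Lemma dyadic_approx x (d : R) : 0 < d -> exists m i k, (i < 2 ^ m)%N /\
  `|x - (gp R (2 ^ m) i%:Z + pi *+ 2 * k%:~R)| <= d.
Proof.
move=> d0; have p0 : 0 < pi *+ 2 :> R by rewrite mulrn_wgt0// pi_gt0.
have [m /(_ m (leqnn m)) hm] := pow2_ge (pi *+ 2 / d).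
have T0 : (0 < 2 ^ m)%N by rewrite expn_gt0.
have TR : 0 < 2 ^+ m :> R by rewrite exprn_gt0.
pose t := Num.floor (x * 2 ^+ m / (pi *+ 2)).
exists m, (absz (t %% (2 ^ m)%:Z)%Z), (t %/ (2 ^ m)%:Z)%Z.
have hr : (0 <= (t %% (2 ^ m)%:Z)%Z) by rewrite modz_ge0//; clear -T0; lia.
have hr2 : (t %% (2 ^ m)%:Z)%Z < (2 ^ m)%:Z by rewrite ltz_pmod//; clear -T0; lia.
split; first by (clear -hr hr2; lia).
rewrite gez0_abs// -(gpN _ _ T0) -gpD [_ + (2 ^ m)%:Z * _]addrC [(2 ^ m)%:Z * _]mulrC -divz_eq.
rewrite /gp natrX.
have /andP[h1 h2] := floor_itv (x * 2 ^+ m / (pi *+ 2)).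
rewrite -/t in h1 h2; set c := pi *+ 2 in p0 hm h1 h2 *.
have E (c' T t' : R) : 0 < c' -> 0 < T -> x - c' * (t' / T) = (x * T / c' - t') * (c' / T).
  by move=> c'0 T'0; field; rewrite !gt_eqF.
rewrite (E c _ _ p0 TR).
rewrite intrD in h2; rewrite ger0_norm; last by rewrite mulr_ge0 ?divr_ge0 ?(ltW p0) ?(ltW TR) ?subr_ge0.
rewrite ler_pdivrMr// mulrC in hm.
apply: (@le_trans _ _ (c / 2 ^+ m)); last by rewrite ler_pdivrMr// mulrC.
by rewrite ler_piMl ?divr_ge0 ?ltW//; lra.
Qed.

Lemma lip_blk g (L : R) m j : per g -> (j < m)%N -> (forall x y, `|g x - g y| <= L * `|x - y|) ->
  \sum_(n <- zw (2 ^ j) | blk j n) cabs (dc (2 ^ m) (toC g) n) ^+ 2 <= (L * pi / 2 ^+ j) ^+ 2.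
Proof.
move=> pg jm hL; have pG : per (toC g) by move=> x k; rewrite /toC pg.
rewrite (le_trans (dc_blk jm pG))// gmean_le_cst ?expn_gt0// => x.
rewrite /toC -rmorphB cabsR.
have := hL (x + pi / 2 ^+ j) x; rewrite addrAC subrr add0r.
have q0 : 0 <= pi / 2 ^+ j :> R by rewrite divr_ge0 ?pi_ge0 ?exprn_ge0.
rewrite (ger0_norm q0) mulrA => h.
by rewrite ler_pXn2r ?nnegrE// (le_trans _ h).
Qed.

(** Block j of a function with Lipschitz constant L contributes at most 16 L r^j to the weighted l^1
    norm, with r = 2^b / sqrt 2; the geometric series converges precisely for b < 1/2. The value 17
    absorbs the mean and block 0. *)
Definition Cb (b : R) : R := 17 + 16 / (1 - 2 `^ b / Num.sqrt 2).

Lemma Cb_ratio (b : R) : 0 <= b < 1 / 2 -> 0 <= 2 `^ b / Num.sqrt 2 < 1.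
Proof.
move=> /andP[b0 b1]; rewrite divr_ge0 ?powR_ge0 ?sqrtr_ge0//= ltr_pdivrMr ?sqrtr_gt0// mul1r.
by rewrite -powR12_sqrt// /powR gt_eqF// ltr_expR ltr_pM2r ?ln_gt0 ?ltr1n//; lra.
Qed.

Lemma Cb_ge1 (b : R) : 0 <= b < 1 / 2 -> 17 <= Cb b.
Proof. by move=> /Cb_ratio /andP[h0 h1]; rewrite /Cb lerDl divr_ge0//; lra. Qed.

Lemma lip_dc_l1 g (L : R) m j : per g -> (j < m)%N -> 0 < L ->
  (forall x y, `|g x - g y| <= L * `|x - y|) ->
  \sum_(n <- zw (2 ^ j) | blk j n) cabs (dc (2 ^ m) (toC g) n) <= 8 * L / Num.sqrt 2 ^+ j.
Proof.
move=> pg jm L0 hL; have B0 : 0 < L * pi by rewrite mulr_gt0// pi_gt0.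
have s2 : Num.sqrt 2 ^+ 2 = 2 :> R by rewrite sqr_sqrtr.
have s0 : 0 < Num.sqrt 2 :> R by rewrite sqrtr_gt0.
rewrite (le_trans (blk_l1 s2 s0 B0 (lip_blk pg jm hL)))// ler_wpM2r ?invr_ge0 ?exprn_ge0 ?(ltW s0)//.
have p4 : pi < 4 :> R by have := @pihalf_lt2 R; lra.
by nra.
Qed.

Lemma mem_map_addz (o : int) N n :
  (n \in [seq o + k%:Z | k : nat <- index_iota 0 N]) = (o <= n < o + N%:Z).
Proof.
apply/mapP/idP => [[k]|h]; first by rewrite mem_index_iota => ? ->; lia.
by exists (absz (n - o)); [rewrite mem_index_iota|]; lia.
Qed.

(* On the dyadic grid the discrete inversion formula recovers [g], and the
   frequencies above [2 ^ kk] contribute a geometric tail. *)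
Lemma dc_partial_sum g (L : R) m0 (i : nat) m kk : per g -> 0 < L ->
  (forall x y, `|g x - g y| <= L * `|x - y|) -> (i < 2 ^ m0)%N -> (m0 <= m)%N -> (kk.+1 < m)%N ->
  forall x r : R, x = gp R (2 ^ m0) i%:Z -> r = (Num.sqrt 2)^-1 ->
  cabs (\sum_(n <- zw (2 ^ kk)) dc (2 ^ m) (toC g) n * expi (n%:~R * x) - toC g x) <=
    8 * L / (1 - r) * r ^+ kk.
Proof.
move=> pg L0 hL im mm km x r xE' rE.
have s1 : 1 < Num.sqrt 2 :> R by rewrite -[X in X < _]sqrtr1 ltr_sqrt ?ltr1n.
have r01 : 0 <= r < 1 by rewrite rE invr_ge0 sqrtr_ge0/= invf_lt1// (lt_trans ltr01).
have L8 : 0 <= 8 * L by lra.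
have T0 : (0 < 2 ^ m)%N by rewrite expn_gt0.
pose o : int := 1 - (2 ^ m.-1)%:Z.
have hN : (2 ^ m = 2 * 2 ^ m.-1)%N by rewrite -expnS prednK// (leq_trans _ km).
pose i' := (i * 2 ^ (m - m0))%N.
have i'm : (i' < 2 ^ m)%N by rewrite /i' -{2}(subnKC mm) expnD ltn_pmul2r ?expn_gt0.
have xE : x = gp R (2 ^ m) i'%:Z.
  rewrite xE' /gp /i' -[_%:~R]/(i%:R) -[(i * _)%N%:~R]/((i * 2 ^ (m - m0))%:R) natrM !natrX.
  by rewrite -{2}(subnKC mm) exprD; field; rewrite !expf_neq0.
have := dc_inverse (toC g) o T0 i'm; rewrite -xE => <-.
pose F n := dc (2 ^ m) (toC g) n * expi (n%:~R * x).
rewrite -(big_mkord xpredT (fun k : nat => F (o + k%:Z))) -(big_map (fun k : nat => o + k%:Z) xpredT F).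
set s := map _ _.
have us : uniq s by rewrite map_inj_uniq ?iota_uniq// => p q /addrI[].
have ms n : (n \in s) = (o <= n < o + (2 ^ m)%:Z) by exact: mem_map_addz.
have k2 : (2 ^ kk < 2 ^ m.-1)%N by (clear -km; rewrite ltn_exp2l//; lia).
have -> : \sum_(n <- s) F n = \sum_(n <- zw (2 ^ kk)) F n + \sum_(n <- [seq n <- s | n \notin zw (2 ^ kk)]) F n.
  rewrite (bigID (mem (zw (2 ^ kk))))/= big_filter; congr (_ + _).
  rewrite -big_filter; apply: perm_big; apply: uniq_perm; rewrite ?filter_uniq ?zw_uniq//.
  by move=> n; rewrite mem_filter mem_zw ms /o; clear -k2 hN; lia.
rewrite opprD addrA -sumrB big1 ?sub0r; last by move=> n _; rewrite subrr.
rewrite cabsN (le_trans (cabs_sum _ _ _))//.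
under eq_bigr do rewrite cabsM cabs_expi mulr1.
pose h n := cabs (dc (2 ^ m) (toC g) n).
have H : \sum_(n <- zw (2 ^ m.-1)) h n <= \sum_(n <- zw (2 ^ kk)) h n + 8 * L / (1 - r) * r ^+ kk.
  have mE : m.-1 = (kk + (m.-1 - kk))%N by rewrite subnKC//; clear -km; lia.
  rewrite {1}mE; apply: sum_zw_tail => // j hj.
  by rewrite /h rE exprVn; apply: lip_dc_l1 => //; clear -hj km; lia.
have hh : \sum_(n <- zw (2 ^ kk)) h n + \sum_(n <- [seq n <- s | n \notin zw (2 ^ kk)]) h n <= \sum_(n <- zw (2 ^ m.-1)) h n.
  rewrite -big_cat/=; apply: ler_sum_zw => [|n|n]; last 2 first.
  - exact: cabs_ge0.
  - by rewrite mem_cat mem_filter !mem_zw ms /o; clear -k2 hN; lia.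
  rewrite cat_uniq zw_uniq filter_uniq// andbT; apply/hasPn => n.
  by rewrite mem_filter => /andP[].
by rewrite /h in hh H *; lra.
Qed.

(* The series of a Lipschitz function: its coefficients are the limits of the
   discrete coefficients on dyadic grids, which are controlled uniformly on
   each dyadic block by the discrete Bessel inequality for a translate. *)
Lemma lipschitz_series g (L M : R) : per g -> 0 < L ->
  (forall x y, `|g x - g y| <= L * `|x - y|) -> (forall x, `|g x| <= M) ->
  exists a, (forall x, ev a x = toC g x) /\
    forall b, 0 <= b < 1 / 2 -> bnd b a (Cb b * (M + L)).
Proof.
move=> pg L0 hL hM; have M0 : 0 <= M by rewrite (le_trans _ (hM 0)).
have s2 : Num.sqrt 2 ^+ 2 = 2 :> R by rewrite sqr_sqrtr.
have s0 : 0 < Num.sqrt 2 :> R by rewrite sqrtr_gt0.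
have s1 : 1 < Num.sqrt 2 :> R by rewrite -[X in X < _]sqrtr1 ltr_sqrt ?ltr1n.
have /choice[a ha] : forall n, exists l, clim (fun m => dc (2 ^ m) (toC g) n) l.
  move=> n; apply: (@clim_geometric _ (4 * (`|n|%:~R * M + L))) => m.
  have := @dc_double (2 ^ m) g n L M; rewrite expn_gt0 => /(_ isT hL hM).
  by rewrite natrX (_ : (2 ^ m).*2 = (2 ^ m.+1)%N)// expnS mul2n.
have ablk j : \sum_(n <- zw (2 ^ j) | blk j n) cabs (a n) ^+ 2 <= (L * pi / 2 ^+ j) ^+ 2.
  rewrite -big_filter; apply: (clim_sq_le (N1 := j.+1) ha) => m jm.
  by rewrite big_filter; exact: lip_blk.
have B0 : 0 < L * pi by rewrite mulr_gt0// pi_gt0.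
have p4 : pi < 4 :> R by have := @pihalf_lt2 R; lra.
have al1 j : \sum_(n <- zw (2 ^ j) | blk j n) cabs (a n) <= 8 * L / Num.sqrt 2 ^+ j.
  rewrite (le_trans (blk_l1 s2 s0 B0 (ablk j)))// ler_wpM2r ?invr_ge0 ?exprn_ge0 ?(ltW s0)//.
  by nra.
have a0 : cabs (a 0) <= M.
  apply: (clim_bound (N1 := 0%N) (ha 0)) => m _.
  by rewrite (le_trans (cabs_dc _ _ _))// gmean_le_cst ?expn_gt0// => x; rewrite cabsR.
have abnd b : 0 <= b < 1 / 2 -> bnd b a (Cb b * (M + L)).
  move=> hb; have /andP[r0 r1] := Cb_ratio hb; set r := 2 `^ b / Num.sqrt 2 in r0 r1.
  have /andP[b0 b1] := hb.
  pose h n := cabs (a n) * wt n `^ b : R.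
  have h0 n : 0 <= h n by rewrite mulr_ge0 ?cabs_ge0 ?wtp_ge0.
  have hblk j : \sum_(n <- zw (2 ^ j) | blk j n) h n <= 16 * L * r ^+ j.
    apply: (@le_trans _ _ (\sum_(n <- zw (2 ^ j) | blk j n) cabs (a n) * (2 * (2 `^ b) ^+ j))).
      apply: ler_sum => n /andP[_ n2]; rewrite ler_wpM2l ?cabs_ge0//.
      apply: (@le_trans _ _ ((2 * 2 ^+ j) `^ b)).
        rewrite ge0_ler_powR ?nnegrE ?wt_ge0 ?mulr_ge0 ?exprn_ge0//.
        rewrite wtE -natrX -natrM -[1]/(1%:R) -natrD ler_nat.
        by rewrite mul2n -addnn leq_add// expn_gt0.
      rewrite powRM ?exprn_ge0// -[2 ^+ j]powR_mulrn// powRAC powR_mulrn ?powR_ge0//.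
      rewrite ler_wpM2r ?exprn_ge0 ?powR_ge0//.
      by rewrite ler1_powR ?ler1n//; lra.
    rewrite -mulr_suml; set c := 2 * _.
    have c0 : 0 <= c by rewrite mulr_ge0 ?exprn_ge0 ?powR_ge0.
    rewrite (le_trans (ler_wpM2r c0 (al1 j)))// /c /r exprMn exprVn.
    by rewrite le_eqVlt; apply/orP; left; apply/eqP; field; rewrite expf_neq0// gt_eqF.
  move=> N; have [J hJ] := zw_le_pow2 N.
  apply: (@le_trans _ _ (\sum_(n <- zw (2 ^ (0 + J))) h n)).
    by apply: ler_sum_zw => //; rewrite ?zw_uniq// => n; rewrite mem_zw => /leq_trans; apply.
  have L16 : 0 <= 16 * L by lra.
  have r01 : 0 <= r < 1 by rewrite r0 r1.
  rewrite (le_trans (sum_zw_tail r01 L16 (fun j _ => hblk j)))//.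
  rewrite sum_zw_blk0 expr0 mulr1.
  have := hblk 0%N; rewrite expr0 mulr1 => hb0.
  have hz : h 0 <= M by rewrite /h wt0 powR1 mulr1.
  have q0 : 0 <= (1 - r)^-1 by rewrite invr_ge0; lra.
  have -> : Cb b = 17 + 16 * (1 - r)^-1 by [].
  have -> : 16 * L / (1 - r) = L * (16 * (1 - r)^-1) by ring.
  have : 0 <= M * (1 - r)^-1 by rewrite mulr_ge0.
  lra.
exists a; split => //.
have as0 : ssum a (Cb 0 * (M + L)).
  by apply: (bnd_ssum (lexx 0)); apply: abnd; rewrite lexx/=; lra.
have pG : per (toC g) by move=> x k; rewrite /toC pg.
(* Inversion is proved first at dyadic grid points, where the discrete formula is exact; uniform
   continuity of both sides then reaches every x. *)
have dyad m0 (i : nat) : (i < 2 ^ m0)%N -> ev a (gp R (2 ^ m0) i%:Z) = toC g (gp R (2 ^ m0) i%:Z).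
  move=> im; set x := gp R _ _.
  pose r : R := (Num.sqrt 2)^-1.
  have r01 : 0 <= r < 1 by rewrite /r invr_ge0 ltW//= invf_lt1.
  have L8 : 0 <= 8 * L by lra.
  pose C := 8 * L / (1 - r).
  have C0 : 0 <= C by rewrite /C divr_ge0//; lra.
  have part kk : cabs (\sum_(n <- zw (2 ^ kk)) a n * expi (n%:~R * x) - toC g x) <= C * r ^+ kk.
    apply: (clim_bound (N1 := maxn m0 kk.+2)) => [|m].
      apply: climD; last exact: clim_cst.
      apply: (@clim_sum _ _ _ (fun n N => dc (2 ^ N) (toC g) n * expi (n%:~R * x))) => n.
      by rewrite [X in clim _ X]mulrC; apply: (@eq_clim _ 0%N) (climMl (expi (n%:~R * x)) (ha n)) => N _; rewrite mulrC.
    by rewrite geq_max => /andP[mm km]; exact: (dc_partial_sum pg L0 hL im mm km erefl erefl).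
  apply/eqP; rewrite -subr_eq0; apply/eqP/cabs_eq0/eqP; rewrite eq_le cabs_ge0 andbT.
  apply/ler_addgt0Pr => e e0; have e2 : 0 < e / 2 by lra.
  have [N0 hN0] := csumP (ssum_ev x as0) e2.
  have [k1 hk1] := geometric_small C r01 e2.
  pose kk := maxn N0 k1.
  have g1 := hk1 kk (leq_maxr _ _).
  have g2 : (N0 <= 2 ^ kk)%N by rewrite (leq_trans (leq_maxl N0 k1))// ltnW// ltn_expl.
  have := hN0 _ g2; rewrite cabs_distC => g3.
  rewrite add0r (le_trans (cabs_dist_triangle (\sum_(n <- zw (2 ^ kk)) a n * expi (n%:~R * x)) _ _))//.
  rewrite -/(ev a x) in g3; have := part kk; lra.
move=> x; apply/eqP; rewrite -subr_eq0; apply/eqP/cabs_eq0/eqP; rewrite eq_le cabs_ge0 andbT.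
apply/ler_addgt0Pr => e e0; have e2 : 0 < e / 2 by lra.
have [d d0 hd] := ev_unif_cont as0 e2.
have m0 : 0 < Num.min d (e / 2 / L) by rewrite lt_min d0 !divr_gt0.
have [m [i [k [im]]]] := dyadic_approx x m0.
set y := gp R (2 ^ m) i%:Z + pi *+ 2 * k%:~R; rewrite le_min ler_pdivlMr// => /andP[xy1 xy2].
have yE : ev a y = toC g y by rewrite /y ev_period pG dyad.
rewrite add0r (le_trans (cabs_dist_triangle (ev a y) _ _))//.
have h1 := hd _ _ xy1.
have h2 : cabs (ev a y - toC g x) <= e / 2.
  by rewrite yE /toC -rmorphB cabsR distrC (le_trans (hL x y))// mulrC.
by lra.
Qed.

(** The values determine the discrete coefficients, and these converge to the sequence. *)
Lemma ev_inj a c A C : ssum a A -> ssum c C -> (forall x, ev a x = ev c x) -> a = c.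
Proof.
move=> ha hc h; apply/funext => n; apply: (clim_unique (dc_aliasing n ha)).
by have /funext -> : forall x, ev a x = ev c x by []; exact: dc_aliasing hc.
Qed.

End lipschitz_series.

(** * Coefficient sequences and means of Lipschitz functions *)

Section lipschitz_functions.
Variable R : realType.
Implicit Types (N j m : nat) (n k : int) (x y L M : R) (g f : R -> R) (a : int -> R[i]).

Definition lipb g L M := [/\ per g, 0 < L, forall x y, `|g x - g y| <= L * `|x - y| &
  forall x, `|g x| <= M].

Definition lipf g := exists L M, lipb g L M.

Lemma lipb_ge0 g L M : lipb g L M -> 0 <= M.
Proof. by move=> [_ _ _ /(_ 0)]; apply: le_trans. Qed.

Lemma lipf_per g : lipf g -> per g. Proof. by move=> [L [M []]]. Qed.

Lemma lipf_cst (c : R) : lipf (fun=> c).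
Proof. by exists 1, `|c|; split => // x y; rewrite subrr normr0 mul1r. Qed.

Lemma lipbD g f L M L' M' : lipb g L M -> lipb f L' M' -> lipb (fun x => g x + f x) (L + L') (M + M').
Proof.
move=> [pg L0 hL hM] [pf L0' hL' hM']; split.
- by move=> x k; rewrite pg pf.
- exact: addr_gt0.
- move=> x y; rewrite (_ : _ - _ = (g x - g y) + (f x - f y)); last by ring.
  by rewrite (le_trans (ler_normD _ _))// mulrDl lerD.
- by move=> x; rewrite (le_trans (ler_normD _ _))// lerD.
Qed.

(** The product rule; the summand 1 keeps the constant positive even when both sup bounds vanish. *)
Lemma lipbM g f L M L' M' : lipb g L M -> lipb f L' M' ->
  lipb (fun x => g x * f x) (L * M' + L' * M + 1) (M * M').
Proof.
move=> hg hf; have M0 := lipb_ge0 hg; have M0' := lipb_ge0 hf.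
move: hg hf => [pg L0 hL hM] [pf L0' hL' hM']; split.
- by move=> x k; rewrite pg pf.
- by rewrite ltr_wpDl// addr_ge0 ?mulr_ge0 ?(ltW L0) ?(ltW L0').
- move=> x y; rewrite (_ : _ - _ = (g x - g y) * f x + g y * (f x - f y)); last by ring.
  rewrite (le_trans (ler_normD _ _))// !normrM.
  have h1 : `|g x - g y| * `|f x| <= L * `|x - y| * M' by rewrite ler_pM.
  have h2 : `|g y| * `|f x - f y| <= M * (L' * `|x - y|) by rewrite ler_pM.
  by have := normr_ge0 (x - y); lra.
- by move=> x; rewrite normrM ler_pM.
Qed.

Lemma lipbN g L M : lipb g L M -> lipb (fun x => - g x) L M.
Proof.
move=> [pg L0 hL hM]; split => //.
- by move=> x k; rewrite pg.
- by move=> x y; rewrite -opprD normrN.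
- by move=> x; rewrite normrN.
Qed.

Lemma lipf_add g f : lipf g -> lipf f -> lipf (fun x => g x + f x).
Proof. by move=> [L [M h]] [L' [M' h']]; do 2 eexists; exact: lipbD h h'. Qed.

Lemma lipf_mul g f : lipf g -> lipf f -> lipf (fun x => g x * f x).
Proof. by move=> [L [M h]] [L' [M' h']]; do 2 eexists; exact: lipbM h h'. Qed.

Lemma lipf_opp g : lipf g -> lipf (fun x => - g x).
Proof. by move=> [L [M h]]; do 2 eexists; exact: lipbN h. Qed.

Lemma lipf_sub g f : lipf g -> lipf f -> lipf (fun x => g x - f x).
Proof. by move=> hg hf; apply: lipf_add => //; exact: lipf_opp. Qed.

Lemma lipf_sum (I : Type) (r : seq I) (F : I -> R -> R) :
  (forall i, lipf (F i)) -> lipf (fun x => \sum_(i <- r) F i x).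
Proof.
move=> hF; elim: r => [|i r IH].
  by under eq_fun do rewrite big_nil; exact: lipf_cst.
by under eq_fun do rewrite big_cons; exact: lipf_add.
Qed.

Lemma maxr_dist (p q s t : R) : `|Num.max p q - Num.max s t| <= Num.max `|p - s| `|q - t|.
Proof.
have h (p1 q1 s1 t1 : R) : Num.max p1 q1 - Num.max s1 t1 <= Num.max `|p1 - s1| `|q1 - t1|.
  have hs : s1 <= Num.max s1 t1 by rewrite le_max lexx.
  have ht : t1 <= Num.max s1 t1 by rewrite le_max lexx orbT.
  have hp : `|p1 - s1| <= Num.max `|p1 - s1| `|q1 - t1| by rewrite le_max lexx.
  have hq : `|q1 - t1| <= Num.max `|p1 - s1| `|q1 - t1| by rewrite le_max lexx orbT.
  have := ler_norm (p1 - s1); have := ler_norm (q1 - t1) => *.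
  by rewrite lerBlDr ge_max; apply/andP; split; lra.
have h1 := h p q s t; have := h s t p q; rewrite (distrC s) (distrC t) => h2.
by rewrite ler_norml; apply/andP; split; lra.
Qed.

Lemma lipf_max g f : lipf g -> lipf f -> lipf (fun x => Num.max (g x) (f x)).
Proof.
move=> [L [M [pg L0 hL hM]]] [L' [M' [pf L0' hL' hM']]].
exists (L + L'), (M + M'); split.
- by move=> x k; rewrite pg pf.
- exact: addr_gt0.
- move=> x y; rewrite (le_trans (maxr_dist _ _ _ _))// ge_max mulrDl.
  rewrite (le_trans (hL x y)) ?(le_trans (hL' x y)) ?lerDl ?lerDr//.
    by rewrite mulr_ge0 ?(ltW L0).
  by rewrite mulr_ge0 ?(ltW L0').
- move=> x; have h := hM x; have h' := hM' x.
  have := normr_ge0 (g x); have := normr_ge0 (f x).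
  by rewrite maxEle; case: ifP => _; lra.
Qed.

Lemma lipf_bigmax (I : Type) (r : seq I) (F : I -> R -> R) :
  (forall i, lipf (F i)) -> lipf (fun x => \big[Num.max/0]_(i <- r) F i x).
Proof.
move=> hF; elim: r => [|i r IH].
  by under eq_fun do rewrite big_nil; exact: lipf_cst.
by under eq_fun do rewrite big_cons; exact: lipf_max.
Qed.

Lemma lipf_scale g (A : nat) : lipf g -> lipf (fun x => g (A%:R * x)).
Proof.
move=> [L [M [pg L0 hL hM]]]; exists (L * (1 + A%:R)), M; split => //.
- move=> x k; rewrite mulrDr mulrCA -[A%:R]/(A%:Z%:~R) -intrM; exact: pg.
- by rewrite mulr_gt0// ltr_wpDr.
- move=> x y; rewrite (le_trans (hL _ _))// -mulrBr normrM normr_nat mulrA ler_wpM2r//.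
  by rewrite ler_wpM2l ?(ltW L0)// lerDr.
Qed.

Lemma lipf_shift g c : lipf g -> lipf (fun x => g (x - c)).
Proof.
move=> [L [M [pg L0 hL hM]]]; exists L, M; split => //.
- by move=> x k; rewrite addrAC pg.
- by move=> x y; rewrite (le_trans (hL _ _))// opprB addrA subrK.
Qed.

(** The coefficient sequence of g, chosen among summable sequences with sum g and unique by
    [ev_inj]; the default is the zero sequence. *)
Definition fc g : int -> R[i] := xget (fun=> 0)
  [set a | (exists C, ssum a C) /\ forall x, ev a x = toC g x].

Lemma fcP g : lipf g -> (exists C, ssum (fc g) C) /\ forall x, ev (fc g) x = toC g x.
Proof.
move=> [L [M [pg L0 hL hM]]]; rewrite /fc; case: xgetP => [a _ //|h]; exfalso.
have [a [ha hb]] := lipschitz_series pg L0 hL hM; apply: (h a); split => //.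
exists (Cb 0 * (M + L)); apply: (bnd_ssum (lexx 0)); apply: hb.
by rewrite lexx/=; lra.
Qed.

Lemma ev_fc g x : lipf g -> ev (fc g) x = toC g x.
Proof. by move=> /fcP[]. Qed.

Lemma ssum_fc g : lipf g -> exists C, ssum (fc g) C.
Proof. by move=> /fcP[]. Qed.

Lemma fc_eq g a C : lipf g -> ssum a C -> (forall x, ev a x = toC g x) -> fc g = a.
Proof.
move=> hg ha h; have [[C' hC'] he] := fcP hg; apply: (ev_inj hC' ha) => x.
by rewrite he h.
Qed.

Lemma fc_bnd g L M b : lipb g L M -> 0 <= b < 1 / 2 -> bnd b (fc g) (Cb b * (M + L)).
Proof.
move=> hg hb; have hgf : lipf g by exists L, M.
move: hg => [pg L0 hL hM].
have [a [ha hab]] := lipschitz_series pg L0 hL hM.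
rewrite (fc_eq hgf (bnd_ssum _ (hab 0 _)) ha)//; first exact: hab.
by rewrite lexx/=; lra.
Qed.

Lemma fc_bnd_ex g b : lipf g -> b < 1 / 2 -> exists C, bnd b (fc g) C.
Proof.
move=> [L [M hg]] hb; have [b0|b0] := leP 0 b.
  by exists (Cb b * (M + L)); apply: fc_bnd => //; rewrite b0.
exists (Cb 0 * (M + L)); apply: (bnd_weight (ltW b0)); apply: fc_bnd => //.
by rewrite lexx/=; lra.
Qed.

Lemma fc_mul g f : lipf g -> lipf f -> fc (fun x => g x * f x) = convol (fc g) (fc f).
Proof.
move=> hg hf; have [C hC] := ssum_fc hg; have [D hD] := ssum_fc hf.
apply: (fc_eq (lipf_mul hg hf) (ssum_conv hC hD)) => x.
by rewrite (ev_conv _ hC hD) !ev_fc// /toC rmorphM.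
Qed.

Lemma fcB g f : lipf g -> lipf f -> fc (fun x => g x - f x) = fun n => fc g n - fc f n.
Proof.
move=> hg hf; have [C hC] := ssum_fc hg; have [D hD] := ssum_fc hf.
have hB : ssum (fun n => fc g n - fc f n) (C + D).
  by apply: (bnd_ssum (lexx 0)); apply: bndB; exact: ssum_bnd.
apply: (fc_eq (lipf_sub hg hf) hB) => x.
by rewrite (evB _ hC hD) !ev_fc// /toC rmorphB.
Qed.

Lemma fc_cst c : fc (fun=> c) = single 0 c%:C.
Proof.
have h : ssum (single 0 c%:C) (cabs c%:C * wt (0 : int) `^ 0).
  by apply: (bnd_ssum (lexx 0)); exact: bnd_single.
by apply: (fc_eq (lipf_cst c) h) => x; rewrite ev_single mul0r expi0 mulr1.
Qed.

Lemma dc_toC0 N g : dc N (toC g) 0 = (gmean N g)%:C.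
Proof.
rewrite /dc /gmean rmorphM/= fmorphV rmorph_nat rmorph_sum; congr (_ * _).
by apply: eq_bigr => j _; rewrite mul0r oppr0 expi0 mulr1.
Qed.

(** The integral mean, read off as the zeroth coefficient; [mean_lim] identifies it with the limit
    of grid means. *)
Definition mean g : R := complex.Re (fc g 0).

Lemma clim_gmean g : lipf g -> clim (fun N => (gmean N g)%:C) (fc g 0).
Proof.
move=> hg; have [C hC] := ssum_fc hg; have := dc_aliasing 0 hC.
have -> : ev (fc g) = toC g by apply/funext => x; exact: ev_fc.
by apply: (@eq_clim _ 0%N) => N _; rewrite dc_toC0.
Qed.

Lemma clim_real (s : nat -> R) (l : R[i]) : clim (fun N => (s N)%:C) l -> l = (complex.Re l)%:C.
Proof.
move=> h; have h2 : clim (fun N => (s N)%:C) (conjc l).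
  by apply: (@eq_clim _ 0%N) (climJ h) => N _; rewrite conjc_real.
have := clim_unique h h2; case: l {h h2} => p q [] /eqP.
by rewrite -subr_eq0 opprK -mulr2n mulrn_eq0/= => /eqP ->.
Qed.

Lemma fc0 g : lipf g -> fc g 0 = (mean g)%:C.
Proof. by move=> /clim_gmean /clim_real. Qed.

Lemma mean_lim g e : lipf g -> 0 < e ->
  exists N0, forall N, (N0 <= N)%N -> `|gmean N g - mean g| <= e.
Proof.
move=> hg e0; have [N0 h] := clim_gmean hg e0; exists N0 => N /h.
by rewrite fc0// -rmorphB cabsR.
Qed.

Lemma mean_ge_of g D : lipf g -> (exists N1, forall N, (N1 <= N)%N -> D <= gmean N g) -> D <= mean g.
Proof.
move=> hg [N1 hD]; apply/ler_addgt0Pr => e e0; have [N0 h] := mean_lim hg e0.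
have := h (maxn N0 N1) (leq_maxl _ _); have := hD (maxn N0 N1) (leq_maxr _ _).
by rewrite ler_norml => ? /andP[]; lra.
Qed.

Lemma mean_ge0 g : lipf g -> (forall x, 0 <= g x) -> 0 <= mean g.
Proof. by move=> hg h; apply: mean_ge_of => //; exists 0%N => N _; exact: gmean_ge0. Qed.

Lemma coef_le_mean a C g n : ssum a C -> lipf g -> (forall x, cabs (ev a x) <= g x) ->
  cabs (a n) <= mean g.
Proof.
move=> ha hg h; apply/ler_addgt0Pr => e e0; have [N0 h0] := mean_lim hg e0.
apply: (clim_bound (N1 := N0) (dc_aliasing n ha)) => N hN.
rewrite (le_trans (cabs_dc _ _ _))// (le_trans (gmean_le N h))//.
by have := h0 _ hN; rewrite ler_norml => /andP[]; lra.
Qed.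

Lemma cabs_fc_le_mean g n : lipf g -> (forall x, 0 <= g x) -> cabs (fc g n) <= mean g.
Proof.
move=> hg g0; have [C hC] := ssum_fc hg; apply: (coef_le_mean _ hC hg) => x.
by rewrite ev_fc// /toC cabsR ger0_norm.
Qed.

Lemma fc_bessel g D (s : seq int) : lipf g -> uniq s ->
  (exists N1, forall N, (N1 <= N)%N -> gmean N (fun x => g x ^+ 2) <= D) ->
  \sum_(n <- s) cabs (fc g n) ^+ 2 <= D.
Proof.
move=> hg us [N1 hD]; have [C hC] := ssum_fc hg; have [K hK] := seq_absz_bound s.
have E : ev (fc g) = toC g by apply/funext => x; exact: ev_fc.
apply: (clim_sq_le (N1 := maxn N1 (K + K).+1) (z := fun n N => dc N (toC g) n)).
  by move=> n; rewrite -E; exact: dc_aliasing hC.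
move=> N; rewrite geq_max => /andP[h1 h2].
apply: (le_trans (@dc_bessel _ _ _ (- K%:Z) s _ us _)); first by rewrite (leq_trans _ h2).
  by move=> n /hK; clear -h2; lia.
by rewrite (le_trans _ (hD _ h1))// gmean_le// => x; rewrite /toC cabsR real_normK ?num_real.
Qed.

(** Only dyadic grids are used because pi / 2^j has to be a multiple of the grid step. *)
Lemma fc_blk g D j : lipf g ->
  (exists m1, forall m, (m1 <= m)%N -> gmean (2 ^ m) (fun x => (g (x + pi / 2 ^+ j) - g x) ^+ 2) <= D) ->
  \sum_(n <- zw (2 ^ j) | blk j n) cabs (fc g n) ^+ 2 <= D.
Proof.
move=> hg [m1 hD]; have [C hC] := ssum_fc hg.
have E : ev (fc g) = toC g by apply/funext => x; exact: ev_fc.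
have pG : per (toC g) by move=> x k; rewrite /toC (lipf_per hg).
rewrite -big_filter.
apply: (clim_sq_le (N1 := maxn m1 j.+1) (z := fun n m => dc (2 ^ m) (toC g) n)).
  move=> n e e0; have [N0 h0] := dc_aliasing n hC e0; exists N0 => N hN.
  by rewrite -E; apply: h0; rewrite (leq_trans hN)// ltnW// ltn_expl.
move=> m; rewrite geq_max => /andP[h1 h2]; rewrite big_filter.
rewrite (le_trans (dc_blk h2 pG))// (le_trans _ (hD _ h1))// gmean_le// => x.
by rewrite /toC -rmorphB cabsR real_normK ?num_real.
Qed.

End lipschitz_functions.

(** * Distance to 2 pi Z, counting in arcs, tent functions *)

Section periodic_distance.
Variable R : realType.
Implicit Types (N j m : nat) (n k : int) (x y c r : R).

(** Distance from x to 2 pi Z; the circle metric is [pd] of the difference of representatives, by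
    definition. *)
Definition pd x : R := inf (lifts x).

Lemma lifts_has_inf x : has_inf (lifts x).
Proof. by split; [exists `|x + (pi *+ 2) * 0%:~R|, 0|exists 0 => _ [k _ <-]]. Qed.

Lemma pd_ge0 x : 0 <= pd x.
Proof. by apply: lb_le_inf; [case: (lifts_has_inf x)|move=> _ [k _ <-]]. Qed.

Lemma pd_le x k : pd x <= `|x + (pi *+ 2) * k%:~R|.
Proof. by apply: ge_inf; [case: (lifts_has_inf x)|exists k]. Qed.

Lemma pd_adherent x e : 0 < e -> exists k, `|x + (pi *+ 2) * k%:~R| < pd x + e.
Proof.
by move=> e0; have [_ [k _ <-] h] := inf_adherent e0 (lifts_has_inf x); exists k.
Qed.

Lemma pd_norm x : pd x <= `|x|.
Proof. by have := pd_le x 0; rewrite mulr0 addr0. Qed.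

Lemma pd0 : pd 0 = 0.
Proof. by apply/eqP; rewrite eq_le pd_ge0 andbT (le_trans (pd_norm 0))// normr0. Qed.

Lemma pdD x y : pd (x + y) <= pd x + pd y.
Proof.
apply/ler_addgt0Pr => e e0; have e2 : 0 < e / 2 by lra.
have [k hk] := pd_adherent x e2; have [l hl] := pd_adherent y e2.
apply: (le_trans (pd_le _ (k + l))); rewrite intrD.
rewrite (_ : x + y + _ = (x + pi *+ 2 * k%:~R) + (y + pi *+ 2 * l%:~R)); last by ring.
by rewrite (le_trans (ler_normD _ _))//; lra.
Qed.

Lemma pdN x : pd (- x) = pd x.
Proof.
have h z : pd (- z) <= pd z.
  apply/ler_addgt0Pr => e e0; have [k hk] := pd_adherent z e0.
  apply: (le_trans (pd_le _ (- k))); rewrite intrN mulrN -opprD normrN.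
  exact: ltW.
by apply/eqP; rewrite eq_le h -{1}[x]opprK h.
Qed.

Lemma pd_period x k : pd (x + pi *+ 2 * k%:~R) = pd x.
Proof.
have z (l : int) : pd (pi *+ 2 * l%:~R) = 0.
  apply/eqP; rewrite eq_le pd_ge0 andbT (le_trans (pd_le _ (- l)))//.
  by rewrite intrN mulrN subrr normr0.
apply/eqP; rewrite eq_le; apply/andP; split.
  by rewrite (le_trans (pdD _ _))// z addr0.
rewrite -{1}(addrK (pi *+ 2 * k%:~R) x) (le_trans (pdD _ _))//.
by rewrite -mulrN -intrN z addr0.
Qed.

Lemma pd_dist x y : `|pd x - pd y| <= pd (x - y).
Proof.
have h u v : pd u <= pd (u - v) + pd v by rewrite -{1}(subrK v u) pdD.
have h1 := h x y; have := h y x; rewrite -(opprB x y) pdN => h2.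
by rewrite ler_norml; apply/andP; split; lra.
Qed.

Lemma pd_lip x y : `|pd x - pd y| <= `|x - y|.
Proof. exact: le_trans (pd_dist x y) (pd_norm _). Qed.

Lemma pi2_gt0 : 0 < pi *+ 2 :> R. Proof. by rewrite mulrn_wgt0// pi_gt0. Qed.

Lemma circle_lift x : exists k, `|x + pi *+ 2 * k%:~R| <= pi.
Proof.
pose t := Num.floor (x / (pi *+ 2) + 1 / 2); exists (- t).
have /andP[h1 h2] := floor_itv (x / (pi *+ 2) + 1 / 2); rewrite -/t in h1 h2.
rewrite intrD in h2; rewrite intrN; have p0 := pi2_gt0.
set c := pi *+ 2 in p0 h1 h2 *; have pE : pi = c / 2 by rewrite /c; field.
have xE : x = c * (x / c) by rewrite mulrC divfK// gt_eqF.
rewrite pE ler_norml; move: h1 h2; rewrite {3 4}xE; set u := x / c => h1 h2.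
by apply/andP; split; nra.
Qed.

Lemma pd_small x : `|x| <= pi -> pd x = `|x|.
Proof.
move=> hx; apply/eqP; rewrite eq_le pd_norm/=; apply: lb_le_inf; first by case: (lifts_has_inf x).
move=> _ [k _ <-]; have [->|k0] := eqVneq k 0; first by rewrite mulr0 addr0.
have h : 1 <= `|k%:~R| :> R by rewrite -intr_norm -[1]/(1%:~R) ler_int; move: k0; clear; lia.
have : `|pi *+ 2 * k%:~R| <= `|x + pi *+ 2 * k%:~R| + `|x|.
  by rewrite -{1}(addKr x (pi *+ 2 * k%:~R)) addrC (le_trans (ler_normB _ _)).
have p0 := pi2_gt0; rewrite normrM (gtr0_norm p0).
have : pi *+ 2 <= pi *+ 2 * `|k%:~R| :> R by rewrite ler_peMr// ltW.
by rewrite mulr2n in p0 *; lra.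
Qed.

Lemma pd_attained x : exists k, pd x = `|x + pi *+ 2 * k%:~R|.
Proof. by have [k hk] := circle_lift x; exists k; rewrite -(pd_period x k) pd_small. Qed.

Lemma pd_le_pi x : pd x <= pi.
Proof. by have [k hk] := circle_lift x; rewrite -(pd_period x k) pd_small. Qed.

Lemma size_int_itv (t : seq int) (A B : R) : A <= B -> uniq t ->
  (forall n, n \in t -> A <= n%:~R <= B) -> (size t)%:R <= B - A + 1.
Proof.
move=> AB ut ht; case: t ut ht => [|n0 t] ut ht; first by rewrite /=; lra.
set s := n0 :: t in ut ht *.
pose lo := Num.ceil A; pose hi := Num.floor B.
have hs n : n \in s -> lo <= n <= hi.
  by move=> /ht /andP[h1 h2]; rewrite ceil_le_int// floor_ge_int// h1 h2.
have lohi : lo <= hi by have /andP[] := hs n0 (mem_head _ _); exact: le_trans.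
pose K := (absz (hi - lo)).+1.
have : (size s <= K)%N.
  rewrite -(size_iota 0 K) -(size_map (fun i : nat => lo + i%:Z)); apply: uniq_leq_size => // n /hs h.
  by apply/mapP; exists (absz (n - lo)); [rewrite mem_iota /K|]; clear -h lohi; lia.
rewrite -(ler_nat R) => /le_trans; apply; rewrite /K -natr1 lerD2r.
have -> : (absz (hi - lo))%:R = (hi - lo)%:~R :> R by rewrite -[LHS]/((absz (hi - lo))%:Z%:~R) gez0_abs// subr_ge0.
rewrite intrB lerB//; first exact: floor_le.
exact: ceil_ge.
Qed.

(** An arc of length 2 r holds at most N r / pi + 1 of the N grid points. *)
Lemma gmean_arc N (F : R -> R) c r : (0 < N)%N -> 0 < r ->
  (forall x, F x <= 1) -> (forall x, r < pd (x - c) -> F x <= 0) ->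
  gmean N F <= r + N%:R^-1.
Proof.
move=> N0 r0 F1 F0; have NR : 0 < N%:R :> R by rewrite ltr0n.
pose S := [seq j <- iota 0 N | pd (gp R N j%:Z - c) <= r].
have /choice[kf hk] : forall x, exists k, pd x = `|x + pi *+ 2 * k%:~R| by move=> x; exact: pd_attained.
(* Each index is moved by a multiple of N so that its grid point lies within r of c on the line
   itself; distinct indices stay distinct modulo N, and the integers of an interval can be
   counted. *)
pose phi (j : nat) : int := j%:Z + N%:Z * kf (gp R N j%:Z - c).
have inj : {in S &, injective phi}.
  move=> i j; rewrite !mem_filter !mem_iota /phi => /andP[_ hi] /andP[_ hj].
  move: (kf _) (kf _) => u v huv.
  have h1 : (N%:Z %| i%:Z - j%:Z)%Z by apply/dvdzP; exists (u - v); clear -huv; lia.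
  by have := dvdz_small _ h1; clear -hi hj; lia.
pose A : R := N%:R * (c - r) / (pi *+ 2); pose B : R := N%:R * (c + r) / (pi *+ 2).
have p2 := pi2_gt0.
have hsz : (size (map phi S))%:R <= B - A + 1.
  apply: size_int_itv.
  - by rewrite /A /B ler_pM2r ?invr_gt0// ler_pM2l//; lra.
  - by rewrite map_inj_in_uniq// filter_uniq// iota_uniq.
  - move=> _ /mapP[j + ->]; rewrite mem_filter hk => /andP[+ _].
    rewrite /phi; move: (kf _) => k; rewrite ler_norml => /andP[h1 h2].
    have E : gp R N j%:Z - c + pi *+ 2 * k%:~R = (j%:Z + N%:Z * k)%:~R * (pi *+ 2) / N%:R - c.
      rewrite /gp intrD intrM -[N%:Z%:~R]/(N%:R) -[j%:Z%:~R]/(j%:R).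
      by field; rewrite gt_eqF.
    rewrite E in h1 h2; rewrite /A /B ler_pdivrMr// ler_pdivlMr//; apply/andP; split.
      rewrite mulrC -ler_pdivlMr//; lra.
    rewrite mulrC [N%:R * _]mulrC -ler_pdivrMr// mulrC; lra.
rewrite size_map in hsz.
have hsum : \sum_(j < N) F (gp R N j%:Z) <= (size S)%:R.
  rewrite -(big_mkord xpredT (fun j : nat => F (gp R N j%:Z))) /index_iota subn0.
  rewrite -sum1_size natr_sum big_filter [X in _ <= X]big_mkcond/=.
  by apply: ler_sum => j _; case: ifPn => [_|]; [exact: F1|rewrite -ltNge; exact: F0].
rewrite /gmean mulrC ler_pdivrMr// (le_trans hsum)// (le_trans hsz)//.
rewrite mulrDl mulVf ?gt_eqF// lerD2r /A /B -mulrBl -mulrBr.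
rewrite ler_pdivrMr//; have := @pi_ge2 R; rewrite mulr2n.
have : 0 < r * N%:R by rewrite mulr_gt0. 
nra.
Qed.

(** Trapezoid equal to 1 up to distance r from 2 pi Z, equal to 0 from distance 2 r on, with slope 1
    / r between. *)
Definition tent r x : R := Num.min 1 (Num.max 0 (2 - pd x / r)).

Lemma tent_ge0 r x : 0 <= tent r x.
Proof. by rewrite /tent le_min ler01 le_max lexx. Qed.

Lemma tent_le1 r x : tent r x <= 1.
Proof. by rewrite /tent ge_min lexx. Qed.

Lemma tent1 r x : 0 < r -> pd x <= r -> tent r x = 1.
Proof.
move=> r0 h; have : pd x / r <= 1 by rewrite ler_pdivrMr// mul1r.
by move=> ?; rewrite /tent min_l// le_max; apply/orP; right; lra.
Qed.

Lemma tent0 r x : 0 < r -> 2 * r <= pd x -> tent r x = 0.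
Proof.
move=> r0 h; have : 2 <= pd x / r by rewrite ler_pdivlMr.
by move=> ?; rewrite /tent max_l ?min_r//; lra.
Qed.

Lemma tent_lip r x y : 0 < r -> `|tent r x - tent r y| <= r^-1 * `|x - y|.
Proof.
move=> r0; have h1 : `|(2 - pd x / r) - (2 - pd y / r)| <= r^-1 * `|x - y|.
  rewrite (_ : _ - _ = - (r^-1 * (pd x - pd y))); last by ring.
  by rewrite normrN normrM gtr0_norm ?invr_gt0// ler_wpM2l ?pd_lip// invr_ge0 ltW.
have key (p q : R) : `|Num.min 1 (Num.max 0 p) - Num.min 1 (Num.max 0 q)| <= `|p - q|.
  have h2 : `|Num.max 0 p - Num.max 0 q| <= `|p - q|.
    by rewrite (le_trans (maxr_dist _ _ _ _))// subrr normr0 max_r.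
  apply: le_trans h2; move: (Num.max 0 p) (Num.max 0 q) => u v.
  have := ler_norm (u - v); have := ler_norm (v - u); rewrite (distrC v u) => h3 h4.
  have := normr_ge0 (u - v) => h5.
  by rewrite !minEle ler_norml; case: (leP 1 u) => ?; case: (leP 1 v) => ?; apply/andP; split; lra.
exact: le_trans (key _ _) h1.
Qed.

Lemma lipf_tent r : 0 < r -> lipf (tent r).
Proof.
move=> r0; exists r^-1, 1; split.
- by move=> x k; rewrite /tent pd_period.
- by rewrite invr_gt0.
- by move=> x y; exact: tent_lip.
- by move=> x; rewrite ger0_norm ?tent_ge0 ?tent_le1.
Qed.

End periodic_distance.

(** * Weighted spaces and the span of translates *)

Section weighted_spaces.
Variable R : realType.
Implicit Types (N : nat) (n m k : int) (u v w a f g : int -> R[i]) (p b C e : R).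

(** Translates the extended-real sum in the definition of the norm into bounds on all windows, the
    form used everywhere else. *)
Lemma esum_windows (h : int -> R) C : (forall n, 0 <= h n) ->
  (\esum_(n in [set: int]) (h n)%:E <= C%:E)%E <-> (forall N, \sum_(n <- zw N) h n <= C).
Proof.
move=> h0; split=> [hC N|hC].
  rewrite -lee_fin; apply: le_trans hC; apply: esum_ge; exists [set` zw N].
    by split => //; exact: finite_seq.
  by rewrite -fsbig_seq ?zw_uniq// sumEFin.
apply: ub_ereal_sup => _ [A [fA _] <-].
rewrite fsbig_finite//= sumEFin lee_fin; apply: zw_bound_sum => //.
exact: finmap.fset_uniq.
Qed.

Definition pterm p b a n : R := cabs (a n) `^ p * wt n `^ (p * b).

(** A bound on the p-th power of the norm, not on the norm. *)
Definition pbd p b a C := forall N, \sum_(n <- zw N) pterm p b a n <= C.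

Lemma pterm_ge0 p b a n : 0 <= pterm p b a n.
Proof. by rewrite mulr_ge0 ?powR_ge0. Qed.

Lemma lp_normE p b a : lp_norm p b a =
  ((\esum_(n in [set: int]) (pterm p b a n)%:E) `^ p^-1)%E.
Proof. by []. Qed.

Lemma esum_pterm_ge0 p b a : (0 <= \esum_(n in [set: int]) (pterm p b a n)%:E)%E.
Proof. by apply: esum_ge0 => n _; rewrite lee_fin pterm_ge0. Qed.

Lemma lp_spaceP p b a : 0 < p -> lp_space p b a <-> exists C, pbd p b a C.
Proof.
move=> p0; have pV : p^-1 != 0 by rewrite gt_eqF// invr_gt0.
rewrite /lp_space/= lp_normE; split.
  move=> /(lty_poweRy pV) h.
  have := esum_pterm_ge0 p b a; case E : (esum _ _) h => [S| |]// _ S0.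
  exists S; apply/(esum_windows _ (pterm_ge0 p b a)); rewrite E//.
move=> [C /(esum_windows _ (pterm_ge0 p b a)) h]; apply: poweR_lty.
exact: le_lt_trans h (ltry _).
Qed.

Lemma lp_norm_lt p b a C e : 0 < p -> 0 < e -> pbd p b a C -> C < e `^ p ->
  (lp_norm p b a < e%:E)%E.
Proof.
move=> p0 e0 /(esum_windows _ (pterm_ge0 p b a)) h Ce; rewrite lp_normE.
have := esum_pterm_ge0 p b a; case E : (esum _ _) h => [S| |]//.
rewrite lee_fin => SC S0; rewrite lee_fin in S0; rewrite poweR_EFin lte_fin.
have eE : e = (e `^ p) `^ p^-1 by rewrite -powRrM mulfV ?gt_eqF// powRr1// ltW.
rewrite eE gt0_ltr_powR ?invr_gt0 ?nnegrE ?powR_ge0//.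
exact: le_lt_trans SC Ce.
Qed.

Lemma lt_lp_norm p b a e : 0 < p -> 0 < e -> (lp_norm p b a < e%:E)%E -> pbd p b a (e `^ p).
Proof.
move=> p0 e0; rewrite lp_normE => h; apply/(esum_windows _ (pterm_ge0 p b a)).
have := esum_pterm_ge0 p b a; case E : (esum _ _) h => [S| |]//; last first.
  by rewrite poweRyr// gt_eqF// invr_gt0.
rewrite poweR_EFin lte_fin !lee_fin => Se S0.
have -> : S = (S `^ p^-1) `^ p by rewrite -powRrM mulVf ?gt_eqF// powRr1.
by rewrite ge0_ler_powR ?nnegrE ?powR_ge0 ?(ltW p0) ?(ltW e0) ?(ltW Se).
Qed.

Lemma lp_space1 b a : lp_space 1 b a <-> exists C, bnd b a C.
Proof.
have E n : pterm 1 b a n = cabs (a n) * wt n `^ b.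
  by rewrite /pterm mul1r powRr1// cabs_ge0.
rewrite (lp_spaceP _ _ ltr01); split => -[C h]; exists C => N.
  by have := h N; under eq_bigr do rewrite E.
by under eq_bigr do rewrite E; exact: h.
Qed.

Lemma pbd_ge0 p b a C : pbd p b a C -> 0 <= C.
Proof. by move=> /(_ 0%N); apply: le_trans; rewrite sumr_ge0// => n _; exact: pterm_ge0. Qed.

Lemma pbd_le p b a C D : C <= D -> pbd p b a C -> pbd p b a D.
Proof. by move=> CD h N; rewrite (le_trans (h N)). Qed.

Lemma ptermE p b a n : pterm p b a n = (cabs (a n) * wt n `^ b) `^ p.
Proof. by rewrite powRM ?cabs_ge0 ?wtp_ge0// -powRrM [b * p]mulrC. Qed.

Lemma powRD_le p (s t : R) : 0 < p -> 0 <= s -> 0 <= t -> (s + t) `^ p <= 2 `^ p * (s `^ p + t `^ p).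
Proof.
move=> p0; wlog st : s t / s <= t.
  move=> H s0 t0; have [st|/ltW ts] := leP s t; first exact: H.
  by rewrite addrC [s `^ p + _]addrC; exact: H.
move=> s0 t0; apply: (@le_trans _ _ ((2 * t) `^ p)).
  by rewrite ge0_ler_powR ?nnegrE ?(ltW p0) ?addr_ge0 ?mulr_ge0//; lra.
by rewrite powRM// ler_wpM2l ?powR_ge0// lerDr powR_ge0.
Qed.

(** The crude factor 2^p takes the place of Minkowski's inequality; it is harmless wherever both
    errors can be made arbitrarily small. *)
Lemma pbdD p b f g C D : 0 < p -> pbd p b f C -> pbd p b g D ->
  pbd p b (fun n => f n + g n) (2 `^ p * (C + D)).
Proof.
move=> p0 hf hg N.
apply: (@le_trans _ _ (\sum_(n <- zw N) 2 `^ p * (pterm p b f n + pterm p b g n))).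
  apply: ler_sum => n _; rewrite !ptermE.
  apply: le_trans (powRD_le p0 _ _); rewrite ?mulr_ge0 ?cabs_ge0 ?wtp_ge0//.
  rewrite ge0_ler_powR ?nnegrE ?(ltW p0) ?addr_ge0 ?mulr_ge0 ?cabs_ge0 ?wtp_ge0//.
  by rewrite -mulrDl ler_wpM2r ?wtp_ge0 ?cabsD.
by rewrite -mulr_sumr ler_wpM2l ?powR_ge0// big_split lerD.
Qed.

Lemma pbdZ p b c f C : 0 < p -> pbd p b f C -> pbd p b (fun n => c * f n) (cabs c `^ p * C).
Proof.
move=> p0 hf N; rewrite (le_trans _ (ler_wpM2l (powR_ge0 (cabs c) p) (hf N)))//.
by rewrite mulr_sumr ler_sum// => n _; rewrite /pterm cabsM powRM ?cabs_ge0// mulrA.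
Qed.

Lemma pbd_shift p b m f C : 0 < p -> 0 <= b -> pbd p b f C ->
  pbd p b (fun n => f (n - m)) (wt m `^ (p * b) * C).
Proof.
move=> p0 b0 hf N.
apply: (@le_trans _ _ (\sum_(n <- zw N) wt m `^ (p * b) * pterm p b f (n - m))).
  apply: ler_sum => n _; rewrite /pterm mulrCA ler_wpM2l ?powR_ge0//.
  by rewrite wtpB// mulr_ge0// ltW.
rewrite -mulr_sumr ler_wpM2l ?powR_ge0//.
rewrite -(big_map (fun n => n - m) xpredT (pterm p b f)).
apply: zw_bound_sum => // [|n]; last exact: pterm_ge0.
by rewrite map_inj_uniq ?zw_uniq// => x y /addIr.
Qed.

Lemma bnd_term b a C n : bnd b a C -> cabs (a n) * wt n `^ b <= C.
Proof.
move=> /(_ (absz n)); apply: le_trans.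
rewrite -(big_seq1 +%R n (fun n => cabs (a n) * wt n `^ b)); apply: ler_sum_zw => // [k|k].
  by rewrite mulr_ge0 ?cabs_ge0 ?wtp_ge0.
by rewrite inE => /eqP ->.
Qed.

Lemma bnd_pbd p b a C : 1 <= p -> C <= 1 -> bnd b a C -> pbd p b a C.
Proof.
move=> p1 C1 ha N; rewrite (le_trans _ (ha N))// ler_sum// => n _; rewrite ptermE.
have : 0 <= cabs (a n) * wt n `^ b by rewrite mulr_ge0 ?cabs_ge0 ?wtp_ge0.
rewrite le_eqVlt => /predU1P[<-|h]; first by rewrite powR0// gt_eqF//; lra.
by rewrite ge1r_powR// h (le_trans (bnd_term n ha)).
Qed.

End weighted_spaces.

(** * The span of the translates and its weighted l^1 closure *)

Section span.
Variable R : realType.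
Implicit Types (N : nat) (n m k : int) (u v w a f g : int -> R[i]) (p b C e : R).

Definition tspan u := linear_span (range (translate u)).

Lemma tspan_translate u m : tspan u (fun n => u (n - m)).
Proof.
exists 1%N, (fun=> 1), (fun=> translate u (- m)); split; first by move=> j; exists (- m).
by apply/funext => n; rewrite big_ord1 mul1r.
Qed.

Lemma tspan0 u : tspan u (fun=> 0).
Proof.
exists 0%N, (fun=> 0), (fun=> u); split; first by case.
by apply/funext => n; rewrite big_ord0.
Qed.

Lemma tspanD u f g : tspan u f -> tspan u g -> tspan u (fun n => f n + g n).
Proof.
move=> [m1 [c1 [v1 [h1 ->]]]] [m2 [c2 [v2 [h2 ->]]]].
exists (m1 + m2)%N, (fun i => match fintype.split i with inl j => c1 j | inr j => c2 j end),
  (fun i => match fintype.split i with inl j => v1 j | inr j => v2 j end).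
split; first by move=> j; case: fintype.split => i; [exact: h1|exact: h2].
apply/funext => n; rewrite big_split_ord/=; congr (_ + _); apply: eq_bigr => j _.
  by rewrite -[lshift _ _]/(unsplit (inl j)) unsplitK.
by rewrite -[rshift _ _]/(unsplit (inr j)) unsplitK.
Qed.

Lemma tspanZ u c f : tspan u f -> tspan u (fun n => c * f n).
Proof.
move=> [m1 [c1 [v1 [h1 ->]]]]; exists m1, (fun j => c * c1 j), v1; split => //.
by apply/funext => n; rewrite mulr_sumr; apply: eq_bigr => j _; rewrite mulrA.
Qed.

Lemma tspan_shift u m f : tspan u f -> tspan u (fun n => f (n - m)).
Proof.
move=> [m1 [c1 [v1 [h1 ->]]]]; exists m1, c1, (fun j n => v1 j (n - m)); split => //.
move=> j; have [k _ <-] := h1 j; exists (k - m) => //.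
by apply/funext => n; rewrite /translate; congr u; ring.
Qed.

Lemma tspan_sum u (s : seq int) (c : int -> R[i]) :
  tspan u (fun n => \sum_(m <- s) c m * u (n - m)).
Proof.
elim: s => [|m s IH]; first by under eq_fun do rewrite big_nil; exact: tspan0.
under eq_fun do rewrite big_cons; apply: tspanD => //.
by apply: tspanZ; exact: tspan_translate.
Qed.

(** Closure in weighted l^1, where Wiener algebra arguments take place; small errors there are small
    in l^p_b by [bnd_pbd]. *)
Definition tclosure b u v := forall e, 0 < e ->
  exists2 w, tspan u w & bnd b (fun n => v n - w n) e.

Lemma convol_trunc N v u : convol (trunc N v) u = fun n => \sum_(m <- zw N) v m * u (n - m).
Proof.
apply/funext => n; rewrite /convol (@csum_fin _ _ N) => [|m]; last first.
  by rewrite /trunc ltnNge => /negPf ->; rewrite mul0r.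
by apply: eq_big_seq => m; rewrite mem_zw /trunc => ->.
Qed.

Lemma tclosure_convol b u v C D : 0 <= b -> bnd b u C -> bnd b v D -> tclosure b u (convol v u).
Proof.
move=> b0 hu hv e e0; have C0 := bnd_ge0 hu.
have [|N /(_ N (leqnn N)) hN] := trunc_approx hv (e := e / (1 + C)).
  by rewrite divr_gt0//; lra.
exists (convol (trunc N v) u); first by rewrite convol_trunc; exact: tspan_sum.
have -> : (fun n => convol v u n - convol (trunc N v) u n) = convol (fun n => v n - trunc N v n) u.
  have hr := bnd_ssum b0 hN; have ht := bnd_ssum b0 (bnd_trunc N hv); have hu0 := bnd_ssum b0 hu.
  have E : v = fun n => (v n - trunc N v n) + trunc N v n by apply/funext => n; rewrite subrK.
  by rewrite {1}E (convDl hr ht hu0); apply/funext => n; rewrite addrK.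
apply: bnd_le (bnd_conv b0 hN hu); rewrite mulrAC ler_pdivrMr ?ltr_wpDr//.
by rewrite mulrDr mulr1 lerDr ltW.
Qed.

Lemma tclosure_lim b u v : (forall e, 0 < e -> exists2 w, tclosure b u w & bnd b (fun n => v n - w n) e) ->
  tclosure b u v.
Proof.
move=> h e e0; have e2 : 0 < e / 2 by lra.
have [w hw hvw] := h _ e2; have [w' hw' hww'] := hw _ e2; exists w' => //.
rewrite [e]splitr; have := bndD hvw hww'; congr (bnd _ _ _).
by apply/funext => n; rewrite addrA subrK.
Qed.

Lemma tclosureD b u v w : tclosure b u v -> tclosure b u w -> tclosure b u (fun n => v n + w n).
Proof.
move=> hv hw e e0; have e2 : 0 < e / 2 by lra.
have [v' sv hv'] := hv _ e2; have [w' sw hw'] := hw _ e2.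
exists (fun n => v' n + w' n); first exact: tspanD.
rewrite [e]splitr; have := bndD hv' hw'; congr (bnd _ _ _).
by apply/funext => n; rewrite opprD addrACA.
Qed.

Lemma tclosureZ b u c v : tclosure b u v -> tclosure b u (fun n => c * v n).
Proof.
move=> hv e e0; have c0 := cabs_ge0 c.
have [|v' sv hv'] := hv (e / (1 + cabs c)); first by rewrite divr_gt0//; lra.
exists (fun n => c * v' n); first exact: tspanZ.
have := bndZ c hv'; under [X in bnd _ X _]eq_fun do rewrite mulrBr.
apply: bnd_le; rewrite mulrCA ler_piMr ?(ltW e0)// ler_pdivrMr; lra.
Qed.

Lemma tclosure_tspan b u w : tspan u w -> tclosure b u w.
Proof.
move=> hw e e0; exists w => //.
by move=> N; rewrite big1 ?(ltW e0)// => n _; rewrite subrr cabs0 mul0r.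
Qed.

Lemma bnd_shift b m f C : 0 <= b -> bnd b f C -> bnd b (fun n => f (n - m)) (wt m `^ b * C).
Proof.
move=> b0 hf N.
apply: (@le_trans _ _ (\sum_(n <- zw N) wt m `^ b * (cabs (f (n - m)) * wt (n - m) `^ b))).
  by apply: ler_sum => n _; rewrite mulrCA ler_wpM2l ?cabs_ge0// wtpB.
rewrite -mulr_sumr ler_wpM2l ?powR_ge0//.
rewrite -(big_map (fun n => n - m) xpredT (fun n => cabs (f n) * wt n `^ b)).
apply: zw_bound_sum => // [|n]; last by rewrite mulr_ge0 ?cabs_ge0 ?wtp_ge0.
by rewrite map_inj_uniq ?zw_uniq// => x y /addIr.
Qed.

Lemma tclosure_shift b u m v : 0 <= b -> tclosure b u v -> tclosure b u (fun n => v (n - m)).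
Proof.
move=> b0 hv e e0; have w0 := wtp_gt0 b m.
have [|v' sv hv'] := hv (e / wt m `^ b); first by rewrite divr_gt0.
exists (fun n => v' (n - m)); first exact: tspan_shift.
have := bnd_shift m b0 hv'; apply: bnd_le.
by rewrite mulrC divfK// gt_eqF.
Qed.

Lemma tclosure_bnd b u v C : bnd b u C -> 0 <= b -> tclosure b u v -> exists D, bnd b v D.
Proof.
move=> hu b0 hv; have [w [m [c [x [hx ->]]]] hw] := hv 1 ltr01.
suff [D hD] : exists D, bnd b (fun n => \sum_(j < m) c j * x j n) D.
  exists (1 + D); have := bndD hw hD; congr (bnd _ _ _).
  by apply/funext => n; rewrite subrK.
elim: m c x hx {hw} => [|m IH] c x hx.
  by exists 0 => N; rewrite big1// => n _; rewrite big_ord0 cabs0 mul0r.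
have [D hD] := IH (fun j => c (widen_ord (leqnSn m) j)) (fun j => x (widen_ord (leqnSn m) j)) (fun j => hx _).
have [k _ hk] := hx ord_max.
have h1 : bnd b (x ord_max) (wt (- k) `^ b * C).
  by rewrite -hk /translate; have := bnd_shift (- k) b0 hu; under eq_fun do rewrite opprK.
exists (D + cabs (c ord_max) * (wt (- k) `^ b * C)).
have := bndD hD (bndZ (c ord_max) h1); congr (bnd _ _ _).
by apply/funext => n; rewrite big_ord_recr.
Qed.

(** The span is stable under translation and scaling, so approximating the unit vector at 0
    approximates every finitely supported sequence, and these are dense. *)
Lemma cyclic_unit_vector p b u : 1 <= p -> 0 <= b ->
  (forall e, 0 < e -> exists2 w, tspan u w & pbd p b (fun n => single 0 1 n - w n) e) ->
  cyclic p b u.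
Proof.
move=> p1 b0 h; have p0 : 0 < p by lra.
have P2 : 0 < 2 `^ p :> R by rewrite powR_gt0.
have hs m c e : 0 < e -> exists2 w, tspan u w & pbd p b (fun n => single m c n - w n) e.
  move=> e0; pose K := 1 + cabs c `^ p * wt m `^ (p * b).
  have K0 : 0 <= cabs c `^ p * wt m `^ (p * b) by rewrite mulr_ge0 ?powR_ge0.
  have [|w sw hw] := h (e / K); first by rewrite divr_gt0// /K; lra.
  exists (fun n => c * w (n - m)); first by apply: tspanZ; exact: tspan_shift.
  have := pbdZ c p0 (pbd_shift m p0 b0 hw).
  rewrite (_ : (fun n => c * _) = (fun n => single m c n - c * w (n - m))); last first.
    by apply/funext => n; rewrite mulrBr /single subr_eq0; case: eqP; rewrite ?mulr1 ?mulr0.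
  apply: pbd_le; rewrite !mulrA -/K -[X in X * _ / _]/(cabs c `^ p * _).
  by rewrite ler_pdivrMr /K; [nra|lra].
(* A window grows by two points at a time; the nested divisors 2^p * 2 undo two applications of
   [pbdD]. *)
have ht N v e : 0 < e -> exists2 w, tspan u w & pbd p b (fun n => trunc N v n - w n) e.
  elim: N e => [|N IH] e e0; first by rewrite trunc0; exact: hs.
  have e1 : 0 < e / (2 `^ p * 2) by rewrite divr_gt0// mulr_gt0.
  have e2 : 0 < e / (2 `^ p * 2) / (2 `^ p * 2) by rewrite divr_gt0// mulr_gt0.
  have [w1 s1 h1] := hs N.+1%:Z (v N.+1%:Z) _ e1.
  have [w2 s2 h2] := hs (- N.+1%:Z) (v (- N.+1%:Z)) _ e2.
  have [w3 s3 h3] := IH _ e2.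
  exists (fun n => w1 n + (w2 n + w3 n)); first by do 2 apply: tspanD => //.
  have := pbdD p0 h1 (pbdD p0 h2 h3).
  rewrite (_ : (fun n => _ + (_ + _)) = (fun n => trunc N.+1 v n - (w1 n + (w2 n + w3 n)))); last first.
    by apply/funext => n; rewrite truncS; ring.
  apply: pbd_le; rewrite le_eqVlt; apply/orP; left; apply/eqP; field.
  by rewrite gt_eqF.
move=> v /(lp_spaceP _ _ p0)[C hv] e e0.
pose d := e `^ p / 2 / (2 `^ p * 2).
have d0 : 0 < d by rewrite !divr_gt0 ?mulr_gt0 ?powR_gt0.
have [N0 hN0] := zw_tail (pterm_ge0 p b v) hv d0.
have hr : pbd p b (fun n => v n - trunc N0 v n) d.
  move=> M; apply: le_trans (hN0 _ (filter_uniq (fun n => (N0 < absz n)%N) (zw_uniq M)) _); last first.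
    by move=> n; rewrite mem_filter => /andP[].
  rewrite big_filter [X in _ <= X]big_mkcond/= ler_sum// => n _; rewrite /pterm /trunc.
  case: leqP => [nN|nN]; last by rewrite subr0.
  by rewrite subrr cabs0 powR0 ?gt_eqF// mul0r.
have [w sw hw] := ht N0 v d d0.
exists w => //; apply: (@lp_norm_lt _ _ _ _ (2 `^ p * (d + d))) => //.
  have := pbdD p0 hr hw; congr (pbd _ _ _ _).
  by apply/funext => n; rewrite addrA subrK.
have -> : 2 `^ p * (d + d) = e `^ p / 2 by rewrite /d; field; rewrite gt_eqF.
by rewrite ltr_pdivrMr// ltr_pMr ?powR_gt0// ltr1n.
Qed.

End span.

Section fourier_evaluation.
Variable R : realType.
Implicit Types (u : int -> R[i]) (x C : R).

(** A positive element of [R[i]] is real, so the complex epsilons behind [limn] reduce to the real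
    ones of [clim]. *)
Lemma clim_lim (z : nat -> R[i]^o) (l : R[i]^o) : clim z l -> limn z = l.
Proof.
move=> h; apply: cvg_lim; first exact: norm_hausdorff.
apply/cvgrPdist_le => /= e e0.
have eE : e = (complex.Re e)%:C by rewrite RRe_real// gtr0_real.
have r0 : 0 < complex.Re e by rewrite eE ltcR in e0.
have [N0 h0] := h _ r0; exists N0 => // N hN.
rewrite eE -[`|_|]/((cabs (l - z N))%:C) lecR cabs_distC.
exact: h0.
Qed.

Lemma fourier_ev u C x : ssum u C -> fourier u (\pi_(circle R) x)%qT = ev u x.
Proof.
move=> hu; rewrite fourierE; apply: clim_lim.
apply: (@eq_clim _ 0%N) (csumP (ssum_ev x hu)) => N _.
by rewrite sum_zw.
Qed.

End fourier_evaluation.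

(** * Local Wiener-Levy theorem *)

Section wiener.
Variable R : realType.
Implicit Types (N k : nat) (n m : int) (u a : int -> R[i]) (b B C x y : R) (phi psi : R -> R[i]) (g chi : R -> R).

Lemma sum_zwN (V : nmodType) N (F : int -> V) :
  \sum_(n <- zw N) F (- n) = \sum_(n <- zw N) F n.
Proof.
rewrite -(big_map (fun n : int => - n) xpredT F); apply: perm_big; apply: uniq_perm.
- by rewrite map_inj_uniq ?zw_uniq//; exact: oppr_inj.
- exact: zw_uniq.
by move=> n; rewrite -[n in LHS]opprK mem_map; [rewrite !mem_zw abszN|exact: oppr_inj].
Qed.

Definition adj u : int -> R[i] := fun n => conjc (u (- n)).

Lemma bnd_adj b u C : bnd b u C -> bnd b (adj u) C.
Proof.
move=> hu N; rewrite (le_trans _ (hu N))// -(sum_zwN N (fun n => cabs (u n) * _)).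
by apply: ler_sum => n _; rewrite cabsJ wtN.
Qed.

Lemma ev_adj u C x : ssum u C -> ev (adj u) x = conjc (ev u x).
Proof.
move=> hu; apply: csum_eq; apply: (@eq_clim _ 0%N) (climJ (csumP (ssum_ev x hu))) => N _.
rewrite -(sum_zwN N) rmorph_sum; apply: eq_bigr => n _.
by rewrite [LHS]conjcM /adj -expiN intrN mulNr opprK.
Qed.

(** Membership in the Wiener algebra of weight [wt ^ b], with norm at most B, for a function known
    by its values. *)
Definition wiener b phi B := exists2 a, bnd b a B & forall x, ev a x = phi x.

Lemma wienerD b phi psi B C : 0 <= b -> wiener b phi B -> wiener b psi C ->
  wiener b (fun x => phi x + psi x) (B + C).
Proof.
move=> b0 [a ha ea] [c hc ec]; exists (fun n => a n + c n); first exact: bndD.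
by move=> x; rewrite (evD x (bnd_ssum b0 ha) (bnd_ssum b0 hc)) ea ec.
Qed.

Lemma wienerM b phi psi B C : 0 <= b -> wiener b phi B -> wiener b psi C ->
  wiener b (fun x => phi x * psi x) (B * C).
Proof.
move=> b0 [a ha ea] [c hc ec]; exists (convol a c); first exact: bnd_conv.
by move=> x; rewrite (ev_conv x (bnd_ssum b0 ha) (bnd_ssum b0 hc)) ea ec.
Qed.

Lemma wiener1 b : wiener b (fun=> 1) 1.
Proof.
exists (single 0 1); last by move=> x; rewrite ev_single mul0r expi0 mulr1.
by have := @bnd_single R b 0 1; rewrite cabs1 wt0 powR1 mulr1.
Qed.

Lemma wienerX b phi B k : 0 <= b -> wiener b phi B -> wiener b (fun x => phi x ^+ k) (B ^+ k).
Proof.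
move=> b0 h; elim: k => [|k IH].
  by under eq_fun do rewrite expr0; rewrite expr0; exact: wiener1.
by under eq_fun do rewrite exprS; rewrite exprS; exact: wienerM.
Qed.

Lemma wiener_sum b k (F : nat -> R -> R[i]) : 0 <= b ->
  (forall i, exists B, wiener b (F i) B) -> exists B, wiener b (fun x => \sum_(i < k) F i x) B.
Proof.
move=> b0 hF; elim: k => [|k [B IH]].
  exists 0; exists (fun=> 0).
    by move=> N; rewrite big1// => n _; rewrite cabs0 mul0r.
  move=> x; rewrite big_ord0 (@ev_fin _ _ 0)// big1// => n _.
  by rewrite mul0r.
have [C hC] := hF k; exists (B + C); under eq_fun do rewrite big_ord_recr/=.
exact: wienerD.
Qed.

Lemma wiener_fc b g L M : lipb g L M -> 0 <= b < 1 / 2 -> wiener b (toC g) (Cb b * (M + L)).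
Proof.
move=> hg hb; exists (fc g); first exact: fc_bnd.
by move=> x; rewrite ev_fc//; exists L, M.
Qed.

Lemma lipf_cabs_trunc N u : lipf (fun x => cabs (ev (trunc N u) x)).
Proof.
pose K := \sum_(n <- zw N) cabs (u n) * `|n|%:~R.
have K0 : 0 <= K by rewrite sumr_ge0// => n _; rewrite mulr_ge0 ?cabs_ge0 ?ler0z.
exists (1 + K), (\sum_(n <- zw N) cabs (u n)); split.
- by move=> x k; rewrite ev_period.
- by lra.
- move=> x y; have h z w : cabs (ev (trunc N u) z) - cabs (ev (trunc N u) w) <= (1 + K) * `|z - w|.
    rewrite lerBlDr; set p := ev _ z; set q := ev _ w.
    rewrite -{1}(subrK q p) (le_trans (cabsD _ _))// lerD2r /p /q !ev_trunc -sumrB.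
    rewrite (le_trans (cabs_sum _ _ _))//.
    apply: (@le_trans _ _ (K * `|z - w|)); last by rewrite ler_wpM2r// lerDr.
    rewrite /K mulr_suml ler_sum// => n _; rewrite -mulrBr cabsM -mulrA ler_wpM2l ?cabs_ge0//.
    by rewrite (le_trans (cabs_expi_lip _ _))// -mulrBr normrM intr_norm.
  have h1 := h x y; have := h y x; rewrite distrC => h2.
  by rewrite ler_norml; apply/andP; split; lra.
- move=> x; rewrite ger0_norm ?cabs_ge0// ev_trunc (le_trans (cabs_sum _ _ _))//.
  by apply: ler_sum => n _; rewrite cabsM cabs_expi mulr1.
Qed.

Lemma exprn_dist (s t c : R) k : `|s| <= c -> `|t| <= c ->
  `|s ^+ k.+1 - t ^+ k.+1| <= k.+1%:R * c ^+ k * `|s - t|.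
Proof.
move=> hs ht; have c0 : 0 <= c by rewrite (le_trans _ hs).
elim: k => [|k IH]; first by rewrite !expr1 expr0 !mul1r.
rewrite exprS [t ^+ k.+2]exprS.
have -> : s * s ^+ k.+1 - t * t ^+ k.+1 = s * (s ^+ k.+1 - t ^+ k.+1) + (s - t) * t ^+ k.+1 by ring.
rewrite (le_trans (ler_normD _ _))// !normrM normrX.
have h1 : `|s| * `|s ^+ k.+1 - t ^+ k.+1| <= c * (k.+1%:R * c ^+ k * `|s - t|) by rewrite ler_pM.
have h2 : `|s - t| * `|t| ^+ k.+1 <= `|s - t| * c ^+ k.+1.
  by rewrite ler_wpM2l// ler_pXn2r ?nnegrE.
rewrite (le_trans (lerD h1 h2))// le_eqVlt; apply/orP; left; apply/eqP.
by rewrite -[k.+2%:R]natr1 exprS; ring.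
Qed.

(** The Lipschitz constant of the k-th power grows like k c^k, the rate of the sup norm up to a
    linear factor. Raising an algebra norm of 1 / g to the k-th power would be too lossy for the
    Neumann series. *)
Lemma lipb_invX g L M c k : lipb g L M -> 0 < c -> (forall x, c^-1 <= g x) ->
  lipb (fun x => (g x)^-1 ^+ k) (k.+1%:R * c ^+ k.+1 * L) (c ^+ k).
Proof.
move=> [pg L0 hL hM] c0 gc.
have g0 x : 0 < g x by rewrite (lt_le_trans _ (gc x))// invr_gt0.
have gV x : `|(g x)^-1| <= c.
  by rewrite gtr0_norm ?invr_gt0// -[c]invrK lef_pV2 ?posrE ?invr_gt0.
have hV x y : `|(g x)^-1 - (g y)^-1| <= c ^+ 2 * L * `|x - y|.
  have -> : (g x)^-1 - (g y)^-1 = (g x)^-1 * (g y)^-1 * (g y - g x).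
    by field; rewrite !gt_eqF.
  rewrite !normrM (distrC (g y)) expr2 -[c * c * L * _]mulrA.
  by rewrite ler_pM ?mulr_ge0// ler_pM.
split.
- by move=> x l; rewrite pg.
- by rewrite !mulr_gt0 ?exprn_gt0 ?ltr0n.
- move=> x y; case: k => [|k].
    by rewrite !expr0 subrr normr0 !mulr_ge0 ?(ltW c0) ?(ltW L0).
  rewrite (le_trans (exprn_dist k (gV x) (gV y)))//.
  rewrite (le_trans (ler_wpM2l _ (hV x y))) ?mulr_ge0 ?exprn_ge0 ?(ltW c0)//.
  have -> : k.+1%:R * c ^+ k * (c ^+ 2 * L * `|x - y|) = k.+1%:R * (c ^+ k.+2 * L * `|x - y|).
    by rewrite (_ : c ^+ k.+2 = c ^+ k * c ^+ 2); [ring|rewrite -exprD addn2].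
  rewrite -[X in _ <= X]mulrA -[X in _ <= X]mulrA [c ^+ k.+2 * (_ * _)]mulrA ler_wpM2r//.
    by rewrite mulr_ge0// mulr_ge0 ?exprn_ge0 ?(ltW c0) ?(ltW L0).
  by rewrite ler_nat.
- by move=> x; rewrite normrX lerXn2r ?nnegrE ?(ltW c0).
Qed.

Lemma neumann_partial_sum (p r : R[i]) K : p != 0 ->
  1 - (p - r) * (\sum_(k < K) r ^+ k * p^-1 ^+ k.+1) = r ^+ K * p^-1 ^+ K.
Proof.
move=> p0; elim: K => [|K IH]; first by rewrite big_ord0 mulr0 subr0 !expr0 mulr1.
rewrite big_ord_recr/= mulrDr opprD addrA IH !exprS.
set q := p^-1 ^+ K; set s := r ^+ K.
by field.
Qed.

(** With r c = 1/3, the linear factor K + 1 <= 2 * 2^K turns (1/3)^K into a multiple of (2/3)^K. *)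
Lemma neumann_small (X B r c L e : R) : 0 <= X -> 0 <= B -> r * c = 1 / 3 -> 0 <= c * L -> 0 < e ->
  exists K, X * (r ^+ K * (B * (c ^+ K + K.+1%:R * c ^+ K.+1 * L))) <= e.
Proof.
move=> X0 B0 rc cL e0; have r23 : 0 <= (2 / 3 : R) < 1 by lra.
have [K /(_ K (leqnn K)) hK] := geometric_small (X * B * (1 + 2 * c * L)) r23 e0.
exists K; apply: le_trans hK.
have -> : X * (r ^+ K * (B * (c ^+ K + K.+1%:R * c ^+ K.+1 * L))) =
  X * B * ((r * c) ^+ K * (1 + K.+1%:R * c * L)) by rewrite exprMn exprS; ring.
have E : (2 / 3 : R) ^+ K = (1 / 3) ^+ K * 2 ^+ K by rewrite -exprMn; congr (_ ^+ _); field.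
have -> : X * B * (1 + 2 * c * L) * (2 / 3) ^+ K = X * B * ((1 / 3) ^+ K * (2 ^+ K * (1 + 2 * c * L))).
  by rewrite E; ring.
rewrite rc ler_wpM2l ?mulr_ge0//.
rewrite ler_wpM2l ?exprn_ge0//.
have K2 : K.+1%:R <= 2 * 2 ^+ K :> R.
  by rewrite -natrX -natrM ler_nat mul2n -addnn -addn1 leq_add// ?expn_gt0// ltnW// ltn_expl.
have K1 : 1 <= 2 ^+ K :> R by rewrite -natrX ler1n expn_gt0.
have := ler_wpM2r cL K2; lra.
Qed.

(* Newman's argument: |u^|^2 = P - (P - |u^|^2) with P the
   square modulus of a truncation and the error small in norm; on the support
   of chi the inverse is the Neumann series in 1/max(P, const), whose powers are
   Lipschitz with norms growing like k c^k. *)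
Lemma wiener_levy b u C chi d : 0 <= b < 1 / 2 -> bnd b u C -> lipf chi -> 0 < d ->
  (forall x, chi x != 0 -> d <= cabs (ev u x)) -> tclosure b u (fc chi).
Proof.
move=> hb hu hchi d0 hd; have /andP[b0 b1] := hb.
have C0 := bnd_ge0 hu; have su := bnd_ssum b0 hu.
pose D := d ^+ 2; have D0 : 0 < D by rewrite exprn_gt0.
pose eta := D / (8 * (1 + C)).
have eta0 : 0 < eta by rewrite divr_gt0// mulr_gt0//; lra.
have [N /(_ N (leqnn N)) hN] := trunc_approx hu eta0.
pose uN := trunc N u; have huN : bnd b uN C := bnd_trunc N hu.
pose F x := cabs (ev u x) ^+ 2; pose P x := cabs (ev uN x) ^+ 2.
have evd x : ev (fun n => u n - uN n) x = ev u x - ev uN x.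
  by rewrite (evB x su (bnd_ssum b0 huN)).
have E2 (z : R[i]) : (cabs z ^+ 2)%:C = conjc z * z by rewrite cabs_sqrC mulrC.
pose r := D / 4; have r0 : 0 < r by rewrite divr_gt0.
(* P - F = conj(u^) (uN^ - u^) + conj(uN^ - u^) uN^, and [eta] makes the two products add up to at
   most D / 4. *)
have hR : wiener b (fun x => (P x)%:C - (F x)%:C) r.
  have w1 : wiener b (fun x => - (ev u x - ev uN x)) eta.
    exists (fun n => - (u n - uN n)); first exact: bndN.
    move=> x; rewrite -evd -mulN1r -(evZ _ x (bnd_ssum b0 hN)).
    by congr (ev _ x); apply/funext => n; rewrite mulN1r.
  have w2 : wiener b (fun x => conjc (ev u x)) C.
    by exists (adj u); [exact: bnd_adj|move=> x; exact: ev_adj su].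
  have w3 : wiener b (fun x => conjc (- (ev u x - ev uN x))) eta.
    case: w1 => a ha ea; exists (adj a); first exact: bnd_adj.
    by move=> x; rewrite (ev_adj x (bnd_ssum b0 ha)) ea.
  have w4 : wiener b (ev uN) C by exists uN.
  have [a ha ea] := wienerD b0 (wienerM b0 w2 w1) (wienerM b0 w3 w4).
  exists a.
    apply: bnd_le ha; rewrite /eta /r.
    have -> : C * (D / (8 * (1 + C))) + D / (8 * (1 + C)) * C = (D / 4) * (C / (1 + C)) by field; lra.
    by rewrite ler_piMr ?(ltW r0)// ler_pdivrMr; lra.
  move=> x; rewrite ea /P /F !E2 !(rmorphN, rmorphB) /=; ring.
have Rb x : `|P x - F x| <= r.
  case: hR => a ha ea; have := ev_bound x (bnd_ssum b0 ha).
  by rewrite ea -rmorphB cabsR.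
(* On the support of chi, F >= D and |P - F| <= r = D / 4, so P >= 3 D / 4 = 1 / c; then r c =
   1/3. *)
pose c := 4 / (3 * D); have c0 : 0 < c by rewrite divr_gt0// mulr_gt0.
have cV : c^-1 = 3 * D / 4 by rewrite /c; field; rewrite gt_eqF.
pose Pt x := Num.max (P x) c^-1.
have hP : lipf P.
  have -> : P = fun x => cabs (ev uN x) * cabs (ev uN x) by apply/funext => x; rewrite /P expr2.
  by apply: lipf_mul; exact: lipf_cabs_trunc.
have [L [M hPt]] : lipf Pt by apply: lipf_max => //; exact: lipf_cst.
have Ptc x : c^-1 <= Pt x by rewrite /Pt le_max lexx orbT.
have Pt0 x : 0 < Pt x by rewrite (lt_le_trans _ (Ptc x))// invr_gt0.
have hPtE x : chi x != 0 -> Pt x = P x.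
  move=> /hd h; rewrite /Pt max_l//.
  have : D <= F x by rewrite /F /D ler_pXn2r ?nnegrE ?cabs_ge0// ltW.
  by have := Rb x; rewrite ler_norml cV /r => /andP[]; lra.
have L0 : 0 < L by case: hPt.
pose G k x := (Pt x)^-1 ^+ k.
have hG k : wiener b (toC (G k)) (Cb b * (c ^+ k + k.+1%:R * c ^+ k.+1 * L)).
  by apply: wiener_fc => //; exact: (lipb_invX k hPt c0 Ptc).
have [X hX] := fc_bnd_ex hchi b1.
have X0 := bnd_ge0 hX.
have wchi : wiener b (toC chi) X by exists (fc chi) => // x; rewrite ev_fc.
apply: tclosure_lim => e e0.
have [K hK] : exists K, X * (r ^+ K * (Cb b * (c ^+ K + K.+1%:R * c ^+ K.+1 * L))) <= e.
  apply: neumann_small => //; first by have := Cb_ge1 hb; lra.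
    by rewrite /r /c; field; rewrite gt_eqF.
  by rewrite mulr_ge0 ?(ltW c0) ?(ltW L0).
have [B hS] : exists B, wiener b (fun x => \sum_(k < K) ((P x)%:C - (F x)%:C) ^+ k * toC (G k.+1) x) B.
  apply: (@wiener_sum b K (fun k x => ((P x)%:C - (F x)%:C) ^+ k * toC (G k.+1) x) b0) => k.
  exact: (ex_intro _ _ (wienerM b0 (wienerX k b0 hR) (hG k.+1))).
have w2 : wiener b (fun x => conjc (ev u x)) C.
  by exists (adj u); [exact: bnd_adj|move=> x; exact: ev_adj su].
(* v^ = chi conj(u^) sum_(k < K) (P - F)^k / P^(k+1) on the support of chi. Hence v^ u^ is chi F
   times a partial Neumann series for 1 / F, and it misses chi by chi ((P - F) / P)^K. *)
have [v hv ev_v] := wienerM b0 (wienerM b0 wchi w2) hS.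
exists (convol v u); first exact: tclosure_convol hu hv.
have [s hs ev_s] := wienerM b0 wchi (wienerM b0 (wienerX K b0 hR) (hG K)).
suff <- : s = fun n => fc chi n - convol v u n by apply: bnd_le hs.
have hvu := bnd_conv b0 hv hu.
apply: (ev_inj (bnd_ssum b0 hs) (bnd_ssum b0 (bndB hX hvu))) => x.
rewrite (evB x (bnd_ssum b0 hX) (bnd_ssum b0 hvu)) ev_fc// (ev_conv x (bnd_ssum b0 hv) su).
rewrite ev_s ev_v.
have [chi0|chi0] := eqVneq (chi x) 0; first by rewrite /toC chi0 !mul0r subr0.
have pE := hPtE _ chi0.
have p0 : (Pt x)%:C != 0 by rewrite -(rmorph0 (real_complex R)) (inj_eq (@complexI R)) gt_eqF.
have GE k : toC (G k) x = (Pt x)%:C^-1 ^+ k by rewrite /toC /G rmorphXn fmorphV.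
under eq_bigr do rewrite GE.
rewrite GE -neumann_partial_sum// /toC pE.
set S := \sum_(_ < _) _.
have E : conjc (ev u x) * ev u x = (F x)%:C by rewrite /F E2.
have -> : (chi x)%:C * conjc (ev u x) * S * ev u x = (chi x)%:C * ((conjc (ev u x) * ev u x) * S) by ring.
by rewrite E; ring.
Qed.

End wiener.

(** * The circle and Hausdorff dimension *)

Section circle_topology.
Variable R : realType.
Implicit Types (x y c r : R) (A : set R) (E : set (circle R)).

Lemma mdistE (s t : circle R) : mdist s t = pd (repr s - repr t).
Proof. by []. Qed.

Lemma repr_pi x : exists k : int, repr (\pi_(circle R) x)%qT = x + pi *+ 2 * k%:~R.
Proof.
have : (\pi_(circle R) (repr (\pi_(circle R) x)) = \pi_(circle R) x)%qT by rewrite reprK.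
move/eqP; rewrite eqmodE/= /eqmod2pi => /intrP[m hm]; exists m.
have pi2 : pi *+ 2 != 0 :> R by rewrite gt_eqF// pi2_gt0.
by rewrite [_ * m%:~R]mulrC -hm (divfK pi2) addrC subrK.
Qed.

Lemma mdist_pi x y : mdist (\pi_(circle R) x)%qT (\pi_(circle R) y)%qT = pd (x - y).
Proof.
rewrite mdistE; have [k ->] := repr_pi x; have [l ->] := repr_pi y.
rewrite (_ : _ - _ = x - y + pi *+ 2 * (k - l)%:~R) ?pd_period//.
by rewrite intrB; ring.
Qed.

Definition lift E : set R := [set x | E (\pi_(circle R) x)%qT].

Definition perset A := forall x (k : int), A x -> A (x + pi *+ 2 * k%:~R).

Lemma lift_perset E : perset (lift E).
Proof.
move=> x k; rewrite /lift/=; set s := \pi_(circle R)%qT x; set t := \pi_(circle R)%qT _.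
suff -> : t = s by [].
apply: (@mdist_positivity R (circle R)); rewrite mdist_pi addrAC subrr.
by rewrite pd_period pd0.
Qed.

Lemma lift_repr E (t : circle R) : lift E (repr t) <-> E t.
Proof. by rewrite /lift/= reprK. Qed.

Lemma unif_cont_continuous (g : R -> R) :
  (forall e, 0 < e -> exists2 d, 0 < d & forall x y, `|x - y| <= d -> `|g x - g y| <= e) ->
  continuous g.
Proof.
move=> h x; apply/cvgrPdist_le => e e0; have [d d0 hd] := h _ e0.
near=> y; apply: hd; near: y; exact: (@cvgr_dist_le _ _ _ _ _ id x).
Unshelve. all: by end_near. Qed.

Lemma lip_continuous (g : R -> R) L : 0 < L -> (forall x y, `|g x - g y| <= L * `|x - y|) ->
  continuous g.
Proof.
move=> L0 h; apply: unif_cont_continuous => e e0; exists (e / L); first by rewrite divr_gt0.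
by move=> x y xy; rewrite (le_trans (h x y))// mulrC -ler_pdivlMr.
Qed.

Lemma open_preimage_lt (g : R -> R) r : continuous g -> open [set x | g x < r].
Proof. by move=> cg; apply: (@open_comp _ _ g [set y | y < r]) => [x _|]; [exact: cg|exact: open_lt]. Qed.

Lemma open_preimage_gt (g : R -> R) r : continuous g -> open [set x | r < g x].
Proof. by move=> cg; apply: (@open_comp _ _ g [set y | y > r]) => [x _|]; [exact: cg|exact: open_gt]. Qed.

Lemma pd_continuous c : continuous (fun x => pd (x - c)).
Proof.
apply: (lip_continuous ltr01) => x y; rewrite mul1r (le_trans (pd_lip _ _))//.
by rewrite opprB addrA subrK.
Qed.

Lemma cabs_ev_continuous (a : int -> R[i]) C : ssum a C -> continuous (fun x => cabs (ev a x)).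
Proof.
move=> ha; apply: unif_cont_continuous => e e0; have [d d0 hd] := ev_unif_cont ha e0.
exists d => // x y xy; have h1 := hd _ _ xy.
have h (z w : R[i]) : cabs z - cabs w <= cabs (z - w).
  by rewrite lerBlDr -{1}(subrK w z) cabsD.
have h2 := h (ev a x) (ev a y); have := h (ev a y) (ev a x); rewrite cabs_distC => h3.
by rewrite ler_norml; apply/andP; split; lra.
Qed.

Lemma closed_lift E : closed (lift E) -> closed E.
Proof.
move=> cE; rewrite -(setCK E); apply: open_closedC; rewrite openE => t nEt.
have n1 : (~` lift E) (repr t) by move=> /lift_repr.
have : nbhs (repr t) (~` lift E) by apply: open_nbhs_nbhs; split => //; exact: closed_openC.
move=> /nbhs_ballP [e e0 he]; apply/nbhs_ballP; exists e => // s.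
rewrite ballEmdist/= mdistE => st Es.
have [k hk] := pd_attained (repr t - repr s); rewrite hk in st.
apply: (he (repr s - pi *+ 2 * k%:~R)).
  by rewrite /ball/= opprB addrA addrAC addrC addrA addrC; move: st; congr (`|_| < _); ring.
by rewrite -mulrN -intrN; apply: lift_perset; apply/lift_repr.
Qed.

Lemma lift_closed E : closed E -> closed (lift E).
Proof.
move=> cE; rewrite -(setCK (lift E)); apply: open_closedC; rewrite openE => x nEx.
have : nbhs (\pi_(circle R) x)%qT (~` E) by apply: open_nbhs_nbhs; split => //; exact: closed_openC.
move=> /nbhs_ballP [e e0 he]; apply/nbhs_ballP; exists e => // y.
rewrite /ball/= => xy; apply: he; rewrite ballEmdist/= mdist_pi.
exact: le_lt_trans (pd_norm _) xy.
Qed.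

(** Compactness of one period, the finite subcover being recorded by a bound on its indices. *)
Lemma periodic_cover A (f : nat -> set R) : closed A -> (forall i, open (f i)) ->
  (forall i, perset (f i)) -> perset A -> (forall x, A x -> exists i, f i x) ->
  exists N, forall x, A x -> exists2 i, (i < N)%N & f i x.
Proof.
move=> cA of_ pf pA cov.
have cK : compact (A `&` `[- pi, pi]%classic).
  by rewrite setIC; apply: compact_closedI => //; exact: segment_compact.
move: cK; rewrite compact_cover => /(_ nat setT f (fun i _ => of_ i)).
case=> [x [Ax _]|D' _ hD].
  by have [i fi] := cov _ Ax; exists i.
exists (\max_(i <- finmap.enum_fset D') i).+1 => x Ax.
have [k hk] := circle_lift x; have := hD (x + pi *+ 2 * k%:~R).
case.
  split; first exact: pA.
  by rewrite /= in_itv/= -ler_norml.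
move=> i Di fi; exists i; first by rewrite ltnS; exact: leq_bigmax_seq.
by have := pf i _ (- k) fi; rewrite intrN mulrN addrK.
Qed.

Lemma perset_pd c r : perset [set x | pd (x - c) < r].
Proof. by move=> x k /=; rewrite addrAC pd_period. Qed.

Lemma ev_bounded_below (u : int -> R[i]) C A : ssum u C -> closed A -> perset A ->
  (forall x, A x -> ev u x != 0) -> exists2 d, 0 < d & forall x, A x -> d <= cabs (ev u x).
Proof.
move=> hu cA pA hA.
pose f (i : nat) := [set x | i.+1%:R^-1 < cabs (ev u x)].
have [||||N hN] := @periodic_cover A f cA.
- by move=> i; apply: open_preimage_gt; exact: cabs_ev_continuous hu.
- by move=> i x k; rewrite /f/= ev_period.
- exact: pA.
- move=> x /hA /cabs_gt0 h0; exists (Num.truncn (cabs (ev u x))^-1).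
  rewrite /f/= -[X in _ < X]invrK ltf_pV2 ?posrE ?invr_gt0 ?ltr0n//.
  exact: real_truncnS_gt (num_real _).
exists N.+1%:R^-1; first by rewrite invr_gt0 ltr0n.
move=> x /hN [i iN] /ltW; apply: le_trans.
by rewrite lef_pV2 ?posrE ?ltr0n// ler_nat ltnS ltnW.
Qed.

(** Compactness of the complement of O, which the complements of the sets E i cover. *)
Lemma nested_subset (E : nat -> set R) O : (forall i, closed (E i)) -> (forall i, perset (~` E i)) ->
  (forall i j, (i <= j)%N -> E j `<=` E i) -> open O -> perset (~` O) ->
  (forall x, (forall i, E i x) -> O x) -> exists N, forall i, (N <= i)%N -> E i `<=` O.
Proof.
move=> cE pE dE oO pO h.
have [|||||N hN] := @periodic_cover (~` O) (fun i => ~` E i).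
- exact: open_closedC.
- by move=> i; exact: closed_openC.
- exact: pE.
- exact: pO.
- move=> x Ox; apply: contrapT => hx; apply: Ox; apply: h => i.
  by apply: contrapT => nE; apply: hx; exists i.
exists N => i Ni x Eix; apply: contrapT => /hN [j jN]; apply.
by apply: dE Eix; rewrite (leq_trans (ltnW jN)).
Qed.

Lemma zero_set_closed (u : int -> R[i]) C : ssum u C -> closed (zero_set u).
Proof.
move=> hu; apply: closed_lift.
have -> : lift (zero_set u) = ~` [set x | 0 < cabs (ev u x)].
  apply/seteqP; split => x; rewrite /lift /zero_set/= (fourier_ev _ hu).
    by move=> ->; rewrite cabs0 ltxx.
  by move=> h; apply/eqP; apply: contraPT h => /cabs_gt0 ->.
apply: open_closedC; apply: open_preimage_gt; exact: cabs_ev_continuous hu.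
Qed.

End circle_topology.

(** * Null Hausdorff measure and covers by arcs *)

Section hausdorff_dimension.
Variable R : realType.
Implicit Types (s d r e : R) (E : set (circle R)) (A : set (circle R)).

Lemma diam_ge0 A t : A t -> (0 <= diam A)%E.
Proof.
move=> At; apply: ereal_sup_ubound; exists t => //; exists t => //.
by rewrite mdistxx.
Qed.

Lemma mdist_le_diam A (t1 t2 : circle R) : A t1 -> A t2 -> ((mdist t1 t2)%:E <= diam A)%E.
Proof. by move=> A1 A2; apply: ereal_sup_ubound; exists t1 => //; exists t2. Qed.

Lemma diam_le A r : (forall t1 t2 : circle R, A t1 -> A t2 -> mdist t1 t2 <= r) -> (diam A <= r%:E)%E.
Proof. by move=> h; apply: ge_ereal_sup => _ [s As [t At <-]]; rewrite lee_fin h. Qed.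

Lemma diam_pow_ge0 s A : (0 <= diam_pow s A)%E.
Proof. by rewrite /diam_pow; case: ifP => // _; exact: poweR_ge0. Qed.

Lemma premeasure_ge0 s d E : (0 <= hausdorff_premeasure s d E)%E.
Proof.
apply: le_ereal_inf_tmp => _ [U _ <-]; apply: nneseries_ge0 => n _ _.
exact: diam_pow_ge0.
Qed.

Lemma measure0P s E : hausdorff_measure s E = 0%E <->
  forall d, 0 < d -> hausdorff_premeasure s d E = 0%E.
Proof.
split=> [h d d0|h].
  apply/eqP; rewrite eq_le premeasure_ge0 andbT -h.
  by apply: ereal_sup_ubound; exists d.
rewrite /hausdorff_measure; apply/eqP; rewrite eq_le; apply/andP; split.
  by apply: ge_ereal_sup => _ [d /= d0 <-]; rewrite h.
by rewrite -(h 1 ltr01); apply: ereal_sup_ubound; exists 1 => //=.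
Qed.

Lemma diam_pow_mono s1 s2 A : 0 <= s1 -> s1 <= s2 -> (diam A <= 1)%E ->
  (diam_pow s2 A <= diam_pow s1 A)%E.
Proof.
move=> s0 s12 A1; rewrite /diam_pow; case: ifPn => // /set0P[t At].
have := diam_ge0 At; case: (diam A) A1 => [r| |]//; rewrite !lee_fin => r1 r0.
have [->|rN] := eqVneq r 0.
  have [s20|s2N] := eqVneq s2 0.
    by rewrite s20 in s12 *; have -> : s1 = 0 by lra.
  by rewrite powR0// powR_ge0.
by apply: ger_powR => //; rewrite r1 andbT lt_neqAle eq_sym rN.
Qed.

Lemma measure_mono s1 s2 E : 0 <= s1 -> s1 <= s2 ->
  hausdorff_measure s1 E = 0%E -> hausdorff_measure s2 E = 0%E.
Proof.
move=> s0 s12 /measure0P h; apply/measure0P => d d0.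
apply/eqP; rewrite eq_le premeasure_ge0 andbT.
(* Covers are taken with diameters at most 1, for which a larger exponent only lowers the sum. *)
have m0 : 0 < Num.min d 1 by rewrite lt_min d0 ltr01.
rewrite -(h _ m0); apply: le_ereal_inf_tmp => _ [U [EU hU] <-].
have hd i : (diam (U i) <= d%:E)%E by rewrite (le_trans (hU i))// lee_fin ge_min lexx.
have h1 i : (diam (U i) <= 1)%E by rewrite (le_trans (hU i))// lee_fin ge_min lexx orbT.
apply: (@le_trans _ _ (\sum_(0 <= i <oo) diam_pow s2 (U i))%E).
  by apply: ereal_inf_lbound; exists U.
by apply: lee_nneseries => [i *|i *]; [exact: diam_pow_ge0|exact: diam_pow_mono].
Qed.

Lemma dim_ge0 E : (0 <= hausdorff_dim E)%E.
Proof. by apply: le_ereal_inf_tmp => _ [s [s0 _] <-]; rewrite lee_fin. Qed.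

Lemma dim_le s E : 0 <= s -> hausdorff_measure s E = 0%E -> (hausdorff_dim E <= s%:E)%E.
Proof. by move=> s0 h; apply: ereal_inf_lbound; exists s. Qed.

Lemma dim_lt_measure0 s E : (hausdorff_dim E < s%:E)%E -> hausdorff_measure s E = 0%E.
Proof.
move=> /ereal_inf_lt[_ [s' [s0 hs'] <-]]; rewrite lte_fin => /ltW ss.
exact: measure_mono hs'.
Qed.

(** Each covering set is replaced by an open arc around one of its points. The radius is raised to
    at least tau i > 0, as a set of diameter 0 would give an empty arc; the added total is a
    geometric series. *)
Lemma null_cover s E : 0 < s -> hausdorff_measure s E = 0%E -> forall e d, 0 < e -> 0 < d ->
  exists (c r : nat -> R), [/\ forall i, 0 < r i <= d, forall t, E t -> exists i, pd (repr t - c i) < r i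
    & forall N, \sum_(i < N) r i `^ s <= e].
Proof.
move=> s0 /measure0P h e d e0 d0.
have d4 : 0 < d / 4 by lra.
have P2 : 0 < 2 `^ s :> R by rewrite powR_gt0.
(* The factor 2^s pays for the doubled radius, and 3 = 1 + 2 for the diameters and the series of the
   tau i. *)
pose e' := e / (2 `^ s * 3); have e'0 : 0 < e' by rewrite divr_gt0// mulr_gt0.
have : (hausdorff_premeasure s (d / 4) E < e'%:E)%E by rewrite h// lte_fin.
move=> /ereal_inf_lt[_ [U [EU hU] <-]] hsum.
pose tau i : R := Num.min (d / 4) ((e' / 2 ^+ i) `^ s^-1).
have tau0 i : 0 < tau i by rewrite lt_min d4 powR_gt0// divr_gt0// exprn_gt0.
pose rho i := if U i == set0 then 0 else fine (diam (U i)).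
have rhoE i : diam_pow s (U i) = (rho i `^ s)%:E /\ 0 <= rho i <= d / 4.
  rewrite /diam_pow /rho; case: ifPn => [_|/set0P[t Ut]].
    by rewrite powR0 ?gt_eqF// lexx (ltW d4).
  have := hU i; have := diam_ge0 Ut; case: (diam (U i)) => [q| |]//.
  by rewrite !lee_fin /= => -> ->.
have /choice[c hc] : forall i, exists c : R, U i = set0 \/ exists2 t, U i t & repr t = c.
  move=> i; have [->|/set0P[t Ut]] := eqVneq (U i) set0; first by exists 0; left.
  by exists (repr t); right; exists t.
exists c, (fun i => 2 * Num.max (rho i) (tau i)); split.
- move=> i; have [_ /andP[h0 h1]] := rhoE i; apply/andP; split.
    by rewrite mulr_gt0// lt_max tau0 orbT.
  have : Num.max (rho i) (tau i) <= d / 4 by rewrite ge_max h1 /tau ge_min lexx.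
  lra.
- move=> t /EU[i _ Ut]; exists i; have [U0|[t' Ut' <-]] := hc i; first by move: Ut; rewrite U0.
  have [_ /andP[h0 h1]] := rhoE i.
  have : mdist t t' <= rho i.
    rewrite -lee_fin /rho ifF; last by apply/negbTE/set0P; exists t.
    rewrite fineK; first exact: mdist_le_diam.
    by rewrite ge0_fin_numE ?(diam_ge0 Ut)// (le_lt_trans (hU i) (ltry _)).
  rewrite mdistE => ht.
  have h2 : rho i <= Num.max (rho i) (tau i) by rewrite le_max lexx.
  have h3 : tau i <= Num.max (rho i) (tau i) by rewrite le_max lexx orbT.
  by have := tau0 i; lra.
- move=> N; apply: (@le_trans _ _ (\sum_(i < N) 2 `^ s * (rho i `^ s + e' / 2 ^+ i))).
    apply: ler_sum => i _; have [_ /andP[h0 _]] := rhoE i.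
    rewrite powRM// ?le_max ?h0// ler_wpM2l ?powR_ge0//.
    have ht : tau i `^ s <= e' / 2 ^+ i.
      apply: (@le_trans _ _ (((e' / 2 ^+ i) `^ s^-1) `^ s)).
        by rewrite ge0_ler_powR ?nnegrE ?(ltW s0) ?powR_ge0 ?(ltW (tau0 i))// /tau ge_min lexx orbT.
      by rewrite -powRrM mulVf ?gt_eqF// powRr1// divr_ge0 ?(ltW e'0) ?exprn_ge0.
    rewrite maxEle; case: ifP => _.
      by rewrite (le_trans ht)// lerDr powR_ge0.
    by rewrite lerDl divr_ge0 ?(ltW e'0) ?exprn_ge0.
  rewrite -mulr_sumr big_split/=.
  have h1 : \sum_(i < N) rho i `^ s <= e'.
    rewrite -lee_fin -sumEFin (le_trans _ (ltW hsum))//.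
    under eq_bigr do rewrite -(proj1 (rhoE _)).
    rewrite -(big_mkord xpredT (fun i => diam_pow s (U i))).
    by apply: nneseries_lim_ge => i _ _; exact: diam_pow_ge0.
  have h2 : \sum_(i < N) e' / 2 ^+ i <= 2 * e'.
    have -> : \sum_(i < N) e' / 2 ^+ i = 2 * e' - 2 * e' / 2 ^+ N.
      elim: (N) => [|N' IH]; first by rewrite big_ord0 expr0 divr1 subrr.
      by rewrite big_ord_recr/= IH exprS; field; rewrite expf_neq0.
    by rewrite gerBl divr_ge0 ?exprn_ge0//; apply: mulr_ge0 => //; exact: ltW.
  apply: (@le_trans _ _ (2 `^ s * (e' + 2 * e'))); first by rewrite ler_wpM2l ?(ltW P2)// lerD.
  by rewrite /e' le_eqVlt; apply/orP; left; apply/eqP; field; rewrite gt_eqF.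
Qed.

Lemma measure0_of_covers s E : 0 < s ->
  (forall e d, 0 < e -> 0 < d -> exists (n : nat) (c r : nat -> R),
     [/\ forall i, 0 < r i <= d, forall t, E t -> exists2 i, (i < n)%N & pd (repr t - c i) <= r i &
       \sum_(0 <= i < n) r i `^ s <= e]) -> hausdorff_measure s E = 0%E.
Proof.
move=> s0 h; apply/measure0P => d d0; apply/eqP; rewrite eq_le premeasure_ge0 andbT.
apply/lee_addgt0Pr => e e0; rewrite add0e.
have P2 : 0 < 2 `^ s :> R by rewrite powR_gt0.
have d2 : 0 < d / 2 by lra.
have e2 : 0 < e / 2 `^ s by rewrite divr_gt0.
have [n [c [r [r0d cov hn]]]] := h _ _ e2 d2.
have r0 i : 0 < r i by case/andP: (r0d i).
pose U i : set (circle R) := if (i < n)%N then [set t | pd (repr t - c i) <= r i] else set0.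
have hU i : (diam (U i) <= (2 * r i)%:E)%E.
  apply: diam_le => t t'; rewrite /U; case: ifP => // _ /= h1 h2.
  rewrite mdistE (_ : repr t - repr t' = (repr t - c i) - (repr t' - c i)); last by ring.
  by rewrite (le_trans (pdD _ _))// pdN; lra.
apply: (@le_trans _ _ (\sum_(0 <= i <oo) diam_pow s (U i))%E).
  apply: ereal_inf_lbound; exists U => //; split.
    by move=> t /cov[i ni ht]; exists i => //; rewrite /U ni.
  by move=> i; rewrite (le_trans (hU i))// lee_fin; have := r0d i; lra.
rewrite (@nneseries_split _ _ 0 n); last by move=> i _; exact: diam_pow_ge0.
rewrite add0n [X in (_ + X)%E]eseries0 ?adde0; last first.
  by move=> i ni _; rewrite /diam_pow /U ltnNge ni/= eqxx.
apply: (@le_trans _ _ (\sum_(0 <= i < n) ((2 * r i) `^ s)%:E)%E).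
  apply: lee_sum => i _; rewrite /diam_pow; case: ifPn => [_|/set0P[t Ut]].
    by rewrite lee_fin powR_ge0.
  have := hU i; have := diam_ge0 Ut; case: (diam (U i)) => [q| |]//.
  rewrite poweR_EFin !lee_fin => q0 qr.
  by rewrite ge0_ler_powR ?nnegrE ?(ltW s0)// (le_trans q0).
rewrite sumEFin lee_fin; under eq_bigr do rewrite powRM ?(ltW (r0 _))//.
by rewrite -mulr_sumr mulrC -ler_pdivlMr.
Qed.

End hausdorff_dimension.

(** * Sets of small capacity *)

Section capacity.
Variable R : realType.
Implicit Types (N i j m n J : nat) (x s h e : R) (c r : nat -> R) (g : R -> R).

Lemma two_rate_sum (rho sg X Y : R) (a : nat -> R) J0 : 1 < rho -> 0 <= sg < 1 -> 0 <= X -> 0 <= Y ->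
  (forall j, 0 <= a j) ->
  (forall j, (j <= J0)%N -> a j <= X * rho ^+ j) -> (forall j, (J0 < j)%N -> a j <= Y * sg ^+ j) ->
  forall J, \sum_(j < J) a j <= X * rho ^+ J0.+1 / (rho - 1) + Y * sg ^+ J0.+1 / (1 - sg).
Proof.
move=> rho1 /andP[sg0 sg1] X0 Y0 a0 h1 h2 J.
have r1 : 0 < rho - 1 by rewrite subr_gt0.
have s1 : 0 < 1 - sg by rewrite subr_gt0.
have H1 j : (j <= J0.+1)%N -> \sum_(i < j) a i <= X * (rho ^+ j - 1) / (rho - 1).
  elim: j => [|j IH] jJ; first by rewrite big_ord0 expr0 subrr mulr0 mul0r.
  rewrite big_ord_recr/= (le_trans (lerD (IH (ltnW jJ)) (h1 j jJ)))//.
  rewrite le_eqVlt; apply/orP; left; apply/eqP; rewrite exprS; field; exact: lt0r_neq0.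
have H2 d : \sum_(i < J0.+1 + d) a i <= X * rho ^+ J0.+1 / (rho - 1) +
    Y * (sg ^+ J0.+1 - sg ^+ (J0.+1 + d)) / (1 - sg).
  elim: d => [|d IH].
    rewrite addn0 subrr mulr0 mul0r addr0 (le_trans (H1 _ (leqnn _)))//.
    by rewrite ler_pM2r ?invr_gt0// ler_wpM2l// gerBl.
  rewrite addnS big_ord_recr/= (le_trans (lerD IH (h2 (J0.+1 + d)%N _)))//; first by lia.
  rewrite le_eqVlt; apply/orP; left; apply/eqP; rewrite [sg ^+ (J0.+1 + d).+1]exprS.
  move: (sg ^+ (J0.+1 + d)) (sg ^+ J0.+1) (rho ^+ J0.+1) => P Q S; field.
  by rewrite !lt0r_neq0.
apply: (@le_trans _ _ (\sum_(i < J0.+1 + J) a i)).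
  by rewrite addnC big_split_ord/= lerDl; apply: sumr_ge0.
rewrite (le_trans (H2 J))// lerD2l ler_pM2r ?invr_gt0// ler_wpM2l// gerBl exprn_ge0//.
Qed.

(** Constant of [dyadic_min_sum]: 2 / (2^s - 1) comes from the blocks below the scale 1 / t, and 64
    from those above. *)
Definition Cd s : R := 2 / (2 `^ s - 1) + 64.

Lemma powR2_gt1 s : 0 < s -> 1 < 2 `^ s :> R.
Proof.
move=> s0; have := @gt0_ltr_powR R _ s0 1 2; rewrite powR1 !nnegrE.
by apply => //; rewrite ltr1n. Qed.

Lemma Cd_ge0 s : 0 < s -> 0 <= Cd s.
Proof. by move=> s0; rewrite addr_ge0// divr_ge0// subr_ge0 ltW// powR2_gt1. Qed.

Lemma powR_expr (u s : R) j : 0 <= u -> (u ^+ j) `^ s = (u `^ s) ^+ j.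
Proof.
move=> u0; elim: j => [|j IH]; first by rewrite !expr0 powR1.
by rewrite !exprS powRM ?exprn_ge0// IH.
Qed.

Lemma dyadic_scale (t : R) : 0 < t <= 1 -> exists J, 2 ^+ J <= t^-1 < 2 ^+ J.+1.
Proof.
move=> /andP[t0 t1]; have v1 : 1 <= t^-1 by rewrite invf_ge1.
exists (trunc_log 2 (Num.truncn t^-1)).
have := truncn_itv (ltW (lt_le_trans ltr01 v1)) => /andP[h1 h2].
have T0 : (0 < Num.truncn t^-1)%N by rewrite truncn_gt0.
apply/andP; split.
  by rewrite (le_trans _ h1)// -natrX ler_nat trunc_logP.
by rewrite (lt_le_trans h2)// -natrX ler_nat trunc_log_ltn.
Qed.

(** The terms grow like 2^(sj) t up to 2^j of order 1 / t and decay with ratio 2^s / 4 afterwards;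
    both geometric sums are governed by the crossover, of size t^(1-s). *)
Lemma dyadic_min_sum s (t : R) J : 0 < s < 1 -> 0 < t <= 1 ->
  \sum_(j < J) (2 `^ s) ^+ j * Num.min t (16 / (4 ^+ j * t)) <= Cd s * t `^ (1 - s).
Proof.
move=> /andP[s0 s1] t01; have /andP[t0 t1] := t01.
have r1 := powR2_gt1 s0; set rho := 2 `^ s in r1 *.
have r2 : rho <= 2 by rewrite -[leRHS]powRr1// ler_powR// ?(ltW s1)// ler1n.
have [J0 /andP[h1 h2]] := dyadic_scale t01.
have hr : rho ^+ J0.+1 <= 2 * t `^ (- s).
  have E : t `^ (- s) = (t^-1) `^ s by rewrite -powR_inv1 ?(ltW t0)// -powRrM mulN1r.
  rewrite exprS E ler_pM ?exprn_ge0 ?powR_ge0// /rho -powR_expr//.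
  by rewrite ge0_ler_powR ?nnegrE ?(ltW s0) ?exprn_ge0 ?invr_ge0 ?(ltW t0).
have T : t `^ (1 - s) = t * t `^ (- s).
  by rewrite powRD ?powRr1 ?(ltW t0)// (gt_eqF t0) implybT.
have rg0 : 0 <= rho by rewrite powR_ge0.
have sg01 : 0 <= rho / 4 < 1 by apply/andP; split; [rewrite divr_ge0|rewrite ltr_pdivrMr//; lra].
have a0 j : 0 <= rho ^+ j * Num.min t (16 / (4 ^+ j * t)).
  by rewrite mulr_ge0 ?exprn_ge0// le_min (ltW t0) divr_ge0// mulr_ge0 ?exprn_ge0// ltW.
have Y0 : 0 <= 16 / t by rewrite divr_ge0// ltW.
apply: (le_trans (two_rate_sum (J0 := J0) r1 sg01 (ltW t0) Y0 a0 _ _ J)).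
- by move=> j _; rewrite mulrC ler_wpM2r ?exprn_ge0// ge_min lexx.
- move=> j _; rewrite exprMn exprVn.
  apply: (@le_trans _ _ (rho ^+ j * (16 / (4 ^+ j * t)))).
    by rewrite ler_wpM2l ?exprn_ge0// ge_min lexx orbT.
  rewrite le_eqVlt; apply/orP; left; apply/eqP; field.
  by rewrite expf_neq0// gt_eqF.
have p0 : 0 <= t `^ (- s) by exact: powR_ge0.
have -> : Cd s * t `^ (1 - s) = 2 / (rho - 1) * (t * t `^ (- s)) + 64 * (t * t `^ (- s)).
  by rewrite T /Cd -/rho; ring.
rewrite lerD//.
  rewrite ler_pdivrMr ?subr_gt0// [leRHS](_ : _ = t * (2 * t `^ (- s))); last first.
    by rewrite -/rho; field; rewrite subr_eq0 gt_eqF.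
  by rewrite ler_wpM2l// ltW.
have h4 : (4 ^+ J0.+1)^-1 <= t * t.
  rewrite invf_ple ?posrE ?exprn_gt0 ?mulr_gt0// invfM.
  rewrite (_ : 4 = 2 * 2); last by rewrite -natrM.
  by rewrite exprMn ler_pM ?invr_ge0 ?(ltW t0) ?(ltW h2).
have h5 : (rho / 4) ^+ J0.+1 <= 2 * t `^ (- s) * (t * t).
  by rewrite exprMn exprVn ler_pM ?exprn_ge0 ?invr_ge0 ?exprn_ge0.
rewrite ler_pdivrMr; last by lra.
apply: (@le_trans _ _ (16 / t * (2 * t `^ (- s) * (t * t)))); first by rewrite ler_wpM2l.
rewrite (_ : 16 / t * _ = 32 * (t * t `^ (- s))); last by field; rewrite gt_eqF.
have : 0 <= t * t `^ (- s) by rewrite mulr_ge0// ltW.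
move: (t * _) => P P0; have : P * (1 - rho / 4) >= P * (1 / 2) by rewrite ler_wpM2l//; lra.
lra.
Qed.

Lemma inv_nat_small n c : (forall i, 0 < c i) ->
  exists N1, forall N, (N1 <= N)%N -> (0 < N)%N /\ forall i, (i < n)%N -> (N%:R)^-1 <= c i.
Proof.
move=> c0; elim: n => [|n [N1 h]].
  by exists 1%N => N hN; split.
have [N2 h2] : exists N2 : nat, (c n)^-1 <= N2%:R.
  by exists (Num.truncn (c n)^-1).+1; rewrite ltW// real_truncnS_gt ?num_real.
exists (maxn N1 N2) => N; rewrite geq_max => /andP[hN1 hN2]; have [N0 hi] := h _ hN1.
split=> // i; rewrite ltnS leq_eqVlt => /predU1P[->|]; last exact: hi.
rewrite invf_ple ?posrE ?ltr0n// (le_trans h2)// ler_nat//.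
Qed.

(** Both tents live on arcs of size t, which bounds the mean by a multiple of t; for h < t the slope
    1 / t also bounds the integrand by (h / t)^2. *)
Lemma tent_diff_mean N (c0 t h : R) : (0 < N)%N -> 0 < t <= 1 -> N%:R^-1 <= t -> 0 < h ->
  gmean N (fun x => (tent t (x + h - c0) - tent t (x - c0)) ^+ 2) <= 6 * Num.min t (h ^+ 2 / t).
Proof.
move=> N0 /andP[t0 t1] Nt h0.
have big : gmean N (fun x => (tent t (x + h - c0) - tent t (x - c0)) ^+ 2) <= 6 * t.
  have A d : gmean N (fun x => tent t (x + d - c0)) <= 3 * t.
    apply: (@le_trans _ _ (2 * t + N%:R^-1)); last by lra.
    apply: (gmean_arc (c := c0 - d)) => //; first by lra.
      by move=> x; exact: tent_le1.
    by move=> x hx; rewrite tent0// (_ : x + d - c0 = x - (c0 - d)) ?(ltW hx)//; ring.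
  apply: (@le_trans _ _ (gmean N (fun x => tent t (x + h - c0) + tent t (x + 0 - c0)))).
    apply: gmean_le => x; rewrite addr0.
    have := tent_ge0 t (x + h - c0); have := tent_le1 t (x + h - c0).
    have := tent_ge0 t (x - c0); have := tent_le1 t (x - c0).
    move: (tent _ _) (tent _ _) => u v; nra.
  by rewrite gmeanD; have := A h; have := A 0; lra.
rewrite minEle; case: ifP => // /negbT; rewrite -ltNge => hlt.
have ht : h < t.
  rewrite ltNge; apply/negP => th; move: hlt; rewrite ltNge => /negP; apply.
  by rewrite ler_pdivlMr// expr2 ler_pM// ltW.
have ht0 : 0 < h / t by rewrite divr_gt0.
have -> : (fun x => (tent t (x + h - c0) - tent t (x - c0)) ^+ 2) =
    (fun x => (h / t) ^+ 2 * (((tent t (x + h - c0) - tent t (x - c0)) / (h / t)) ^+ 2)).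
  apply/funext => x; rewrite -exprMn; congr (_ ^+ 2); rewrite mulrC divfK// gt_eqF//.
rewrite gmeanZ; apply: (@le_trans _ _ ((h / t) ^+ 2 * (3 * t + N%:R^-1))).
  rewrite ler_wpM2l ?exprn_ge0 ?(ltW ht0)//.
  apply: (gmean_arc (c := c0)) => //; first by lra.
    move=> x; rewrite -real_normK ?num_real// expr_le1 ?normr_ge0//.
    rewrite normrM normfV (gtr0_norm ht0) ler_pdivrMr// mul1r.
    by rewrite (le_trans (tent_lip _ _ t0))// (_ : x + h - c0 - (x - c0) = h) ?gtr0_norm 1?mulrC//; ring.
  move=> x hx; rewrite !tent0 ?subrr ?mul0r ?expr0n//; first by lra.
  have := pdD (x + h - c0) (- h); rewrite pdN (_ : x + h - c0 + - h = x - c0); last by ring.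
  have := pd_norm h; rewrite gtr0_norm//; lra.
apply: (@le_trans _ _ ((h / t) ^+ 2 * (6 * t))).
  by rewrite ler_wpM2l ?exprn_ge0 ?(ltW ht0)//; lra.
by rewrite le_eqVlt; apply/orP; left; apply/eqP; field; rewrite gt_eqF.
Qed.

(** The two hypotheses on g let the tents be handled one at a time. By Bessel for the translate by
    pi / 2^j, a tent of radius r adds to block j at most a multiple of min(r, 16 / (4^j r)), and
    summing against 2^(sj) gives r^(1-s). *)
Lemma tent_energy n c r g s : 0 < s < 1 -> (forall i, 0 < r i <= 1) -> lipf g ->
  (forall x, g x ^+ 2 <= \sum_(i < n) tent (r i) (x - c i)) ->
  (forall x h, (g (x + h) - g x) ^+ 2 <=
     \sum_(i < n) (tent (r i) (x + h - c i) - tent (r i) (x - c i)) ^+ 2) ->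
  forall N, \sum_(k <- zw N) cabs (fc g k) ^+ 2 * wt k `^ s <=
    (3 + 12 * Cd s) * \sum_(i < n) r i `^ (1 - s).
Proof.
move=> s01 r01 lg hg hd N; have /andP[s0 s1] := s01.
have r0 i : 0 < r i by have /andP[] := r01 i.
have [N1 hN1] := inv_nat_small n r0.
have F0 k : 0 <= cabs (fc g k) ^+ 2 * wt k `^ s by rewrite mulr_ge0 ?exprn_ge0 ?cabs_ge0 ?wtp_ge0.
pose h0 (k : int) : R := cabs (fc g k) ^+ 2 * wt k `^ s.
have zero : h0 0 <= 3 * \sum_(i < n) r i `^ (1 - s).
  rewrite /h0 wt0 powR1 mulr1.
  have /= := @fc_bessel R g (3 * \sum_(i < n) r i `^ (1 - s)) [:: 0] lg isT.
  rewrite big_seq1; apply; exists N1 => M hM; have [M0 hi] := hN1 _ hM.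
  apply: (le_trans (gmean_le M hg)); rewrite gmean_sum mulr_sumr; apply: ler_sum => i _.
  have /andP[ri0 ri1] := r01 i.
  apply: (@le_trans _ _ (3 * r i)); last first.
    by rewrite ler_pM2l// ger1_powR ?r01// gerBl ltW.
  apply: (@le_trans _ _ (2 * r i + M%:R^-1)); last by have := hi i (ltn_ord i); lra.
  apply: (gmean_arc (c := c i)) => //; first by lra.
    by move=> x; exact: tent_le1.
  by move=> x hx; rewrite tent0// ltW.
have block j : \sum_(k <- zw (2 ^ j) | blk j k) h0 k <=
    12 * \sum_(i < n) (2 `^ s) ^+ j * Num.min (r i) (16 / (4 ^+ j * r i)).
  apply: (@le_trans _ _ (\sum_(k <- zw (2 ^ j) | blk j k) cabs (fc g k) ^+ 2 * (2 * (2 `^ s) ^+ j))).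
    apply: ler_sum => k /andP[_ hk]; rewrite ler_wpM2l ?exprn_ge0 ?cabs_ge0//.
    rewrite -powR_expr//; apply: (@le_trans _ _ ((2 * 2 ^+ j) `^ s)).
      rewrite ge0_ler_powR ?nnegrE ?(ltW s0) ?wt_ge0 ?mulr_ge0 ?exprn_ge0//.
      rewrite wtE; have : (absz k)%:R <= 2 ^+ j :> R by rewrite -natrX ler_nat.
      have : 1 <= 2 ^+ j :> R by rewrite exprn_ege1// ler1n.
      lra.
    rewrite powRM ?exprn_ge0// ler_wpM2r ?powR_ge0//.
    by rewrite -[leRHS]powRr1// ler_powR ?ler1n ?(ltW s1).
  rewrite -mulr_suml [leRHS](_ : _ = (6 * \sum_(i < n) Num.min (r i) (16 / (4 ^+ j * r i))) *
      (2 * (2 `^ s) ^+ j)); last first.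
    by rewrite -mulr_sumr; ring.
  rewrite ler_wpM2r ?mulr_ge0 ?exprn_ge0 ?powR_ge0//.
  apply: fc_blk => //; exists N1 => m hm.
  have [M0 hi] : (0 < 2 ^ m)%N /\ forall i, (i < n)%N -> ((2 ^ m)%:R)^-1 <= r i.
    by apply: hN1; rewrite (leq_trans hm)// ltnW// ltn_expl.
  apply: (le_trans (gmean_le _ (fun x => hd x _))); rewrite gmean_sum mulr_sumr.
  apply: ler_sum => i _.
  have p0 : 0 < pi / 2 ^+ j :> R by rewrite divr_gt0 ?pi_gt0 ?exprn_gt0.
  apply: (le_trans (tent_diff_mean (c i) M0 (r01 i) (hi i (ltn_ord i)) p0)).
  rewrite ler_wpM2l// le_min2//; have := r0 i => ri0.
  rewrite invfM mulrA ler_pM2r ?invr_gt0// expr_div_n.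
  rewrite (_ : (2 ^+ j) ^+ 2 = 4 ^+ j :> R); last by rewrite -exprM mulnC exprM -natrX.
  rewrite ler_pM2r ?invr_gt0 ?exprn_gt0//.
  have p4 : pi < 4 :> R by have := @pihalf_lt2 R; lra.
  by have := @pi_ge0 R; nra.
pose G j : R := 12 * \sum_(i < n) (2 `^ s) ^+ j * Num.min (r i) (16 / (4 ^+ j * r i)).
have sumJ J : \sum_(k <- zw (2 ^ J)) h0 k <= h0 0 + \sum_(j < J.+1) G j.
  elim: J => [|J IH].
    by rewrite sum_zw_blk0 big_ord_recr big_ord0/= add0r lerD2l block.
  rewrite sum_zw_blkS big_ord_recr/= addrA lerD//; exact: block.
have [J hJ] : exists J, (N <= 2 ^ J)%N by exists N; rewrite ltnW// ltn_expl.
apply: (@le_trans _ _ (\sum_(k <- zw (2 ^ J)) h0 k)).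
  by apply: ler_sum_zw => // [|k]; [exact: zw_uniq|rewrite mem_zw => /leq_trans ->].
apply: (le_trans (sumJ J)); rewrite mulrDl lerD// /G -mulr_sumr -mulrA ler_pM2l//.
rewrite exchange_big mulr_sumr/=; apply: ler_sum => i _; exact: dyadic_min_sum.
Qed.

(** A difference of maxima is at most the largest difference, whose square is one of the
    summands. *)
Lemma bigmax_diff_sq (I : Type) (u : seq I) (f g : I -> R) :
  (\big[Num.max/0]_(i <- u) f i - \big[Num.max/0]_(i <- u) g i) ^+ 2 <=
    \sum_(i <- u) (f i - g i) ^+ 2.
Proof.
elim: u => [|a u IH]; first by rewrite !big_nil subrr expr0n.
rewrite !big_cons; move: IH.
set P := \big[_/_]_(i <- u) f i; set Q := \big[_/_]_(i <- u) g i; set S := \sum_(i <- u) _ => IH.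
rewrite -(real_normK (num_real (Num.max (f a) P - _))).
apply: (@le_trans _ _ (Num.max `|f a - g a| `|P - Q| ^+ 2)).
  by rewrite ler_pXn2r ?nnegrE ?maxr_dist// le_max normr_ge0.
have h1 := sqr_ge0 (f a - g a); have h2 := sqr_ge0 (P - Q).
rewrite maxEle; case: ifP => _; rewrite real_normK ?num_real//; lra.
Qed.

Lemma bigmax_sq_le (I : Type) (u : seq I) (f : I -> R) : (forall i : I, 0 <= f i <= 1) ->
  0 <= \big[Num.max/0]_(i <- u) f i <= 1 /\ (\big[Num.max/0]_(i <- u) f i) ^+ 2 <= \sum_(i <- u) f i.
Proof.
move=> f01; elim: u => [|a u [/andP[h0 h1] IH]]; first by rewrite !big_nil lexx ler01 expr0n.
rewrite !big_cons; move: IH h0 h1.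
set P := \big[_/_]_(i <- u) f i; set S := \sum_(i <- u) _ => IH h0 h1.
have /andP[a0 a1] := f01 a; have S0 : 0 <= S by apply: sumr_ge0 => i _; case/andP: (f01 i).
split; first by rewrite le_max h0 orbT ge_max h1 a1.
by rewrite maxEle; case: ifP => _; nra.
Qed.

Lemma bigmax_eq1 (I : eqType) (u : seq I) (f : I -> R) (i : I) : (forall j : I, f j <= 1) -> i \in u ->
  f i = 1 -> \big[Num.max/0]_(j <- u) f j = 1.
Proof.
move=> f1 ui fi; apply/eqP; rewrite eq_le; apply/andP; split.
  by elim: u {ui} => [|a u IH]; rewrite ?big_nil// big_cons ge_max f1.
elim: u ui => // a u IH; rewrite inE big_cons le_max => /predU1P[<-|/IH ->]; last by rewrite orbT.
by rewrite fi lexx.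
Qed.

(** A null set has covers by arcs with small sum of r^(1-s), which is the energy cost of the maximum
    of their tents. Open arcs make chi equal to 1 on an open set, and compactness keeps finitely
    many of them. *)
Lemma capacity_zero (E : set (circle R)) s e : closed E -> 0 < s < 1 ->
  hausdorff_measure (1 - s) E = 0%E -> 0 < e ->
  exists (chi : R -> R) (O : set R), [/\ lipf chi, forall x, 0 <= chi x <= 1,
    open O /\ perset (~` O), (lift E `<=` O /\ forall x, O x -> chi x = 1) &
    forall N, \sum_(k <- zw N) cabs (fc chi k) ^+ 2 * wt k `^ s <= e].
Proof.
move=> cE s01 hE e0; have /andP[s0 s1] := s01.
have K0 : 0 < 3 + 12 * Cd s by have := Cd_ge0 s0; lra.
have s10 : 0 < 1 - s by lra.
have eK : 0 < e / (3 + 12 * Cd s) by rewrite divr_gt0.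
have [c [r [r01 cov sumr]]] := null_cover s10 hE eK ltr01.
have r0 i : 0 < r i by have /andP[] := r01 i.
have [n hn] : exists n, forall x, lift E x -> exists2 i, (i < n)%N & [set x | pd (x - c i) < r i] x.
  apply: periodic_cover; first exact: lift_closed.
  - by move=> i; apply: open_preimage_lt; exact: pd_continuous.
  - by move=> i; exact: perset_pd.
  - exact: lift_perset.
  - move=> x /cov[i hi]; exists i => /=.
    have [k hk] := repr_pi x; move: hi; rewrite hk.
    by rewrite (_ : x + pi *+ 2 * k%:~R - c i = x - c i + pi *+ 2 * k%:~R) ?pd_period//; ring.
pose T i x := tent (r i) (x - c i).
pose chi x := \big[Num.max/0]_(i <- iota 0 n) T i x.
have T01 x i : 0 <= T i x <= 1 by rewrite /T tent_ge0 tent_le1.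
have lT i : lipf (T i) by apply: lipf_shift; exact: lipf_tent.
exists chi, (\bigcup_(i in [set i | (i < n)%N]) [set x | pd (x - c i) < r i]); split.
- by apply: lipf_bigmax => i; exact: lT.
- by move=> x; have [] := bigmax_sq_le (iota 0 n) (T01 x).
- split; first by apply: bigcup_open => i _; apply: open_preimage_lt; exact: pd_continuous.
  move=> x k hx [i hi] hk; apply: hx; exists i => //.
  by have := perset_pd (- k) hk; rewrite rmorphN/= mulrN addrK.
- split; first by move=> x /hn[i ni hi]; exists i.
  move=> x [i ni hi]; apply: (bigmax_eq1 (i := i)); [by move=> j; case/andP: (T01 x j)|by rewrite mem_iota|].
  by rewrite /T tent1// ltW.
move=> N; apply: (le_trans (tent_energy (n := n) (c := c) s01 r01 _ _ _ N)).
- by apply: lipf_bigmax => i; exact: lT.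
- by move=> x; rewrite -(big_mkord xpredT (T^~ x)) /index_iota subn0; have [] := bigmax_sq_le (iota 0 n) (T01 x).
- move=> x h; rewrite -(big_mkord xpredT (fun i => (T i (x + h) - T i x) ^+ 2)) /index_iota subn0.
  exact: bigmax_diff_sq.
by rewrite mulrC -ler_pdivlMr.
Qed.

End capacity.

(** * From energy to l^p, and cyclicity for small zero sets *)

Section summability.
Variable R : realType.
Implicit Types (N J : nat) (n : int) (k : R).

Lemma size_zw N : size (zw N) = N.*2.+1.
Proof. by rewrite -sum1_size sum_zw sum1_card card_ord. Qed.

Lemma sum_blk_cst J (x : R) : \sum_(n <- zw (2 ^ J.+1) | blk J.+1 n) x = x * (2 ^+ J.+1).
Proof.
have := sum_zw_blkS J (fun=> x); rewrite !big_const_seq !count_predT !iter_addr_0 !size_zw => h.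
have {}h : x *+ count (blk J.+1) (zw (2 ^ J.+1)) = x *+ (2 ^ J.+1).
  apply: (addrI (x *+ (2 ^ J).*2.+1)); rewrite -h -mulrnDr; congr (x *+ _).
  by rewrite expnS; lia.
by rewrite h -[LHS]mulr_natr natrX.
Qed.

Lemma wt_summable k : 0 < k -> exists C, forall N, \sum_(n <- zw N) wt n `^ (- (1 + k)) <= C.
Proof.
move=> k0; have r1 : 2 `^ (- k) < 1 :> R by rewrite powRN invf_lt1 ?powR_gt0// powR2_gt1.
set r := 2 `^ (- k) in r1; have r0 : 0 <= r by exact: powR_ge0.
have r10 : 0 < 1 - r by lra.
pose h (n : int) : R := wt n `^ (- (1 + k)).
have h0 n : 0 <= h n by exact: wtp_ge0.
have h1 n : h n <= 1.
  by rewrite /h powRN invf_le1 ?wtp_gt0// wtp_ge1//; lra.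
have bl J : \sum_(n <- zw (2 ^ J.+1) | blk J.+1 n) h n <= 2 * r ^+ J.
  apply: (@le_trans _ _ (\sum_(n <- zw (2 ^ J.+1) | blk J.+1 n) (2 ^+ J) `^ (- (1 + k)))).
    apply: ler_sum => n /andP[]; rewrite expnS ltn_pmul2l// => hn _.
    rewrite /h !powRN lef_pV2 ?posrE ?powR_gt0 ?exprn_gt0 ?wt_gt0//.
    rewrite ge0_ler_powR ?nnegrE ?wt_ge0 ?exprn_ge0//; first by lra.
    rewrite wtE -natrX; have : (2 ^ J)%:R <= (absz n)%:R :> R by rewrite ler_nat ltnW.
    by lra.
  rewrite sum_blk_cst powR_expr// opprD powRD ?pnatr_eq0 ?implybT// powR_inv1// -/r.
  rewrite exprMn exprVn exprS.
  by rewrite le_eqVlt; apply/orP; left; apply/eqP; field; rewrite expf_neq0.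
have S J : \sum_(n <- zw (2 ^ J)) h n <= 3 + 2 * (1 - r ^+ J) / (1 - r).
  elim: J => [|J IH].
    rewrite expr0 subrr mulr0 mul0r addr0; apply: (@le_trans _ _ (\sum_(n <- zw (2 ^ 0)) 1)).
      by apply: ler_sum => n _.
    by rewrite big_const_seq count_predT iter_addr_0 size_zw.
  rewrite sum_zw_blkS (le_trans (lerD IH (bl J)))// exprS.
  by rewrite le_eqVlt; apply/orP; left; apply/eqP; field; rewrite gt_eqF.
exists (3 + 2 / (1 - r)) => N.
have NJ : (N <= 2 ^ N)%N by rewrite ltnW// ltn_expl.
apply: (@le_trans _ _ (\sum_(n <- zw (2 ^ N)) h n)).
  by apply: ler_sum_zw => // [|n]; [exact: zw_uniq|rewrite mem_zw => /leq_trans ->].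
rewrite (le_trans (S N))// lerD2l ler_pM2r ?invr_gt0// ler_piMr// lerBlDr lerDl exprn_ge0//.
Qed.

(** If l B <= A^(1-t), then A^t B <= A / l; otherwise A^t is at most a power of l B. The free
    parameter l makes the second sum small at the expense of the first. *)
Lemma young_split (t l A B : R) : 0 < t < 1 -> 0 < l -> 0 <= A -> 0 <= B ->
  A `^ t * B <= A / l + l `^ (t / (1 - t)) * B `^ ((1 - t)^-1).
Proof.
move=> /andP[t0 t1] l0 A0 B0; have t10 : 0 < 1 - t by lra.
have R0 : 0 <= l `^ (t / (1 - t)) * B `^ ((1 - t)^-1) by rewrite mulr_ge0 ?powR_ge0.
have L0 : 0 <= A / l by rewrite divr_ge0// ltW.
have [h|h] := leP (l * B) (A `^ (1 - t)).
  apply: (@le_trans _ _ (A / l)); last by rewrite lerDl.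
  rewrite ler_pdivlMr// -mulrA [B * l]mulrC (le_trans (ler_wpM2l (powR_ge0 _ _) h))//.
  rewrite -powRD; last by rewrite addrCA subrr addr0 oner_eq0.
  by rewrite addrCA subrr addr0 powRr1.
apply: (@le_trans _ _ (l `^ (t / (1 - t)) * B `^ ((1 - t)^-1))); last by rewrite lerDr.
have lB0 : 0 <= l * B by rewrite mulr_ge0// ltW.
have t1N : 1 - t != 0 by rewrite gt_eqF.
have tt0 : 0 <= t / (1 - t) by rewrite divr_ge0 ?(ltW t0) ?(ltW t10).
have hA : A `^ t <= (l * B) `^ (t / (1 - t)).
  rewrite (_ : A `^ t = (A `^ (1 - t)) `^ (t / (1 - t))).
    by rewrite ge0_ler_powR ?nnegrE ?powR_ge0// ltW.
  by rewrite -powRrM mulrC divfK.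
rewrite (le_trans (ler_wpM2r B0 hA))// powRM ?(ltW l0)// -mulrA ler_wpM2l ?powR_ge0//.
rewrite le_eqVlt; apply/orP; left; apply/eqP.
rewrite [X in _ = B `^ X](_ : _ = t / (1 - t) + 1); last by field.
by rewrite powRD ?powRr1// gt_eqF//; lra.
Qed.

(** Hoelder with exponents 2/p and 2/(2-p), in the form of [young_split]. The hypothesis on s says
    that the weight left over has exponent below -1; its sum is finite and l reduces its share to e
    / 2. *)
Lemma energy_pbd (p b s : R) : 1 < p < 2 -> 2 / p - 1 + 2 * b < s ->
  forall e, 0 < e -> exists2 d, 0 < d & forall a : int -> R[i],
    (forall N, \sum_(n <- zw N) cabs (a n) ^+ 2 * wt n `^ s <= d) -> pbd p b a e.
Proof.
move=> /andP[p1 p2] hs e e0.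
have p0 : 0 < p by lra. have p20 : 0 < 2 - p by lra.
pose t := p / 2; have t01 : 0 < t < 1 by rewrite /t; apply/andP; split; lra.
have t10 : 0 < 1 - t by case/andP: t01 => *; lra.
pose x := p * b - s * t.
have hx : x / (1 - t) < - 1.
  rewrite ltr_pdivrMr// /x /t.
  have : (2 / p - 1 + 2 * b) * (p / 2) < s * (p / 2) by rewrite ltr_pM2r// divr_gt0.
  rewrite (_ : (2 / p - 1 + 2 * b) * (p / 2) = 1 - p / 2 + p * b); first by lra.
  by field; rewrite gt_eqF.
pose k := - (x / (1 - t)) - 1; have k0 : 0 < k by rewrite /k; lra.
have [C0 hC0] := wt_summable k0; pose C := C0 + 1.
have C1 : 0 < C by have := hC0 0; rewrite sum_zw0 wt0 powR1 /C; lra.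
have hC N : \sum_(n <- zw N) wt n `^ (- (1 + k)) <= C by have := hC0 N; rewrite /C; lra.
pose u := t / (1 - t); have u0 : 0 < u by rewrite divr_gt0//; case/andP: t01.
have eC : 0 < e / (2 * C) by rewrite divr_gt0// mulr_gt0.
have [l l0 lu] : exists2 l, 0 < l & l `^ u = e / (2 * C).
  exists ((e / (2 * C)) `^ u^-1); first by rewrite powR_gt0.
  by rewrite -powRrM mulVf ?gt_eqF// powRr1// ltW.
exists (l * e / 2); first by rewrite divr_gt0// mulr_gt0.
move=> a ha N.
apply: (@le_trans _ _ (\sum_(n <- zw N) (l^-1 * (cabs (a n) ^+ 2 * wt n `^ s) +
    l `^ u * wt n `^ (- (1 + k))))).
  apply: ler_sum => n _.
  have := @young_split t l (cabs (a n) ^+ 2 * wt n `^ s) (wt n `^ x) t01 l0.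
  rewrite mulr_ge0 ?exprn_ge0 ?cabs_ge0 ?wtp_ge0// => /(_ isT isT).
  rewrite powRM ?exprn_ge0 ?cabs_ge0 ?wtp_ge0// -mulrA -!powRrM.
  rewrite -powRD; last by rewrite (_ : wt n != 0 :> R) ?implybT// gt_eqF ?wt_gt0.
  rewrite -[cabs (a n) ^+ 2](powR_mulrn 2 (cabs_ge0 _)) -powRrM mulrC.
  rewrite (_ : s * t + x = p * b); last by rewrite /x; ring.
  rewrite (_ : 2%:R * t = p); last by rewrite /t; field.
  rewrite (_ : x * (1 - t)^-1 = - (1 + k)); last by rewrite /k; ring.
  by rewrite [wt n `^ _ * _]mulrC powR_mulrn ?cabs_ge0// [_ / l]mulrC.
rewrite big_split/= -!mulr_sumr lu; apply: (@le_trans _ _ (l^-1 * (l * e / 2) + e / (2 * C) * C)).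
  by rewrite lerD// ler_wpM2l// ?invr_ge0 ltW.
rewrite le_eqVlt; apply/orP; left; apply/eqP; field.
by rewrite !gt_eqF.
Qed.

Lemma lift_zero_set (u : int -> R[i]) C x : ssum u C -> lift (zero_set u) x <-> ev u x = 0.
Proof. by move=> hu; rewrite /lift/= /zero_set/= (fourier_ev x hu). Qed.

Theorem cyclic_of_small_dim (p q b : R) (u : int -> R[i]) : 1 < p < 2 -> q = p / (p - 1) ->
  0 < b -> b * q <= 1 -> lp_space 1 b u ->
  (hausdorff_dim (zero_set u) < (2 / q * (1 - b * q))%:E)%E -> cyclic p b u.
Proof.
move=> p12 hq b0 bq hu hdim; have /andP[p1 p2] := p12.
have p0 : 0 < p by lra. have p10 : 0 < p - 1 by lra.
have q2 : 2 < q by rewrite hq ltr_pdivlMr//; lra.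
have b12 : 0 <= b < 1 / 2 by apply/andP; split; [exact: ltW|nra].
have [C hC] := (lp_space1 b u).1 hu; have sC := bnd_ssum (ltW b0) hC.
have hE : 2 / q * (1 - b * q) = 2 - 2 / p - 2 * b.
  by rewrite hq; field; rewrite !gt_eqF.
rewrite hE in hdim; have := dim_ge0 (zero_set u).
have hd x := @dim_lt_measure0 R x (zero_set u).
move: hd hdim; case: (hausdorff_dim _) => [d| |]// hd; rewrite lte_fin lee_fin => dB d0.
(* Midpoint of the dimension and the threshold: the al-measure vanishes, and 1 - al still exceeds
   the exponent that [energy_pbd] asks for. *)
pose al := (d + (2 - 2 / p - 2 * b)) / 2.
have hal : hausdorff_measure al (zero_set u) = 0%E by apply: hd; rewrite lte_fin /al; lra.
have p2i : 1 < 2 / p by rewrite ltr_pdivlMr//; lra.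
have s01 : 0 < 1 - al < 1 by rewrite /al; apply/andP; split; lra.
have hs : 2 / p - 1 + 2 * b < 1 - al by rewrite /al; lra.
apply: cyclic_unit_vector; [exact: ltW|exact: ltW|].
move=> e e0; pose e1 := Num.min 1 (e / (2 * 2 `^ p)).
have P2 : 0 < 2 `^ p :> R by rewrite powR_gt0.
have e2 : 0 < e / (2 * 2 `^ p) by rewrite divr_gt0// mulr_gt0.
have e10 : 0 < e1 by rewrite lt_min ltr01.
have [de de0 hde] := energy_pbd p12 hs e2.
have hal' : hausdorff_measure (1 - (1 - al)) (zero_set u) = 0%E.
  by rewrite (_ : 1 - (1 - al) = al)//; ring.
have [chi [U [lchi chi01 [oO pO] [EO hO] hen]]] :=
  capacity_zero (zero_set_closed sC) s01 hal' de0.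
have [c c0 hc] : exists2 c, 0 < c & forall x, (~` U) x -> c <= cabs (ev u x).
  apply: (ev_bounded_below sC (open_closedC oO) pO) => x Ux; apply/eqP => h; apply: Ux.
  by apply/EO/(lift_zero_set x sC).
(* 1 - chi vanishes on the neighbourhood U of the zero set, and |u^| is bounded below off U. *)
have [w hw bw] : exists2 w, tspan u w & bnd b (fun n => fc (fun x => 1 - chi x) n - w n) e1.
  suff : tclosure b u (fc (fun x => 1 - chi x)) by apply.
  apply: (wiener_levy b12 hC _ c0); first by apply: lipf_sub => //; exact: lipf_cst.
  move=> x hx; apply: hc => Ox; move: hx; rewrite (hO _ Ox) subrr eqxx//.
exists w => //.
have -> : (fun n => single 0 1 n - w n) =
    (fun n => fc chi n + (fc (fun x => 1 - chi x) n - w n)).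
  apply/funext => n; rewrite fcB ?fc_cst//; [|exact: lipf_cst].
  rewrite -[(1 : R)%:C]/(1 : R[i]); ring.
apply: (@pbd_le _ _ _ _ (2 `^ p * (e / (2 * 2 `^ p) + e1))).
  apply: (@le_trans _ _ (2 `^ p * (e / (2 * 2 `^ p) + e / (2 * 2 `^ p)))).
    by rewrite ler_wpM2l ?(ltW P2)// lerD2l ge_min lexx orbT.
  by rewrite le_eqVlt; apply/orP; left; apply/eqP; field; rewrite gt_eqF.
apply: pbdD => //; first exact: hde.
by apply: bnd_pbd => //; [exact: ltW|rewrite ge_min lexx].
Qed.

End summability.

(** * Dual norms *)

Section duality.
Variable R : realType.
Implicit Types (N M L : nat) (n m k : int) (a f v w u : int -> R[i]) (p q b A C e t : R).

(** The norm of f as a functional on l^p_b is at most C, tested on windows so that f itself need not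
    be summable. The pairing is bilinear. *)
Definition dual p b f C := forall N v, pbd p b v 1 -> cabs (\sum_(n <- zw N) f n * v n) <= C.

Lemma pbd_zero p b : 0 < p -> pbd p b (fun=> 0) 0.
Proof. by move=> p0 N; rewrite big1// => n _; rewrite /pterm cabs0 powR0 ?gt_eqF// mul0r. Qed.

Lemma dual_ge0 p b f C : 0 < p -> dual p b f C -> 0 <= C.
Proof.
move=> p0 /(_ 0 (fun=> 0)) h; rewrite (le_trans (cabs_ge0 _) (h _))//.
exact: pbd_le (pbd_zero b p0).
Qed.

Lemma dual_le p b f C D : C <= D -> dual p b f C -> dual p b f D.
Proof. by move=> CD h N v /h/le_trans; apply. Qed.

Lemma dualD p b f g C D : dual p b f C -> dual p b g D -> dual p b (fun n => f n + g n) (C + D).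
Proof.
move=> hf hg N v hv; under eq_bigr do rewrite mulrDl.
by rewrite big_split/= (le_trans (cabsD _ _))// lerD ?hf ?hg.
Qed.

Lemma dual_scaled p b f C t N v : 0 < p -> dual p b f C -> 0 < t -> pbd p b v (t `^ p) ->
  cabs (\sum_(n <- zw N) f n * v n) <= C * t.
Proof.
move=> p0 hf t0 hv; have tN : t%:C != 0 :> R[i] by rewrite fmorph_eq0 gt_eqF.
have h : pbd p b (fun n => (t^-1)%:C * v n) 1.
  apply: pbd_le (pbdZ _ p0 hv); rewrite cabsR gtr0_norm ?invr_gt0//.
  by rewrite -powRM ?invr_ge0 ?(ltW t0)// mulVf ?gt_eqF// powR1.
have := hf N _ h.
rewrite (_ : \sum_(n <- zw N) _ = (t^-1)%:C * \sum_(n <- zw N) f n * v n); last first.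
  by rewrite mulr_sumr; apply: eq_bigr => n _; rewrite mulrCA.
by rewrite cabsM cabsR gtr0_norm ?invr_gt0// mulrC ler_pdivrMr.
Qed.

(** Young's inequality term by term, after dividing f by C, yields Hoelder's inequality for the
    sum. *)
Lemma dual_lq p q b f C : 1 < p -> q = p / (p - 1) -> 0 < C ->
  (forall N, \sum_(n <- zw N) cabs (f n) `^ q * wt n `^ (- (b * q)) <= C `^ q) -> dual p b f C.
Proof.
move=> p1 qE C0 hf N v hv; have p0 : 0 < p by lra.
have q0 : 0 < q by rewrite qE divr_gt0//; lra.
have pq : q^-1 + p^-1 = 1 by rewrite qE; field; rewrite !gt_eqF//; lra.
rewrite (le_trans (cabs_sum _ _ _))//.
apply: (@le_trans _ _ (C * (\sum_(n <- zw N) (C `^ (- q) * (cabs (f n) `^ q * wt n `^ (- (b * q))) / q +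
    pterm p b v n / p)))).
  rewrite mulr_sumr; apply: ler_sum => n _.
  have w0 := @wt_gt0 R n.
  have := @conjugate_powR R (cabs (f n) * wt n `^ (- b) / C) (cabs (v n) * wt n `^ b) q p.
  rewrite !mulr_ge0 ?invr_ge0 ?cabs_ge0 ?wtp_ge0 ?(ltW C0)// => /(_ isT isT q0 p0 pq).
  rewrite -ptermE 2?powRM ?mulr_ge0 ?invr_ge0 ?cabs_ge0 ?wtp_ge0 ?(ltW C0)//.
  rewrite -powR_inv1 ?(ltW C0)// -!powRrM mulN1r mulNr => h.
  rewrite [C `^ (- q) * _]mulrC cabsM; apply: le_trans (ler_wpM2l (ltW C0) h).
  rewrite powR_inv1 ?(ltW C0)// powRN; rewrite le_eqVlt; apply/orP; left; apply/eqP; field.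
  by rewrite !gt_eqF// powR_gt0.
rewrite big_split/= -!mulr_suml -mulr_sumr -[leRHS]mulr1 ler_pM2l// -pq lerD//.
  rewrite ler_piMl ?invr_ge0 ?(ltW q0)// powRN mulrC ler_pdivrMr ?powR_gt0// mul1r; exact: hf.
by rewrite ler_piMl ?invr_ge0 ?(ltW p0)// hv.
Qed.

Lemma sum_zw_shift (V : nmodType) N L m (G : int -> V) : (N + absz m <= L)%N ->
  (forall k, (N < absz (k + m)%R)%N -> G k = 0) ->
  \sum_(k <- zw L) G k = \sum_(n <- zw N) G (n - m).
Proof.
move=> NL hG; rewrite -(big_map (fun n => n - m) xpredT G) (bigID (fun k => k + m \in zw N))/=.
rewrite [X in _ + X]big1 ?addr0; last by move=> k; rewrite mem_zw -ltnNge => /hG.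
rewrite -big_filter; apply: perm_big; apply: uniq_perm.
- by rewrite filter_uniq// zw_uniq.
- by rewrite map_inj_uniq ?zw_uniq// => x y /addIr.
move=> k; rewrite mem_filter; apply/andP/mapP.
  by move=> [h _]; exists (k + m) => //; rewrite addrK.
by move=> [n nN ->]; rewrite subrK; split => //; move: nN; rewrite !mem_zw; lia.
Qed.

Lemma pbd_trunc p b N v C : 0 < p -> pbd p b v C -> pbd p b (trunc N v) C.
Proof.
move=> p0 hv M; apply: le_trans (hv M); apply: ler_sum => n _.
rewrite /pterm ler_wpM2r ?wtp_ge0// /trunc; case: ifP => // _.
by rewrite cabs0 powR0 ?gt_eqF// powR_ge0.
Qed.

Lemma dual_shift p b f C m : 0 < p -> 0 <= b -> dual p b f C ->
  dual p b (fun n => f (n - m)) (C * wt m `^ b).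
Proof.
move=> p0 b0 hf N v hv.
have hv' : pbd p b (fun k => trunc N v (k - - m)) ((wt m `^ b) `^ p).
  apply: pbd_le (pbd_shift (- m) p0 b0 (pbd_trunc N p0 hv)).
  by rewrite mulr1 wtN mulrC powRrM.
have := dual_scaled (N + absz m) p0 hf (wtp_gt0 _ _) hv'.
rewrite (@sum_zw_shift _ N _ m)//; last first.
  by move=> k hk; rewrite opprK /trunc leqNgt hk mulr0.
rewrite (eq_big_seq (fun n => f (n - m) * v n))// => n; rewrite mem_zw opprK subrK => nN.
by rewrite /trunc nN.
Qed.

(** A translate by m costs the factor wt(m)^b in the dual norm, so weighted l^1 acts on the dual by
    convolution. *)
Lemma dual_conv p b a f A B C : 0 < p -> 0 <= b -> bnd b a A -> ssum f B -> dual p b f C ->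
  dual p b (convol a f) (A * C).
Proof.
move=> p0 b0 ha hf hd N v hv; have C0 := dual_ge0 p0 hd.
have sa := bnd_ssum b0 ha.
have hl : clim (fun M => \sum_(n <- zw N) v n * \sum_(m <- zw M) a m * f (n - m))
    (\sum_(n <- zw N) v n * convol a f n).
  apply: clim_sum => n; apply: climMl; exact: csumP (ssum_conv1 n sa hf).
under eq_bigr do rewrite mulrC.
apply: (clim_bound (N1 := 0) hl) => M _.
under eq_bigr do rewrite mulr_sumr.
rewrite exchange_big/= (le_trans (cabs_sum _ _ _))//.
apply: (@le_trans _ _ (\sum_(m <- zw M) cabs (a m) * wt m `^ b * C)); last first.
  by rewrite -mulr_suml ler_wpM2r.
apply: ler_sum => m _.
rewrite (_ : \sum_(n <- zw N) _ = a m * \sum_(n <- zw N) f (n - m) * v n); last first.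
  by rewrite mulr_sumr; apply: eq_bigr => n _; rewrite mulrCA [v n * _]mulrC.
rewrite cabsM -mulrA ler_wpM2l ?cabs_ge0// mulrC.
exact: (dual_shift m p0 b0 hd).
Qed.

Lemma ssum_mul_bounded u f C B : ssum u C -> (forall n, cabs (f n) <= B) ->
  ssum (fun n => u n * f n) (C * B).
Proof.
move=> hu hf N; apply: (@le_trans _ _ (\sum_(n <- zw N) cabs (u n) * B)).
  by apply: ler_sum => n _; rewrite cabsM ler_wpM2l ?cabs_ge0.
by rewrite -mulr_suml ler_wpM2r// (le_trans (cabs_ge0 _) (hf 0)).
Qed.

(** An element w of the span close to the unit vector is fixed first, with an accuracy depending
    only on D and c. It involves finitely many translates, so an f that almost annihilates these is
    enough: |f_0| would be at most c/4 + c/4. *)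
Lemma not_cyclic p b u C D c : 1 <= p -> 0 <= b -> bnd b u C -> 0 < c ->
  (forall M e, 0 < e -> exists f, [/\ exists B, forall n, cabs (f n) <= B, dual p b f D,
     c <= cabs (f 0) & forall k, (absz k <= M)%N -> cabs (csum (fun n => u (n + k) * f n)) <= e]) ->
  ~ cyclic p b u.
Proof.
move=> p1 b0 hu c0 h cyc; have p0 : 0 < p by lra.
have su := bnd_ssum b0 hu.
have sshift k : ssum (fun n => u (n + k)) C by rewrite -[k]opprK; exact: ssum_shift.
have D0 : 0 <= D by have [f [_ hd _ _]] := h 0 1 ltr01; exact: dual_ge0 hd.
have e0 : 0 < c / (4 * (D + 1)) by rewrite divr_gt0// mulr_gt0//; lra.
have s1 : lp_space p b (single 0 1 : int -> R[i]).
  apply/(lp_spaceP _ _ p0); exists 1; apply: bnd_pbd => //.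
  by have := @bnd_single R b 0 1; rewrite cabs1 wt0 powR1 mulr1.
have [w [m [cf [v [hv wE]]]] hw] := cyc _ s1 _ e0.
have {}hw := lt_lp_norm p0 e0 hw.
have /choice[k hk] : forall j, exists k : int, v j = translate u k.
  by move=> j; have [k _ <-] := hv j; exists k.
pose S := \sum_(j < m) cabs (cf j); have S0 : 0 <= S by apply: sumr_ge0 => j _; exact: cabs_ge0.
have et : 0 < c / (4 * (S + 1)) by rewrite divr_gt0// mulr_gt0//; lra.
have [f [[B hB] hd cf0 hf]] := h (\max_(j < m) absz (k j))%N _ et.
have lw : clim (fun N => \sum_(n <- zw N) w n * f n)
    (\sum_(j < m) cf j * csum (fun n => u (n + k j) * f n)).
  apply: (@eq_clim _ 0%N (fun N => \sum_(j < m) cf j * \sum_(n <- zw N) u (n + k j) * f n)).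
    move=> N _; under eq_bigr do rewrite mulr_sumr.
    rewrite exchange_big/=; apply: eq_bigr => n _; rewrite wE mulr_suml.
    by apply: eq_bigr => j _; rewrite hk /translate mulrA.
  apply: clim_sum => j; apply: climMl; apply: csumP; exact: ssum_mul_bounded (sshift _) hB.
have lw2 : clim (fun N => f 0 - \sum_(n <- zw N) w n * f n)
    (f 0 - \sum_(j < m) cf j * csum (fun n => u (n + k j) * f n)).
  by apply: climD; [exact: clim_cst|exact: climN].
have h1 : cabs (f 0 - \sum_(j < m) cf j * csum (fun n => u (n + k j) * f n)) <= D * (c / (4 * (D + 1))).
  apply: (clim_bound (N1 := 0) lw2) => N _.
  rewrite (_ : f 0 - _ = \sum_(n <- zw N) f n * (single 0 1 n - w n)).
    exact: dual_scaled hd e0 hw.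
  under [RHS]eq_bigr do rewrite mulrBr.
  rewrite big_split/= sumrN; congr (_ - _); last by apply: eq_bigr => n _; rewrite mulrC.
  rewrite (bigD1_seq 0) ?zw_uniq ?mem_zw//= /single eqxx mulr1 big1 ?addr0// => n /negbTE ->.
  by rewrite mulr0.
have h2 : cabs (\sum_(j < m) cf j * csum (fun n => u (n + k j) * f n)) <= S * (c / (4 * (S + 1))).
  rewrite (le_trans (cabs_sum _ _ _))// /S mulr_suml; apply: ler_sum => j _.
  rewrite cabsM ler_wpM2l ?cabs_ge0// hf//.
  exact: (leq_bigmax j).
have h3 := cabsD (f 0 - \sum_(j < m) cf j * csum (fun n => u (n + k j) * f n))
  (\sum_(j < m) cf j * csum (fun n => u (n + k j) * f n)).
rewrite subrK in h3.
have q x : 0 <= x -> x * (c / (4 * (x + 1))) <= c / 4.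
  move=> x0; rewrite mulrA ler_pdivrMr ?mulr_gt0//; last by lra.
  by rewrite (_ : c / 4 * (4 * (x + 1)) = x * c + c); [lra|field].
by have := q _ D0; have := q _ S0; lra.
Qed.

End duality.

(** * Frostman measures *)

Section dirichlet_kernel.
Variable R : realType.
Implicit Types (M N l J : nat) (n : int) (x t : R).

(** Doubling the angle at most doubles |e^(ix) - 1|. After J doublings the angle has size in (pi/2,
    pi], where this modulus is at least 1. *)
Lemma expi_sub1_ge x : `|x| <= pi -> `|x| / 4 <= cabs (expi x - 1).
Proof.
have [->|x0] := eqVneq x 0; first by rewrite normr0 mul0r cabs_ge0.
move=> xpi; have xn0 : 0 < `|x| by rewrite normr_gt0.
have p0 := @pi_gt0 R; have p4 : pi < 4 :> R by have := @pihalf_lt2 R; lra.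
have t01 : 0 < `|x| / pi <= 1 by rewrite divr_gt0//= ler_pdivrMr// mul1r.
have [J /andP[h1 h2]] := dyadic_scale t01.
have P0 : 0 < 2 ^+ J :> R by rewrite exprn_gt0.
rewrite invf_div in h1 h2.
have a1 : 2 ^+ J * `|x| <= pi by rewrite -ler_pdivlMr.
have a2 : pi < 2 * (2 ^+ J * `|x|) by rewrite mulrA -exprS -ltr_pdivrMr.
have lip : cabs (expi (2 ^+ J * x) - 1) <= 2 ^+ J * cabs (expi x - 1).
  elim: (J) => [|j IH]; first by rewrite !expr0 !mul1r.
  rewrite exprS -[2 * 2 ^+ j * x]mulrA [2 * (_ * x)]mulr_natl mulr2n expiD.
  rewrite (_ : expi (2 ^+ j * x) * expi (2 ^+ j * x) - 1 =
    (expi (2 ^+ j * x) - 1) * (expi (2 ^+ j * x) + 1)); last by ring.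
  rewrite cabsM; apply: (@le_trans _ _ (2 ^+ j * cabs (expi x - 1) * 2)).
    rewrite ler_pM ?cabs_ge0// (le_trans (cabsD _ _))// cabs_expi cabs1; lra.
  by rewrite le_eqVlt; apply/orP; left; apply/eqP; ring.
have big : 1 <= cabs (expi (2 ^+ J * x) - 1).
  rewrite -(@ler_pXn2r _ 2%N)// ?nnegrE ?cabs_ge0// expr1n.
  have -> : cabs (expi (2 ^+ J * x) - 1) ^+ 2 = 2 - 2 * cos (2 ^+ J * x).
    rewrite cabs_sqr /expi/= subr0; have := cos2Dsin2 (2 ^+ J * x); nra.
  suff : cos (2 ^+ J * x) <= 0 by lra.
  have -> : cos (2 ^+ J * x) = cos `|2 ^+ J * x| by case: ger0P => // _; rewrite cosN.
  rewrite normrM (gtr0_norm P0) (_ : 2 ^+ J * `|x| = (2 ^+ J * `|x| - pi / 2) + pi / 2); last by ring.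
  by rewrite cosDpihalf oppr_le0 sin_ge0_pi//; lra.
rewrite ler_pdivrMr//; apply: (@le_trans _ _ (2 ^+ J * `|x| / 2 ^+ J)).
  by rewrite mulrAC mulfV ?gt_eqF// mul1r.
rewrite ler_pdivrMr//; apply: (le_trans a1); have := le_trans big lip; nra.
Qed.

Lemma pd_expi t : pd t / 4 <= cabs (expi t - 1).
Proof.
have [k hk] := circle_lift t.
rewrite -(pd_period t k) pd_small// (le_trans (expi_sub1_ge hk))//.
by rewrite expi_period.
Qed.

Lemma dirichlet_bound M t : 0 < pd t -> cabs (\sum_(n <- zw M) expi (n%:~R * t)) <= 8 / pd t.
Proof.
move=> t0; have tel : (expi t - 1) * \sum_(n <- zw M) expi (n%:~R * t) =
    expi (M.+1%:R * t) - expi (- (M%:R * t)).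
  elim: M => [|M IH]; first by rewrite sum_zw0 !mul0r mul1r oppr0 expi0 mulr1.
  rewrite sum_zwS !mulrDr IH rmorphN/= !mulNr -[M.+1%:~R]/(M.+1%:R).
  rewrite !mulrBl !mul1r -!expiD.
  rewrite (_ : t + M.+1%:R * t = M.+2%:R * t); last by rewrite -[M.+2%:R]natr1; ring.
  rewrite (_ : t + - (M.+1%:R * t) = - (M%:R * t)); last by rewrite -[M.+1%:R]natr1; ring.
  by ring.
have h : cabs (expi t - 1) * cabs (\sum_(n <- zw M) expi (n%:~R * t)) <= 2.
  by rewrite -cabsM tel (le_trans (cabsB _ _))// !cabs_expi.
rewrite ler_pdivlMr// mulrC.
have := ler_wpM2r (cabs_ge0 (\sum_(n <- zw M) expi (n%:~R * t))) (pd_expi t).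
by move: (cabs (\sum_(n <- _) _)) h => S; lra.
Qed.

(** The bound 8 / pd t is rewritten with indicators of dyadic arcs, so that integrating it against a
    measure only calls for arc masses. *)
Lemma dirichlet_dyadic J t : cabs (\sum_(n <- zw (2 ^ J)) expi (n%:~R * t)) <=
  4 * \sum_(l < J.+1) 2 ^+ l * (pd t <= pi *+ 2 / 2 ^+ l)%R%:R.
Proof.
have pi2 := pi2_gt0 R; have p2 : 2 <= pi :> R by have := @pihalf_ge1 R; lra.
have pdpi : pd t <= pi *+ 2 by rewrite (le_trans (pd_le_pi t))// mulr2n lerDl; lra.
have F0 l : 0 <= 2 ^+ l * (pd t <= pi *+ 2 / 2 ^+ l)%R%:R :> R by rewrite mulr_ge0 ?exprn_ge0.
have one l : (l <= J)%N -> pd t <= pi *+ 2 / 2 ^+ l ->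
    2 ^+ l <= \sum_(l < J.+1) 2 ^+ l * (pd t <= pi *+ 2 / 2 ^+ l)%R%:R :> R.
  move=> lJ hl; rewrite (bigD1 (inord l))//= inordK// hl mulr1 lerDl.
  by apply: sumr_ge0 => i _.
have [hJ|hJ] := leP (pd t) (pi *+ 2 / 2 ^+ J).
  apply: (@le_trans _ _ (4 * 2 ^+ J)); last by rewrite ler_pM2l// one.
  rewrite (le_trans (cabs_sum _ _ _))//; under eq_bigr do rewrite cabs_expi.
  rewrite big_const_seq count_predT iter_addr_0 size_zw -natrX -natrM ler_nat.
  by have := expn_gt0 2 J; lia.
have [l [lJ hl hl1]] : exists l, [/\ (l < J)%N, pd t <= pi *+ 2 / 2 ^+ l & pi *+ 2 / 2 ^+ l.+1 < pd t].
  elim: J hJ {F0 one} => [|j IH] h; first by move: h; rewrite expr0 divr1 ltNge pdpi.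
  have [h'|h'] := leP (pd t) (pi *+ 2 / 2 ^+ j); first by exists j.
  by have [l [lj h1 h2]] := IH h'; exists l; split => //; rewrite ltnW.
have P0 : 0 < 2 ^+ l :> R by rewrite exprn_gt0.
have t0 : 0 < pd t by rewrite (lt_trans _ hl1)// divr_gt0// exprn_gt0.
apply: (@le_trans _ _ (4 * 2 ^+ l)); last by rewrite ler_pM2l// one// ltnW.
rewrite (le_trans (dirichlet_bound _ t0))// ler_pdivrMr//.
rewrite exprS ltr_pdivrMr ?mulr_gt0// mulr2n in hl1; nra.
Qed.

End dirichlet_kernel.

Section frostman.
Variable R : realType.
Implicit Types (l j h d J : nat) (k i : int) (x y : R) (A : R -> Prop) (mu : seq (R * R)).

Definition fl l y : int := Num.floor (y * 2 ^+ l).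

Lemma flP l y i : (fl l y == i) = (i%:~R <= y * 2 ^+ l < (i + 1)%:~R).
Proof. by rewrite eq_sym; apply/eqP/idP => [->|/floor_def <-]//; exact: floor_itv. Qed.

Lemma fl_parent l y k : fl l y = k <-> (fl l.+1 y = 2 * k \/ fl l.+1 y = 2 * k + 1).
Proof.
have P : y * 2 ^+ l.+1 = 2 * (y * 2 ^+ l) by rewrite exprS; ring.
split.
  move/eqP; rewrite flP => /andP[h1 h2].
  rewrite intrD in h2.
  have [h|h] := ltP (2 * (y * 2 ^+ l)) (2 * k%:~R + 1).
    left; apply/eqP; rewrite flP P !intrD intrM; apply/andP; split; lra.
  by right; apply/eqP; rewrite flP P !intrD intrM; apply/andP; split; lra.
case=> /eqP; rewrite flP P !intrD intrM => /andP[h1 h2]; apply/eqP; rewrite flP intrD.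
  by apply/andP; split; lra.
by apply/andP; split; lra.
Qed.

Lemma fl_ancestor j d y y' : fl (j + d) y = fl (j + d) y' -> fl j y = fl j y'.
Proof.
elim: d => [|d IH]; rewrite ?addn0// addnS => h; apply: IH.
by have [/(_ erefl)[h1|h1] _] := fl_parent (j + d) y (fl (j + d) y); apply/esym/fl_parent;
  [left|right]; rewrite -h.
Qed.

(** A finite measure is a list of pairs (weight, point), the point y standing for the angle 2 pi
    y. *)
Definition mass mu (P : pred R) : R := \sum_(z <- mu | P z.2) z.1.

Lemma mass_le mu (P Q : pred R) : (forall z, z \in mu -> 0 <= z.1) -> (forall y, P y -> Q y) ->
  mass mu P <= mass mu Q.
Proof.
move=> h PQ; rewrite /mass [leLHS]big_mkcond [leRHS]big_mkcond/=.
apply: ler_sum_seq => z /h z0; case: ifPn => [/PQ ->//|_]; by case: ifP.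
Qed.

Lemma mass_ge0 mu P : (forall z, z \in mu -> 0 <= z.1) -> 0 <= mass mu P.
Proof.
move=> h; rewrite /mass big_seq_cond; apply: sumr_ge0 => z /andP[zm _]; exact: h.
Qed.

Lemma mass_cat mu nu P : mass (mu ++ nu) P = mass mu P + mass nu P.
Proof. by rewrite /mass big_cat. Qed.

Lemma mass0 mu (P : pred R) : (forall z, z \in mu -> ~~ P z.2) -> mass mu P = 0.
Proof. by move=> h; rewrite /mass big_seq_cond big1// => z /andP[/h/negbTE ->]. Qed.

(* Frostman's measure at a finite depth, built from the leaves of the dyadic
   tree: at each node the mass is cut down to the allowed amount, and [cov]
   collects the topmost nodes whose allowance is attained. *)
Lemma frostman_tree A (rho : R) : 0 <= rho -> forall h j k,
  exists mu (cov : seq (nat * int)),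
   [/\ forall z, z \in mu -> [/\ 0 <= z.1, A z.2 & fl j z.2 = k],
       mass mu xpredT = \sum_(c <- cov) rho ^+ c.1,
       forall y, A y -> fl j y = k -> exists2 c, c \in cov & fl c.1 y = c.2 &
       forall l i, (j <= l <= j + h)%N -> mass mu (fun y => fl l y == i) <= rho ^+ l].
Proof.
move=> rho0; elim=> [|h IH] j k.
  have [[y [Ay yk]]|no] := pselect (exists y, A y /\ fl j y = k).
    exists [:: (rho ^+ j, y)], [:: (j, k)]; split.
    - by move=> z; rewrite inE => /eqP ->; split=> //=; exact: exprn_ge0.
    - by rewrite /mass !big_seq1.
    - by move=> y' _ hy'; exists (j, k) => //; rewrite inE.
    - move=> l i; rewrite addn0 -eqn_leq => /eqP <-; rewrite /mass big_mkcond big_seq1/=.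
      by case: ifP => // _; exact: exprn_ge0.
  exists [::], [::]; split => //; first by rewrite /mass !big_nil.
    by move=> y Ay yk; exfalso; apply: no; exists y.
  by move=> l i _; rewrite /mass big_nil exprn_ge0.
have [m1 [c1 [a1 b1 v1 d1]]] := IH j.+1 (2 * k).
have [m2 [c2 [a2 b2 v2 d2]]] := IH j.+1 (2 * k + 1).
pose mu := m1 ++ m2.
have pos z : z \in mu -> [/\ 0 <= z.1, A z.2 & fl j z.2 = k].
  rewrite mem_cat => /orP[/a1[h0 hA hf]|/a2[h0 hA hf]]; split=> //; apply/fl_parent.
    by left.
  by right.
have pos0 z : z \in mu -> 0 <= z.1 by case/pos.
(* A dyadic interval of level at least j + 1 lies under a single child, so only one of the two
   measures charges it. *)
have big l i : (j.+1 <= l <= j.+1 + h)%N -> mass mu (fun y => fl l y == i) <= rho ^+ l.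
  move=> lj; rewrite mass_cat.
  have [/hasP[z zm /= /eqP hz]|/hasPn no] := boolP (has (fun z => fl l z.2 == i) m1); last first.
      by rewrite (mass0 no) add0r; exact: d2.
  rewrite (@mass0 m2) ?addr0; first exact: d1.
  move=> z' zm'; apply/negP => /eqP hz'.
  have [_ _ e1] := a1 _ zm; have [_ _ e2] := a2 _ zm'.
  have E : l = (j.+1 + (l - j.+1))%N by clear -lj; lia.
  have := @fl_ancestor j.+1 (l - j.+1) z.2 z'.2; rewrite -E hz hz' e1 e2 => /(_ erefl).
  by clear; lia.
have [le|gt] := leP (mass mu xpredT) (rho ^+ j).
  exists mu, (c1 ++ c2); split => //.
  - by rewrite /mass !big_cat -b1 -b2.
  - move=> y Ay /fl_parent[hy|hy].
      by have [c cc hc] := v1 y Ay hy; exists c => //; rewrite mem_cat cc.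
    by have [c cc hc] := v2 y Ay hy; exists c => //; rewrite mem_cat cc orbT.
  - move=> l i /andP[jl lh]; have [E|E] := eqVneq l j.
      by rewrite E (le_trans _ le)// mass_le.
    by apply: big; clear -jl lh E; lia.
have T0 : 0 < mass mu xpredT by rewrite (le_lt_trans _ gt)// exprn_ge0.
pose f := rho ^+ j / mass mu xpredT.
have f0 : 0 <= f by rewrite divr_ge0 ?exprn_ge0// ltW.
have f1 : f <= 1 by rewrite ler_pdivrMr// mul1r ltW.
have scale P : mass [seq (f * z.1, z.2) | z <- mu] P = f * mass mu P.
  by rewrite /mass big_map mulr_sumr.
exists [seq (f * z.1, z.2) | z <- mu], [:: (j, k)]; split.
- by move=> _ /mapP[z /pos[h0 hA hf] ->]; split => //=; exact: mulr_ge0.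
- by rewrite scale big_seq1 /= /f divfK// gt_eqF.
- by move=> y _ hy; exists (j, k) => //; rewrite inE.
- move=> l i /andP[jl lh]; rewrite scale; have [E|E] := eqVneq l j.
    rewrite E; apply: (@le_trans _ _ (f * mass mu xpredT)); last by rewrite /f divfK// gt_eqF.
    by rewrite ler_wpM2l// mass_le.
  have m0 : 0 <= mass mu (fun y => fl l y == i) by apply: mass_ge0.
  apply: (@le_trans _ _ (mass mu (fun y => fl l y == i))); first by rewrite ler_piMl.
  by apply: big; clear -jl lh E; lia.
Qed.

Lemma fl_dist1 l y y' : `|y - y'| <= (2 ^+ l)^-1 ->
  exists2 d : int, d \in [:: -1; 0; 1] & fl l y = fl l y' + d.
Proof.
move=> h; have P0 : 0 < 2 ^+ l :> R by rewrite exprn_gt0.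
have {}h : `|y * 2 ^+ l - y' * 2 ^+ l| <= 1.
  by rewrite -mulrBl normrM (gtr0_norm P0) -ler_pdivlMr// div1r.
exists (fl l y - fl l y'); last by rewrite addrC subrK.
have /andP[] : fl l y' - 1 - 1 < fl l y < fl l y' + 1 + 1; last first.
  by rewrite !inE; move: (fl l y) (fl l y') => a b; clear; lia.
move: h; rewrite ler_norml => /andP[h1 h2].
have := eqxx (fl l y); have := eqxx (fl l y'); rewrite !flP !intrD => /andP[a1 a2] /andP[a3 a4].
by rewrite -!(ltr_int R) !(rmorphB, rmorphD)/=; apply/andP; split; lra.
Qed.

Lemma fl_near l x y : (pd (pi *+ 2 * (x - y)) <= pi *+ 2 / 2 ^+ l)%R -> 0 <= x < 1 -> 0 <= y < 1 ->
  exists2 c : int, c \in [:: -1; 0; 1] & exists2 d : int, d \in [:: -1; 0; 1] &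
    fl l y = fl l (x + c%:~R) + d.
Proof.
have p2 := pi2_gt0 R; have P1 : 1 <= 2 ^+ l :> R by rewrite exprn_ege1// ler1n.
have [k ->] := pd_attained (pi *+ 2 * (x - y)).
rewrite -mulrDr normrM (gtr0_norm p2) ler_pM2l// => h /andP[x0 x1] /andP[y0 y1].
have h1 : `|x - y + k%:~R| <= 1 by rewrite (le_trans h)// invf_le1// (lt_le_trans ltr01).
exists k.
  move: h1; rewrite ler_norml => /andP[h1 h2].
  have /andP[] : -2 < k < 2; last by rewrite !inE; clear; lia.
  by rewrite -!(ltr_int R); apply/andP; split; rewrite -?[(-2)%:~R]/(-2) -?[2%:~R]/2; lra.
by apply: fl_dist1; rewrite distrC (_ : x + k%:~R - y = x - y + k%:~R)//; ring.
Qed.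

(** The factor 9 counts three lifts of x around the circle and, for each, an interval with its two
    neighbours. *)
Lemma mass_ball mu l x (rho : R) : (forall z, z \in mu -> 0 <= z.1 /\ 0 <= z.2 < 1) -> 0 <= x < 1 ->
  (forall i, mass mu (fun y => fl l y == i) <= rho) ->
  mass mu (fun y => pd (pi *+ 2 * (x - y)) <= pi *+ 2 / 2 ^+ l)%R <= 9 * rho.
Proof.
move=> hmu x01 hr.
apply: (@le_trans _ _ (\sum_(c <- [:: -1; 0; 1 : int]) \sum_(d <- [:: -1; 0; 1 : int])
    mass mu (fun y => fl l y == fl l (x + c%:~R) + d))); last first.
  apply: (@le_trans _ _ (\sum_(c <- [:: -1; 0; 1 : int]) \sum_(d <- [:: -1; 0; 1 : int]) rho)).
    by do 2 apply: ler_sum => ? _.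
  by rewrite !big_cons !big_nil; lra.
have -> : \sum_(c <- [:: -1; 0; 1 : int]) \sum_(d <- [:: -1; 0; 1 : int])
      mass mu (fun y => fl l y == fl l (x + c%:~R) + d) =
    \sum_(z <- mu) \sum_(c <- [:: -1; 0; 1 : int]) \sum_(d <- [:: -1; 0; 1 : int])
      if fl l z.2 == fl l (x + c%:~R) + d then z.1 else 0.
  rewrite [RHS]exchange_big/=; apply: eq_bigr => c _; rewrite [RHS]exchange_big/=.
  by apply: eq_bigr => d _; rewrite /mass big_mkcond.
rewrite /mass big_mkcond/=.
apply: ler_sum_seq => z /hmu[z0 z1].
have F0 c d : 0 <= (if fl l z.2 == fl l (x + c%:~R) + d then z.1 else 0) by case: ifP.
case: ifP => [hz|_]; last by apply: sumr_ge0 => c _; apply: sumr_ge0 => d _; case: ifP.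
have [c hc [d hd E]] := fl_near hz x01 z1.
rewrite (big_rem c hc) (big_rem d hd)/= E eqxx -addrA lerDl addr_ge0//; last first.
  by apply: sumr_ge0 => c' _; apply: sumr_ge0 => d' _; case: ifP.
by apply: sumr_ge0 => d' _; case: ifP.
Qed.

(** Fourier-Stieltjes coefficients, with the sign of the exponent for which pairing with u
    integrates u^ against mu. *)
Definition mhat mu (n : int) : R[i] := \sum_(z <- mu) z.1%:C * expi (n%:~R * (pi *+ 2 * z.2)).

Lemma conjc_sum (I : Type) (r : seq I) (F : I -> R[i]) :
  conjc (\sum_(i <- r) F i) = \sum_(i <- r) conjc (F i).
Proof.
elim: r => [|i r IH]; first by rewrite !big_nil conjc0.
by rewrite !big_cons -IH; case: (F i) (\sum_(_ <- _) _) => a b [c d]; rewrite /= opprD.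
Qed.

Lemma mhat_le mu n : (forall z, z \in mu -> 0 <= z.1) -> cabs (mhat mu n) <= mass mu xpredT.
Proof.
move=> h; rewrite (le_trans (cabs_sum _ _ _))// /mass; apply: ler_sum_seq => z /h z0.
by rewrite cabsM cabs_expi mulr1 cabsR ger0_norm.
Qed.

(** The sum of squares is a double integral of the Dirichlet kernel. Its dyadic majorant turns the
    inner integral into arc masses, at most 4 * 2^l * 9 rho^l at level l, and the geometric sum of
    ratio 2 rho > 1 is governed by its last term. *)
Lemma mhat_energy mu J (rho : R) : (forall z, z \in mu -> 0 <= z.1 /\ 0 <= z.2 < 1) ->
  mass mu xpredT <= 1 -> 1 / 2 < rho <= 1 ->
  (forall l i, (l <= J)%N -> mass mu (fun y => fl l y == i) <= rho ^+ l) ->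
  \sum_(n <- zw (2 ^ J)) cabs (mhat mu n) ^+ 2 <= 72 / (2 * rho - 1) * (2 * rho) ^+ J.
Proof.
move=> hmu m1 /andP[r1 r1'] hl; pose D x := \sum_(n <- zw (2 ^ J)) expi (n%:~R * x) : R[i].
have E : (\sum_(n <- zw (2 ^ J)) cabs (mhat mu n) ^+ 2)%:C =
    \sum_(z <- mu) \sum_(z' <- mu) (z.1 * z'.1)%:C * D (pi *+ 2 * (z.2 - z'.2)).
  rewrite rmorph_sum/=.
  under [RHS]eq_bigr => z _ do under eq_bigr => z' _ do rewrite /D mulr_sumr.
  under [RHS]eq_bigr do rewrite exchange_big/=.
  rewrite [RHS]exchange_big/=; apply: eq_bigr => n _.
  rewrite cabs_sqrC {1}/mhat mulr_suml; apply: eq_bigr => z _.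
  rewrite /mhat conjc_sum mulr_sumr; apply: eq_bigr => z' _.
  rewrite conjcM -expiN conjc_real mulrACA -expiD -rmorphM.
  by congr (_ * expi _); ring.
have r0 : 0 < 2 * rho - 1 by lra.
have K0 : 0 <= 72 / (2 * rho - 1) * (2 * rho) ^+ J.
  by rewrite mulr_ge0 ?exprn_ge0 ?divr_ge0//; lra.
have inner z : z \in mu -> \sum_(z' <- mu) z'.1 * cabs (D (pi *+ 2 * (z.2 - z'.2))) <=
    72 / (2 * rho - 1) * (2 * rho) ^+ J.
  move=> /hmu[z0 z1].
  apply: (@le_trans _ _ (\sum_(z' <- mu) \sum_(l < J.+1) 4 * 2 ^+ l * (z'.1 *
      (pd (pi *+ 2 * (z.2 - z'.2)) <= pi *+ 2 / 2 ^+ l)%R%:R))).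
    apply: ler_sum_seq => z' /hmu[z'0 _].
    apply: (le_trans (ler_wpM2l z'0 (dirichlet_dyadic _ _))).
    rewrite le_eqVlt; apply/orP; left; apply/eqP.
    by rewrite !mulr_sumr; apply: eq_bigr => l _; ring.
  rewrite exchange_big/=.
  apply: (@le_trans _ _ (\sum_(l < J.+1) 36 * (2 * rho) ^+ l)).
    apply: ler_sum => l _; rewrite -mulr_sumr exprMn.
    have := mass_ball hmu z1 (fun i => hl l i (ltn_ord l)).
    rewrite /mass big_mkcond/= => h.
    have P0 : 0 <= 2 ^+ l :> R by rewrite exprn_ge0.
    apply: (@le_trans _ _ (4 * 2 ^+ l * (9 * rho ^+ l))); last first.
      by rewrite le_eqVlt; apply/orP; left; apply/eqP; ring.
    rewrite ler_wpM2l ?mulr_ge0//; apply: le_trans h; apply: ler_sum => z' _.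
    by case: ifP => _; rewrite ?mulr1 ?mulr0.
  rewrite -mulr_sumr.
  have -> : \sum_(l < J.+1) (2 * rho) ^+ l = ((2 * rho) ^+ J.+1 - 1) / (2 * rho - 1).
    elim: (J) => [|j IH]; first by rewrite big_ord_recr big_ord0/= expr0 expr1 add0r divff ?gt_eqF.
    by rewrite big_ord_recr/= IH !exprS; field; rewrite gt_eqF.
  rewrite mulrA [leRHS]mulrAC ler_pM2r ?invr_gt0// exprS.
  have : 0 <= (2 * rho) ^+ J by rewrite exprn_ge0//; lra.
  by move: (_ ^+ J) => X X0; nra.
have S0 : 0 <= \sum_(n <- zw (2 ^ J)) cabs (mhat mu n) ^+ 2.
  by apply: sumr_ge0 => n _; rewrite exprn_ge0 ?cabs_ge0.
rewrite -[leLHS](ger0_norm S0) -cabsR E (le_trans (cabs_sum _ _ _))//.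
apply: (@le_trans _ _ (\sum_(z <- mu) z.1 * (72 / (2 * rho - 1) * (2 * rho) ^+ J))).
  apply: ler_sum_seq => z zm; have [z0 _] := hmu z zm.
  rewrite (le_trans (cabs_sum _ _ _))//; apply: le_trans (ler_wpM2l z0 (inner z zm)).
  rewrite mulr_sumr; apply: ler_sum_seq => z' /hmu[z'0 _].
  by rewrite cabsM cabsR ger0_norm ?mulr_ge0// mulrA.
by rewrite -mulr_suml ler_piMl.
Qed.

End frostman.

(** * Frostman measures on large zero sets, and non-cyclicity *)

Section large_zero_set.
Variable R : realType.
Implicit Types (l j J N : nat) (n k : int) (s t e d x y K : R) (E : set (circle R)) (mu : seq (R * R)) (f : int -> R[i]).

(** At every depth the tree gives either mass at least c or a cover of total size below c. If every
    c failed at some depth, there would be covers of arbitrarily small total size. *)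
Lemma frostman E s : 0 < s -> hausdorff_measure s E <> 0%E ->
  exists2 c, 0 < c & forall J, exists mu,
   [/\ forall z, z \in mu -> [/\ 0 <= z.1, 0 <= z.2 < 1 & lift E (pi *+ 2 * z.2)],
       c <= mass mu xpredT, mass mu xpredT <= 1 &
       forall l i, (l <= J)%N -> mass mu (fun y => fl l y == i) <= (2 `^ (- s)) ^+ l].
Proof.
move=> s0 hE; apply: contrapT => no; apply: hE; apply: measure0_of_covers => // e d e0 d0.
have p2 := pi2_gt0 R; have P2 : 0 < (pi *+ 2) `^ s :> R by rewrite powR_gt0.
pose rho : R := 2 `^ (- s); have rho0 : 0 <= rho by exact: powR_ge0.
have rhoE l : rho ^+ l = ((2 ^+ l)^-1) `^ s.
  rewrite /rho -[in RHS]powR_inv1 ?exprn_ge0// -powRrM mulN1r powR_expr//.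
(* The first entry bounds the total after scaling by 2 pi; the second forces each single radius to
   be at most d. *)
pose c := Num.min (e / (pi *+ 2) `^ s) ((d / (pi *+ 2)) `^ s).
have c0 : 0 < c by rewrite lt_min divr_gt0//= powR_gt0// divr_gt0.
pose A y := 0 <= y < 1 /\ lift E (pi *+ 2 * y).
have [cov [hcov csum]] : exists cov : seq (nat * int),
    (forall y, A y -> exists2 c, c \in cov & fl c.1 y = c.2) /\ \sum_(c <- cov) rho ^+ c.1 <= c.
  apply: contrapT => hno; apply: no; exists c => // J.
  have [mu [cov [h1 h2 h3 h4]]] := @frostman_tree R A rho rho0 J 0 0.
  exists mu; split.
  - by move=> z /h1[z0 [z1 z2] _].
  - rewrite leNgt; apply/negP => hc; apply: hno; exists cov; split; last by rewrite -h2 ltW.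
    move=> y Ay; apply: h3 => //; apply/eqP; rewrite flP expr0 mulr1 add0r.
    by case: Ay => -[].
  - have := h4 0%N 0 isT; rewrite expr0; apply: le_trans.
    rewrite le_eqVlt; apply/orP; left; apply/eqP; rewrite /mass big_seq_cond [RHS]big_seq_cond.
    by apply: eq_bigl => z; have [/h1[_ _ ->]|//] := boolP (z \in mu); rewrite eqxx.
  - by move=> l i lJ; apply: h4.
pose c' i := nth (0%N, 0) cov i.
(* Indices beyond the list receive the dummy radius d, which keeps all radii in (0, d]. *)
pose r i : R := if (i < size cov)%N then pi *+ 2 / 2 ^+ (c' i).1 else d.
exists (size cov), (fun i => pi *+ 2 * ((c' i).2%:~R / 2 ^+ (c' i).1)), r; split.
- move=> i; rewrite /r; case: ifP => [ic|_]; last by rewrite d0 lexx.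
  rewrite divr_gt0 ?exprn_gt0//= -ler_pdivlMl// mulrC.
  have : rho ^+ (c' i).1 <= (d / (pi *+ 2)) `^ s.
    apply: (@le_trans _ _ c); last by rewrite ge_min lexx orbT.
    apply: le_trans csum; rewrite (big_nth (0%N, 0)) big_mkord (bigD1 (Ordinal ic))//= lerDl.
    by apply: sumr_ge0 => j _; exact: exprn_ge0.
  rewrite rhoE => h; rewrite leNgt; apply/negP => h'; move: h; rewrite leNgt => /negP; apply.
  by rewrite gt0_ltr_powR ?nnegrE ?invr_ge0 ?exprn_ge0// divr_ge0 ?(ltW d0) ?(ltW p2).
- move=> t Et; pose x := repr t; pose k := Num.floor (x / (pi *+ 2)); pose y := x / (pi *+ 2) - k%:~R.
  have xE : x = pi *+ 2 * y + pi *+ 2 * k%:~R by rewrite /y mulrBr mulrC divfK ?gt_eqF// subrK.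
  have yE : pi *+ 2 * y = x + pi *+ 2 * (- k)%:~R by rewrite xE rmorphN/= mulrN addrK.
  have Ay : A y.
    split; last by rewrite yE; apply: lift_perset; exact/lift_repr.
    have /andP[h1 h2] := floor_itv (x / (pi *+ 2)); rewrite intrD -/k in h1 h2.
    by rewrite /y; apply/andP; split; lra.
  have [c1 /(nthP (0%N, 0))[i ic hi] hc] := hcov y Ay; exists i => //.
  rewrite -/x /r ic /c' hi xE.
  rewrite (_ : _ + _ - _ = pi *+ 2 * (y - c1.2%:~R / 2 ^+ c1.1) + pi *+ 2 * k%:~R); last by ring.
  rewrite pd_period (le_trans (pd_norm _))// normrM (gtr0_norm p2) ler_pM2l//.
  move/eqP: hc; rewrite flP intrD => /andP[h1 h2].
  have P0 : 0 < 2 ^+ c1.1 :> R by rewrite exprn_gt0.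
  rewrite -(@ler_pM2r _ (2 ^+ c1.1))// mulVf ?gt_eqF//.
  rewrite -[X in _ * X <= _](gtr0_norm P0) -normrM mulrBl divfK ?gt_eqF// ger0_norm; lra.
rewrite (eq_big_nat _ _ (F2 := fun i => (pi *+ 2) `^ s * rho ^+ (c' i).1)); last first.
  move=> i /andP[_ ic]; rewrite /r ic powRM ?invr_ge0 ?exprn_ge0 ?(ltW p2)//.
  by rewrite -rhoE.
rewrite -mulr_sumr /c' -(big_nth (0%N, 0) xpredT (fun c => rho ^+ c.1)) mulrC -ler_pdivlMr//.
by rewrite (le_trans csum)// ge_min lexx.
Qed.

(** Since |f| <= 1 and q >= 2, q-th powers are at most squares; block j then contributes a multiple
    of (2 rho 2^(-t))^j, a convergent geometric series whose sum does not depend on J. *)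
Lemma block_dual (q t K rho : R) : 2 <= q -> 0 < t -> 0 <= K -> 0 < rho -> 2 * rho * 2 `^ (- t) < 1 ->
  exists2 C, 0 < C & forall J f, (forall n, cabs (f n) <= 1) ->
   (forall n, (2 ^ J < absz n)%N -> f n = 0) ->
   (forall j, (j <= J)%N -> \sum_(n <- zw (2 ^ j)) cabs (f n) ^+ 2 <= K * (2 * rho) ^+ j) ->
   forall N, \sum_(n <- zw N) cabs (f n) `^ q * wt n `^ (- t) <= C.
Proof.
move=> q2 t0 K0 r0; set sg := 2 * rho * 2 `^ (- t) => sg1.
have sg0 : 0 <= sg by rewrite !mulr_ge0 ?powR_ge0// ltW.
have s10 : 0 < 1 - sg by lra.
have X0 : 0 <= 2 * rho * K / (1 - sg) by rewrite divr_ge0 ?(ltW s10)// !mulr_ge0// ltW.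
exists (3 + 2 * rho * K / (1 - sg)); first by lra.
move=> J f f1 fJ hf N; pose h n : R := cabs (f n) `^ q * wt n `^ (- t).
have h0 n : 0 <= h n by rewrite mulr_ge0 ?powR_ge0.
have w1 n : wt n `^ (- t) <= 1 :> R by rewrite powRN invf_le1 ?wtp_gt0// wtp_ge1// ltW.
have fq n : cabs (f n) `^ q <= cabs (f n) ^+ 2.
  rewrite -powR_mulrn ?cabs_ge0//; have [->|N0] := eqVneq (cabs (f n)) 0.
    by rewrite !powR0 ?gt_eqF//; lra.
  by apply: ger_powR => //; rewrite f1 andbT lt_neqAle eq_sym N0 cabs_ge0.
have h1 n : h n <= 1.
  rewrite -[leRHS]mulr1 ler_pM ?powR_ge0// (le_trans (fq n))// expr_le1 ?cabs_ge0//.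
have bl j : (j.+1 <= J)%N -> \sum_(n <- zw (2 ^ j.+1) | blk j.+1 n) h n <= 2 * rho * K * sg ^+ j.
  move=> jJ; apply: (@le_trans _ _ (\sum_(n <- zw (2 ^ j.+1)) cabs (f n) ^+ 2 * (2 `^ (- t)) ^+ j)).
    rewrite [leLHS]big_mkcond/=; apply: ler_sum => n _; case: ifP => [|_]; last first.
      by rewrite mulr_ge0 ?exprn_ge0 ?cabs_ge0 ?powR_ge0.
    move=> /andP[]; rewrite expnS ltn_pmul2l// => hn _; rewrite ler_pM ?powR_ge0//.
    rewrite -powR_expr// !powRN lef_pV2 ?posrE ?powR_gt0 ?exprn_gt0 ?wt_gt0//.
    rewrite ge0_ler_powR ?nnegrE ?wt_ge0 ?exprn_ge0 ?(ltW t0)//.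
    rewrite wtE -natrX; have : (2 ^ j)%:R <= (absz n)%:R :> R by rewrite ler_nat ltnW.
    by lra.
  rewrite -mulr_suml; apply: (le_trans (ler_wpM2r _ (hf _ jJ))); first by rewrite exprn_ge0 ?powR_ge0.
  by rewrite le_eqVlt; apply/orP; left; apply/eqP; rewrite /sg [in RHS]exprMn exprS; ring.
have S j : (j <= J)%N -> \sum_(n <- zw (2 ^ j)) h n <= 3 + 2 * rho * K * (1 - sg ^+ j) / (1 - sg).
  elim: j => [|j IH] jJ.
    rewrite expr0 subrr mulr0 mul0r addr0; apply: (@le_trans _ _ (\sum_(n <- zw (2 ^ 0)) 1)).
      by apply: ler_sum => n _.
    by rewrite big_const_seq count_predT iter_addr_0 size_zw.
  rewrite sum_zw_blkS (le_trans (lerD (IH (ltnW jJ)) (bl j jJ)))// exprS.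
  by rewrite le_eqVlt; apply/orP; left; apply/eqP; field; rewrite gt_eqF.
apply: (@le_trans _ _ (\sum_(n <- zw (2 ^ J)) h n)); last first.
  rewrite (le_trans (S J _))// lerD2l ler_pM2r ?invr_gt0// ler_piMr ?mulr_ge0 ?(ltW r0)//.
  by rewrite lerBlDr lerDl exprn_ge0.
rewrite -/(h _) (bigID (fun n => absz n <= 2 ^ J)%N)/= [X in _ + X]big1 ?addr0; last first.
  move=> n; rewrite -ltnNge => /fJ ->; rewrite cabs0 powR0 ?mul0r// gt_eqF//; lra.
rewrite -big_filter; apply: ler_sum_zw => //; first by rewrite filter_uniq// zw_uniq.
by move=> n; rewrite mem_filter => /andP[].
Qed.

(** The pairing integrates u^ times a character against mu, whose atoms are zeros of u^. *)
Lemma csum_mhat (u : int -> R[i]) C mu k : ssum u C ->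
  (forall z, z \in mu -> ev u (pi *+ 2 * z.2) = 0) -> csum (fun n => u (n + k) * mhat mu n) = 0.
Proof.
move=> hu hz; have sk : ssum (fun n => u (n - - k)) C by exact: ssum_shift.
apply: csum_eq.
have h : clim (fun N => \sum_(z <- mu) z.1%:C * \sum_(n <- zw N) u (n - - k) * expi (n%:~R * (pi *+ 2 * z.2)))
    (\sum_(z <- mu) z.1%:C * ev (fun n => u (n - - k)) (pi *+ 2 * z.2)).
  by apply: clim_sum => z; apply: climMl; exact: csumP (ssum_ev _ sk).
rewrite big_seq big1 in h; last first.
  by move=> z /hz E; rewrite (ev_shift _ _ hu) E !mulr0.
apply: (@eq_clim _ 0%N _ _ _ _ h) => N _; under eq_bigr do rewrite mulr_sumr.
rewrite exchange_big/=; apply: eq_bigr => n _; rewrite /mhat mulr_sumr; apply: eq_bigr => z _.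
by rewrite opprK; ring.
Qed.

Theorem not_cyclic_of_large_dim (p q b : R) (u : int -> R[i]) : 1 < p < 2 -> q = p / (p - 1) ->
  0 < b -> b * q <= 1 -> lp_space 1 b u ->
  ((1 - b * q)%:E < hausdorff_dim (zero_set u))%E -> ~ cyclic p b u.
Proof.
move=> p12 hq b0 bq hu hdim; have /andP[p1 p2] := p12.
have p0 : 0 < p by lra. have p10 : 0 < p - 1 by lra.
have q2 : 2 < q by rewrite hq ltr_pdivlMr//; lra.
have bq0 : 0 < b * q by rewrite mulr_gt0//; lra.
have [C hC] := (lp_space1 b u).1 hu; have sC := bnd_ssum (ltW b0) hC.
(* An exponent strictly between 1 - b q and the dimension, kept below 1 so that 2 rho > 1. An
   infinite value of the extended-real dimension is treated separately. *)
have [s [s0 s1 s2] hs] : exists2 s, [/\ 0 < s, s < 1 & 1 - b * q < s] &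
    hausdorff_measure s (zero_set u) <> 0%E.
  have hd s := @dim_le R s (zero_set u).
  move: hd hdim; case: (hausdorff_dim _) => [dm| |]// hd; rewrite ?lte_fin => hdim.
    pose s := (1 - b * q + Num.min 1 dm) / 2.
    have m1 : Num.min 1 dm <= 1 by rewrite ge_min lexx.
    have m2 : Num.min 1 dm <= dm by rewrite ge_min lexx orbT.
    have m3 : 1 - b * q < Num.min 1 dm by rewrite lt_min hdim andbT; lra.
    have s0 : 0 < s by rewrite /s; lra.
    exists s; first by split; rewrite /s; lra.
    by move=> /(hd _ (ltW s0)); rewrite lee_fin /s; lra.
  exists (1 - b * q / 2); first by split; lra.
  have h0 : 0 <= 1 - b * q / 2 by lra.
  by move=> /(hd _ h0).
have [c c0 fro] := frostman s0 hs.
pose rho : R := 2 `^ (- s); have rho0 : 0 < rho by rewrite powR_gt0.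
have rE : 2 * rho = 2 `^ (1 - s) by rewrite powRD ?powRr1// pnatr_eq0 implybT.
have rho12 : 1 / 2 < rho <= 1.
  have := @powR2_gt1 R (1 - s); rewrite -rE subr_gt0 => /(_ s1) h.
  apply/andP; split; first by lra.
  by rewrite /rho powRN invf_le1 ?powR_gt0// ltW// powR2_gt1.
have sg1 : 2 * rho * 2 `^ (- (b * q)) < 1.
  rewrite rE -powRD; last by rewrite pnatr_eq0 implybT.
  rewrite (_ : 1 - s - b * q = - (s - (1 - b * q))); last by ring.
  by rewrite powRN invf_lt1 ?powR_gt0// powR2_gt1// subr_gt0.
have K0 : 0 <= 72 / (2 * rho - 1) by case/andP: rho12 => h _; rewrite divr_ge0//; lra.
have [D D0 hD] := block_dual (ltW q2) bq0 K0 rho0 sg1.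
apply: (@not_cyclic R p b u C (D `^ q^-1) c (ltW p1) (ltW b0) hC c0) => M e e0.
have [N0 hN0] := zw_tail (fun n => cabs_ge0 (u n)) sC e0.
(* The mass bounds hold only down to depth J, so the coefficients are cut at 2^J > N0 + M. For |k|
   <= M the part that is cut off meets only the tail of u beyond N0. *)
pose J := (N0 + M)%N.
have [mu [h1 h2 h3 h4]] := fro J.
have mpos z : z \in mu -> 0 <= z.1 by move=> /h1[].
exists (trunc (2 ^ J) (mhat mu)).
have f1 n : cabs (trunc (2 ^ J) (mhat mu) n) <= 1.
  rewrite /trunc; case: ifP => _; last by rewrite cabs0.
  by rewrite (le_trans (mhat_le _ mpos)).
split.
- by exists 1.
- apply: dual_lq hq _ _ => //; first by rewrite powR_gt0.
  move=> N; rewrite -powRrM mulVf ?gt_eqF//; last by lra.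
  rewrite powRr1 ?(ltW D0)//; apply: (hD J) => //.
    by move=> n hn; rewrite /trunc leqNgt hn.
  move=> j jJ; apply: (@le_trans _ _ (\sum_(n <- zw (2 ^ j)) cabs (mhat mu n) ^+ 2)).
    apply: ler_sum => n _; rewrite /trunc; case: ifP => _ //.
    by rewrite cabs0 expr0n/= exprn_ge0 ?cabs_ge0.
  apply: mhat_energy => //; first by move=> z /h1[].
  by move=> l i lj; apply: h4; exact: leq_trans jJ.
- rewrite /trunc/= /mhat (eq_bigr (fun z => z.1%:C)); last by move=> z _; rewrite mul0r expi0 mulr1.
  rewrite -rmorph_sum cabsR ger0_norm; first exact: h2.
  exact: (@mass_ge0 R mu xpredT mpos).
move=> k kM.
have sk : ssum (fun n => u (n + k)) C by rewrite -[k]opprK; exact: ssum_shift.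
have mb n : cabs (mhat mu n) <= 1 by rewrite (le_trans (mhat_le _ mpos)).
pose g n := mhat mu n - trunc (2 ^ J) (mhat mu) n.
have gE n : g n = if (absz n <= 2 ^ J)%N then 0 else mhat mu n.
  by rewrite /g /trunc; case: ifP; rewrite ?subrr ?subr0.
have g1 n : cabs (g n) <= 1 by rewrite gE; case: ifP => // _; rewrite cabs0.
have E : csum (fun n => u (n + k) * trunc (2 ^ J) (mhat mu) n) + csum (fun n => u (n + k) * g n) = 0.
  rewrite -(csumD (ssum_mul_bounded sk f1) (ssum_mul_bounded sk g1)).
  rewrite -[RHS](@csum_mhat u C mu k)//; last first.
    by move=> z /h1[_ _ /(lift_zero_set _ sC)].
  by congr csum; apply/funext => n; rewrite /g; ring.
rewrite (_ : csum _ = - csum (fun n => u (n + k) * g n)); last by apply/eqP; rewrite -addr_eq0 E.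
rewrite cabsN; apply: csum_bound => N.
have NJ : (N0 + M < 2 ^ J)%N by rewrite /J ltn_expl.
apply: (@le_trans _ _ (\sum_(n <- [seq n <- zw N | ~~ (absz n <= 2 ^ J)%N]) cabs (u (n + k)))).
  rewrite big_filter [leRHS]big_mkcond/=; apply: ler_sum => n _; rewrite gE cabsM.
  case: ifP => _; first by rewrite cabs0 mulr0.
  by rewrite ler_piMr ?cabs_ge0.
rewrite -(big_map (fun n => n + k) xpredT (fun n => cabs (u n))); apply: hN0.
  by rewrite map_inj_uniq ?filter_uniq ?zw_uniq// => x y /addIr.
move=> _ /mapP[n + ->]; rewrite mem_filter -ltnNge => /andP[hn _].
by clear -hn kM NJ; lia.
Qed.

End large_zero_set.

(** * Products of bumps with small coefficients *)

Section product_machine.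
Variable R : realType.
Implicit Types (N K : nat) (n m k : int) (f v : int -> R[i]) (g F : R -> R) (p b e x : R) (S : set R).

Lemma pbd_reflect p b v C : pbd p b v C -> pbd p b (fun n => v (- n)) C.
Proof.
move=> h N; rewrite -sum_zwN; apply: le_trans (h N); apply: ler_sum => n _.
by rewrite /pterm opprK wtN.
Qed.

Lemma dual_reflect p b f C : dual p b f C -> dual p b (fun n => f (- n)) C.
Proof.
move=> h N v hv; rewrite -sum_zwN; under eq_bigr do rewrite opprK.
exact: h (pbd_reflect hv).
Qed.

Lemma dual_weight p b b' f C : 0 < p -> b <= b' -> dual p b f C -> dual p b' f C.
Proof.
move=> p0 bb h N v hv; apply: h => M; apply: le_trans (hv M); apply: ler_sum => n _.
by rewrite /pterm ler_wpM2l ?powR_ge0// ler_powR ?wt_ge1// ler_pM2l.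
Qed.

Lemma pbd_single p b c : 0 < p -> cabs c <= 1 -> pbd p b (single 0 c) 1.
Proof.
move=> p0 c1 N; rewrite (bigD1_seq 0) ?zw_uniq ?mem_zw//= big1 ?addr0; last first.
  by move=> n /negbTE n0; rewrite /pterm /single n0 cabs0 powR0 ?mul0r ?gt_eqF.
rewrite /pterm /single eqxx wt0 powR1 mulr1 (_ : 1 = 1 `^ p); last by rewrite powR1.
by rewrite ge0_ler_powR ?nnegrE ?cabs_ge0 ?(ltW p0).
Qed.

Lemma dual_coef0 p b f C : 0 < p -> dual p b f C -> cabs (f 0) <= C.
Proof.
move=> p0 /(_ 0 (single 0 1)); rewrite sum_zw0 /single eqxx mulr1; apply.
by apply: pbd_single; rewrite // cabs1.
Qed.

Lemma dual_single p b : 0 < p -> dual p b (single 0 1) 1.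
Proof.
move=> p0 N v hv; rewrite (bigD1_seq 0) ?zw_uniq ?mem_zw//= big1 ?addr0; last first.
  by move=> n /negbTE n0; rewrite /single n0 mul0r.
rewrite /single eqxx mul1r; have := hv 0; rewrite sum_zw0 /pterm wt0 powR1 mulr1 => h.
rewrite leNgt; apply/negP => h'; move: h; rewrite leNgt => /negP; apply.
by rewrite (_ : 1 = 1 `^ p) ?gt0_ltr_powR ?nnegrE ?cabs_ge0// powR1.
Qed.

(** The coefficients of g are a weighted l^1 sequence convolved with the unit vector. *)
Lemma dual_lipf p b g : 1 <= p -> 0 <= b < 1 / 2 -> lipf g -> exists C, dual p b (fc g) C.
Proof.
move=> p1 /andP[b0 b12] lg; have p0 : 0 < p by lra.
have [A hA] := fc_bnd_ex lg b12.
have h1 : ssum (single 0 1 : int -> R[i]) 1.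
  by move=> N; have := @bnd_single R 0 0 1 N; rewrite cabs1 wt0 powR1 mulr1; apply: le_trans;
    apply: ler_sum => n _; rewrite powRr0 mulr1.
have := dual_conv p0 b0 hA h1 (@dual_single p b p0).
by rewrite -[1 : R[i]]/((1 : R)%:C) -fc_cst -fc_mul// ?mulr1; [|exact: lipf_cst];
  rewrite (_ : (fun x => g x * 1) = g) => [h|]; [exists A|apply/funext => x; rewrite mulr1].
Qed.

Lemma dual_product p b g F A C : 0 < p -> 0 <= b -> lipf g -> lipf F -> bnd b (fc g) A ->
  dual p b (fc (fun x => F x - 1)) C -> dual p b (fc (fun x => g x * F x - g x)) (A * C).
Proof.
move=> p0 b0 lg lF hA hC.
have l1 : lipf (fun x => F x - 1) by apply: lipf_sub => //; exact: lipf_cst.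
have -> : (fun x => g x * F x - g x) = (fun x => g x * (F x - 1)).
  by apply/funext => x; rewrite mulrBr mulr1.
have [B hB] := ssum_fc l1.
rewrite fc_mul//; exact: dual_conv hA hB hC.
Qed.

Lemma csum_reflect f C : ssum f C -> csum (fun n => f (- n)) = csum f.
Proof.
move=> hf; apply: csum_eq; apply: (@eq_clim _ 0%N _ _ _ _ (csumP hf)) => N _.
by rewrite sum_zwN.
Qed.

(** A factor F close to 1 in two dual norms: exponent p for non-cyclicity, and an energy norm of
    exponent 2, depending on the stage, for the dimension. Q records the shape of the set S that
    carries F. *)
Definition machine_step p b (bK : nat -> R) (Q : nat -> set R -> Prop) := forall K e, 0 < e ->
  exists F S, [/\ lipf F, forall x, 0 <= F x, forall x, F x != 0 -> S x, Q K S &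
    dual p b (fc (fun x => F x - 1)) e /\ dual 2 (bK K) (fc (fun x => F x - 1)) e].

(** F_K is chosen after the partial product g_K, small relative to the weighted l^1 norms of its
    coefficients. Each increment g_K (F_K - 1) is then at most 1 / (4 * 2^K) in both norms, and
    these sum to at most 1/2. *)
Lemma machine p b (bK : nat -> R) (Q : nat -> set R -> Prop) : 1 <= p -> 0 <= b < 1 / 2 ->
  (forall K, 0 <= bK K < 1 / 2) -> machine_step p b bK Q ->
  exists (g : nat -> R -> R) (S : nat -> set R),
    [/\ forall K, lipf (g K), forall K x, 0 <= g K x, forall K, Q K (S K),
       forall K x, g K x != 0 -> forall i, (i < K)%N -> S i x &
       (forall K, dual p b (fc (fun x => g K x - 1)) (1 / 2)) /\
       forall b' K0, b' < 1 / 2 -> (forall K, (K0 <= K)%N -> bK K <= b') ->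
         exists C, forall K, (K0 <= K)%N -> dual 2 b' (fc (g K)) C].
Proof.
move=> p1 b01 hbK step; have p0 : 0 < p by lra.
(* The next factor is made a function of the stage and the current product, so that the recursion is
   a plain fixpoint; arguments that are not Lipschitz get a dummy. *)
have /choice[Phi hPhi] : forall Kg : nat * (R -> R), exists FS : (R -> R) * set R, lipf Kg.2 ->
    [/\ lipf FS.1, forall x, 0 <= FS.1 x, forall x, FS.1 x != 0 -> FS.2 x, Q Kg.1 FS.2 &
      dual p b (fc (fun x => Kg.2 x * FS.1 x - Kg.2 x)) ((4 * 2 ^+ Kg.1)^-1) /\
      dual 2 (bK Kg.1) (fc (fun x => Kg.2 x * FS.1 x - Kg.2 x)) ((4 * 2 ^+ Kg.1)^-1)].
  move=> [K g] /=; have [lg|nlg] := pselect (lipf g); last first.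
    by exists (fun=> 0, set0) => /nlg.
  have /andP[b0 b12] := b01; have /andP[c0 c12] := hbK K.
  have [A hA] := fc_bnd_ex lg b12; have [A' hA'] := fc_bnd_ex lg c12.
  have A0 := bnd_ge0 hA; have A'0 := bnd_ge0 hA'.
  pose T := A + A' + 1; have T0 : 0 < T by rewrite /T; lra.
  have P0 : 0 < (4 * 2 ^+ K)^-1 :> R by rewrite invr_gt0 mulr_gt0 ?exprn_gt0.
  have e0 : 0 < (4 * 2 ^+ K)^-1 / T :> R by rewrite divr_gt0.
  have [F [S [lF F0 FS QS [d1 d2]]]] := step K _ e0.
  exists (F, S) => _; split => //=.
  split; [apply: dual_le (dual_product p0 b0 lg lF hA d1)|
          apply: dual_le (dual_product (ltr0n _ 2) c0 lg lF hA' d2)];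
  by rewrite mulrCA ler_piMr ?(ltW P0)// ler_pdivrMr// mul1r /T; lra.
pose g := fix g K := if K is K'.+1 then (fun x => g K' x * (Phi (K', g K')).1 x) else (fun=> 1 : R).
have lg K : lipf (g K).
  elim: K => [|K IH]; first exact: lipf_cst.
  by apply: lipf_mul => //; case: (hPhi (K, g K) IH).
have hP K := hPhi (K, g K) (lg K).
exists g, (fun K => (Phi (K, g K)).2); split.
- exact: lg.
- move=> K x; elim: K => [|K IH]/=; first exact: ler01.
  by rewrite mulr_ge0//; have [_ h _ _ _] := hP K.
- by move=> K; have [_ _ _ h _] := hP K.
- move=> K x; elim: K => [|K IH]//=; rewrite mulf_eq0 negb_or => /andP[h1 h2] i.
  rewrite ltnS leq_eqVlt => /predU1P[->|]; last exact: IH.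
  by have [_ _ h _ _] := hP K; exact: h.
have ll K : lipf (fun x => g K.+1 x - g K x) by exact: lipf_sub.
(* Telescoping from stage K0 on. A later starting stage is needed for the energy norm, whose
   exponent is admissible only from K0 on. *)
have diff p' b' K0 C : (forall K, (K0 <= K)%N ->
      dual p' b' (fc (fun x => g K.+1 x - g K x)) ((4 * 2 ^+ K)^-1)) ->
    forall h, lipf h -> dual p' b' (fc (fun x => g K0 x - h x)) C ->
    forall d, dual p' b' (fc (fun x => g (K0 + d)%N x - h x)) (C + (1 / 2 / 2 ^+ K0 - 1 / 2 / 2 ^+ (K0 + d))).
  move=> hd h lh h0; elim=> [|d IH]; first by rewrite addn0 subrr addr0.
  have := dualD IH (hd (K0 + d)%N (leq_addr _ _)).
  have -> : (fun n => fc (fun x => g (K0 + d)%N x - h x) n +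
      fc (fun x => g (K0 + d).+1 x - g (K0 + d)%N x) n) = fc (fun x => g (K0 + d.+1)%N x - h x).
    apply/funext => n; rewrite addnS !fcB//; by ring.
  apply: dual_le; rewrite addnS exprS le_eqVlt; apply/orP; left; apply/eqP; field.
  by rewrite !expf_neq0.
split.
  move=> K; have := @diff p b 0%N 0 _ (fun=> 1) (lipf_cst 1) _ K; rewrite add0n.
  have -> : fc (fun x : R => g 0%N x - 1) = fun=> 0.
    rewrite (_ : (fun x : R => g 0%N x - 1) = (fun=> 0)); last by apply/funext => x; rewrite subrr.
    by rewrite fc_cst; apply/funext => n; rewrite /single; case: ifP.
  move=> h; apply: dual_le (h _ _).
  - by rewrite expr0 divr1 add0r gerBl divr_ge0// exprn_ge0.
  - by move=> K' _; have [_ _ _ _ []] := hP K'.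
  - by move=> N v _; rewrite big1 ?cabs0// => n _; rewrite mul0r.
move=> b' K0 b'12 hb'.
have b'0 : 0 <= b' by have := hb' K0 (leqnn _); have /andP[+ _] := hbK K0; apply: le_trans.
have b'01 : 0 <= b' < 1 / 2 by rewrite b'0.
have [C hC] := @dual_lipf 2 b' (g K0) (ler1n _ 2) b'01 (lg K0).
exists (C + 1) => K KK0; rewrite -(subnKC KK0).
have := @diff 2 b' K0 C _ (fun=> 0) (lipf_cst 0) _ (K - K0)%N.
have E K' : (fun x => g K' x - 0) = g K' by apply/funext => x; rewrite subr0.
rewrite !E => h; apply: dual_le (h _ _) => //.
- rewrite lerD2l lerBlDr; apply: (@le_trans _ _ 1); last by rewrite lerDl divr_ge0// exprn_ge0.
  rewrite ler_pdivrMr ?exprn_gt0// mul1r; have : 1 <= 2 ^+ K0 :> R by rewrite exprn_ege1// ler1n.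
  lra.
- move=> K' hK'; have [_ _ _ _ [_ h']] := hP K'; exact: dual_weight (ltr0n _ 2) (hb' _ hK') h'.
Qed.

End product_machine.

(** * The limit set of a product: non-cyclicity and dimension from below *)

Section limit_set.
Variable R : realType.
Implicit Types (N K : nat) (n m k : int) (f u v : int -> R[i]) (g : nat -> R -> R) (p b e x s : R).

(** The pairing is the k-th coefficient of h u^, which is at most e h pointwise. *)
Lemma convol_small u C (h : R -> R) e k : lipf h -> (forall x, 0 <= h x) -> ssum u C ->
  (forall x, h x != 0 -> cabs (ev u x) <= e) -> 0 <= e ->
  cabs (csum (fun n => u (n + k) * fc h (- n))) <= e * mean h.
Proof.
move=> lh h0 hu small e0; have [B hB] := ssum_fc lh.
have -> : csum (fun n => u (n + k) * fc h (- n)) = convol (fc h) u k.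
  rewrite /convol -(csum_reflect (ssum_conv1 k hB hu)); congr csum; apply/funext => n.
  by rewrite opprK mulrC addrC.
have le : lipf (fun x => e * h x) by apply: lipf_mul => //; exact: lipf_cst.
have -> : e * mean h = mean (fun x => e * h x).
  rewrite /mean fc_mul//; last exact: lipf_cst.
  rewrite fc_cst conv_single subr0; case: (fc h 0) => a c /=; rewrite mul0r subr0//.
refine (coef_le_mean k (ssum_conv hB hu) le _) => x.
rewrite (ev_conv x hB hu) ev_fc// cabsM cabsR ger0_norm// mulrC.
have [->|hx] := eqVneq (h x) 0; first by rewrite !mulr0.
by rewrite ler_wpM2r// small.
Qed.

(** The g_K act as densities of mean at least 1/2 that concentrate near E. Where u^ is small they
    almost annihilate the translates of u; and their bounded energy forbids E to have small
    capacity. *)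
Lemma limit_set g (S : nat -> set R) p b (E : set (circle R)) : 1 <= p -> 0 <= b ->
  (forall K, closed (S K) /\ perset (S K)) ->
  (forall K, lipf (g K)) -> (forall K x, 0 <= g K x) ->
  (forall K x, g K x != 0 -> forall i, (i < K)%N -> S i x) ->
  (forall K, dual p b (fc (fun x => g K x - 1)) (1 / 2)) ->
  E = [set t | forall K, S K (repr t)] ->
  [/\ closed E,
     forall u C, bnd b u C -> zero_set u = E -> ~ cyclic p b u &
     forall s, 0 < s <= 1 ->
       (forall s', 0 < s' < s -> exists K0 C, forall K, (K0 <= K)%N -> dual 2 ((1 - s') / 2) (fc (g K)) C) ->
       (s%:E <= hausdorff_dim E)%E].
Proof.
move=> p1 b0 hS lg g0 gS hg EE; have p0 : 0 < p by lra.
have pS K x (k : int) : S K (x + pi *+ 2 * k%:~R) <-> S K x.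
  have [_ h] := hS K; split; last exact: h.
  by move=> /(h _ (- k)); rewrite rmorphN/= mulrN addrK.
have liftE : lift E = [set x | forall K, S K x].
  apply/seteqP; split => x; rewrite /lift EE/=; have [k ->] := repr_pi x.
    by move=> h K; apply/(pS K x k).
  by move=> h K; apply/(pS K x k).
have cE : closed E.
  apply: closed_lift; rewrite liftE.
  rewrite (_ : [set x | _] = \bigcap_K S K); last first.
    by apply/seteqP; split => x /=; [move=> h K _|move=> h K]; apply: h.
  by apply: closed_bigI => K _; case: (hS K).
have l1 K : lipf (fun x => g K x - 1) by apply: lipf_sub => //; exact: lipf_cst.
have m01 K : `|mean (g K) - 1| <= 1 / 2.
  have := dual_coef0 p0 (hg K); rewrite fcB//; last exact: lipf_cst.
  by rewrite fc_cst /single eqxx fc0// -rmorphB cabsR.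
(* By compactness finitely many S j already cut out a subset of U, and g_K lives on them for large
   K. *)
have eventually (U : set R) : open U -> perset (~` U) -> lift E `<=` U ->
    exists K0, forall K x, (K0 <= K)%N -> g K x != 0 -> U x.
  move=> oU pU EU.
  have [N hN] : exists N, forall i, (N <= i)%N ->
      [set x | forall j, (j <= i)%N -> S j x] `<=` U.
    apply: nested_subset => //.
    - move=> i; rewrite (_ : [set x | _] = \bigcap_(j in [set j | (j <= i)%N]) S j); last first.
        by apply/seteqP; split => x /= h j; exact: h.
      by apply: closed_bigI => K _; case: (hS K).
    - move=> i x k h h'; apply: h => j ji; apply/(pS j x k); exact: h'.
    - by move=> i j ij x h l li; apply: h; exact: leq_trans ij.
    - move=> x h; apply: EU; rewrite liftE => K; exact: (h K K (leqnn _)).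
  exists N.+1 => -[//|K] x NK gx; apply: (hN K NK) => j jK.
  by apply: (gS _ _ gx); rewrite ltnS.
split => //.
- move=> u C hu hz; have su := bnd_ssum b0 hu.
  apply: (@not_cyclic R p b u C (1 + 1 / 2) (1 / 2) p1 b0 hu) => // M e e0.
  have e2 : 0 < e / 2 by lra.
  have [K0 hK0] : exists K0, forall K x, (K0 <= K)%N -> g K x != 0 -> cabs (ev u x) < e / 2.
    apply: eventually.
    - by apply: open_preimage_lt; exact: cabs_ev_continuous su.
    - by move=> x k /=; rewrite ev_period.
    - by rewrite -hz => x /(lift_zero_set _ su) /= ->; rewrite cabs0.
  exists (fun n => fc (g K0) (- n)); have [B hB] := ssum_fc (lg K0).
  split.
  + by exists B => n; exact: ssum_cabs hB.
  + apply: dual_reflect.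
    have -> : fc (g K0) = fun n => single 0 1 n + fc (fun x => g K0 x - 1) n.
      by apply/funext => n; rewrite fcB ?fc_cst//; [ring|exact: lipf_cst].
    by apply: dualD; [exact: dual_single|exact: hg].
  + rewrite oppr0 fc0// cabsR; have := m01 K0; rewrite ler_norml => /andP[h _].
    by rewrite ger0_norm; lra.
  + move=> k _; apply: (le_trans (convol_small k (lg K0) (g0 K0) su _ (ltW e2))).
      by move=> x /hK0 h; apply/ltW/h.
    have := m01 K0; rewrite ler_norml => /andP[_ h].
    by apply: (@le_trans _ _ (e / 2 * 2)); [rewrite ler_wpM2l// ?(ltW e2)//; lra|lra].
- move=> s /andP[s0 s1] hd; rewrite leNgt; apply/negP => /ereal_inf_lt[_ [s1' [s1'0 hs1'] <-]].
  rewrite lte_fin => s1's.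
  pose s' := (s1' + s) / 2; have s's : 0 < s' < s by rewrite /s'; apply/andP; split; lra.
  have /andP[s'0 s's1] := s's.
  have hs' : hausdorff_measure (1 - (1 - s')) E = 0%E.
    rewrite (_ : 1 - (1 - s') = s'); last by ring.
    by apply: measure_mono hs1'; rewrite /s'; lra.
  have s01 : 0 < 1 - s' < 1 by apply/andP; split; lra.
  have [K0 [C hC]] := hd _ s's.
  have C0 : 0 <= C by exact: dual_ge0 (hC K0 (leqnn _)).
  pose t := (4 * (C + 1))^-1; have t0 : 0 < t by rewrite invr_gt0 mulr_gt0//; lra.
  have [chi [U [lchi chi01 [oU pU] [EU hU] hen]]] :=
    capacity_zero cE s01 hs' (exprn_gt0 2 t0).
  have [K1 hK1] := eventually U oU pU EU.
  pose K := maxn K0 K1.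
  (* Since chi = 1 where g_K lives, the mean of g_K is the pairing of its coefficients with those of
     chi. Bounded times small energy makes it at most 1/4, against a mean of at least 1/2. *)
  have E1 : (fun x => g K x * chi x) = g K.
    apply/funext => x; have [->|gx] := eqVneq (g K x) 0; first by rewrite mul0r.
    by rewrite hU ?mulr1//; apply: hK1 gx; rewrite leq_maxr.
  have [B hB] := ssum_fc lchi; have [B' hB'] := ssum_fc (lg K).
  have h1 : cabs (fc (g K) 0) <= C * t.
    rewrite -E1 fc_mul//.
    have hc := csumP (ssum_conv1 0 hB' hB).
    apply: (clim_bound (N1 := 0) hc) => N _.
    have hd' : dual 2 ((1 - s') / 2) (fun n => fc (g K) n) C by apply: hC; rewrite leq_maxl.
    have hp : pbd 2 ((1 - s') / 2) (fun n => fc chi (0 - n)) (t `^ 2).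
      have -> : (fun n => fc chi (0 - n)) = (fun n => fc chi (- n)) by apply/funext => n; rewrite sub0r.
      apply: pbd_reflect => M; rewrite -[2 in leRHS]/(2%:R) powR_mulrn ?(ltW t0)//.
      apply: le_trans (hen M); apply: ler_sum => n _.
      rewrite /pterm -[X in cabs _ `^ X]/(2%:R) powR_mulrn ?cabs_ge0//.
      by rewrite (_ : 2 * ((1 - s') / 2) = 1 - s')//; field.
    exact: dual_scaled (ltr0n _ 2) hd' t0 hp.
  have := m01 K; rewrite fc0// cabsR in h1; rewrite ler_norml => /andP[h2 _].
  move: h1; rewrite ger0_norm; last by lra.
  have : C * t <= 1 / 4.
    rewrite /t ler_pdivrMr ?mulr_gt0//; lra.
  lra.
Qed.

End limit_set.

(** * Sets defined by dilations *)

Section dilations.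
Variable R : realType.
Implicit Types (N A : nat) (n m k : int) (a h : int -> R[i]) (g : R -> R) (c x r t b e : R).

Lemma fc_shift g c : lipf g -> fc (fun x => g (x - c)) = fun n => expi (- (n%:~R * c)) * fc g n.
Proof.
move=> lg; have [B hB] := ssum_fc lg.
apply: (@fc_eq _ _ _ B); first exact: lipf_shift.
  by move=> N; under eq_bigr do rewrite cabsM cabs_expi mul1r; exact: hB.
move=> x; rewrite -[RHS](ev_fc (x - c) lg); congr csum; apply/funext => n.
by rewrite mulrAC -expiD mulrC; congr (_ * expi _); ring.
Qed.

Lemma mean_shift g c : lipf g -> mean (fun x => g (x - c)) = mean g.
Proof. by move=> lg; rewrite /mean fc_shift// mul0r oppr0 expi0 mul1r. Qed.

Lemma fc_sum (I : Type) (u : seq I) (F : I -> R -> R) n : (forall i, lipf (F i)) ->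
  fc (fun x => \sum_(i <- u) F i x) n = \sum_(i <- u) fc (F i) n.
Proof.
move=> lF; elim: u => [|i u IH].
  rewrite big_nil (_ : (fun x => _) = fun=> 0); last by apply/funext => x; rewrite big_nil.
  by rewrite fc_cst /single; case: ifP.
have -> : (fun x => \sum_(j <- i :: u) F j x) = (fun x => F i x - (0 - \sum_(j <- u) F j x)).
  by apply/funext => x; rewrite big_cons sub0r opprK.
have ls := lipf_sum u lF.
rewrite big_cons !fcB//; [|exact: lipf_cst|apply: lipf_sub => //; exact: lipf_cst].
by rewrite fc_cst IH /single; case: ifP => _; ring.
Qed.

Lemma mean_sum (I : Type) (u : seq I) (F : I -> R -> R) : (forall i, lipf (F i)) ->
  mean (fun x => \sum_(i <- u) F i x) = \sum_(i <- u) mean (F i).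
Proof.
move=> lF; rewrite /mean fc_sum//; elim: u => [|i u IH]; first by rewrite !big_nil.
by rewrite !big_cons -IH; case: (fc _ _) (\sum_(_ <- _) _) => ? ? [].
Qed.

Lemma mean_ge_cst g c : lipf g -> (forall x, c <= g x) -> c <= mean g.
Proof.
move=> lg h; apply: mean_ge_of => //; exists 1%N => N N0.
rewrite -[leLHS](@gmean_cst _ N c)//; exact: gmean_le.
Qed.

(** About 2 pi / r translates of the tent have sum at least 1. Their number is at most 9 / r,
    because 2 pi < 8 and r <= 1. *)
Lemma tent_mean_ge r : 0 < r <= 1 -> r / 9 <= mean (tent r).
Proof.
move=> /andP[r0 r1]; have p2 := pi2_gt0 R; have p4 : pi < 4 :> R by have := @pihalf_lt2 R; lra.
pose n := (Num.truncn (pi *+ 2 / r)).+1.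
have q0 : 0 <= pi *+ 2 / r by rewrite divr_ge0// ltW.
have nr : n%:R <= 9 / r.
  have /andP[h _] := truncn_itv q0; rewrite /n -natr1.
  apply: (@le_trans _ _ (pi *+ 2 / r + 1)); first by rewrite lerD2r.
  rewrite ler_pdivlMr// mulrDl divfK ?gt_eqF// mulr2n; lra.
have lt i : lipf (fun x => tent r (x - i%:R * r)) by apply: lipf_shift; exact: lipf_tent.
have : 1 <= mean (fun x => \sum_(i <- iota 0 n) tent r (x - i%:R * r)).
  apply: mean_ge_cst; first by apply: lipf_sum => i; exact: lt.
  move=> x; pose k := Num.floor (x / (pi *+ 2)); pose y := x + pi *+ 2 * (- k)%:~R.
  have /andP[h1 h2] := floor_itv (x / (pi *+ 2)); rewrite intrD -/k in h1 h2.
  have y0 : 0 <= y.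
    by rewrite /y rmorphN/= mulrN subr_ge0 mulrC -ler_pdivlMr.
  have y1 : y < pi *+ 2.
    rewrite /y rmorphN/= mulrN ltrBlDl mulrC -[X in _ < _ + X]mul1r -mulrDl.
    by rewrite -ltr_pdivrMr.
  pose i := Num.truncn (y / r).
  have yr0 : 0 <= y / r by rewrite divr_ge0// ltW.
  have /andP[h3 h4] := truncn_itv yr0; rewrite -/i -natr1 in h3 h4.
  have ni : i \in iota 0 n.
    rewrite mem_iota/= add0n -(ltr_nat R) (le_lt_trans h3)//.
    by rewrite (lt_trans _ (real_truncnS_gt (num_real _)))// ltr_pM2r ?invr_gt0.
  rewrite (bigD1_seq i) ?iota_uniq//= tent1//; last first.
    rewrite -(pd_period _ (- k)) (le_trans (pd_norm _))//.
    rewrite (_ : _ + _ = y - i%:R * r); last by rewrite /y; ring.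
    rewrite ler_pdivlMr// in h3; rewrite ltr_pdivrMr// in h4.
    by rewrite ler_norml; apply/andP; split; lra.
  by rewrite lerDl sumr_ge0// => j _; exact: tent_ge0.
rewrite mean_sum//; rewrite (eq_bigr (fun=> mean (tent r))); last by move=> i _; exact: mean_shift (lipf_tent r0).
rewrite big_const_seq count_predT iter_addr_0 size_iota -[mean (tent r) *+ n]mulr_natl => h.
have m0 : 0 <= mean (tent r) by apply: mean_ge0 => [|x]; [exact: lipf_tent|exact: tent_ge0].
rewrite ler_pdivrMr// -(ler_pM2l (_ : 0 < r^-1)) ?invr_gt0// mulVf ?gt_eqF//.
apply: (le_trans h); apply: (le_trans (ler_wpM2r m0 nr)).
by rewrite le_eqVlt; apply/orP; left; apply/eqP; ring.
Qed.

(** Coefficients of x -> g(A x) when a are those of g. *)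
Definition dil A a : int -> R[i] := fun n => if (A%:Z %| n)%Z then a (n %/ A%:Z)%Z else 0.

Lemma sum_zw_dvd (V : nmodType) N A (H : int -> V) : (0 < A)%N ->
  \sum_(n <- zw N | (A%:Z %| n)%Z) H n = \sum_(m <- zw (N %/ A)) H (A%:Z * m).
Proof.
move=> A0; have AN : A%:Z != 0 by rewrite eqz_nat -lt0n.
have -> : \sum_(m <- zw (N %/ A)) H (A%:Z * m) = \sum_(n <- [seq A%:Z * m | m <- zw (N %/ A)]) H n.
  by rewrite big_map.
rewrite -[LHS]big_filter; apply: perm_big; apply: uniq_perm.
- by rewrite filter_uniq// zw_uniq.
- by rewrite map_inj_uniq ?zw_uniq// => x y; exact: mulfI.
have E m : absz (A%:Z * m) = (A * absz m)%N by rewrite abszM.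
move=> n; rewrite mem_filter mem_zw; apply/andP/mapP.
  move=> [/dvdzP[m ->] h]; exists m; last by rewrite mulrC.
  by rewrite mem_zw leq_divRL// mulnC -E mulrC.
move=> [m + ->]; rewrite mem_zw leq_divRL// mulnC => h; split; last by rewrite E.
by rewrite dvdz_mulr.
Qed.

Lemma dil_mul A a m : (0 < A)%N -> dil A a (A%:Z * m) = a m.
Proof. by move=> A0; rewrite /dil dvdz_mulr// mulKz// eqz_nat -lt0n. Qed.

Lemma sum_dil (V : nmodType) N A a (H : R[i] -> int -> V) : (0 < A)%N -> (forall n, H 0 n = 0) ->
  \sum_(n <- zw N) H (dil A a n) n = \sum_(m <- zw (N %/ A)) H (a m) (A%:Z * m).
Proof.
move=> A0 H0; rewrite (bigID (fun n => (A%:Z %| n)%Z))/= [X in _ + X]big1 ?addr0; last first.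
  by move=> n /negbTE h; rewrite /dil h H0.
by rewrite sum_zw_dvd//; apply: eq_bigr => m _; rewrite dil_mul.
Qed.

Lemma ssum_dil A a C : (0 < A)%N -> ssum a C -> ssum (dil A a) C.
Proof.
move=> A0 ha N.
have -> : \sum_(n <- zw N) cabs (dil A a n) = \sum_(m <- zw (N %/ A)) cabs (a m).
  by apply: (@sum_dil _ N A a (fun z _ => cabs z)) => // n; rewrite cabs0.
exact: ha.
Qed.

Lemma fc_scale g A : (0 < A)%N -> lipf g -> fc (fun x => g (A%:R * x)) = dil A (fc g).
Proof.
move=> A0 lg; have [B hB] := ssum_fc lg.
apply: (fc_eq (lipf_scale A lg) (ssum_dil A0 hB)) => x.
rewrite /toC -[RHS]/(toC g (A%:R * x)) -(ev_fc _ lg).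
apply: csum_eq => e e0; have [N0 hN0] := csumP (ssum_ev (A%:R * x) hB) e0.
exists (A * N0)%N => N hN.
rewrite (@sum_dil _ N A (fc g) (fun z n => z * expi (n%:~R * x)))//; last by move=> n; rewrite mul0r.
rewrite (eq_bigr (fun m => fc g m * expi (m%:~R * (A%:R * x)))); last first.
  by move=> m _; rewrite intrM -mulrA mulrCA.
by apply: hN0; rewrite leq_divRL// mulnC.
Qed.

Definition lam r x : R := (mean (tent r))^-1 * tent r x.

(** 243 = 81 * 3: the normalising factor is at most 9 / r and the mean square of the tent at most 3
    r. *)
Lemma lamP r : 0 < r <= 1 -> [/\ lipf (lam r), forall x, 0 <= lam r x,
  forall x, 2 * r <= pd x -> lam r x = 0, fc (lam r) 0 = 1 &
  (forall n, cabs (fc (lam r) n) <= 1) /\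
  forall N, \sum_(n <- zw N) cabs (fc (lam r) n) ^+ 2 <= 243 / r].
Proof.
move=> r01; have /andP[r0 r1] := r01; have lt := lipf_tent r0.
have m9 := tent_mean_ge r01; have m0 : 0 < mean (tent r) by lra.
have ll : lipf (lam r) by apply: lipf_mul => //; exact: lipf_cst.
have l0 x : 0 <= lam r x by rewrite mulr_ge0 ?tent_ge0// invr_ge0 ltW.
have fcE : fc (lam r) = fun n => ((mean (tent r))^-1)%:C * fc (tent r) n.
  rewrite fc_mul//; last exact: lipf_cst.
  by rewrite fc_cst conv_single; apply/funext => n; rewrite subr0.
have f0 : fc (lam r) 0 = 1 by rewrite fcE fc0// -rmorphM/= mulVf ?gt_eqF.
split => //.
  by move=> x hx; rewrite /lam tent0 ?mulr0.
split=> [n|N].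
  by have := cabs_fc_le_mean n ll l0; rewrite /mean f0.
rewrite fcE; under eq_bigr do rewrite cabsM cabsR exprMn.
rewrite -mulr_sumr gtr0_norm ?invr_gt0//.
apply: (@le_trans _ _ ((r / 9)^-1 ^+ 2 * (3 * r))).
  rewrite ler_pM ?exprn_ge0 ?invr_ge0 ?(ltW m0)//.
  - by apply: sumr_ge0 => n _; rewrite exprn_ge0 ?cabs_ge0.
  - by rewrite ler_pXn2r ?nnegrE ?invr_ge0 ?(ltW m0)// ?lef_pV2 ?posrE ?divr_gt0//; lra.
  apply: fc_bessel => //; first exact: zw_uniq.
  have [N1 hN1] := inv_nat_small 1 (fun=> r0); exists N1 => M hM; have [M0 hi] := hN1 _ hM.
  apply: (@le_trans _ _ (2 * r + M%:R^-1)); last by have := hi 0%N isT; lra.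
  apply: (gmean_arc (c := 0)) => //; first by lra.
    by move=> x; rewrite expr_le1 ?tent_ge0 ?tent_le1.
  by move=> x; rewrite subr0 => hx; rewrite tent0 ?expr0n// ltW.
by rewrite le_eqVlt; apply/orP; left; apply/eqP; field; rewrite gt_eqF.
Qed.

(** Where wt <= B, the bound |h| <= 1 is used and a summable power of the weight is borrowed at the
    price B^(1-t+e); beyond, wt^(-t) <= B^(-t) is paired with the l^2 bound. *)
Lemma energy_split e : 0 < e -> exists2 C, 1 <= C & forall t (B : R) h, 0 <= t <= 1 -> 1 <= B ->
  (forall n, cabs (h n) <= 1) -> (forall N, \sum_(n <- zw N) cabs (h n) ^+ 2 <= B) ->
  forall N, \sum_(n <- zw N) cabs (h n) ^+ 2 * wt n `^ (- t) <= C * B `^ (1 - t + e).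
Proof.
move=> e0; have [C hC] := wt_summable e0; have C0 : 0 <= C.
  by have := hC 0%N; rewrite sum_zw0; apply: le_trans; exact: powR_ge0.
exists (C + 1); first by rewrite lerDr.
move=> t B h /andP[t0 t1] B1 h1 hB N; have B0 : 0 < B by lra.
apply: (@le_trans _ _ (\sum_(n <- zw N) (B `^ (1 - t + e) * wt n `^ (- (1 + e)) +
   B `^ (- t) * cabs (h n) ^+ 2))).
  apply: ler_sum => n _; have w0 := @wt_gt0 R n; have wN : wt n != 0 :> R by rewrite gt_eqF.
  have a0 : 0 <= B `^ (1 - t + e) * wt n `^ (- (1 + e)) by rewrite mulr_ge0 ?powR_ge0.
  have b0 : 0 <= B `^ (- t) * cabs (h n) ^+ 2 by rewrite mulr_ge0 ?powR_ge0 ?exprn_ge0 ?cabs_ge0.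
  have [wB|Bw] := leP (wt n) B.
    apply: (@le_trans _ _ (B `^ (1 - t + e) * wt n `^ (- (1 + e)))); last by rewrite lerDl.
    apply: (@le_trans _ _ (wt n `^ (- t))); first by rewrite ler_piMl ?powR_ge0// expr_le1 ?cabs_ge0.
    have -> : wt n `^ (- t) = wt n `^ (1 - t + e) * wt n `^ (- (1 + e)) :> R.
      by rewrite -powRD ?wN ?implybT//; congr (_ `^ _); ring.
    rewrite ler_wpM2r ?powR_ge0// ge0_ler_powR ?nnegrE ?(ltW w0) ?(ltW B0)//; lra.
  apply: (@le_trans _ _ (B `^ (- t) * cabs (h n) ^+ 2)); last by rewrite lerDr.
  rewrite mulrC ler_wpM2r ?exprn_ge0 ?cabs_ge0// !powRN lef_pV2 ?posrE ?powR_gt0//.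
  by rewrite ge0_ler_powR ?nnegrE ?(ltW w0) ?(ltW B0)// ltW.
rewrite big_split/= -!mulr_sumr mulrDl mul1r lerD//.
  by rewrite mulrC ler_wpM2r ?powR_ge0.
apply: (@le_trans _ _ (B `^ (- t) * B)); first by rewrite ler_wpM2l ?powR_ge0.
rewrite -[X in _ * X](powRr1 (ltW B0)) -powRD ?(gt_eqF B0) ?implybT//.
by rewrite ler_powR//; lra.
Qed.

End dilations.

(** * Sets of points whose dilates are close to 2 pi Z *)

Section resonant_set.
Variable R : realType.
Implicit Types (N A K : nat) (n m : int) (s t e r w x mu : R) (E : set (circle R)).

Lemma powR_small mu e : 0 < mu -> 0 < e -> exists N0, forall A, (N0 <= A)%N -> (0 < A)%N ->
  A%:R `^ (- mu) <= e.
Proof.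
move=> m0 e0; pose M := (e^-1) `^ mu^-1.
exists (Num.truncn M).+1 => A hA A0.
have AR : 0 < A%:R :> R by rewrite ltr0n.
have MA : M <= A%:R.
  by rewrite (le_trans (ltW (real_truncnS_gt (num_real M))))// ler_nat.
have ei : e^-1 <= A%:R `^ mu.
  rewrite (_ : e^-1 = M `^ mu); first by rewrite ge0_ler_powR ?nnegrE ?powR_ge0// ltW.
  by rewrite /M -powRrM mulVf ?gt_eqF// powRr1// invr_ge0 ltW.
by rewrite powRN invf_ple ?posrE ?powR_gt0.
Qed.

(** Subtracting the mean removes frequency 0; the others are multiples of A, so the weight yields
    A^(-t). The power of r comes from [energy_split] at B = 243 / r. *)
Lemma lam_dilated_energy e : 0 < e -> exists2 C, 0 < C & forall A r t, (0 < A)%N -> 0 < r <= 1 -> 0 <= t <= 1 ->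
  forall N, \sum_(n <- zw N) cabs (fc (fun x => lam r (A%:R * x) - 1) n) ^+ 2 * wt n `^ (- t) <=
    C * (A%:R `^ (- t) * r `^ (- (1 - t + e))).
Proof.
move=> e0; have [C C1 hC] := @energy_split R e e0; have C0 : 0 < C by lra.
have [T [T1 TE]] : exists T : R, 1 <= T /\ T = 243 by exists 243; rewrite ler1n.
exists (C * 2 * T `^ (1 + e)); first by rewrite !mulr_gt0// powR_gt0; lra.
move=> A r t A0 r01 t01 N; have /andP[r0 r1] := r01; have /andP[t0 t1] := t01.
have [ll l0 lz f0 [f1 f2]] := lamP r01; rewrite -TE in f2.
have T0 : 0 < T by lra.
have AR : 1 <= A%:R :> R by rewrite ler1n.
have AR0 : 0 < A%:R :> R by rewrite ltr0n.
have lh : lipf (fun x => lam r x - 1) by apply: lipf_sub => //; exact: lipf_cst.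
have fE : fc (fun x => lam r x - 1) = fun n => if n == 0 then 0 else fc (lam r) n.
  apply/funext => n; rewrite fcB//; last exact: lipf_cst.
  by rewrite fc_cst /single; case: eqP => [->|_]; rewrite ?f0 ?subrr ?subr0.
rewrite (@fc_scale R (fun x => lam r x - 1) A A0 lh).
pose a := fc (fun x => lam r x - 1).
have -> : \sum_(n <- zw N) cabs (dil A a n) ^+ 2 * wt n `^ (- t) =
    \sum_(m <- zw (N %/ A)) cabs (a m) ^+ 2 * wt (A%:Z * m) `^ (- t).
  apply: (@sum_dil _ _ N A a (fun z n => cabs z ^+ 2 * wt n `^ (- t))) => // n.
  by rewrite cabs0 expr0n mul0r.
have a1 n : cabs (a n) <= 1 by rewrite /a fE; case: ifP; rewrite ?cabs0.
have a2 M : \sum_(n <- zw M) cabs (a n) ^+ 2 <= T / r.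
  apply: le_trans (f2 M); apply: ler_sum => n _; rewrite /a fE; case: ifP => // _.
  by rewrite cabs0 expr0n/= exprn_ge0 ?cabs_ge0.
have B1 : 1 <= T / r by rewrite ler_pdivlMr//; lra.
apply: (@le_trans _ _ ((A%:R / 2) `^ (- t) * \sum_(m <- zw (N %/ A)) cabs (a m) ^+ 2 * wt m `^ (- t))).
  rewrite mulr_sumr; apply: ler_sum => m _; rewrite mulrCA.
  have [->|m0] := eqVneq m 0; first by rewrite /a fE eqxx cabs0 expr0n !mul0r.
  rewrite ler_wpM2l ?exprn_ge0 ?cabs_ge0//.
  rewrite -powRM ?wt_ge0 ?divr_ge0 ?(ltW AR0)// !powRN lef_pV2 ?posrE ?powR_gt0 ?mulr_gt0 ?divr_gt0 ?wt_gt0//.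
  rewrite ge0_ler_powR ?nnegrE ?mulr_ge0 ?divr_ge0 ?(ltW AR0) ?wt_ge0//.
  rewrite !wtE abszM natrM; have : 1 <= (absz m)%:R :> R by rewrite ler1n absz_gt0.
  by rewrite -[(absz A)%:R]/(A%:R : R); nra.
apply: (le_trans (ler_wpM2l (powR_ge0 _ _) (hC t (T / r) a t01 B1 a1 a2 _))).
rewrite !powRM ?invr_ge0 ?(ltW AR0) ?(ltW r0) ?(ltW T0)//.
have -> : (r^-1) `^ (1 - t + e) = r `^ (- (1 - t + e)).
  by rewrite -powR_inv1 ?(ltW r0)// -powRrM mulN1r.
have h2 : (2^-1) `^ (- t) <= 2 :> R.
  by rewrite -powR_inv1 ?ler0n// -powRrM mulN1r opprK -[leRHS]powRr1 ?ler0n// ler_powR ?ler1n.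
have h3 : T `^ (1 - t + e) <= T `^ (1 + e) by rewrite ler_powR//; lra.
rewrite [leLHS](_ : _ = C * ((2^-1) `^ (- t) * T `^ (1 - t + e)) * (A%:R `^ (- t) * r `^ (- (1 - t + e)))); last first.
  by ring.
rewrite ler_wpM2r ?mulr_ge0 ?powR_ge0// -[leRHS]mulrA ler_pM2l// ler_pM ?powR_ge0//.
Qed.

(** The points whose A-fold dilate is within w of 2 pi Z form A arcs of radius w / A, which provides
    covers. *)
Lemma pd_scaled A x : (0 < A)%N -> exists2 i, (i < A)%N & pd (x - pi *+ 2 * (i%:R / A%:R)) <= pd (A%:R * x) / A%:R.
Proof.
move=> A0; have AR : 0 < A%:R :> R by rewrite ltr0n.
have [k hk] := pd_attained (A%:R * x).
pose i := ((- k) %% A%:Z)%Z; pose j := ((- k) %/ A%:Z)%Z.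
have AZ : A%:Z != 0 by rewrite eqz_nat -lt0n.
have E : - k = j * A%:Z + i by exact: divz_eq.
have i0 : 0 <= i by rewrite modz_ge0.
have iA : i < A%:Z by have := ltz_mod (- k) AZ; rewrite /i; clear; lia.
have kE : k%:~R = - (j%:~R * A%:R + i%:~R) :> R.
  by rewrite -[A%:R]/(A%:Z%:~R) -intrM -intrD -E rmorphN/= opprK.
exists (absz i); first by move: i0 iA; clear; lia.
have -> : (absz i)%:R = i%:~R :> R by rewrite -[(absz i)%:R]/((absz i)%:Z%:~R) gez0_abs.
rewrite -(pd_period _ (- j)) (le_trans (pd_norm _))// hk ler_pdivlMr//.
rewrite -[X in _ * X <= _](gtr0_norm AR) -normrM le_eqVlt; apply/orP; left; apply/eqP.
by congr `|_|; rewrite rmorphN/= kE; field; rewrite gt_eqF.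
Qed.

Lemma perset_scaled A w : perset [set x | pd (A%:R * x) <= w]%R.
Proof.
move=> x k /=; rewrite (_ : A%:R * (x + pi *+ 2 * k%:~R) = A%:R * x + pi *+ 2 * (A%:Z * k)%:~R) ?pd_period//.
by rewrite intrM; ring.
Qed.

Lemma pd_scaled_lip A x y : `|pd (A%:R * x) - pd (A%:R * y)| <= A%:R * `|x - y|.
Proof. by rewrite (le_trans (pd_lip _ _))// -mulrBr normrM ger0_norm. Qed.

Lemma pd_scaled_continuous A : continuous (fun x : R => pd (A%:R * x)).
Proof.
apply: (@lip_continuous _ _ (A%:R + 1)); first by rewrite ltr_wpDl.
by move=> x y; rewrite (le_trans (pd_scaled_lip _ _ _))// ler_wpM2r// lerDl.
Qed.

Lemma closed_le (g : R -> R) w : continuous g -> closed [set x | g x <= w]%R.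
Proof.
move=> cg; rewrite (_ : [set x | _] = ~` [set x | w < g x]).
  by apply: open_closedC; exact: open_preimage_gt.
by apply/seteqP; split => x /=; rewrite leNgt => /negP.
Qed.

Lemma closed_ge (g : R -> R) w : continuous g -> closed [set x | w <= g x]%R.
Proof.
move=> cg; rewrite (_ : [set x | _] = ~` [set x | g x < w]).
  by apply: open_closedC; exact: open_preimage_lt.
by apply/seteqP; split => x /=; rewrite leNgt => /negP.
Qed.

Lemma resonant_set s : 0 < s < 1 -> exists (A : nat -> nat) (w : nat -> R) E,
  [/\ forall K, [/\ (0 < A K)%N, 0 < w K <= 1 & (A K)%:R `^ (1 - s) * w K `^ s <= K.+1%:R^-1],
     E = [set t | forall K, pd ((A K)%:R * repr t) <= w K]%R, closed E & hausdorff_dim E = s%:E].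
Proof.
move=> /andP[s0 s1].
(* Exponents increasing to s. Stage K controls only the energy attached to sg K, as the estimate
   loses a small power at the endpoint s. *)
pose sg K : R := s * (K.+1%:R / K.+2%:R); pose bK K := (1 - sg K) / 2.
have K0 K : 0 < K.+1%:R :> R by rewrite ltr0n.
have sgE K : sg K = s - s / K.+2%:R.
  by rewrite /sg -[X in _ * (X / _)](addrK 1) natr1; field; rewrite gt_eqF.
have sg01 K : 0 < sg K < s.
  rewrite mulr_gt0 ?divr_gt0//= sgE ltrBlDr ltrDl divr_gt0//.
have hbK K : 0 <= bK K < 1 / 2 by have := sg01 K; rewrite /bK; lra.
have bmono K : bK K <= bK 0%N.
  rewrite /bK ler_pM2r// lerD2l lerN2 !sgE lerD2l lerN2 ler_pM2l// lef_pV2 ?posrE// ler_nat//.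
pose Q K (S : set R) := exists A w, [/\ (0 < A)%N, 0 < w <= 1,
   A%:R `^ (1 - s) * w `^ s <= K.+1%:R^-1 & S = [set x | pd (A%:R * x) <= w]%R].
have step : machine_step 2 (bK 0%N) bK Q.
  move=> K e e0; have /andP[sg0 sgs] := sg01 K.
  (* With this kp the loss kp (1 + 1/s) is half of the gap 1 / (K + 2), which keeps mu positive. *)
  pose kp := (2 * K.+2%:R * (1 + s^-1))^-1.
  have si : 1 < s^-1 by rewrite invf_gt1.
  have D0 : 0 < 2 * K.+2%:R * (1 + s^-1) by rewrite !mulr_gt0//; lra.
  have kp0 : 0 < kp by rewrite invr_gt0.
  have kp1 : kp <= 1.
    rewrite invf_le1//; apply: (@le_trans _ _ (1 * 1 * 1)); first by rewrite !mulr1.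
    by rewrite ler_pM ?ler_pM ?ler1n//; lra.
  (* The width is w = A^(-nu). At nu = 1/s - 1 the quantity A^(1-s) w^s would be of order 1; the
     surplus kp sends it to 0, while the energy of the factor is of order A^(-mu). *)
  pose nu := s^-1 - 1 + kp; have nu0 : 0 < nu by rewrite /nu; lra.
  pose mu := 1 - sg K - nu * (sg K + kp).
  have mu0 : 0 < mu.
    have E : mu = 1 / K.+2%:R - kp * (sg K + s^-1 - 1 + kp).
      by rewrite /mu /nu sgE; field; rewrite !gt_eqF.
    rewrite E subr_gt0; apply: (@le_lt_trans _ _ (kp * (1 + s^-1))).
      by rewrite ler_pM2l//; lra.
    rewrite (_ : kp * (1 + s^-1) = 1 / K.+2%:R / 2); last first.
      by rewrite /kp; field; rewrite !gt_eqF//; lra.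
    by rewrite ltr_pdivrMr// ltr_pMr ?divr_gt0// ltr1n.
  have [C C0 hC] := lam_dilated_energy kp0.
  pose C' := C * (2^-1) `^ (- (sg K + kp)).
  have C'0 : 0 < C' by rewrite mulr_gt0// powR_gt0.
  have e2 : 0 < e ^+ 2 / C' by rewrite divr_gt0// exprn_gt0.
  have [N1 h1] := powR_small mu0 e2.
  have skp : 0 < s * kp by rewrite mulr_gt0.
  have Ki : 0 < K.+1%:R^-1 :> R by rewrite invr_gt0.
  have [N2 h2] := powR_small skp Ki.
  pose A := (maxn N1 N2).+1; pose w : R := A%:R `^ (- nu).
  have AR : 1 <= A%:R :> R by rewrite ler1n.
  have A0 : 0 < A%:R :> R by rewrite ltr0n.
  have w0 : 0 < w by rewrite powR_gt0.
  have w1 : w <= 1 by rewrite /w powRN invf_le1 ?powR_gt0// -[leLHS](powRr0 A%:R) ler_powR// ltW.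
  have r01 : 0 < w / 2 <= 1 by clear -w0 w1; apply/andP; split; lra.
  have [ll l0 lz f0 _] := lamP r01.
  have dl : dual 2 (bK K) (fc (fun x => lam (w / 2) (A%:R * x) - 1)) e.
    apply: (@dual_lq _ 2 2) => //; first by rewrite ltr1n.
      by rewrite (_ : 2 - 1 = 1 :> R) ?divr1//; ring.
    move=> N; rewrite -[X in e `^ X]/(2%:R) powR_mulrn ?(ltW e0)//.
    have t01 : 0 <= 1 - sg K <= 1 by apply/andP; split; lra.
    have := hC A (w / 2) (1 - sg K) isT r01 t01 N.
    rewrite (eq_bigr (fun n => cabs (fc (fun x => lam (w / 2) (A%:R * x) - 1) n) `^ 2 * wt n `^ (- (bK K * 2)))); last first.
      move=> n _; rewrite -[X in _ `^ X * _]/(2%:R) powR_mulrn ?cabs_ge0//.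
      by rewrite /bK divfK.
    move=> h; apply: (le_trans h).
    rewrite powRM ?(ltW w0)//.
    rewrite (_ : 1 - (1 - sg K) + kp = sg K + kp); last by ring.
    rewrite (_ : C * _ = C' * A%:R `^ (- mu)).
      by rewrite mulrC -ler_pdivlMr// h1// /A leqW// leq_maxl.
    rewrite /C' /w -[in LHS]powRrM.
    have -> : A%:R `^ (- mu) = A%:R `^ (- (1 - sg K)) * A%:R `^ (- nu * - (sg K + kp)) :> R.
      by rewrite -powRD ?(gt_eqF A0) ?implybT//; congr (_ `^ _); rewrite /mu; ring.
    by ring.
  exists (fun x => lam (w / 2) (A%:R * x)), [set x | pd (A%:R * x) <= w]%R; split.
  - exact: lipf_scale.
  - by move=> x; exact: l0.
  - move=> x hx /=; rewrite leNgt; apply/negP => hw; move: hx; rewrite lz ?eqxx//; lra.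
  - exists A, w; split => //; first by rewrite w0.
    rewrite /w -powRrM -powRD ?(gt_eqF A0) ?implybT//.
    rewrite (_ : 1 - s + - nu * s = - (s * kp)); last by rewrite /nu; field; rewrite gt_eqF.
    by apply: h2; rewrite // /A leqW// leq_maxr.
  - by split => //; apply: dual_weight dl => //; exact: bmono.
have [g [S [lg g0 hQ gS [hd hb]]]] := machine (ler1n _ 2) (hbK 0%N) hbK step.
have /choice[A /choice[w hAw]] : forall K, exists A w, [/\ (0 < A)%N, 0 < w <= 1,
   A%:R `^ (1 - s) * w `^ s <= K.+1%:R^-1 & S K = [set x | pd (A%:R * x) <= w]%R] by exact: hQ.
pose E := [set t : circle R | forall K, S K (repr t)].
have EE : E = [set t | forall K, pd ((A K)%:R * repr t) <= w K]%R.
  by apply/seteqP; split=> t h K; have := h K; have [_ _ _ ->] := hAw K.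
exists A, w, E.
have hS K : closed (S K) /\ perset (S K).
  have [_ _ _ ->] := hAw K; split; last exact: perset_scaled.
  by apply: closed_le; exact: pd_scaled_continuous.
have b00 : 0 <= bK 0%N by have /andP[] := hbK 0%N.
have [cE _ hdim] := limit_set (ler1n _ 2) b00 hS lg g0 gS hd (erefl E).
split => //; first by move=> K; have [] := hAw K.
apply/eqP; rewrite eq_le; apply/andP; split; last first.
  apply: hdim; first by rewrite s0 ltW.
  move=> s' /andP[s'0 s's].
  exists (Num.truncn (s / (s - s'))).+1; apply: hb; first by lra.
  move=> K hK; rewrite /bK ler_pM2r// lerD2l lerN2 sgE.
  have ss : 0 < s - s' by rewrite subr_gt0.
  have : s / K.+2%:R <= s - s'.
    rewrite ler_pdivrMr// mulrC -ler_pdivrMr//.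
    by rewrite (le_trans (ltW (real_truncnS_gt (num_real (s / (s - s'))))))// ler_nat (leq_trans hK)// leqW.
  by move: (s / _) => z; lra.
apply: dim_le; first exact: ltW.
apply: measure0_of_covers => // e d e0 d0.
have m0 : 0 < Num.min e (d `^ s) by rewrite lt_min e0 powR_gt0.
pose K := Num.truncn (Num.min e (d `^ s))^-1.
have hK : K.+1%:R^-1 <= Num.min e (d `^ s).
  by rewrite invf_ple ?posrE// ltW// real_truncnS_gt ?num_real.
have [A0 /andP[w0 w1] hA SE] := hAw K.
have AR : 1 <= (A K)%:R :> R by rewrite ler1n.
have AR0 : 0 < (A K)%:R :> R by lra.
pose r := w K / (A K)%:R; have r0 : 0 < r by rewrite divr_gt0.
have rs : (A K)%:R * r `^ s <= K.+1%:R^-1.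
  apply: le_trans hA; rewrite /r powRM ?invr_ge0 ?(ltW w0) ?(ltW AR0)//.
  rewrite -powR_inv1 ?(ltW AR0)// -powRrM mulN1r powRD ?(gt_eqF AR0) ?implybT// powRr1 ?(ltW AR0)//.
  by rewrite le_eqVlt; apply/orP; left; apply/eqP; ring.
exists (A K), (fun i => pi *+ 2 * (i%:R / (A K)%:R)), (fun=> r); split.
- move=> _; rewrite r0/=; rewrite leNgt; apply/negP => dr.
  have : d `^ s < r `^ s by rewrite gt0_ltr_powR ?nnegrE// ltW.
  rewrite ltNge => /negP; apply; apply: (@le_trans _ _ ((A K)%:R * r `^ s)).
    by rewrite ler_peMl ?powR_ge0.
  by rewrite (le_trans rs)// (le_trans hK)// ge_min lexx orbT.
- move=> t /(_ K); rewrite SE /= => ht; have [i iA hi] := pd_scaled (repr t) A0.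
  by exists i => //; rewrite (le_trans hi)// ler_pM2r ?invr_gt0.
rewrite sumr_const_nat subn0 -[_ *+ A K]mulr_natl (le_trans rs)// (le_trans hK)// ge_min lexx//.
Qed.

End resonant_set.

(** * Near-minimisers and spectra *)

Section near_minimiser.
Variable R : realType.
Implicit Types (N K k : nat) (n m : int) (z a : R[i]) (d v u w f : int -> R[i]) (p b e t x dm M B : R).

Lemma bernoulli_powR t x : 0 < t < 1 -> 0 <= x -> x `^ t <= t * x + (1 - t).
Proof.
move=> /andP[t0 t1] x0; have t10 : 0 < 1 - t by lra.
have := @conjugate_powR R (x `^ t) 1 t^-1 (1 - t)^-1; rewrite powR_ge0 ler01 !invr_gt0 !invrK.
move=> /(_ isT isT t0 t10); rewrite addrC subrK => /(_ erefl).
by rewrite mulr1 -powRrM mulfV ?gt_eqF// powRr1// powR1 mul1r [t * x]mulrC.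
Qed.

Lemma cabsD_sqr z a : cabs (z + a) ^+ 2 = cabs z ^+ 2 + 2 * complex.Re (conjc z * a) + cabs a ^+ 2.
Proof. by rewrite !cabs_sqr; case: z a => z1 z2 [a1 a2] /=; ring. Qed.

(** For |a| <= |z|, concavity of the power p/2 applied to |z + a|^2 leaves a remainder of order
    |z|^(p-2) |a|^2 <= |a|^p, as p < 2. For |a| > |z| all terms are crudely of size |a|^p. At z = 0
    the convention that 0 raised to p - 2 is 0 removes the linear term. *)
Lemma cpow_le p z a : 1 < p < 2 ->
  cabs (z + a) `^ p <= cabs z `^ p + p * (cabs z `^ (p - 2) * complex.Re (conjc z * a)) + 6 * cabs a `^ p.
Proof.
move=> /andP[p1 p2]; have p0 : 0 < p by lra.
have [->|z0] := eqVneq z 0.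
  have p2N : p - 2 != 0 by rewrite lt_eqF// subr_lt0.
  rewrite add0r cabs0 (powR0 p2N) powR0 ?gt_eqF//.
  by have := powR_ge0 (cabs a) p; lra.
have A0 := cabs_gt0 z0; have B0 := cabs_ge0 a.
have X1 : `|complex.Re (conjc z * a)| <= cabs z * cabs a.
  by rewrite (le_trans (cabs_Re _))// cabsM cabsJ.
have tri := cabsD z a; have sq := cabsD_sqr z a.
move: (cabs z) (cabs a) (cabs (z + a)) (cabs_ge0 (z + a)) (complex.Re _) A0 B0 X1 tri sq
  => A B C C0 X A0 B0 X1 tri sq.
have Ap : A `^ p = A `^ (p - 2) * A ^+ 2.
  rewrite -(powR_mulrn 2 (ltW A0)) -powRD ?(gt_eqF A0) ?implybT//; congr (_ `^ _).
  by rewrite subrK.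
have P0 : 0 < A `^ (p - 2) by rewrite powR_gt0.
have Bp0 : 0 <= B `^ p by exact: powR_ge0.
have [BA|AB] := leP B A.
  pose y := (C / A) ^+ 2; have y0 : 0 <= y by rewrite exprn_ge0// divr_ge0// ltW.
  have t01 : 0 < p / 2 < 1 by apply/andP; split; lra.
  have := bernoulli_powR t01 y0.
  have -> : y `^ (p / 2) = C `^ p / A `^ p.
    rewrite /y -powR_mulrn ?divr_ge0 ?(ltW A0)// -powRrM (_ : 2%:R * (p / 2) = p); last by field.
    by rewrite powRM ?invr_ge0 ?(ltW A0)// -(powR_inv1 (ltW A0)) -powRrM mulN1r powRN.
  rewrite ler_pdivrMr ?powR_gt0// => h; apply: (le_trans h).
  have -> : (p / 2 * y + (1 - p / 2)) * A `^ p =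
      A `^ p + p * (A `^ (p - 2) * X) + p / 2 * (A `^ (p - 2) * B ^+ 2).
    rewrite /y expr_div_n sq Ap; field; rewrite gt_eqF//.
  rewrite lerD2l; have BB : A `^ (p - 2) * B ^+ 2 <= B `^ p.
    have [B00|BN] := eqVneq B 0; first by rewrite B00 expr0n mulr0 powR_ge0.
    have BP : 0 < B by rewrite lt_neqAle eq_sym BN.
    rewrite (_ : B `^ p = B `^ (p - 2) * B ^+ 2); last first.
      rewrite -(powR_mulrn 2 B0) -powRD ?(gt_eqF BP) ?implybT//; congr (_ `^ _).
      by rewrite subrK.
    rewrite ler_wpM2r ?exprn_ge0// -[p - 2]opprK !(powRN _ (- (p - 2))).
    by rewrite lef_pV2 ?posrE ?powR_gt0// ge0_ler_powR ?nnegrE ?(ltW A0)//; lra.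
  have : p / 2 * (A `^ (p - 2) * B ^+ 2) <= p / 2 * B `^ p by rewrite ler_pM2l//; lra.
  by move: (B `^ p) Bp0 => Y Y0; nra.
have C2 : C `^ p <= 4 * B `^ p.
  apply: (@le_trans _ _ ((2 * B) `^ p)).
    by rewrite ge0_ler_powR ?nnegrE ?(ltW p0)//; lra.
  rewrite powRM// ler_wpM2r// (_ : 4 = 2 `^ 2%:R :> R); last by rewrite powR_mulrn// -natrX.
  by rewrite ler_powR ?ler1n ?(ltW p2).
have hX : - (2 * B `^ p) <= p * (A `^ (p - 2) * X).
  have h : - (A * B) <= X by move: X1; rewrite ler_norml => /andP[].
  have h1 : A `^ (p - 2) * (A * B) <= B `^ p.
    rewrite mulrA -[X in _ * X * _](powRr1 (ltW A0)) -powRD ?(gt_eqF A0) ?implybT//.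
    rewrite (_ : p - 2 + 1 = p - 1); last by ring.
    rewrite -(mulr_powRB1 B0 p0) mulrC ler_wpM2l// ge0_ler_powR ?nnegrE ?(ltW A0) ?(ltW AB)//; lra.
  have h2 : - (A `^ (p - 2) * (A * B)) <= A `^ (p - 2) * X by rewrite -mulrN ler_pM2l.
  move: (A `^ (p - 2) * X) (A `^ (p - 2) * (A * B)) (B `^ p) Bp0 h1 h2 => Y Z W W0 h1 h2.
  by apply: (@le_trans _ _ (p * - W)); [nra|rewrite ler_pM2l//; lra].
by have := powR_ge0 A p; lra.
Qed.

(** Derivative of the p-th power of the norm at d, up to the factor p; it vanishes where d does. *)
Definition grad p b d : int -> R[i] := fun n =>
  (cabs (d n) `^ (p - 2) * wt n `^ (p * b))%:C * conjc (d n).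

Lemma powRB2 p x : p != 0 -> p - 2 != 0 -> 0 <= x -> x `^ (p - 2) * x ^+ 2 = x `^ p.
Proof.
move=> p0 p2 x0; have [->|xN] := eqVneq x 0; first by rewrite !powR0// expr0n mulr0.
rewrite -(powR_mulrn 2 x0) -powRD ?xN ?implybT//; congr (_ `^ _).
by rewrite subrK.
Qed.

Lemma cabs_grad p b d n : 1 < p < 2 -> cabs (grad p b d n) = cabs (d n) `^ (p - 1) * wt n `^ (p * b).
Proof.
move=> /andP[p1 p2]; rewrite /grad cabsM cabsJ cabsR ger0_norm ?mulr_ge0 ?powR_ge0//.
rewrite mulrAC; congr (_ * _); have [->|xN] := eqVneq (cabs (d n)) 0.
  by rewrite mulr0 powR0// gt_eqF// subr_gt0.
rewrite -[X in _ * X = _](powRr1 (cabs_ge0 _)) -powRD ?xN ?implybT//; congr (_ `^ _); ring.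
Qed.

Lemma grad_mul p b d n : 1 < p < 2 -> grad p b d n * d n = (pterm p b d n)%:C.
Proof.
move=> /andP[p1 p2]; rewrite /grad -mulrA [conjc _ * _]mulrC -cabs_sqrC -rmorphM/=.
have p2N : p - 2 != 0 by rewrite lt_eqF// subr_lt0.
have pN : p != 0 by rewrite gt_eqF//; lra.
by rewrite mulrAC powRB2 ?cabs_ge0.
Qed.

Lemma pterm_variation p b d v (tau : R[i]) n : 1 < p < 2 ->
  pterm p b (fun n => d n + tau * v n) n <=
    pterm p b d n + p * complex.Re (tau * (grad p b d n * v n)) + 6 * cabs tau `^ p * pterm p b v n.
Proof.
move=> p12; rewrite /pterm; apply: (le_trans (ler_wpM2r (wtp_ge0 _ _) (cpow_le (d n) (tau * v n) p12))).
rewrite le_eqVlt; apply/orP; left; apply/eqP.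
rewrite cabsM powRM ?cabs_ge0// /grad.
have -> : tau * ((cabs (d n) `^ (p - 2) * wt n `^ (p * b))%:C * conjc (d n) * v n) =
    (cabs (d n) `^ (p - 2) * wt n `^ (p * b))%:C * (conjc (d n) * (tau * v n)) by ring.
by case: (conjc (d n) * (tau * v n)) => a1 a2; rewrite /= mul0r subr0; ring.
Qed.

Lemma powR_le_max p x M : 0 <= x -> 1 <= M -> 1 <= p -> x `^ p <= M -> x <= M.
Proof.
move=> x0 M1 p1 h; have [x1|x1] := leP x 1; first exact: le_trans M1.
by rewrite (le_trans _ h)// le1r_powR// ltW.
Qed.

(** A bound on |d_n| wt^b bounds the gradient by a multiple of wt^b, which is the growth that lets
    it be paired with weighted l^1 sequences. *)
Lemma grad_bound p b d M n : 1 < p < 2 -> 1 <= M -> pbd p b d M -> cabs (grad p b d n) <= M * wt n `^ b.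
Proof.
move=> p12 M1 hd; have /andP[p1 p2] := p12.
have hn : pterm p b d n <= M.
  apply: le_trans (hd (absz n)); rewrite (bigD1_seq n) ?zw_uniq ?mem_zw//= lerDl.
  by apply: sumr_ge0 => k _; exact: pterm_ge0.
rewrite ptermE in hn; set x := cabs (d n) * wt n `^ b in hn.
have x0 : 0 <= x by rewrite mulr_ge0 ?cabs_ge0 ?wtp_ge0.
have xM := powR_le_max x0 M1 (ltW p1) hn.
rewrite cabs_grad// (_ : _ * _ = x `^ (p - 1) * wt n `^ b).
  rewrite ler_wpM2r ?wtp_ge0//; have [x1|x1] := leP x 1.
    apply: le_trans M1; rewrite -[leRHS](_ : 1 `^ (p - 1) = 1); last by rewrite powR1.
    by rewrite ge0_ler_powR ?nnegrE//; lra.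
  by rewrite (le_trans _ xM)// -[leRHS]powRr1// ler_powR ?(ltW x1)//; lra.
rewrite /x powRM ?cabs_ge0 ?wtp_ge0// -mulrA; congr (_ * _).
rewrite -powRrM -powRD; first by congr (_ `^ _); ring.
by rewrite (gt_eqF (@wt_gt0 R n)) implybT.
Qed.

Lemma ssum_grad p b d M v B : 1 < p < 2 -> 1 <= M -> pbd p b d M -> bnd b v B ->
  ssum (fun n => grad p b d n * v n) (M * B).
Proof.
move=> p12 M1 hd hv N; apply: (@le_trans _ _ (\sum_(n <- zw N) M * (cabs (v n) * wt n `^ b))).
  apply: ler_sum => n _; rewrite cabsM mulrCA mulrC ler_wpM2l ?cabs_ge0//.
  exact: grad_bound.
by rewrite -mulr_sumr ler_wpM2l//; lra.
Qed.

(** The infimum runs over the weighted l^1 closure of the span, which contains the sequences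
    produced by [wiener_levy]. If it were 0, approximating in the closure and then in the span would
    give cyclicity. *)
Lemma not_cyclic_distance p b u C : 1 < p -> 0 <= b -> bnd b u C -> ~ cyclic p b u ->
  exists dm, [/\ 0 < dm, dm <= 1,
    forall w B, tclosure b u w -> pbd p b (fun n => single 0 1 n - w n) B -> dm <= B &
    forall e, 0 < e -> exists2 w, tclosure b u w & pbd p b (fun n => single 0 1 n - w n) (dm + e)].
Proof.
move=> p1 b0 hu nc; have p0 : 0 < p by lra.
pose D := [set B | exists2 w, tclosure b u w & pbd p b (fun n => single 0 1 n - w n) B].
have D1 : D 1.
  exists (fun=> 0); first by apply: tclosure_tspan; exact: tspan0.
  rewrite (_ : (fun n => _) = single 0 1); first by apply: pbd_single => //; rewrite cabs1.
  by apply/funext => n; rewrite subr0.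
have hD : has_inf D by split; [exists 1|exists 0 => B [w _]; exact: pbd_ge0].
have ge0 : 0 <= inf D by apply: lb_le_inf; [exists 1|move=> B [w _]; exact: pbd_ge0].
exists (inf D); split.
- rewrite lt_neqAle ge0 andbT; apply/negP => /eqP i0; apply: nc.
  apply: cyclic_unit_vector; [exact: ltW|by []|move=> e e0].
  have P2 : 0 < 2 `^ p :> R by rewrite powR_gt0.
  have e2 : 0 < e / (2 * 2 `^ p) by rewrite divr_gt0// mulr_gt0.
  have [B [w hw hB]] := inf_adherent e2 hD; rewrite -i0 add0r => BE.
  pose e1 := Num.min 1 (e / (2 * 2 `^ p)); have e10 : 0 < e1 by rewrite lt_min ltr01.
  have [w' sw' hw'] := hw _ e10; exists w' => //.
  rewrite (_ : (fun n => _) = (fun n => (single 0 1 n - w n) + (w n - w' n))); last first.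
    by apply/funext => n; ring.
  apply: (@pbd_le _ _ _ _ (2 `^ p * (B + e1))).
    apply: (@le_trans _ _ (2 `^ p * (e / (2 * 2 `^ p) + e / (2 * 2 `^ p)))).
      by rewrite ler_wpM2l ?(ltW P2)// lerD ?(ltW BE)// ge_min lexx orbT.
    by rewrite le_eqVlt; apply/orP; left; apply/eqP; field; rewrite gt_eqF.
  apply: pbdD => //; apply: bnd_pbd => //; [exact: ltW|by rewrite ge_min lexx].
- by apply: ge_inf => //; case: hD.
- by move=> w B hw hB; apply: ge_inf; [case: hD|exists w].
- move=> e e0; have [B [w hw hB] BE] := inf_adherent e0 hD.
  by exists w => //; exact: pbd_le (ltW BE) hB.
Qed.

(* First variation at a near-minimiser d of the distance to the closed span:
   moving by tau v gains nothing beyond e, so the gradient almost annihilates v. *)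
Lemma grad_almost_orthogonal p b u C dm B e : 1 < p < 2 -> 0 <= b -> bnd b u C -> dm <= 1 ->
  (forall w B, tclosure b u w -> pbd p b (fun n => single 0 1 n - w n) B -> dm <= B) ->
  0 < B -> 0 < e -> exists2 e', 0 < e' <= 1 & forall w v,
    tclosure b u w -> pbd p b (fun n => single 0 1 n - w n) (dm + e') ->
    tclosure b u v -> pbd p b v B ->
    cabs (csum (fun n => grad p b (fun n => single 0 1 n - w n) n * v n)) <= e.
Proof.
move=> p12 b0 hu m1 hm B0 e0; have /andP[p1 p2] := p12; have p0 : 0 < p by lra.
have p10 : 0 < p - 1 by lra.
(* Step length for which the remainder 6 t^p B is p t e / 4, a quarter of the linear gain p t e. *)
pose t := (p * e / (24 * B)) `^ (p - 1)^-1.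
have q0 : 0 < p * e / (24 * B) by rewrite divr_gt0 ?mulr_gt0.
have t0 : 0 < t by rewrite powR_gt0.
have tp : t `^ p = t * (p * e / (24 * B)).
  by rewrite -(mulr_powRB1 (ltW t0) p0) {2}/t -powRrM mulVf ?gt_eqF// powRr1// ltW.
pose e' := Num.min 1 (p * t * e / 4); have e'0 : 0 < e' by rewrite lt_min ltr01 !mulr_gt0.
have e'1 : e' <= p * t * e / 4 by rewrite ge_min lexx orbT.
exists e'; first by rewrite e'0 ge_min lexx.
move=> w v hw; set d := fun n => single 0 1 n - w n => hd hv hB.
have [A hA] := tclosure_bnd hu b0 hv.
have M1 : 1 <= 2 :> R by rewrite ler1n.
have e11 : e' <= 1 by rewrite ge_min lexx.
have hd2 : pbd p b d 2 by apply: pbd_le hd; lra.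
have hs := ssum_grad p12 M1 hd2 hA.
set I := csum _; rewrite leNgt; apply/negP => eI.
have I0 : 0 < cabs I by lra.
(* Phase opposite to the pairing I, so that the linear term is -t |I|. *)
pose tau : R[i] := - ((t / cabs I)%:C * conjc I).
have tauI : tau * I = - (t * cabs I)%:C.
  rewrite /tau mulNr -mulrA [conjc I * I]mulrC -cabs_sqrC -rmorphM/=.
  by congr (- _%:C); field; rewrite gt_eqF.
have ctau : cabs tau = t.
  by rewrite /tau cabsN cabsM cabsJ cabsR gtr0_norm ?divr_gt0// divfK// gt_eqF.
have hw' : tclosure b u (fun n => w n - tau * v n).
  rewrite (_ : (fun n => _) = (fun n => w n + (- tau) * v n)); last by apply/funext => n; ring.
  by apply: tclosureD => //; exact: tclosureZ.
have e4 : 0 < e / 4 by rewrite divr_gt0.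
have [N0 hN0] := climMl tau (csumP hs) (mulr_gt0 t0 e4).
have hp : pbd p b (fun n => single 0 1 n - (w n - tau * v n)) (dm + e' - p * t * e * (3 / 4) + p * t * e / 4).
  have E : (fun n => single 0 1 n - (w n - tau * v n)) = (fun n => d n + tau * v n).
    by apply/funext => n; rewrite /d; ring.
  rewrite E => N; have [N' NN' N0N'] : exists2 N', (N <= N')%N & (N0 <= N')%N.
    by exists (maxn N N0); rewrite ?leq_maxl ?leq_maxr.
  apply: (@le_trans _ _ (\sum_(n <- zw N') pterm p b (fun n => d n + tau * v n) n)).
    apply: ler_sum_zw => // [|n|n]; [exact: zw_uniq|exact: pterm_ge0|].
    by rewrite mem_zw => /leq_trans; apply.
  apply: (le_trans (ler_sum _ (fun n _ => pterm_variation b d v tau n p12))).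
  rewrite !big_split/= -!mulr_sumr ctau.
  have h1 := hd N'; have h2 := hB N'.
  have h3 : \sum_(n <- zw N') complex.Re (tau * (grad p b d n * v n)) <= - (t * cabs I) + t * (e / 4).
    have := hN0 N' N0N'; rewrite -[csum _]/I tauI => h.
    have hr : \sum_(n <- zw N') complex.Re (tau * (grad p b d n * v n)) =
        complex.Re (tau * \sum_(n <- zw N') grad p b d n * v n).
      rewrite mulr_sumr; elim: (zw N') => [|n r IH]; first by rewrite !big_nil.
      by rewrite !big_cons IH; case: (tau * _) (\sum_(_ <- _) _) => ? ? [].
    rewrite hr; have := le_trans (cabs_Re _) h; rewrite opprK raddfD/= ler_norml => /andP[_ h'].
    lra.
  have h4 : t * e <= t * cabs I by rewrite ler_pM2l// ltW.
  have h5 : p * (\sum_(n <- zw N') complex.Re (tau * (grad p b d n * v n))) <= p * (- (t * e) + t * (e / 4)).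
    by rewrite ler_pM2l//; lra.
  have h6 : 6 * t `^ p * \sum_(n <- zw N') pterm p b v n <= 6 * t `^ p * B.
    by rewrite ler_wpM2l// mulr_ge0// powR_ge0.
  have h7 : 6 * t `^ p * B = p * t * e / 4 by rewrite tp; field; rewrite gt_eqF.
  rewrite h7 in h6; lra.
have := hm _ _ hw' hp; have : 0 < p * t * e by rewrite !mulr_gt0.
lra.
Qed.

End near_minimiser.

(** * Filtering a spectrum, and the spectrum of powers *)

Section spectral_support.
Variable R : realType.
Implicit Types (N L K k : nat) (n m l : int) (f c S v u w d : int -> R[i]) (p b e t x y B C M : R) (G : R -> Prop).

Fixpoint sums G k : R -> Prop :=
  if k is k'.+1 then fun z => exists x y, [/\ G x, sums G k' y & z = x + y] else fun z => z = 0.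

(** Correlation of S with c, truncated at L. When c = chi^ it filters the spectrum of S to the
    support of chi; truncation makes it a finite sum, whose powers can be expanded. *)
Definition corr L S c n : R[i] := \sum_(l <- zw L) S l * c (l - n).

Lemma bounded_expr (r : int -> R[i]) B k : (forall n, cabs (r n) <= B) -> forall n, cabs (r n ^+ k) <= B ^+ k.
Proof. by move=> h n; rewrite cabsX lerXn2r ?nnegrE ?cabs_ge0// (le_trans (cabs_ge0 _) (h n)). Qed.

Lemma csum0 : csum (fun=> 0 : R[i]) = 0.
Proof. by apply: csum_eq => e e0; exists 0%N => N _; rewrite big1// subrr cabs0 ltW. Qed.

Lemma csum_sumr (I : Type) (s : seq I) (F : I -> int -> R[i]) : (forall i, exists C, ssum (F i) C) ->
  csum (fun n => \sum_(i <- s) F i n) = \sum_(i <- s) csum (F i).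
Proof.
move=> h; apply: csum_eq.
apply: (@eq_clim _ 0%N (fun N => \sum_(i <- s) \sum_(n <- zw N) F i n)) => [N _|].
  by rewrite exchange_big.
by apply: clim_sum => i; have [C hC] := h i; exact: csumP hC.
Qed.

(** Expanding one factor replaces f by f_n chi^(l - n), whose transform at y is the l-th coefficient
    of chi(x) f^(x + y). It vanishes for y in the (k-1)-fold sumset, so induction on k applies. *)
Lemma spectrum_power chi L S k f C : lipf chi -> ssum f C ->
  (forall y, sums (fun x => chi x != 0) k y -> ev f y = 0) ->
  csum (fun n => f n * corr L S (fc chi) n ^+ k) = 0.
Proof.
move=> lchi; have [A hA] := ssum_fc lchi.
have rb n : cabs (corr L S (fc chi) n) <= \sum_(l <- zw L) cabs (S l) * A.
  rewrite (le_trans (cabs_sum _ _ _))// ler_sum// => l _.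
  by rewrite cabsM ler_wpM2l ?cabs_ge0// (ssum_cabs _ hA).
elim: k f C => [|k IH] f C hf hz.
  rewrite -(hz 0)//; congr csum; apply/funext => n.
  by rewrite expr0 mulr0 expi0.
have hg l : ssum (fun n => f n * fc chi (l - n)) (C * A).
  by apply: ssum_mul_bounded hf _ => n; exact: ssum_cabs hA.
have E : (fun n => f n * corr L S (fc chi) n ^+ k.+1) = (fun n => \sum_(l <- zw L)
    S l * (f n * fc chi (l - n) * corr L S (fc chi) n ^+ k)).
  apply/funext => n; rewrite exprS {1}/corr mulr_suml mulr_sumr; apply: eq_bigr => l _; ring.
rewrite E csum_sumr; last first.
  move=> l; eexists; apply: ssumZ; exact: ssum_mul_bounded (hg l) (bounded_expr k rb).
apply: big1 => l _; rewrite (csumZ _ (ssum_mul_bounded (hg l) (bounded_expr k rb))).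
rewrite (IH _ _ (hg l)) ?mulr0// => y hy.
pose fy n := f n * expi (n%:~R * y).
have hfy : ssum fy C by exact: ssum_ev.
have -> : ev (fun n => f n * fc chi (l - n)) y = convol fy (fc chi) l.
  by congr csum; apply/funext => n; rewrite /fy mulrAC.
have -> : convol fy (fc chi) = fun=> 0; last by [].
apply: (ev_inj (ssum_conv hfy hA) (_ : ssum (fun=> 0) 0)).
  by move=> N; rewrite big1// => n _; rewrite cabs0.
move=> x; rewrite (ev_conv x hfy hA) (ev_fc x lchi) /toC.
rewrite (_ : ev (fun=> 0) x = 0); last first.
  by rewrite -[RHS]csum0; congr csum; apply/funext => n; rewrite mul0r.
have [->|hx] := eqVneq (chi x) 0; first by rewrite mulr0.
rewrite (_ : ev fy x = 0) ?mul0r// -(hz (x + y)); last by exists x, y.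
by congr csum; apply/funext => n; rewrite /fy -mulrA -expiD; congr (_ * expi _); ring.
Qed.

Lemma exprB_small k (r s : R[i]) B e : cabs r <= B -> cabs s <= B -> 0 <= B -> cabs (r - s) <= e ->
  cabs (r ^+ k - s ^+ k) <= k%:R * (B + 1) ^+ k * e.
Proof.
move=> hr hs B0 he; have e0 : 0 <= e by exact: le_trans (cabs_ge0 _) he.
have B1 : 0 <= B + 1 by lra.
elim: k => [|k IH]; first by rewrite !expr0 subrr cabs0 !mul0r.
rewrite !exprS (_ : _ - _ = r * (r ^+ k - s ^+ k) + (r - s) * s ^+ k); last by ring.
rewrite (le_trans (cabsD _ _))// !cabsM.
apply: (@le_trans _ _ ((B + 1) * (k%:R * (B + 1) ^+ k * e) + e * ((B + 1) * (B + 1) ^+ k))).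
  rewrite lerD// ler_pM ?cabs_ge0//; first by lra.
  rewrite cabsX; apply: (@le_trans _ _ ((B + 1) ^+ k)).
    by rewrite lerXn2r ?nnegrE ?cabs_ge0//; lra.
  by rewrite ler_peMl ?exprn_ge0//; lra.
rewrite -natr1 le_eqVlt; apply/orP; left; apply/eqP; ring.
Qed.

Lemma bnd_pbd_ex p b f C : 1 <= p -> bnd b f C -> pbd p b f ((C + 1) `^ p).
Proof.
move=> p1 hf; have C0 := bnd_ge0 hf; have C1 : 0 < C + 1 by lra.
have p0 : 0 < p by lra.
have h : bnd b (fun n => ((C + 1)^-1)%:C * f n) 1.
  apply: bnd_le (bndZ _ hf); rewrite cabsR gtr0_norm ?invr_gt0// mulrC ler_pdivrMr// mul1r; lra.
have := pbdZ (C + 1)%:C p0 (bnd_pbd p1 (lexx 1) h).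
rewrite mulr1 cabsR gtr0_norm// (_ : (fun n => _) = f)//.
by apply/funext => n; rewrite mulrA -rmorphM/= mulfV ?gt_eqF// mul1r.
Qed.

End spectral_support.

(** * Cyclicity for resonant zero sets when q = 2 k *)

Section resonant_cyclic.
Variable R : realType.
Implicit Types (N L K k A : nat) (n m l : int) (f c S v u w d : int -> R[i]) (p q b e t x y s rho B C M : R).

Lemma sum_zw_split (V : nmodType) N L (F : int -> V) : (L <= N)%N ->
  \sum_(n <- zw N) F n = \sum_(n <- zw L) F n + \sum_(n <- zw N | (L < absz n)%N) F n.
Proof.
move=> LN; rewrite (bigID (fun n => absz n <= L)%N)/=; congr (_ + _).
  rewrite -big_filter; apply: perm_big; apply: uniq_perm.
  - by rewrite filter_uniq// zw_uniq.
  - exact: zw_uniq.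
  - by move=> n; rewrite mem_filter !mem_zw; apply: andb_idr => /leq_trans; apply.
by apply: eq_bigl => n; rewrite ltnNge.
Qed.

Lemma csum_single S n : csum (fun l => S l * single 0 1 (l - n)) = S n.
Proof.
rewrite (@csum_fin _ _ (absz n)).
  rewrite (bigD1_seq n) ?zw_uniq ?mem_zw//= /single subrr eqxx mulr1 big1 ?addr0// => l ln.
  by rewrite subr_eq0 (negbTE ln) mulr0.
move=> l hl; rewrite /single subr_eq0; case: eqP => [E|_]; last by rewrite mulr0.
by move: hl; rewrite E ltnn.
Qed.

(** Dilation puts the frequencies at multiples of A, where the weight is at most A times larger; the
    tent itself costs rho^s. *)
Lemma tent_dilated_energy A rho s : (0 < A)%N -> 0 < rho <= 1 -> 0 < s < 1 -> forall N,
  \sum_(n <- zw N) cabs (fc (fun x => tent rho (A%:R * x)) n) ^+ 2 * wt n `^ (1 - s) <=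
    (3 + 12 * Cd (1 - s)) * (A%:R `^ (1 - s) * rho `^ s).
Proof.
move=> A0 rho01 /andP[s0 s1] N; have /andP[rho0 rho1] := rho01.
have lt := lipf_tent rho0; have AR : 1 <= A%:R :> R by rewrite ler1n.
have AR0 : 0 <= A%:R :> R by lra.
rewrite (fc_scale A0 lt); set a := fc (tent rho).
have -> : \sum_(n <- zw N) cabs (dil A a n) ^+ 2 * wt n `^ (1 - s) =
    \sum_(m <- zw (N %/ A)) cabs (a m) ^+ 2 * wt (A%:Z * m) `^ (1 - s).
  apply: (@sum_dil _ _ N A a (fun z n => cabs z ^+ 2 * wt n `^ (1 - s))) => // n.
  by rewrite cabs0 expr0n mul0r.
apply: (@le_trans _ _ (A%:R `^ (1 - s) * \sum_(m <- zw (N %/ A)) cabs (a m) ^+ 2 * wt m `^ (1 - s))).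
  rewrite mulr_sumr; apply: ler_sum => m _; rewrite mulrCA ler_wpM2l ?exprn_ge0 ?cabs_ge0//.
  rewrite -powRM ?wt_ge0// ge0_ler_powR ?nnegrE ?mulr_ge0 ?wt_ge0//; first by lra.
  by rewrite !wtE abszM natrM -[(absz A)%:R]/(A%:R : R) mulrDr mulr1 lerD2r.
rewrite [leRHS]mulrCA ler_wpM2l ?powR_ge0//.
have s01 : 0 < 1 - s < 1 by apply/andP; split; lra.
have := @tent_energy R 1 (fun=> 0) (fun=> rho) (tent rho) (1 - s) s01 (fun=> rho01) lt.
rewrite (_ : 1 - (1 - s) = s); last by ring.
move=> h; have := h _ _ (N %/ A)%N; rewrite big_ord_recr big_ord0/= add0r; apply.
- move=> x; rewrite big_ord_recr big_ord0/= add0r subr0.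
  by rewrite expr2 ler_piMr ?tent_ge0 ?tent_le1.
- by move=> x y; rewrite big_ord_recr big_ord0/= add0r !subr0.
Qed.

(** Subadditivity of [pd]: this is the arithmetic structure that keeps sumsets small. *)
Lemma sums_scaled (chi : R -> R) A B k y : (forall x, chi x != 0 -> pd (A%:R * x) <= B)%R ->
  sums (fun x => chi x != 0) k y -> (pd (A%:R * y) <= k%:R * B)%R.
Proof.
move=> h; elim: k y => [|k IH] y /=; first by move=> ->; rewrite mulr0 pd0 mul0r.
move=> [x [z [hx hz ->]]]; rewrite mulrDr (le_trans (pdD _ _))//.
by have := h _ hx; have := IH _ hz; rewrite -natr1 mulrDl mul1r; lra.
Qed.

(** The gradient S at a near-minimiser d almost annihilates the translates of (1 - chi)^, so it
    agrees with its filtered version on a window. Writing the unit vector as d + v gives S_0: the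
    pairing with d is at least dm, that with v almost 0. *)
Lemma near_annihilator p b u C : 1 < p < 2 -> 0 < b < 1 / 2 -> bnd b u C -> ~ cyclic p b u ->
  exists2 dm, 0 < dm & forall chi Cc N0 e, lipf chi -> bnd b (fc chi) Cc ->
    tclosure b u (fc (fun x => 1 - chi x)) -> 0 < e ->
    exists d L, [/\ pbd p b d 2, dm - e <= cabs (grad p b d 0) &
      forall n, (absz n <= N0)%N -> cabs (corr L (grad p b d) (fc chi) n - grad p b d n) <= e].
Proof.
move=> p12 /andP[b0 b12] hC nc; have /andP[p1 p2] := p12; have p0 : 0 < p by lra.
have [dm [dm0 dm1 hm near]] := not_cyclic_distance p1 (ltW b0) hC nc.
exists dm => // chi Cc N0 e lchi hCc v0V e0; pose c := fc chi; pose v0 := fc (fun x => 1 - chi x).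
have l1 : lipf (fun x => 1 - chi x) by apply: lipf_sub => //; exact: lipf_cst.
have v0E n : v0 n = single 0 1 n - c n by rewrite /v0 fcB ?fc_cst//; exact: lipf_cst.
have [Cv hCv] := fc_bnd_ex l1 b12; have Cv0 := bnd_ge0 hCv.
pose W : R := wt N0%:Z.
have wW n : (absz n <= N0)%N -> wt n <= W :> R by move=> h; rewrite /W !wtE lerD2l ler_nat.
have P1 : 0 <= W `^ (p * b) * (Cv + 1) `^ p by rewrite mulr_ge0 ?powR_ge0.
have P2 : 0 <= 2 `^ p :> R by exact: powR_ge0.
(* One bound, fixed before the near-minimiser, for the translates of (1 - chi)^ by |n| <= N0 and for
   v itself. *)
have [B [B0 B1 B2]] : exists B, [/\ 0 < B, W `^ (p * b) * (Cv + 1) `^ p <= B & 2 `^ p * (1 + 2) <= B].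
  exists (1 + W `^ (p * b) * (Cv + 1) `^ p + 2 `^ p * (1 + 2)).
  by move: (W `^ _ * _) (2 `^ p) P1 P2 => x y x0 y0; split; lra.
have e2 : 0 < e / 2 by rewrite divr_gt0.
have [e' /andP[e'0 e'1] orth] := grad_almost_orthogonal p12 (ltW b0) hC dm1 hm B0 e2.
have [v hv] := near _ e'0; set d := fun n => single 0 1 n - v n => hd.
have hd2 : pbd p b d 2 by apply: pbd_le hd; clear -dm1 e'1; lra.
have one2 : 1 <= 2 :> R by rewrite ler1n.
pose S := grad p b d.
have hshift n : ssum (fun l => S l * c (l - n)) (2 * (wt n `^ b * Cc)).
  by apply: ssum_grad => //; apply: bnd_shift => //; exact: ltW.
have [L hL] := clim_unif (zw N0) (fun n => csumP (hshift n)) e2.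
exists d, L; split => //; last first.
  move=> n nN; have /hL h1 : n \in zw N0 by rewrite mem_zw.
  have hvs : tclosure b u (fun l => v0 (l - n)) by apply: tclosure_shift => //; exact: ltW.
  have hvB : pbd p b (fun l => v0 (l - n)) B.
    apply: pbd_le (pbd_shift n p0 (ltW b0) (bnd_pbd_ex (ltW p1) hCv)); apply: le_trans B1.
    by rewrite ler_wpM2r ?powR_ge0// ge0_ler_powR ?nnegrE ?wt_ge0// ?wW// mulr_ge0// ltW.
  have h2 := orth v _ hv hd hvs hvB.
  have hSs : ssum (fun l => S l * single 0 1 (l - n)) (2 * (wt n `^ b * 1)).
    apply: ssum_grad => //; apply: bnd_shift; first exact: ltW.
    by apply: bnd_le (bnd_single _ _ _); rewrite cabs1 wt0 powR1 mulr1.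
  (* (1 - chi)^ is the unit vector minus chi^. *)
  have E2 : csum (fun l => S l * v0 (l - n)) = S n - csum (fun l => S l * c (l - n)).
    rewrite -(csum_single S n) -[X in _ - X]mul1r -mulNr -(csumZ _ (hshift n)).
    rewrite -(csumD hSs (ssumZ (-1) (hshift n))).
    by congr csum; apply/funext => l; rewrite v0E; ring.
  rewrite -[csum _]/(csum (fun l => S l * v0 (l - n))) E2 in h2.
  rewrite (_ : corr L S c n - S n = (corr L S c n - csum (fun l => S l * c (l - n))) -
    (S n - csum (fun l => S l * c (l - n)))); last by ring.
  by rewrite (le_trans (cabsB _ _))// [leRHS](splitr e) lerD.
have hSd N : \sum_(n <- zw N) S n * d n = (\sum_(n <- zw N) pterm p b d n)%:C.
  by rewrite rmorph_sum; apply: eq_bigr => n _; exact: grad_mul.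
have [Bv hBv] := tclosure_bnd hC (ltW b0) hv.
have hdel : bnd b (single 0 1 : int -> R[i]) 1.
  by apply: bnd_le (bnd_single _ _ _); rewrite cabs1 wt0 powR1 mulr1.
have sd := ssum_grad p12 one2 hd2 (bndB hdel hBv); rewrite -/d -/S in sd.
have sv := ssum_grad p12 one2 hd2 hBv; rewrite -/S in sv.
have big : dm <= cabs (csum (fun n => S n * d n)).
  apply: (hm v) => // N; apply/ler_addgt0Pr => x x0.
  have [M hM] := csumP sd x0.
  apply: (@le_trans _ _ (\sum_(n <- zw (maxn N M)) pterm p b d n)).
    apply: ler_sum_zw => // [|n|n]; [exact: zw_uniq|exact: pterm_ge0|].
    by rewrite mem_zw => /leq_trans; apply; exact: leq_maxl.
  have := hM _ (leq_maxr N M); rewrite hSd => h.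
  have P0 : 0 <= \sum_(n <- zw (maxn N M)) pterm p b d n by apply: sumr_ge0 => n _; exact: pterm_ge0.
  rewrite -[leLHS](ger0_norm P0) -cabsR.
  have := cabsD ((\sum_(n <- zw (maxn N M)) pterm p b d n)%:C - csum (fun n => S n * d n)) (csum (fun n => S n * d n)).
  by rewrite subrK => h'; apply: (le_trans h'); rewrite addrC lerD2l.
have vB : pbd p b v B.
  have h := pbdD p0 (@pbd_single R p b 1 p0 (_ : cabs 1 <= 1)) (pbdZ (-1) p0 hd2).
  have {}h : pbd p b (fun n => single 0 1 n + -1 * d n) (2 `^ p * (1 + cabs (-1 : R[i]) `^ p * 2)).
    by apply: h; rewrite cabs1.
  rewrite (_ : (fun n => _) = v) in h; last by apply/funext => n; rewrite /d; ring.
  by apply: pbd_le h; rewrite cabsN cabs1 powR1 mul1r.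
have sm := orth v v hv hd hv vB; rewrite -/d -/S in sm.
have E0 : S 0 = csum (fun n => S n * d n) + csum (fun n => S n * v n).
  rewrite -(csumD sd sv) -[LHS](csum_single S 0); congr csum; apply/funext => l.
  by rewrite /d subr0; ring.
have := cabsB (S 0) (csum (fun n => S n * v n)); rewrite {1}E0 addrK.
move: (cabs _) (cabs _) (cabs _) sm big => x y z; clear -e0; lra.
Qed.

(** |S|^(2k) wt^(-2kb) equals |d|^p wt^(pb), because q = 2k and q (p - 1) = p. The sum is at most 2,
    hence at most 2^2. *)
Lemma grad_power_dual k p q b s d : 1 < p < 2 -> q = p / (p - 1) -> q = 2 * k%:R -> s = 1 - b * q ->
  pbd p b d 2 -> dual 2 (k%:R * b) (fun n => grad p b d n ^+ k) 2.
Proof.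
move=> p12 hq qk sE hd; have /andP[p1 p2] := p12.
have pN : p - 1 != 0 by rewrite gt_eqF// subr_gt0.
apply: (@dual_lq _ 2 2) => //; first by rewrite ltr1n.
  by rewrite (_ : 2 - 1 = 1 :> R) ?divr1//; ring.
move=> N; apply: (@le_trans _ _ 2); last by rewrite -[X in _ `^ X]/(2%:R) powR_mulrn//; lra.
apply: le_trans (hd N); rewrite le_eqVlt; apply/orP; left; apply/eqP; apply: eq_bigr => n _.
rewrite -[X in cabs _ `^ X]/(2%:R) powR_mulrn ?cabs_ge0// cabsX -exprM mulnC.
rewrite -powR_mulrn ?cabs_ge0// natrM -qk cabs_grad// powRM ?powR_ge0//.
rewrite -!powRrM -mulrA -powRD; last by rewrite (gt_eqF (@wt_gt0 R n)) implybT.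
rewrite /pterm; congr (_ `^ _ * _ `^ _); first by rewrite hq; field.
by rewrite (_ : k%:R * b * 2 = q * b); [rewrite hq; field|rewrite qk; ring].
Qed.

(* If F = 1 on the spectrum of r ^ k, the value r_0 ^ k is the pairing of F^
   with r ^ k, hence almost its pairing with S ^ k. *)
Lemma spectral_bound k L N0 b M Cc CF e (tau t : R) S chi F : let r := corr L S (fc chi) in
  0 < b -> lipf chi -> lipf F -> 1 <= M -> 0 < e -> 0 < t ->
  (forall y, sums (fun x => chi x != 0) k y -> F y = 1) ->
  (forall n, cabs (S n) <= M * wt n `^ b) -> (forall n, cabs (r n) <= M * wt n `^ b) ->
  (forall n, (absz n <= N0)%N -> cabs (r n - S n) <= e) ->
  dual 2 (k%:R * b) (fun n => S n ^+ k) Cc -> pbd 2 (k%:R * b) (fc F) (t `^ 2) ->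
  bnd (k%:R * b) (fc F) CF ->
  (forall z : seq int, uniq z -> (forall n, n \in z -> (N0 < absz n)%N) ->
     \sum_(n <- z) cabs (fc F n) * wt n `^ (k%:R * b) <= tau / M ^+ k) ->
  cabs (r 0) ^+ k <= Cc * t + CF * (k%:R * (M * wt N0%:Z `^ b + 1) ^+ k) * e + tau.
Proof.
move=> r b0 lchi lF M1 e0 t0 hF hS hr hrS hd hpF hCF htail.
have kb0 : 0 <= k%:R * b by rewrite mulr_ge0// ltW.
have M0 : 0 <= M by lra.
have Mk0 : 0 < M ^+ k by rewrite exprn_gt0//; lra.
pose Bx := M * wt N0%:Z `^ b; have Bx0 : 0 <= Bx by rewrite mulr_ge0 ?powR_ge0.
have lfF : lipf (fun x => 1 - F x) by apply: lipf_sub => //; exact: lipf_cst.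
have [CfF hfF] := ssum_fc lfF; have [sF hsF] := ssum_fc lF.
have hspec : csum (fun n => fc (fun x => 1 - F x) n * r n ^+ k) = 0.
  by apply: (spectrum_power L S lchi hfF) => y hy; rewrite (ev_fc y lfF) /toC hF// subrr.
have [rB hrB] : exists rB, forall n, cabs (r n) <= rB.
  have [sc hsc] := ssum_fc lchi; exists (\sum_(l <- zw L) cabs (S l) * sc) => n.
  rewrite (le_trans (cabs_sum _ _ _))// ler_sum// => l _.
  by rewrite cabsM ler_wpM2l ?cabs_ge0// (ssum_cabs _ hsc).
have rk := bounded_expr k hrB.
have h1 := ssum_mul_bounded hsF rk; have h2 := ssum_mul_bounded hfF rk.
have E3 : csum (fun n => fc F n * r n ^+ k) = r 0 ^+ k.
  rewrite -[LHS]addr0 -hspec -(csumD h1 h2) -(csum_single (fun n => r n ^+ k) 0).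
  congr csum; apply/funext => n; rewrite fcB//; last exact: lipf_cst.
  by rewrite fc_cst subr0; ring.
have hl := csumP h1; rewrite E3 in hl.
rewrite -cabsX; apply: (clim_bound (N1 := N0) hl) => N hN; rewrite (sum_zw_split _ hN).
rewrite (_ : \sum_(n <- zw N0) fc F n * r n ^+ k = \sum_(n <- zw N0) S n ^+ k * fc F n +
   \sum_(n <- zw N0) fc F n * (r n ^+ k - S n ^+ k)); last first.
  by rewrite -big_split/=; apply: eq_bigr => n _; ring.
have Z0 : 0 <= k%:R * (Bx + 1) ^+ k * e.
  by rewrite !mulr_ge0 ?exprn_ge0 ?(ltW e0)//; lra.
rewrite (le_trans (cabsD _ _))// lerD//.
  rewrite (le_trans (cabsD _ _))// lerD//; first exact: dual_scaled (ltr0n _ 2) hd t0 hpF.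
  rewrite (le_trans (cabs_sum _ _ _))//.
  apply: (@le_trans _ _ (\sum_(n <- zw N0) (cabs (fc F n) * wt n `^ (k%:R * b)) * (k%:R * (Bx + 1) ^+ k * e))).
    apply: ler_sum_seq => n; rewrite mem_zw => nN; rewrite cabsM -mulrA.
    rewrite ler_wpM2l ?cabs_ge0//.
    have hwb : M * wt n `^ b <= Bx.
      by rewrite ler_wpM2l// ge0_ler_powR ?nnegrE ?wt_ge0 ?(ltW b0)// !wtE lerD2l ler_nat.
    apply: (le_trans (exprB_small k (le_trans (hr n) hwb) (le_trans (hS n) hwb) Bx0 (hrS _ nN))).
    by rewrite ler_peMl ?wtp_ge1.
  by rewrite -mulr_suml -[leRHS]mulrA ler_wpM2r.
rewrite (le_trans (cabs_sum _ _ _))//.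
apply: (@le_trans _ _ (\sum_(n <- zw N | (N0 < absz n)%N) (cabs (fc F n) * wt n `^ (k%:R * b)) * M ^+ k)).
  apply: ler_sum => n _; rewrite cabsM -mulrA ler_wpM2l ?cabs_ge0// cabsX.
  apply: (@le_trans _ _ ((M * wt n `^ b) ^+ k)).
    by rewrite lerXn2r ?nnegrE ?cabs_ge0 ?mulr_ge0 ?wtp_ge0.
  rewrite exprMn mulrC ler_wpM2r ?(ltW Mk0)//.
  by rewrite -powR_mulrn ?wtp_ge0// -powRrM mulrC.
rewrite -mulr_suml -ler_pdivlMr// -big_filter; apply: htail.
  by rewrite filter_uniq// zw_uniq.
by move=> n; rewrite mem_filter => /andP[].
Qed.

Lemma corr_bound p b L d c Cc n : 1 < p < 2 -> 0 <= b -> pbd p b d 2 -> bnd b c Cc ->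
  cabs (corr L (grad p b d) c n) <= 2 * Cc * wt n `^ b.
Proof.
move=> p12 b0 hd hc; apply: (le_trans (cabs_sum _ _ _)).
apply: (le_trans (ssum_grad p12 (_ : 1 <= 2) hd (bnd_shift n b0 hc) L)); first by rewrite ler1n.
by rewrite le_eqVlt; apply/orP; left; apply/eqP; ring.
Qed.

(** The factor 3/2 separates the zeros, where [pd] is at most x0, from the closed set [pd] >= 3/2 x0
    outside which the function vanishes. *)
Lemma resonant_complement b u C (a : nat) (x0 : R) : 0 <= b < 1 / 2 -> bnd b u C -> 0 < x0 ->
  (forall x, ev u x = 0 -> pd (a%:R * x) <= x0)%R ->
  tclosure b u (fc (fun x => 1 - tent (3 / 2 * x0) (a%:R * x))).
Proof.
move=> b01 hC x00 hz; have /andP[b0 b12] := b01; have sC := bnd_ssum b0 hC.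
have w32 : 0 < 3 / 2 * x0 by rewrite mulr_gt0// divr_gt0.
have [cc cc0 hcc] : exists2 cc, 0 < cc & forall x, [set x | 3 / 2 * x0 <= pd (a%:R * x)]%R x -> cc <= cabs (ev u x).
  apply: (ev_bounded_below sC).
  - by apply: closed_ge; exact: pd_scaled_continuous.
  - move=> x j /=; rewrite (_ : a%:R * (x + pi *+ 2 * j%:~R) = a%:R * x + pi *+ 2 * (a%:Z * j)%:~R).
      by rewrite pd_period.
    by rewrite intrM; ring.
  - by move=> x /= hx; apply/eqP => /hz h; clear -hx h x00; lra.
apply: (wiener_levy b01 hC _ cc0).
  by apply: lipf_sub; [exact: lipf_cst|apply: lipf_scale; exact: lipf_tent].
move=> x hx; apply: hcc; rewrite /= leNgt; apply/negP => h.
by move: hx; rewrite tent1 ?subrr ?eqxx// ltW.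
Qed.

(** The filter will live where [pd] <= 3 w, so sums of k of its points satisfy [pd] <= 3 k w. The
    tent equal to 1 there has energy of order A^(1-s) w^s, which tends to 0 with K. *)
Lemma resonant_scale k s t (A : nat -> nat) (w : nat -> R) : (0 < k)%N -> 0 < s < 1 -> 0 < t ->
  (forall K, [/\ (0 < A K)%N, 0 < w K <= 1 & (A K)%:R `^ (1 - s) * w K `^ s <= K.+1%:R^-1]) ->
  exists K, 0 < 3 * k%:R * w K /\
    pbd 2 ((1 - s) / 2) (fc (fun x => tent (3 * k%:R * w K) ((A K)%:R * x))) (t `^ 2).
Proof.
move=> k0 s01 t0 hAw; have /andP[s0 s1] := s01; have k1 : 1 <= k%:R :> R by rewrite ler1n.
set k3 : R := 3 * k%:R; have k30 : 0 < k3 by rewrite /k3; lra.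
have K10 : 0 < 3 + 12 * Cd (1 - s).
  have : 0 < 1 - s by lra.
  by move=> /Cd_ge0; lra.
set K1 := 3 + 12 * Cd (1 - s) in K10.
have k3s : 0 < k3 `^ s by rewrite powR_gt0.
(* The first entry gives the energy bound t^2; the second ensures 3 k w <= 1, as the estimate for
   tents requires. *)
pose bd := Num.min (t ^+ 2 / (K1 * k3 `^ s)) ((k3^-1) `^ s).
have bd0 : 0 < bd by rewrite lt_min divr_gt0 ?exprn_gt0 ?mulr_gt0//= powR_gt0// invr_gt0.
have hK : (Num.truncn bd^-1).+1%:R^-1 <= bd by rewrite invf_ple ?posrE// ltW// real_truncnS_gt ?num_real.
exists (Num.truncn bd^-1); have [A0 /andP[w0 w1] hA] := hAw (Num.truncn bd^-1).
set a := A _ in A0 hA *; set wk := w _ in w0 w1 hA *.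
have AR : 1 <= a%:R :> R by rewrite ler1n.
have hA2 := le_trans hA hK.
have wk3 : wk <= k3^-1.
  rewrite leNgt; apply/negP => h.
  have : (k3^-1) `^ s < wk `^ s by rewrite gt0_ltr_powR ?nnegrE ?invr_ge0 ?(ltW k30) ?(ltW w0).
  rewrite ltNge => /negP; apply; apply: (@le_trans _ _ (a%:R `^ (1 - s) * wk `^ s)).
    by rewrite ler_peMl ?powR_ge0// -[leLHS](powRr0 a%:R) ler_powR// subr_ge0 ltW.
  by rewrite (le_trans hA2)// ge_min lexx orbT.
have rho0 : 0 < k3 * wk by rewrite mulr_gt0.
split => // N.
have rho01 : 0 < k3 * wk <= 1 by rewrite rho0 mulrC -ler_pdivlMr// div1r.
rewrite -[2 in leRHS]/(2%:R) powR_mulrn ?(ltW t0)//.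
rewrite (eq_bigr (fun n => cabs (fc (fun x => tent (k3 * wk) (a%:R * x)) n) ^+ 2 * wt n `^ (1 - s))); last first.
  move=> n _; rewrite /pterm -[X in cabs _ `^ X]/(2%:R) powR_mulrn ?cabs_ge0//.
  by congr (_ * _ `^ _); field.
apply: (le_trans (tent_dilated_energy A0 rho01 s01 N)).
rewrite -/K1 powRM ?(ltW k30) ?(ltW w0)//.
rewrite (_ : K1 * _ = (a%:R `^ (1 - s) * wk `^ s) * (K1 * k3 `^ s)); last by ring.
by rewrite -ler_pdivlMr ?mulr_gt0// (le_trans hA2)// ge_min lexx.
Qed.

Theorem resonant_cyclic k p q b s (A : nat -> nat) (w : nat -> R) (E : set (circle R)) u :
  (0 < k)%N -> 1 < p < 2 -> q = p / (p - 1) -> q = 2 * k%:R -> 0 < b -> s = 1 - b * q -> 0 < s ->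
  (forall K, [/\ (0 < A K)%N, 0 < w K <= 1 & (A K)%:R `^ (1 - s) * w K `^ s <= K.+1%:R^-1]) ->
  E = [set t | forall K, pd ((A K)%:R * repr t) <= w K]%R ->
  lp_space 1 b u -> zero_set u = E -> cyclic p b u.
Proof.
move=> k0 p12 hq qk b0 sE s0 hAw EE hu hz; have /andP[p1 p2] := p12.
have [C hC] := (lp_space1 b u).1 hu; have sC := bnd_ssum (ltW b0) hC.
have k1 : 1 <= k%:R :> R by rewrite ler1n.
have kb2 : k%:R * b = (1 - s) / 2 by rewrite sE qk; field.
have s01 : 0 < s < 1 by rewrite s0/= sE gtrBl mulr_gt0// qk mulr_gt0// ltr0n.
have kb12 : k%:R * b < 1 / 2 by rewrite kb2; lra.
have b12 : b < 1 / 2 by apply: le_lt_trans kb12; rewrite ler_peMl// ltW.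
apply: contrapT => nc.
have b012 : 0 < b < 1 / 2 by rewrite b0.
have [dm dm0 ann] := near_annihilator p12 b012 hC nc.
(* A lower bound for |r_0|^k, contradicted by the upper bound T/4 + T/8 + T/8 from
   [spectral_bound]. *)
pose T := (dm / 2) ^+ k; have T0 : 0 < T by rewrite exprn_gt0// divr_gt0.
have t0 : 0 < T / 8 by rewrite divr_gt0.
have [K [rho0 hF]] := resonant_scale k0 s01 t0 hAw.
have [A0 /andP[w0 w1] _] := hAw K.
set a := A K in A0 hF; set wk := w K in rho0 w0 w1 hF.
pose F := fun x : R => tent (3 * k%:R * wk) (a%:R * x).
have lF : lipf F by apply: lipf_scale; exact: lipf_tent.
pose chi := fun x : R => tent (3 / 2 * wk) (a%:R * x).
have w32 : 0 < 3 / 2 * wk by rewrite mulr_gt0// divr_gt0.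
have lchi : lipf chi by apply: lipf_scale; exact: lipf_tent.
have v0V : tclosure b u (fc (fun x => 1 - chi x)).
  apply: (resonant_complement _ hC w0); first by rewrite ltW.
  move=> x /(lift_zero_set x sC); rewrite /lift hz EE /= => /(_ K).
  have [j ->] := repr_pi x.
  rewrite (_ : (A K)%:R * (x + pi *+ 2 * j%:~R) = a%:R * x + pi *+ 2 * (a%:Z * j)%:~R).
    by rewrite pd_period.
  by rewrite intrM -/a; ring.
have F1 y : sums (fun x => chi x != 0) k y -> F y = 1.
  move=> hy; rewrite /F tent1//; apply: (le_trans (sums_scaled (B := 3 * wk) _ hy)).
    move=> x h; rewrite leNgt; apply/negP => h'; move: h; rewrite /chi tent0 ?eqxx//.
    by apply: le_trans (ltW h'); clear -w0; lra.
  by rewrite mulrA [k%:R * 3]mulrC.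
have [Cc hCc] := fc_bnd_ex lchi b12; have Cc0 := bnd_ge0 hCc.
have [CF hCF] := fc_bnd_ex lF kb12; have CF0 := bnd_ge0 hCF.
have [M [M1 M2 MC]] : exists M, [/\ 1 <= M, 2 <= M & 2 * Cc <= M].
  by exists (2 + 2 * Cc); clear -Cc0; split; lra.
have Mk0 : 0 < M ^+ k by rewrite exprn_gt0// (lt_le_trans ltr01).
have Fh0 n : 0 <= cabs (fc F n) * wt n `^ (k%:R * b) by rewrite mulr_ge0 ?cabs_ge0 ?wtp_ge0.
(* K and F are fixed first, then N0 from the tail of F^, then e in terms of N0. The near-minimiser
   comes last, all bounds so far being uniform in it. *)
have [N0 htail] := zw_tail Fh0 hCF (divr_gt0 t0 Mk0).
have [Q [Q0 hQ]] : exists Q, 0 < Q /\ CF * (k%:R * (M * wt N0%:Z `^ b + 1) ^+ k) <= Q.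
  exists (1 + CF * (k%:R * (M * wt N0%:Z `^ b + 1) ^+ k)); split; last by rewrite lerDr.
  rewrite ltr_wpDr// !mulr_ge0// exprn_ge0// addr_ge0// mulr_ge0 ?powR_ge0//.
  exact: le_trans M1.
have [e [e0 e1 e2]] : exists e, [/\ 0 < e, e <= T / 8 / Q & e <= dm / 4].
  by exists (Num.min (T / 8 / Q) (dm / 4)); rewrite lt_min !divr_gt0// !ge_min !lexx orbT.
have [d [L [hd d0 hr]]] := ann chi Cc N0 e lchi hCc v0V e0.
have := @spectral_bound k L N0 b M 2 CF e (T / 8) (T / 8) (grad p b d) chi F b0 lchi lF M1 e0 t0 F1.
have hSM n : cabs (grad p b d n) <= M * wt n `^ b.
  by apply: (le_trans (grad_bound n p12 (_ : 1 <= 2) hd)); [rewrite ler1n|rewrite ler_wpM2r ?powR_ge0].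
have hrM n : cabs (corr L (grad p b d) (fc chi) n) <= M * wt n `^ b.
  by apply: (le_trans (corr_bound L n p12 (ltW b0) hd hCc)); rewrite ler_wpM2r ?powR_ge0.
move=> /(_ hSM hrM hr (grad_power_dual p12 hq qk sE hd)); rewrite [in pbd _ _ _]kb2.
move=> /(_ hF hCF htail); apply/negP; rewrite -ltNge.
have rb : dm / 2 <= cabs (corr L (grad p b d) (fc chi) 0).
  have := cabs_dist_triangle (grad p b d 0) (corr L (grad p b d) (fc chi) 0) 0.
  have := hr 0 isT; have := cabsD (corr L (grad p b d) (fc chi) 0) (grad p b d 0 - corr L (grad p b d) (fc chi) 0).
  rewrite [X in cabs X]addrC subrK [cabs (grad p b d 0 - _)]cabs_distC.
  move: (cabs _) (cabs _) (cabs _) d0 e2 => x y z; clear; lra.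
have TT : T <= cabs (corr L (grad p b d) (fc chi) 0) ^+ k.
  by rewrite /T lerXn2r ?nnegrE ?cabs_ge0// divr_ge0// ltW.
apply: lt_le_trans TT; have h := ler_wpM2r (ltW e0) hQ.
have h' : Q * e <= T / 8 by rewrite mulrC -ler_pdivlMr.
have h3 := le_trans h h'.
by move: (CF * _ * e) h3 T0 => x; clear; lra.
Qed.

End resonant_cyclic.

(** * Random bumps *)

Section random_sums.
Variable R : realType.
Implicit Types (x y e : R).

Lemma expR_le_quadratic x : `|x| <= 1 / 2 -> expR x <= 1 + x + 2 * x ^+ 2.
Proof.
rewrite ler_norml => /andP[x0 x1].
have h : 1 - x <= expR (- x) by exact: expR_ge1Dx.
have p0 : 0 < 1 - x by lra.
rewrite -[x in leLHS]opprK expRN -[leLHS]div1r ler_pdivrMr ?expR_gt0//.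
have q0 : 0 <= 1 + x + 2 * x ^+ 2 by have := sqr_ge0 x; lra.
apply: le_trans (ler_wpM2l q0 h); have := sqr_ge0 x; nra.
Qed.

(* Exponential moments: the average of exp (theta sum_i X (f i)) over all f is
   at most exp (2 theta^2 L), so some f is good for all tests at once. *)
Lemma random_sum (J T : finType) (X : T -> J -> R) L : (0 < #|J|)%N -> (0 < #|T|)%N -> (0 < L)%N ->
  (forall tau j, `|X tau j| <= 1) -> (forall tau, \sum_j X tau j = 0) ->
  exists f : 'I_L -> J, forall tau, \sum_i X tau (f i) <= 2 * Num.sqrt L%:R * (1 + ln #|T|%:R).
Proof.
move=> J0 T0 L0 X1 Xs; pose r : R := Num.sqrt L%:R.
have LR : 1 <= L%:R :> R by rewrite ler1n.
have r1 : 1 <= r by rewrite -[leLHS]sqrtr1 ler_sqrt//; lra.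
have r2 : r ^+ 2 = L%:R by rewrite sqr_sqrtr//; lra.
pose th := (2 * r)^-1; have th0 : 0 < th by rewrite invr_gt0; lra.
have th1 : th <= 1 / 2 by rewrite /th invfM -[leRHS]mulr1 mul1r ler_pM2l ?invr_gt0// invf_le1//; lra.
have TR : 0 < #|T|%:R :> R by rewrite ltr0n.
have JR : 0 < #|J|%:R :> R by rewrite ltr0n.
have one tau : \sum_j expR (th * X tau j) <= #|J|%:R * expR (2 * th ^+ 2).
  apply: (@le_trans _ _ (\sum_j (1 + th * X tau j + 2 * th ^+ 2))).
    apply: ler_sum => j _; apply: (le_trans (expR_le_quadratic _)).
      by rewrite normrM (gtr0_norm th0) (le_trans _ th1)// ler_piMr// ltW.
    rewrite lerD2l ler_pM2l// exprMn ler_piMr ?exprn_ge0 ?(ltW th0)//.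
    by rewrite -real_normK ?num_real// expr_le1.
  rewrite !big_split/= -mulr_sumr Xs mulr0 addr0 -big_split/= sumr_const.
  by rewrite -[_ *+ #|J|]mulr_natl ler_pM2l// expR_ge1Dx.
pose H (f : {ffun 'I_L -> J}) := \sum_tau expR (th * \sum_i X tau (f i)).
have sumH : \sum_f H f <= (#|T|%:R * expR (2 * th ^+ 2 * L%:R)) * (#|J| ^ L)%:R.
  rewrite /H exchange_big/=.
  apply: (@le_trans _ _ (\sum_(tau : T) (#|J|%:R * expR (2 * th ^+ 2)) ^+ L)).
    apply: ler_sum => tau _.
    rewrite (eq_bigr (fun f : {ffun 'I_L -> J} => \prod_i expR (th * X tau (f i)))); last first.
      by move=> f _; rewrite mulr_sumr expR_sum.
    rewrite -(bigA_distr_bigA (fun (_ : 'I_L) j => expR (th * X tau j))) prodr_const card_ord.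
    by rewrite lerXn2r ?nnegrE ?mulr_ge0 ?expR_ge0// sumr_ge0// => j _; exact: expR_ge0.
  rewrite sumr_const -[_ *+ #|T|]mulr_natl exprMn natrX -expRM_natr.
  by rewrite le_eqVlt; apply/orP; left; apply/eqP; ring.
have [f hf] : exists f, H f <= #|T|%:R * expR (2 * th ^+ 2 * L%:R).
  apply: contrapT => no; move: sumH; rewrite leNgt => /negP; apply.
  have := @ltr_sum R {ffun 'I_L -> J} (index_enum _) xpredT
    (fun=> #|T|%:R * expR (2 * th ^+ 2 * L%:R)) H.
  rewrite sumr_const card_ffun card_ord -[_ *+ (_ ^ _)]mulr_natr; apply.
    apply/hasP; have [j _] := card_gt0P J0.
    by exists [ffun=> j] => //; rewrite mem_index_enum.
  move=> f _; rewrite ltNge; apply/negP => h; apply: no; by exists f.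
exists f => tau.
have : expR (th * \sum_i X tau (f i)) <= #|T|%:R * expR (2 * th ^+ 2 * L%:R).
  apply: le_trans hf; rewrite /H (bigD1 tau)//= lerDl; apply: sumr_ge0 => t' _; exact: expR_ge0.
rewrite -[#|T|%:R in leRHS](lnK (_ : #|T|%:R \is Num.pos)) ?posrE// -expRD ler_expR.
move=> h; have r20 : 0 < 2 * r by lra.
have := ler_wpM2l (ltW r20) h; rewrite mulrA /th mulfV ?gt_eqF// mul1r => h'; apply: (le_trans h').
rewrite -/r (_ : 2 * r * _ = 2 * r * ln #|T|%:R + r); last by rewrite -r2; field; rewrite gt_eqF//; lra.
by rewrite [leRHS]mulrDr mulr1 addrC lerD2r; lra.
Qed.

(** Only frequencies modulo N matter. Real and imaginary parts with both signs make 4 N tests for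
    [random_sum]; at frequency 0, where no cancellation is possible, the test is identically 0. *)
Lemma random_frequencies N L : (0 < N)%N -> (0 < L)%N -> exists f : 'I_L -> 'I_N,
  forall n : int, ~~ (N%:Z %| n)%Z ->
    cabs (\sum_i expi (n%:~R * gp R N (f i)%:Z)) <= 4 * Num.sqrt L%:R * (1 + ln (4 * N%:R)).
Proof.
move=> N0 L0; have NZ : N%:Z != 0 by rewrite eqz_nat -lt0n.
pose pr (c : bool) (z : R[i]) : R := if c then complex.Re z else complex.Im z.
have pr1 c z : `|pr c z| <= cabs z by case: c; [exact: cabs_Re|exact: cabs_Im].
have prD c (I : Type) (s : seq I) (F : I -> R[i]) : pr c (\sum_(i <- s) F i) = \sum_(i <- s) pr c (F i).
  elim: s => [|i s IH]; first by rewrite !big_nil /pr; case: c.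
  by rewrite !big_cons -IH /pr; case: (c); case: (F i) (\sum_(_ <- _) _) => ? ? [].
pose e (n : 'I_N) (j : 'I_N) : R[i] := expi (n%:Z%:~R * gp R N j%:Z).
pose X (tau : 'I_N * (bool * bool)) (j : 'I_N) : R :=
  if nat_of_ord tau.1 == 0%N then 0 else (-1) ^+ tau.2.1 * pr tau.2.2 (e tau.1 j).
have X1 tau j : `|X tau j| <= 1.
  rewrite /X; case: ifP => _; first by rewrite normr0 ler01.
  by rewrite normrM normrX normrN1 expr1n mul1r (le_trans (pr1 _ _))// cabs_expi.
have Xs tau : \sum_j X tau j = 0.
  rewrite /X; case: eqP => [_|n0]; first by rewrite big1.
  rewrite -mulr_sumr -prD sum_expi_gp// ?/pr; first by case: (tau.2.2); rewrite mulr0.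
  apply/negP => /dvdz_small; rewrite absz_nat => /(_ (ltn_ord _)) [] h; exact: n0.
have cT : #|{: 'I_N * (bool * bool)}| = (4 * N)%N.
  by rewrite !card_prod card_ord card_bool mulnC.
have cJ : (0 < #|'I_N|)%N by rewrite card_ord.
have cT0 : (0 < #|{: 'I_N * (bool * bool)}|)%N by rewrite cT muln_gt0.
have [f hf] := random_sum cJ cT0 L0 X1 Xs.
rewrite cT natrM in hf; exists f => n nN.
pose m := (n %% N%:Z)%Z; have m0 : 0 <= m by rewrite modz_ge0.
have mN : (absz m < N)%N by have := ltz_mod n NZ; move: m0; rewrite /m; clear; lia.
have m1 : absz m != 0%N.
  by rewrite absz_eq0; apply: contra nN => /eqP h; apply/dvdz_mod0P.
pose M := Ordinal mN.
have E i : expi (n%:~R * gp R N (f i)%:Z) = e M (f i).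
  rewrite /e [M%:Z]/= gez0_abs//.
  rewrite {1}(divz_eq n N%:Z) -/m intrD mulrDl expiD intrM -mulrA gp_mulC gpN//.
  rewrite mulrCA -intrM (_ : pi *+ 2 * _ = 0 + pi *+ 2 * ((n %/ N)%Z * (f i)%:Z)%:~R); last by rewrite add0r.
  by rewrite expi_period expi0 mul1r.
rewrite (eq_bigr _ (fun i _ => E i)).
have key b2 : `|pr b2 (\sum_i e M (f i))| <= 2 * Num.sqrt L%:R * (1 + ln (4 * N%:R)).
  have h0 := hf (M, (false, b2)); have h1 := hf (M, (true, b2)); rewrite /X/= (negbTE m1) in h0 h1.
  rewrite -!mulr_sumr -prD in h0 h1; rewrite expr0 mul1r in h0; rewrite expr1 mulN1r in h1.
  by rewrite ler_norml lerNl h0 h1.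
apply: (le_trans (cabs_ReIm _)); apply: (le_trans (lerD (key true) (key false))).
by rewrite le_eqVlt; apply/orP; left; apply/eqP; ring.
Qed.

End random_sums.

(** * Averages of bumps at random centres *)

Section random_bump.
Variable R : realType.
Implicit Types (N L M Q B K : nat) (n m : int) (x r t e al kp gam : R).

Definition bump r N L (f : 'I_L -> 'I_N) x : R := \sum_i L%:R^-1 * lam r (x - gp R N (f i)%:Z).

Lemma bumpP r N L (f : 'I_L -> 'I_N) : 0 < r <= 1 -> (0 < L)%N ->
  [/\ lipf (bump r f), forall x, 0 <= bump r f x,
     forall x, bump r f x != 0 -> exists i, (pd (x - gp R N (f i)%:Z) <= 2 * r)%R &
     forall n, fc (fun x => bump r f x - 1) n = if n == 0 then 0 else
       L%:R^-1 * (\sum_i expi ((- n)%:~R * gp R N (f i)%:Z)) * fc (lam r) n].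
Proof.
move=> r01 L0; have [ll l0 lz f0 _] := lamP r01.
have LR : 0 < L%:R :> R by rewrite ltr0n.
have l1 i : lipf (fun x => L%:R^-1 * lam r (x - gp R N (f i)%:Z)).
  by apply: lipf_mul; [exact: lipf_cst|exact: lipf_shift].
have lb : lipf (bump r f) by exact: lipf_sum.
split => //.
- by move=> x; apply: sumr_ge0 => i _; rewrite mulr_ge0// invr_ge0 ltW.
- move=> x; apply: contra_neqP => /forallNP h; apply: big1 => i _; rewrite lz ?mulr0//.
  by rewrite leNgt; apply/negP => /ltW; exact: h.
move=> n; rewrite fcB//; last exact: lipf_cst.
have -> : fc (bump r f) n = L%:R^-1 * (\sum_i expi ((- n)%:~R * gp R N (f i)%:Z)) * fc (lam r) n.
  rewrite /bump fc_sum// mulr_sumr mulr_suml; apply: eq_bigr => i _.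
  rewrite fc_mul//; [|exact: lipf_cst|exact: lipf_shift].
  rewrite fc_cst conv_single subr0 fc_shift// rmorphN/= mulNr mulrA; congr (_ * _ * _).
  by rewrite fmorphV/= rmorph_nat.
rewrite fc_cst /single; case: eqP => [->|_]; last by rewrite subr0.
rewrite f0 mulr1 (eq_bigr (fun=> 1)); last by move=> i _; rewrite oppr0 mul0r expi0.
rewrite sumr_const card_ord mulVf ?subrr//.
by rewrite pnatr_eq0 -lt0n.
Qed.

Lemma powR_le_sqr x gam : 0 <= x <= 1 -> 2 <= gam -> x `^ gam <= x ^+ 2.
Proof.
move=> /andP[x0 x1] g2; rewrite -powR_mulrn//; have [->|xN] := eqVneq x 0.
  by rewrite !powR0// ?gt_eqF//; lra.
by apply: ger_powR => //; rewrite x1 andbT lt_neqAle eq_sym xN.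
Qed.

(** Off the multiples of N the random sum brings the factor Del. At the multiples there is no
    cancellation, but the weight is at most N^(-t). *)
Lemma bump_energy e : 0 < e -> exists2 C, 1 <= C & forall r N L (f : 'I_L -> 'I_N) gam t (Del : R),
  0 < r <= 1 -> (0 < L)%N -> 2 <= gam -> 0 <= t <= 1 -> 0 <= Del ->
  (forall n, ~~ (N%:Z %| n)%Z -> cabs (\sum_i expi (n%:~R * gp R N (f i)%:Z)) <= Del * L%:R) ->
  forall M, \sum_(n <- zw M) cabs (fc (fun x => bump r f x - 1) n) `^ gam * wt n `^ (- t) <=
    Del `^ gam * (C * (243 / r) `^ (1 - t + e)) + N%:R `^ (- t) * (243 / r).
Proof.
move=> e0; have [C C1 hC] := @energy_split R e e0; exists C => //.
move=> r N L f gam t Del r01 L0 g2 t01 D0 hD M; have /andP[r0 r1] := r01; have /andP[t0 t1] := t01.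
have [_ _ _ fE] := bumpP f r01 L0; have [_ _ _ _ [a1 a2]] := lamP r01.
have LR : 0 < L%:R :> R by rewrite ltr0n.
have N0 : (0 < N)%N by exact: leq_ltn_trans (leq0n _) (ltn_ord (f (Ordinal L0))).
have NR : 0 < N%:R :> R by rewrite ltr0n.
have B1 : 1 <= 243 / r by rewrite ler_pdivlMr//; lra.
pose a := fc (lam r).
apply: (@le_trans _ _ (\sum_(n <- zw M) (Del `^ gam * (cabs (a n) ^+ 2 * wt n `^ (- t)) +
    N%:R `^ (- t) * cabs (a n) ^+ 2))).
  apply: ler_sum => n _; rewrite fE.
  have X0 : 0 <= Del `^ gam * (cabs (a n) ^+ 2 * wt n `^ (- t)).
    by rewrite !mulr_ge0 ?powR_ge0 ?exprn_ge0 ?cabs_ge0.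
  have Y0 : 0 <= N%:R `^ (- t) * cabs (a n) ^+ 2 by rewrite mulr_ge0 ?powR_ge0 ?exprn_ge0 ?cabs_ge0.
  have ag : cabs (a n) `^ gam <= cabs (a n) ^+ 2 by apply: powR_le_sqr; rewrite ?cabs_ge0 ?a1.
  case: eqP => [_|/eqP n0].
    by rewrite cabs0 powR0 ?mul0r ?addr_ge0// gt_eqF//; lra.
  rewrite !cabsM cabsV cabs_nat.
  have [dv|ndv] := boolP (N%:Z %| n)%Z.
    apply: (@le_trans _ _ (N%:R `^ (- t) * cabs (a n) ^+ 2)); last by rewrite lerDr.
    rewrite [leRHS]mulrC ler_pM ?powR_ge0//.
      apply: le_trans ag; rewrite ge0_ler_powR ?nnegrE ?mulr_ge0 ?cabs_ge0 ?invr_ge0 ?(ltW LR)//; first by lra.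
      rewrite ler_piMl ?cabs_ge0// mulrC ler_pdivrMr// mul1r (le_trans (cabs_sum _ _ _))//.
      rewrite (eq_bigr (fun=> 1)); last by move=> i _; rewrite cabs_expi.
      by rewrite sumr_const card_ord.
    rewrite !powRN lef_pV2 ?posrE ?powR_gt0 ?wt_gt0// ge0_ler_powR ?nnegrE ?wt_ge0 ?(ltW NR)//.
    rewrite wtE; have : (N <= absz n)%N.
      by rewrite dvdn_leq ?absz_gt0//; move: dv; rewrite /dvdz/=.
    by rewrite -(ler_nat R); lra.
  apply: (@le_trans _ _ (Del `^ gam * (cabs (a n) ^+ 2 * wt n `^ (- t)))); last by rewrite lerDl.
  rewrite mulrA ler_wpM2r ?wtp_ge0//.
  apply: (@le_trans _ _ ((Del * cabs (a n)) `^ gam)).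
    rewrite ge0_ler_powR ?nnegrE ?mulr_ge0 ?cabs_ge0 ?invr_ge0 ?(ltW LR)//; first by lra.
    rewrite ler_wpM2r ?cabs_ge0// mulrC ler_pdivrMr// hD//.
    by move: ndv; rewrite !dvdzE abszN.
  by rewrite powRM ?cabs_ge0// ler_wpM2l ?powR_ge0.
rewrite big_split/= -!mulr_sumr lerD// ler_wpM2l ?powR_ge0//.
exact: hC.
Qed.

Lemma log_bound B kp : 0 < kp -> exists2 C, 0 < C & forall Q, (0 < Q)%N ->
  1 + ln (4 * (Q ^ B)%:R) <= C * Q%:R `^ kp :> R.
Proof.
move=> kp0; exists (4 + B%:R / kp); first by rewrite ltr_wpDr// divr_ge0// ltW.
move=> Q Q0; have QR : 1 <= Q%:R :> R by rewrite ler1n.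
have Q00 : 0 < Q%:R :> R by rewrite ltr0n.
have lnle (x : R) : 0 < x -> ln x <= x - 1.
  by move=> x0; rewrite -ler_expR lnK ?posrE// (le_trans _ (expR_ge1Dx _))// addrC subrK.
have P1 : 1 <= Q%:R `^ kp by rewrite -[leLHS](powRr0 Q%:R) ler_powR// ltW.
rewrite natrX lnM ?posrE ?exprn_gt0// lnXn//.
have h1 : ln 4 <= 3 :> R by rewrite (le_trans (lnle _ _))//; lra.
have h2 : ln Q%:R <= Q%:R `^ kp / kp.
  rewrite ler_pdivlMr// mulrC -ln_powR (le_trans (lnle _ _)) ?powR_gt0// gerBl//.
have h3 : ln Q%:R *+ B <= B%:R / kp * Q%:R `^ kp.
  rewrite -[_ *+ B]mulr_natl (_ : B%:R / kp * _ = B%:R * (Q%:R `^ kp / kp)); last by ring.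
  by rewrite ler_wpM2l.
rewrite [leRHS]mulrDl; move: h1 h3 P1.
by move: (ln 4) (ln Q%:R *+ B) (B%:R / kp * Q%:R `^ kp) (Q%:R `^ kp) => w y z p; lra.
Qed.

(** With r = 1 / Q and about Q^al bumps, Del is of order Q^(-al/2), so frequencies off the multiples
    of N contribute Q^(1 - t - al gam / 2) up to small powers. Taking N = Q^B, the multiples
    contribute Q^(1 - B t). *)
Lemma bump_small gam t al B e : 2 <= gam -> 0 <= t <= 1 -> 0 < al -> 1 - t < al * gam / 2 -> 1 < B%:R * t ->
  0 < e -> exists M0, forall Q, (M0 <= Q)%N -> (0 < Q)%N ->
  forall L (f : 'I_L -> 'I_(Q ^ B)), (0 < L)%N -> Q%:R `^ al <= 2 * L%:R ->
  (forall n, ~~ ((Q ^ B)%:Z %| n)%Z -> cabs (\sum_i expi (n%:~R * gp R (Q ^ B) (f i)%:Z)) <=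
     4 * Num.sqrt L%:R * (1 + ln (4 * (Q ^ B)%:R))) ->
  forall M, \sum_(n <- zw M) cabs (fc (fun x => bump (Q%:R^-1) f x - 1) n) `^ gam * wt n `^ (- t) <= e.
Proof.
move=> g2 t01 al0 hal hB e0; have /andP[t0 t1] := t01.
have g0 : 0 < gam by lra.
(* A quarter of the gap: one e' is lost in [energy_split], another to the logarithm through kp = e'
   / gam, and the exponent -2 e' is left. *)
pose e' := (al * gam / 2 - (1 - t)) / 4; have e'0 : 0 < e' by rewrite /e'; lra.
pose kp := e' / gam; have kp0 : 0 < kp by rewrite divr_gt0.
have [C C1 hC] := bump_energy e'0; have C0 : 0 < C by lra.
have [C2 C20 hlog] := log_bound B kp0.
have [T [T1 TE]] : exists T : R, 1 <= T /\ T = 243 by exists 243; rewrite ler1n.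
have T0 : 0 < T by exact: lt_le_trans T1.
pose Z := (8 * C2) `^ gam * (C * T `^ (1 - t + e')).
have Z0 : 0 < Z by rewrite !mulr_gt0 ?powR_gt0// mulr_gt0.
have z1 : 0 < e / 2 / Z by rewrite !divr_gt0.
have z2 : 0 < e / 2 / T by rewrite !divr_gt0.
have m1 : 0 < 2 * e' by rewrite mulr_gt0.
have m2 : 0 < B%:R * t - 1 by rewrite subr_gt0.
have [M1 hM1] := powR_small m1 z1; have [M2 hM2] := powR_small m2 z2.
exists (maxn M1 M2) => Q; rewrite geq_max => /andP[QM1 QM2] Q0 L f L0 QL hf M.
have QR : 1 <= Q%:R :> R by rewrite ler1n.
have Q00 : 0 < Q%:R :> R by rewrite ltr0n.
have LR : 0 < L%:R :> R by rewrite ltr0n.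
have r01 : 0 < (Q%:R^-1 : R) <= 1 by rewrite invr_gt0 Q00 invf_le1.
pose Del := 8 * C2 * Q%:R `^ (kp - al / 2).
have Del0 : 0 <= Del by rewrite !mulr_ge0 ?powR_ge0// ltW.
have hD n : ~~ ((Q ^ B)%:Z %| n)%Z ->
    cabs (\sum_i expi (n%:~R * gp R (Q ^ B) (f i)%:Z)) <= Del * L%:R.
  move=> /hf h; apply: (le_trans h).
  have s0 : 0 < Num.sqrt L%:R :> R by rewrite sqrtr_gt0.
  have s2 : L%:R = Num.sqrt L%:R ^+ 2 :> R by rewrite sqr_sqrtr// ltW.
  have h1 : Q%:R `^ (al / 2) <= 2 * Num.sqrt L%:R.
    rewrite -(@ler_pXn2r _ 2)// ?nnegrE ?powR_ge0 ?mulr_ge0 ?(ltW s0)//.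
    rewrite -powR_mulrn ?powR_ge0// -powRrM (_ : al / 2 * 2%:R = al); last by field.
    by rewrite exprMn -s2 (le_trans QL)// ler_pM2r// expr2; clear; lra.
  have h2 := hlog Q Q0.
  apply: (@le_trans _ _ (4 * Num.sqrt L%:R * (C2 * Q%:R `^ kp))).
    by rewrite ler_wpM2l// mulr_ge0// ltW.
  have -> : Q%:R `^ kp = Q%:R `^ (kp - al / 2) * Q%:R `^ (al / 2) :> R.
    by rewrite -powRD ?(gt_eqF Q00) ?implybT//; congr (_ `^ _); ring.
  apply: (@le_trans _ _ (4 * Num.sqrt L%:R * (C2 * (Q%:R `^ (kp - al / 2) * (2 * Num.sqrt L%:R))))).
    by rewrite ler_wpM2l ?mulr_ge0 ?(ltW s0)// ler_wpM2l ?(ltW C20)// ler_wpM2l ?powR_ge0.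
  by rewrite /Del [in leRHS]s2 le_eqVlt; apply/orP; left; apply/eqP; ring.
apply: (le_trans (hC _ _ _ f gam t Del r01 L0 g2 t01 Del0 hD M)).
rewrite -TE invrK [leRHS](splitr e) lerD//.
  rewrite /Del !powRM ?powR_ge0 ?(ltW C20) ?(ltW T0) ?(ltW Q00) ?mulr_ge0 ?(ltW C20)//.
  have := hM1 Q QM1 Q0; rewrite ler_pdivlMr//; apply: le_trans.
  rewrite le_eqVlt; apply/orP; left; apply/eqP.
  rewrite /Z [in RHS]powRM ?(ltW C20)// -powRrM.
  have -> : Q%:R `^ (- (2 * e')) = Q%:R `^ ((kp - al / 2) * gam) * Q%:R `^ (1 - t + e') :> R.
    rewrite -powRD ?(gt_eqF Q00) ?implybT//; congr (_ `^ _); rewrite /kp /e'; field.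
    by rewrite gt_eqF.
  by ring.
rewrite natrX -powR_mulrn ?(ltW Q00)// -powRrM.
have := hM2 Q QM2 Q0; rewrite ler_pdivlMr//; apply: le_trans.
rewrite le_eqVlt; apply/orP; left; apply/eqP.
rewrite (_ : - (B%:R * t - 1) = B%:R * - t + 1); last by ring.
rewrite powRD ?(gt_eqF Q00) ?implybT// powRr1 ?(ltW Q00)//; ring.
Qed.

Theorem random_set p q b al : 1 < p < 2 -> q = p / (p - 1) -> 0 < b -> b * q <= 1 ->
  2 / q * (1 - b * q) < al <= 1 -> exists E : set (circle R),
  [/\ closed E, hausdorff_dim E = al%:E &
    forall u, lp_space 1 b u -> zero_set u = E -> ~ cyclic p b u].
Proof.
move=> p12 hq b0 bq /andP[hal al1]; have /andP[p1 p2] := p12.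
have p0 : 0 < p by lra. have p10 : 0 < p - 1 by lra.
have q2 : 2 < q by rewrite hq ltr_pdivlMr//; lra.
have q0 : 0 < q by lra.
have bq0 : 0 < b * q by rewrite mulr_gt0.
have b01 : 0 <= b < 1 / 2 by apply/andP; split; [exact: ltW|nra].
have al0 : 0 < al.
  by apply: le_lt_trans hal; rewrite mulr_ge0 ?divr_ge0 ?(ltW q0)// subr_ge0.
have halq : 1 - b * q < al * q / 2.
  rewrite (_ : 1 - b * q = (2 / q * (1 - b * q)) * (q / 2)); last by field; rewrite gt_eqF.
  by rewrite -[ltRHS]mulrA ltr_pM2r// divr_gt0.
pose sg K : R := al - al / K.+2%:R; pose bK K := (1 - sg K) / 2.
have sg01 K : 0 < sg K < al.
  rewrite /sg subr_gt0 ltrBlDr ltrDl divr_gt0 ?ltr0n// andbT.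
  by rewrite ltr_pdivrMr ?ltr0n// ltr_pMr// ltr1n.
have hbK K : 0 <= bK K < 1 / 2 by have /andP[] := sg01 K; rewrite /bK => h1 h2; apply/andP; split; lra.
(* At most Q^al arcs of radius 2 / Q, with Q > K so that the radii tend to 0; this is all the upper
   bound on the dimension uses. *)
pose Qp K (S : set R) := exists Q L (c : nat -> R), [/\ (K < Q)%N, L%:R <= Q%:R `^ al &
   S = [set x | exists2 i, (i < L)%N & pd (x - c i) <= 2 / Q%:R]%R].
have step : machine_step p b bK Qp.
  move=> K e e0; have /andP[sg0 sgal] := sg01 K.
  pose t := 1 - sg K; have t0 : 0 < t by rewrite /t; lra.
  have [B [B1 B2]] : exists B : nat, 1 < B%:R * (b * q) /\ 1 < B%:R * t.
    exists (maxn (Num.truncn (b * q)^-1).+1 (Num.truncn t^-1).+1); split.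
      rewrite -ltr_pdivrMr// mul1r (lt_le_trans (real_truncnS_gt (num_real _)))// ler_nat leq_maxl//.
    rewrite -ltr_pdivrMr// mul1r (lt_le_trans (real_truncnS_gt (num_real _)))// ler_nat leq_maxr//.
  have bq01 : 0 <= b * q <= 1 by rewrite (ltW bq0).
  have t01 : 0 <= t <= 1 by rewrite (ltW t0) gerBl ltW.
  have hal2 : 1 - t < al * 2 / 2 by rewrite /t; clear -sgal; lra.
  have eq0 : 0 < e `^ q by rewrite powR_gt0.
  have e20 : 0 < e `^ 2 by rewrite powR_gt0.
  (* The exponent q with t = b q serves non-cyclicity, and its condition 1 - b q < al q / 2 is the
     threshold on alpha; the exponent 2 with t = 1 - sg K serves the dimension. *)
  have [M1 hM1] := bump_small (ltW q2) bq01 al0 halq B1 eq0.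
  have [M2 hM2] := bump_small (lexx 2) t01 al0 hal2 B2 e20.
  pose Q := (maxn K (maxn M1 M2)).+1.
  have QR : 1 <= Q%:R :> R by rewrite ler1n.
  have Qal : 1 <= Q%:R `^ al by rewrite -[leLHS](powRr0 Q%:R) ler_powR// ltW.
  pose L := Num.truncn (Q%:R `^ al).
  have /andP[L1 L2] := truncn_itv (ltW (lt_le_trans ltr01 Qal)); rewrite -/L -natr1 in L1 L2.
  have L0 : (0 < L)%N by rewrite truncn_gt0.
  have LR : 1 <= L%:R :> R by rewrite ler1n.
  have QL : Q%:R `^ al <= 2 * L%:R by clear -L2 LR; lra.
  have N0 : (0 < Q ^ B)%N by rewrite expn_gt0.
  have [f hf] := random_frequencies R N0 L0.
  have r01 : 0 < (Q%:R^-1 : R) <= 1 by rewrite invf_le1 ?QR ?invr_gt0 ?andbT//; lra.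
  have [lF F0 FS _] := bumpP f r01 L0.
  exists (bump Q%:R^-1 f), [set x | exists2 i, (i < L)%N &
     (pd (x - (if insub i is Some j then gp R (Q ^ B) (f j)%:Z else 0)) <= 2 / Q%:R)%R].
  split => //.
  - move=> x /FS[i hi] /=; exists i; first exact: ltn_ord.
    by rewrite valK.
  - exists Q, L, (fun i => if insub i is Some j then gp R (Q ^ B) (f j)%:Z else 0); split => //.
    by rewrite /Q ltnS leq_maxl.
  split.
  - apply: (dual_lq p1 hq e0) => M; apply: hM1 => //.
    by rewrite /Q leqW// leq_max leq_maxl orbT.
  - apply: (@dual_lq _ 2 2) => //; first by rewrite ltr1n.
      by rewrite (_ : 2 - 1 = 1 :> R) ?divr1//; ring.
    move=> M; rewrite (_ : bK K * 2 = t); last by rewrite /bK divfK.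
    by apply: hM2 => //; rewrite /Q leqW// leq_max leq_maxr orbT.
have [g [S [lg g0 hQ gS [hd hb]]]] := machine (ltW p1) b01 hbK step.
pose E := [set t : circle R | forall K, S K (repr t)].
have hS K : closed (S K) /\ perset (S K).
  have [Q [L [c [_ _ ->]]]] := hQ K; split.
    rewrite (_ : [set x | _] = \bigcup_(i in [set i | (i < L)%N]) [set x | pd (x - c i) <= 2 / Q%:R]%R).
      apply: closed_bigcup; first exact: finite_II.
      by move=> i _; apply: closed_le; exact: pd_continuous.
    by apply/seteqP; split => x /= [i iL hi]; exists i.
  move=> x k [i iL hi]; exists i => //.
  by rewrite (_ : x + pi *+ 2 * k%:~R - c i = x - c i + pi *+ 2 * k%:~R) ?pd_period//; ring.
have [cE ncE hdim] := limit_set (ltW p1) (ltW b0) hS lg g0 gS hd (erefl E).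
exists E; split => //; last by move=> u /lp_space1[C hC]; exact: ncE hC.
apply/eqP; rewrite eq_le; apply/andP; split; last first.
  apply: hdim; first by rewrite al0.
  move=> s' /andP[s'0 s's].
  exists (Num.truncn (al / (al - s'))).+1; apply: hb; first by lra.
  move=> K hK; rewrite /bK ler_pM2r// lerD2l lerN2 /sg.
  have ss : 0 < al - s' by rewrite subr_gt0.
  have : al / K.+2%:R <= al - s'.
    rewrite ler_pdivrMr ?ltr0n// mulrC -ler_pdivrMr//.
    by rewrite (le_trans (ltW (real_truncnS_gt (num_real (al / (al - s'))))))// ler_nat (leq_trans hK)// leqW.
  by move: (al / _) => z; lra.
(* Q^al arcs of radius 2 / Q have (al + eps)-sum of order Q^(-eps). *)
apply/lee_addgt0Pr => eps eps0; rewrite -EFinD.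
have s0 : 0 < al + eps by rewrite addr_gt0.
apply: dim_le; first exact: ltW.
apply: measure0_of_covers => // e d e0 d0.
have e2 : 0 < e / 2 `^ (al + eps) by rewrite divr_gt0 ?powR_gt0.
have [N1 hN1] := powR_small eps0 e2.
pose K := maxn N1 (Num.truncn (2 / d)).
have [Q [L [c [KQ LQ SE]]]] := hQ K.
have Q0 : (0 < Q)%N by exact: leq_ltn_trans KQ.
have QR : 0 < Q%:R :> R by rewrite ltr0n.
have rd : 2 / Q%:R <= d.
  rewrite ler_pdivrMr// mulrC -ler_pdivrMr//.
  rewrite (le_trans (ltW (real_truncnS_gt (num_real (2 / d)))))// ler_nat.
  by rewrite (leq_trans _ KQ)// ltnS leq_maxr.
exists L, c, (fun=> 2 / Q%:R); split.
- by move=> _; rewrite divr_gt0.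
- by move=> x /(_ K); rewrite SE => -[i iL hi]; exists i.
rewrite sumr_const_nat subn0 -[_ *+ L]mulr_natl.
apply: (@le_trans _ _ (Q%:R `^ al * (2 / Q%:R) `^ (al + eps))); first by rewrite ler_wpM2r ?powR_ge0.
rewrite powRM ?invr_ge0 ?(ltW QR)// -[Q%:R^-1](powR_inv1 (ltW QR)) -powRrM mulN1r.
have NQ : (N1 <= Q)%N by rewrite (leq_trans _ (ltnW KQ))// leq_maxl.
have := hN1 Q NQ Q0; rewrite ler_pdivlMr ?powR_gt0//; apply: le_trans.
rewrite le_eqVlt; apply/orP; left; apply/eqP.
have -> : Q%:R `^ (- eps) = Q%:R `^ al * Q%:R `^ (- (al + eps)) :> R.
  by rewrite -powRD ?(gt_eqF QR) ?implybT//; congr (_ `^ _); ring.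
by ring.
Qed.

End random_bump.

(** * The empty zero set *)

Section empty_zero_set.
Variable R : realType.

Lemma dim_set0 : hausdorff_dim (set0 : set (circle R)) = 0%E.
Proof.
apply/eqP; rewrite eq_le dim_ge0 andbT; apply: dim_le => //.
apply/measure0P => d d0; apply/eqP; rewrite eq_le premeasure_ge0 andbT.
apply: (@le_trans _ _ (\sum_(0 <= i <oo) diam_pow 0 (set0 : set (circle R)))%E).
  apply: ereal_inf_lbound; exists (fun=> set0) => //; split => // i.
  exact: diam_le.
by rewrite eseries0// => i _ _; rewrite /diam_pow eqxx.
Qed.

(** |u^| is bounded below on the whole circle, so the Wiener-Levy theorem applies to the constant
    function 1, whose coefficients are the unit vector. *)
Lemma cyclic_of_empty_zero_set (p b : R) (u : int -> R[i]) : 1 < p -> 0 <= b < 1 / 2 ->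
  lp_space 1 b u -> zero_set u = set0 -> cyclic p b u.
Proof.
move=> p1 b01 hu hz; have /andP[b0 _] := b01.
have [C hC] := (lp_space1 b u).1 hu; have sC := bnd_ssum b0 hC.
have [d d0 hd] : exists2 d, 0 < d & forall x, setT x -> d <= cabs (ev u x).
  apply: (ev_bounded_below sC closedT) => // x _; apply/eqP => /(lift_zero_set x sC).
  by rewrite hz.
have := wiener_levy b01 hC (lipf_cst 1) d0 (fun x _ => hd x I); rewrite fc_cst => h.
apply: cyclic_unit_vector (ltW p1) b0 _ => e e0.
have e1 : 0 < Num.min 1 e by rewrite lt_min ltr01.
have [w sw hw] := h _ e1; exists w => //.
apply: (@pbd_le _ _ _ _ (Num.min 1 e)); first by rewrite ge_min lexx orbT.
by apply: bnd_pbd hw; [exact: ltW|rewrite ge_min lexx].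
Qed.

End empty_zero_set.

Theorem theoremA (R : realType) (p q beta : R)
  (hp : 1 < p < 2) (hq : q = p / (p - 1))
  (hbeta : 0 < beta) (hbetaq : beta * q <= 1) :
  [/\ (forall u : int -> R[i], lp_space 1 beta u ->
         (hausdorff_dim (zero_set u) < (2 / q * (1 - beta * q))%:E)%E ->
         cyclic p beta u),
      (forall u : int -> R[i], lp_space 1 beta u ->
         ((1 - beta * q)%:E < hausdorff_dim (zero_set u))%E ->
         ~ cyclic p beta u),
      (forall alpha : R, 2 / q * (1 - beta * q) < alpha <= 1 ->
         exists E : set (circle R),
           [/\ closed E, hausdorff_dim E = alpha%:E &
             forall u : int -> R[i], lp_space 1 beta u ->
               zero_set u = E -> ~ cyclic p beta u]) &
      (forall k : nat, (0 < k)%N -> p = 2 * k%:R / (2 * k%:R - 1) ->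
         exists E : set (circle R),
           [/\ closed E, hausdorff_dim E = (1 - beta * q)%:E &
             forall u : int -> R[i], lp_space 1 beta u ->
               zero_set u = E -> cyclic p beta u])].
Proof.
have /andP[p1 p2] := hp; have p0 : 0 < p by lra.
have q0 : 0 < q by rewrite hq divr_gt0//; lra.
split.
- by move=> u; exact: cyclic_of_small_dim.
- by move=> u; exact: not_cyclic_of_large_dim.
- by move=> alpha; exact: random_set.
move=> k k0 pk; have k1 : 1 <= k%:R :> R by rewrite ler1n.
have q2 : 2 < q by rewrite hq ltr_pdivlMr; lra.
have qk : q = 2 * k%:R.
  have D0 : 2 * k%:R - 1 != 0 :> R by rewrite gt_eqF//; lra.
  have p1E : p - 1 = (2 * k%:R - 1)^-1 by rewrite pk; field.
  by rewrite hq p1E invrK pk divfK.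
(* At beta q = 1 the required dimension is 0, outside the range of [resonant_set]; the empty set, of
   dimension 0 by convention, serves. *)
have [b1|bN] := eqVneq (beta * q) 1.
  exists set0; split; [exact: closed0|by rewrite b1 subrr dim_set0|].
  by move=> u; apply: cyclic_of_empty_zero_set => //; apply/andP; split; [exact: ltW|nra].
have s0 : 0 < 1 - beta * q by rewrite subr_gt0 lt_neqAle bN.
have s1 : 1 - beta * q < 1 by rewrite gtrBl mulr_gt0.
have s01 : 0 < 1 - beta * q < 1 by rewrite s0.
have [A [w [E [hAw EE cE dE]]]] := resonant_set s01.
exists E; split => // u.
exact: (resonant_cyclic k0 hp hq qk hbeta erefl s0 hAw EE).
Qed.
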